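(* Assume $d=\dim_{\mathbb C}H^0_{(2)}(X,L)\ge1$ (with $d=\infty$ allowed), and let $\eta=\{\eta_j\}_{j=1}^d$ be a sequence of i.i.d. standard complex Gaussian random variables. If $S=\{S_j\}_{j=1}^d$ and $S'=\{S'_j\}_{j=1}^d$ are two orthonormal bases of $H^0_{(2)}(X,L)$, then $\psi^{S}_\eta=\sum_{j=1}^d\eta_jS_j$ and $\psi^{S'}_\eta=\sum_{j=1}^d\eta_jS'_j$ have the same distribution as random holomorphic sections of $L$.
   Context: $(X,J,\Theta)$ is a connected complex manifold without boundary of complex dimension $n$ with Hermitian form $\Theta$, $\mathrm{dV}=\Theta^n/n!$, and $(L,h_L)$ is a holomorphic line bundle on $X$ with smooth Hermitian metric. $H^0_{(2)}(X,L)$ is the separable Hilbert space of holomorphic sections $s$ of $L$ with $\int_X|s|^2_{h_L}\mathrm{dV}<\infty$, with inner product $\int_X\langle s_1,s_2\rangle_{h_L}\mathrm{dV}$. A standard complex Gaussian has the law of $\frac1{\sqrt2}(A+\sqrt{-1}B)$ with $A,B$ independent standard real Gaussians. The series defining $\psi^S_\eta$ almost surely converges locally uniformly on $X$, so that $\psi^S_\eta$ is a random variable with values in the space $H^0(X,L)$ of all holomorphic sections, equipped with the Fréchet topology of uniform convergence on compact sets. *)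

(* Defs.v *)
From HB Require Import structures.
From mathcomp Require Import all_boot all_order all_fingroup all_algebra.
From mathcomp Require Import all_classical all_reals all_analysis.
From mathcomp Require Export complex.

Set Implicit Arguments.
Unset Strict Implicit.
Unset Printing Implicit Defensive.

Import Order.TTheory GRing.Theory Num.Theory.
Import numFieldNormedType.Exports.

Local Open Scope classical_set_scope.
Local Open Scope ring_scope.
Local Open Scope complex_scope.

(* [numFieldNormedType] puts the norm topology on abstract fields only. *)
HB.instance Definition _ (R : realType) := GRing.ComAlgebra.copy R[i] R[i]^o.
HB.instance Definition _ (R : realType) := Vector.copy R[i] R[i]^o.
HB.instance Definition _ (R : realType) := NormedModule.copy R[i] R[i]^o.
HB.instance Definition _ (R : realType) := Num.ClosedField.on R[i].

Notation Cn R n := ('rV[R[i]]_n).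

Section functions_on_Cn.
Context {R : realType} {n : nat}.

(* The base field is [R[i]], so [differentiable] is C-differentiability. *)
Definition holomorphic_on (V : normedModType R[i]) (U : set (Cn R n))
  (f : Cn R n -> V) := forall z, U z -> differentiable f z.

(* [f] restricted to the real line through [z] with direction [v]. *)
Definition real_line (f : Cn R n -> R) (z v : Cn R n) : R -> R :=
  fun t => f (z + t%:C *: v).

(* C^k on an open set in the sense of real calculus on C^n = R^(2n). *)
Fixpoint Ck_on (k : nat) (U : set (Cn R n)) (f : Cn R n -> R) : Prop :=
  (forall z, U z -> {for z, continuous f}) /\
  if k is k'.+1 then
    forall v, (forall z, U z -> derivable (real_line f z v) 0 1) /\
              Ck_on k' U (fun z => derive1 (real_line f z v) 0)
  else True.

Definition smooth_on (U : set (Cn R n)) (f : Cn R n -> R) :=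
  forall k, Ck_on k U f.

End functions_on_Cn.

(* Lebesgue integral on C^n = (R^2)^n of a nonnegative Borel function, written *)
(* as an iterated integral (Tonelli) over the complex coordinates.             *)
Fixpoint integral_Cn (R : realType) (n : nat) : (Cn R n -> \bar R) -> \bar R :=
  if n is n'.+1 return (Cn R n -> \bar R) -> \bar R then
    fun f => (\int[lebesgue_measure \x lebesgue_measure]_p
      integral_Cn (fun z : Cn R n' =>
        f (row_mx ((p.1 : R) +i* (p.2 : R))%:M z)))%E
  else fun f => f 0.

Record complex_atlas (R : realType) (n : nat) (X : topologicalType) := {
  chart_index : Type;
  chart_dom : chart_index -> set X;
  chart : chart_index -> X -> Cn R n;
  chart_inv : chart_index -> Cn R n -> X;
  chart_dom_open : forall a, open (chart_dom a);
  chart_dom_cover : forall x, exists a, chart_dom a x;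
  chart_im_open : forall a, open (chart a @` chart_dom a);
  chartK : forall a x, chart_dom a x -> chart_inv a (chart a x) = x;
  chart_continuous : forall a x, chart_dom a x -> {for x, continuous (chart a)};
  chart_inv_continuous : forall a z, (chart a @` chart_dom a) z ->
    {for z, continuous (chart_inv a)};
  chart_transition : forall a b,
    holomorphic_on (chart a @` (chart_dom a `&` chart_dom b))
      (chart b \o chart_inv a) }.

Section manifold.
Context {R : realType} {n : nat} {X : topologicalType}.
Variable M : complex_atlas R n X.

Definition mholomorphic_on (U : set X) (f : X -> R[i]) :=
  forall a : chart_index M,
    holomorphic_on (chart a @` (chart_dom a `&` U)) (f \o chart_inv a).

Definition msmooth_on (U : set X) (f : X -> R) :=
  forall a : chart_index M,
    smooth_on (chart a @` (chart_dom a `&` U)) (f \o chart_inv a).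

(* A positive real (1,1)-form, given by its coordinate expressions             *)
(* [form_at a z], alternating R-bilinear forms on T_z C^n = C^n.  The complex  *)
(* structure J is multiplication by 'i, and [form_at a z u ('i *: v)] is the   *)
(* Riemannian metric associated with the form.                                 *)
Record hermitian_form := {
  form_at : chart_index M -> Cn R n -> Cn R n -> Cn R n -> R;
  form_linear : forall a z, (chart a @` chart_dom a) z ->
    forall (t : R) u v w,
      form_at a z (t%:C *: u + v) w = t * form_at a z u w + form_at a z v w;
  form_antisym : forall a z, (chart a @` chart_dom a) z ->
    forall u v, form_at a z u v = - form_at a z v u;
  form_J : forall a z, (chart a @` chart_dom a) z ->
    forall u v, form_at a z ('i%C *: u) ('i%C *: v) = form_at a z u v;
  form_pos : forall a z, (chart a @` chart_dom a) z ->
    forall u, u != 0 -> 0 < form_at a z u ('i%C *: u);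
  form_smooth : forall a u v,
    smooth_on (chart a @` chart_dom a) (fun z => form_at a z u v);
  form_transition : forall a b z,
    (chart a @` (chart_dom a `&` chart_dom b)) z ->
    let tau := chart b \o chart_inv a in
    forall u v, form_at a z u v = form_at b (tau z) ('d tau z u) ('d tau z v) }.

(* The real coordinate frame of C^n: d/dx_j for (j, false), d/dy_j for         *)
(* (j, true).                                                                  *)
Definition real_frame (p : 'I_n * bool) : Cn R n :=
  (if p.2 then 'i%C else 1) *: delta_mx 0 p.1.

(* The value of the n-fold wedge power omega ^ ... ^ omega of a 2-form on the  *)
(* frame d/dx_1, d/dy_1, ..., d/dx_n, d/dy_n.  The signature does not depend   *)
(* on how the index set of the frame is identified with {1, ..., 2n}.          *)
Definition wedge_power (omega : Cn R n -> Cn R n -> R) : R :=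
  (2 ^+ n)^-1 * \sum_(s : {perm 'I_n * bool}) (-1) ^+ s *
    \prod_(j < n) omega (real_frame (s (j, false))) (real_frame (s (j, true))).

(* The density of Theta^n / n! with respect to dx_1 dy_1 ... dx_n dy_n.        *)
Definition volume_density (Theta : hermitian_form) (a : chart_index M)
  (z : Cn R n) : R := wedge_power (form_at Theta a z) / n`!%:R.

(* A family of complex lines with local frames whose transition functions are  *)
(* holomorphic.                                                                *)
Record line_bundle := {
  fiber : X -> lmodType R[i];
  triv_index : Type;
  triv_dom : triv_index -> set X;
  local_frame : triv_index -> forall x, fiber x;
  fiber_coord : triv_index -> forall x, {scalar fiber x};
  triv_dom_open : forall k, open (triv_dom k);
  triv_dom_cover : forall x, exists k, triv_dom k x;
  coord_frame : forall k x, triv_dom k x ->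
    fiber_coord k x (local_frame k x) = 1;
  coordK : forall k x, triv_dom k x ->
    forall v : fiber x, fiber_coord k x v *: local_frame k x = v;
  frame_transition : forall k l,
    mholomorphic_on (triv_dom k `&` triv_dom l)
      (fun x => fiber_coord k x (local_frame l x)) }.

Definition holomorphic_section (L : line_bundle) (s : forall x, fiber L x) :=
  forall k, mholomorphic_on (triv_dom k) (fun x => fiber_coord k x (s x)).

Record hermitian_metric (L : line_bundle) := {
  herm : forall x, fiber L x -> fiber L x -> R[i];
  herm_linear : forall x (c : R[i]) (u v w : fiber L x),
    herm (c *: u + v) w = c * herm u w + herm v w;
  herm_sym : forall x (u v : fiber L x), herm v u = (herm u v)^*;
  herm_pos : forall x (u : fiber L x), u != 0 -> 0 < herm u u;
  herm_smooth : forall k, msmooth_on (triv_dom k)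
    (fun x => complex.Re (herm (local_frame k x) (local_frame k x))) }.

Definition herm_norm (L : line_bundle) (h : hermitian_metric L) x
  (v : fiber L x) : R := Num.sqrt (complex.Re (herm h v v)).

End manifold.

Notation borel X := (g_sigma_algebraType (@open X)).

(* [dV] is the measure of the volume form Theta^n / n!; on a second countable  *)
(* manifold this determines [dV].                                              *)
Definition is_volume_measure (R : realType) (n : nat) (X : ptopologicalType)
    (M : complex_atlas R n X) (Theta : hermitian_form M)
    (dV : {measure set (borel X) -> \bar R}) :=
  forall (a : chart_index M) (B : set (borel X)),
    measurable B -> B `<=` chart_dom a ->
    dV B = integral_Cn (fun z =>
      (volume_density Theta a z * \1_(chart a @` B) z)%:E).

(* Families indexed by j = 1, ..., d with d finite or infinite are indexed     *)
(* here by the [j : nat] with [index_lt d j]; [None] stands for infinity and   *)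
(* values at other indices are irrelevant.                                     *)
Definition index_lt (d : option nat) (j : nat) : bool :=
  if d is Some m then (j < m)%N else true.

Definition size_le (m : nat) (d : option nat) : bool :=
  if d is Some m' then (m <= m')%N else true.

Section sections.
Context {R : realType} {n : nat} {X : ptopologicalType}.
Context {M : complex_atlas R n X} {L : line_bundle M}.
Implicit Types s t : forall x, fiber L x.

Definition partial_sum (d : option nat) (c : nat -> R[i])
    (S : nat -> forall x, fiber L x) (m : nat) : forall x, fiber L x :=
  fun x => \sum_(j < m | index_lt d j) c j *: S j x.

Section L2.
Variables (h : hermitian_metric L) (dV : {measure set (borel X) -> \bar R}).

Definition L2_norm2 s : \bar R :=
  (\int[dV]_x ((herm_norm h (s x)) ^+ 2)%:E)%E.

Definition L2_section s := holomorphic_section s /\ (L2_norm2 s < +oo)%E.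

Definition L2_inner s t : R[i] :=
  (\int[dV]_x complex.Re (herm h (s x) (t x))) +i*
  (\int[dV]_x complex.Im (herm h (s x) (t x))).

Definition linearly_independent (m : nat) (v : 'I_m -> forall x, fiber L x) :=
  forall c : 'I_m -> R[i],
    (forall x, \sum_(j < m) c j *: v j x = 0) -> forall j, c j = 0.

Definition L2_dim (d : option nat) := forall m : nat, size_le m d <->
  exists v : 'I_m -> forall x, fiber L x,
    (forall j, L2_section (v j)) /\ linearly_independent v.

Definition orthonormal_basis (d : option nat)
    (S : nat -> forall x, fiber L x) :=
  [/\ forall j, index_lt d j -> L2_section (S j),
      forall j k, index_lt d j -> index_lt d k ->
        L2_inner (S j) (S k) = (j == k)%:R &
      forall s, L2_section s -> forall e : R, 0 < e ->
        exists m c, (L2_norm2 (fun x => s x - partial_sum d c S m x)%R < e%:E)%E].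

End L2.

End sections.

Section holomorphic_sections.
Context {R : realType} {n : nat} {X : ptopologicalType}.
Context {M : complex_atlas R n X}.
Variables (L : line_bundle M) (h : hermitian_metric L).

Definition H0 := {s : forall x, fiber L x | holomorphic_section s}.

Lemma holomorphic_section0 : holomorphic_section (fun x => 0 : fiber L x).
Proof.
move=> k a z _.
rewrite (_ : _ \o _ = cst 0); first exact: differentiable_cst.
by apply/funext => y /=; rewrite linear0.
Qed.

Definition zero_section : H0 := exist _ _ holomorphic_section0.

HB.instance Definition _ := gen_eqMixin H0.
HB.instance Definition _ := gen_choiceMixin H0.
HB.instance Definition _ := isPointed.Build H0 zero_section.

(* The Frechet topology of uniform convergence on compact sets. *)
Definition frechet_ball (K : set X) (e : R) (s : H0) : set H0 :=
  [set t | forall x, K x -> herm_norm h (sval t x - sval s x) < e].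

Definition frechet_open : set (set H0) :=
  [set U | forall s, U s ->
    exists K e, [/\ compact K, 0 < e & frechet_ball K e s `<=` U]].

Definition is_frechet_sum (d : option nat) (c : nat -> R[i])
    (S : nat -> forall x, fiber L x) (s : H0) :=
  forall (K : set X) (e : R), compact K -> 0 < e ->
    \forall m \near \oo, forall x, K x ->
      herm_norm h (partial_sum d c S m x - sval s x) < e.

(* The sum of the series in [H0], with value 0 where it does not converge. *)
Definition frechet_sum (d : option nat) (c : nat -> R[i])
    (S : nat -> forall x, fiber L x) : H0 :=
  xget zero_section [set s | is_frechet_sum d c S s].

Definition random_section (T : Type) (d : option nat) (eta : nat -> T -> R[i])
    (S : nat -> forall x, fiber L x) : T -> H0 :=
  fun w => frechet_sum d (fun j => eta j w) S.

Definition same_distribution disp (T : measurableType disp)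
    (P : probability T R) (psi psi' : T -> g_sigma_algebraType frechet_open) :=
  [/\ measurable_fun setT psi, measurable_fun setT psi' &
      forall B, measurable B -> pushforward P psi B = pushforward P psi' B].

End holomorphic_sections.

Section gaussian.
Context {R : realType}.

(* The law of (A + iB) / sqrt 2 with A, B independent standard normal. *)
Definition std_complex_gaussian : set (borel R[i]) -> \bar R :=
  pushforward (normal_prob (0 : R) 1 \x normal_prob (0 : R) 1)%E
    (fun p => ((p.1 : R) +i* (p.2 : R)) / (Num.sqrt 2)%:C : borel R[i]).

Definition iid_std_complex_gaussian disp (T : measurableType disp)
    (P : probability T R) (d : option nat)
    (eta : nat -> {RV P >-> borel R[i]}) :=
  (forall j, index_lt d j ->
    forall B, measurable B -> distribution P (eta j) B = std_complex_gaussian B)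
  /\
  (forall (I : seq nat) (B : nat -> set (borel R[i])),
    uniq I -> all (index_lt d) I -> (forall j, measurable (B j)) ->
    P (\bigcap_(j in [set` I]) eta j @^-1` B j) =
    \prod_(j <- I) P (eta j @^-1` B j))%E.

End gaussian.

(* Main.v *)
Require Import Defs.
From HB Require Import structures.
From mathcomp Require Import all_boot all_order all_fingroup all_algebra.
From mathcomp Require Import all_classical all_reals all_analysis.
From mathcomp Require Import measurable_realfun complex ring lra.

Set Implicit Arguments.
Unset Strict Implicit.
Unset Printing Implicit Defensive.

Import Order.TTheory GRing.Theory Num.Theory.
Import numFieldNormedType.Exports.

Local Open Scope classical_set_scope.
Local Open Scope ring_scope.
Local Open Scope complex_scope.

(** The series converges almost surely; its sum [psi^S] is determined by its values on a countable
    dense set of points, and these values form a centred complex Gaussian family.  The covariance of two of them,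
    for evaluation functionals [ell] and [ell'], is [\sum_j ell (S j) * (ell' (S j))^*]: this is the
    inner product of [ell] and [ell'] as continuous functionals on the Hilbert space of square
    integrable sections, hence it does not depend on the orthonormal basis.  A centred Gaussian family
    is determined by its covariance, so [psi^S] and [psi^S'] have the same law.  The work lies in
    making each of these steps meaningful.

    Evaluations are continuous for the L2 norm because of the local Bergman inequality
    [patch_exists]: near every point the norm of a holomorphic section is at most a constant times its
    L2 norm on a slightly larger set of finite volume.  It follows from the sub-mean value property
    [mean_value_Cn], obtained by averaging the Cauchy formula over squares, in one variable at a time.
    The comparison of the volume measure with Lebesgue measure needs [volume_density_gt0]: the top
    exterior power of a positive (1,1)-form does not vanish ([wedge_power_neq0]), and its sign is
    forced by the positivity of the measure.

    Basis independence of the covariance is [norm_sum_le]: by Pythagoras and the density of partial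
    sums, both [\sum_j |ell (S j)|^2] and [\sum_j |ell (S' j)|^2] are the squared norm of [ell].

    For a finite number of independent standard Gaussians, two systems of linear forms with the same
    Gram matrix have the same law ([gauss_gram_law]): a product of plane rotations and reflections
    carries one system onto the other, and these maps preserve the law ([gauss_rot2], where a rotation
    is factored into three shears).  When the dimension is infinite, truncated covariances of the two
    bases agree only up to a small error; [gauss_gram_close] absorbs the error in a few additional
    Gaussian coordinates with small coefficients, which are small in probability.

    Almost sure locally uniform convergence ([ucauchy_patch]) is a maximal inequality: for the
    quadratic form [energy], the integral over a patch of the squared norm of a linear combination of
    the basis, Levy's reflection argument bounds the largest of the partial sums by the last one, and
    the trace of the form is finite by Bessel's inequality for the evaluations ([bessel_pointwise]).
    The limit is holomorphic by Weierstrass' theorem ([differentiable_limit], [holomorphic_limit]).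

    Finally, the Borel sets of the Frechet topology are brought back to the countably many sample
    values: on the closure of the rational combinations of the two bases, each open set is a countable
    union of closed balls, and membership in such a ball is a countable set of conditions on the sample
    values ([trace_setP]).  This gives measurability ([measurable_psi]) and reduces the equality of laws
    to that of the sequences of sample values ([psi_law]). *)

(** * Complex modulus and integrals over segments *)

Section complex_line.
Context {R : realType}.
Local Notation C := R[i].
Local Notation cn := (@ComplexField.Normc.normc R).
Implicit Types (z w : C) (x y : R).

(** The norm of [R[i]] takes its values in [R[i]]; estimates are carried out with the real-valued
    modulus [cn] instead. *)
Lemma normCE z : `|z| = (cn z)%:C.
Proof. by rewrite normc_def; case: z. Qed.

Lemma cn_ge0 z : 0 <= cn z.
Proof. by case: z => a b /=; rewrite sqrtr_ge0. Qed.

Lemma cn0 : cn 0 = 0. Proof. exact: ComplexField.Normc.normc0. Qed.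

Lemma cnM z w : cn (z * w) = cn z * cn w.
Proof. exact: ComplexField.Normc.normcM. Qed.

Lemma cnV z : cn z^-1 = (cn z)^-1.
Proof. exact: ComplexField.Normc.normcV. Qed.

Lemma cnN z : cn (- z) = cn z. Proof. exact: normcN. Qed.

Lemma cnD z w : cn (z + w) <= cn z + cn w. Proof. exact: le_normcD. Qed.

Lemma cnB z w : cn (z - w) <= cn z + cn w.
Proof. by rewrite -(cnN w); exact: cnD. Qed.

Lemma cnC z w : cn (z - w) = cn (w - z). Proof. by rewrite -cnN opprB. Qed.

Lemma cn_real x : cn x%:C = `|x|.
Proof. by rewrite /= expr0n /= addr0 sqrtr_sqr. Qed.

Lemma cnE (a b : R) : cn (a +i* b) = Num.sqrt (a ^+ 2 + b ^+ 2). Proof. by []. Qed.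

Lemma cn_sqr z : cn z ^+ 2 = complex.Re z ^+ 2 + complex.Im z ^+ 2.
Proof. by case: z => a b; rewrite cnE sqr_sqrtr ?addr_ge0 ?sqr_ge0. Qed.

Lemma Re_le_cn z : `|complex.Re z| <= cn z.
Proof.
case: z => a b; rewrite cnE /= -sqrtr_sqr ler_sqrt ?addr_ge0 ?sqr_ge0//.
by rewrite lerDl sqr_ge0.
Qed.

Lemma Im_le_cn z : `|complex.Im z| <= cn z.
Proof.
case: z => a b; rewrite cnE /= -sqrtr_sqr ler_sqrt ?addr_ge0 ?sqr_ge0//.
by rewrite lerDr sqr_ge0.
Qed.

Lemma cn_i : cn 'i = 1.
Proof. by rewrite cnE expr0n /= add0r expr1n sqrtr1. Qed.

Lemma cn_le z : cn z <= `|complex.Re z| + `|complex.Im z|.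
Proof.
rewrite {1}[z]complexE; apply: le_trans (cnD _ _) _.
by rewrite cnM cn_i mul1r !cn_real.
Qed.

Lemma cn_eq0 z : (cn z == 0) = (z == 0).
Proof.
apply/eqP/eqP => [|->]; last exact: cn0.
exact: ComplexField.Normc.eq0_normc.
Qed.

Lemma cn_gt0 z : (0 < cn z) = (z != 0).
Proof. by rewrite lt_neqAle cn_ge0 andbT eq_sym cn_eq0. Qed.

Lemma ReB z w : complex.Re (z - w) = complex.Re z - complex.Re w.
Proof. by case: z w => [a b] [c d]. Qed.
Lemma ImB z w : complex.Im (z - w) = complex.Im z - complex.Im w.
Proof. by case: z w => [a b] [c d]. Qed.
Lemma ReD z w : complex.Re (z + w) = complex.Re z + complex.Re w.
Proof. by case: z w => [a b] [c d]. Qed.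
Lemma ImD z w : complex.Im (z + w) = complex.Im z + complex.Im w.
Proof. by case: z w => [a b] [c d]. Qed.

Lemma cvg_cnP (T : Type) (F : set_system T) (FF : Filter F) (f : T -> C) (l : C) :
  f @ F --> l <-> forall e : R, 0 < e -> \forall t \near F, cn (l - f t) < e.
Proof.
split=> [/cvgrPdist_lt fl e e0|fl].
  have /fl : 0 < e%:C by rewrite ltcR.
  by apply: filterS => t; rewrite normCE ltcR.
apply/cvgrPdist_lt => -[e e'] /=; rewrite ltcE /= => /andP[/eqP -> e0].
by apply: filterS (fl _ e0) => t; rewrite normCE -[_ +i* 0]/(e%:C) ltcR.
Qed.

Lemma nbhs_cnP (z : C) (A : set C) :
  nbhs z A <-> exists2 d : R, 0 < d & forall w, cn (z - w) < d -> A w.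
Proof.
split=> [/nbhs_ballP [[e e']] /=|[d d0 dA]].
  rewrite ltcE /= => /andP[/eqP -> e0] bA; exists e => // w we.
  by apply: bA; rewrite -ball_normE /= normCE -[_ +i* 0]/(e%:C) ltcR.
apply/nbhs_ballP; exists d%:C => /=; first by rewrite ltcR.
by move=> w; rewrite -ball_normE /= normCE ltcR; exact: dA.
Qed.

Lemma continuous_Re : continuous (@complex.Re R : C -> R).
Proof.
move=> z; apply/(@cvgrPdist_lt _ _ _ (nbhs z) (nbhs_filter z)) => e e0.
apply/nbhs_cnP; exists e => // w; apply: le_lt_trans.
by rewrite /= -ReB Re_le_cn.
Qed.

Lemma continuous_Im : continuous (@complex.Im R : C -> R).
Proof.
move=> z; apply/(@cvgrPdist_lt _ _ _ (nbhs z) (nbhs_filter z)) => e e0.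
apply/nbhs_cnP; exists e => // w; apply: le_lt_trans.
by rewrite /= -ImB Im_le_cn.
Qed.

Lemma cvg_complex (T : Type) (F : set_system T) (FF : Filter F) (f g : T -> R) (a b : R) :
  f @ F --> a -> g @ F --> b -> (fun t => f t +i* g t) @ F --> (a +i* b : C).
Proof.
move=> /cvgrPdist_lt fa /cvgrPdist_lt gb; apply/cvg_cnP => e e0.
have e2 : 0 < e / 2 by rewrite divr_gt0.
near=> t.
apply: le_lt_trans (cn_le _) _; rewrite /= [e]splitr ltrD//.
  by near: t; exact: fa.
by near: t; exact: gb.
Unshelve. all: by end_near. Qed.

Lemma cvg_Re (T : Type) (F : set_system T) (FF : Filter F) (f : T -> C) (l : C) :
  f @ F --> l -> (fun t => complex.Re (f t)) @ F --> complex.Re l.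
Proof. by move=> fl; apply: (cvg_comp f (@complex.Re R) fl); exact: continuous_Re. Qed.

Lemma cvg_Im (T : Type) (F : set_system T) (FF : Filter F) (f : T -> C) (l : C) :
  f @ F --> l -> (fun t => complex.Im (f t)) @ F --> complex.Im l.
Proof. by move=> fl; apply: (cvg_comp f (@complex.Im R) fl); exact: continuous_Im. Qed.

(** Continuity of [phi] itself at each point of the segment, rather than of its restriction: the
    integrands below are traces of functions continuous in the plane, and no subspace topology is
    then needed. *)
Definition icont (a b : R) (phi : R -> C) :=
  forall t, a <= t <= b -> {for t, continuous phi}.

Lemma icontD a b phi psi : icont a b phi -> icont a b psi -> icont a b (fun t => phi t + psi t).
Proof. by move=> h1 h2 t tab; apply: cvgD; [exact: h1|exact: h2]. Qed.
Lemma icontB a b phi psi : icont a b phi -> icont a b psi -> icont a b (fun t => phi t - psi t).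
Proof. by move=> h1 h2 t tab; apply: cvgB; [exact: h1|exact: h2]. Qed.
Lemma icontM a b phi psi : icont a b phi -> icont a b psi -> icont a b (fun t => phi t * psi t).
Proof. by move=> h1 h2 t tab; apply: cvgM; [exact: h1|exact: h2]. Qed.
Lemma icont_cst a b c : icont a b (fun=> c).
Proof. by move=> t tab; exact: cvg_cst. Qed.
Definition cint (a b : R) (phi : R -> C) : C :=
  (\int[lebesgue_measure]_(t in `[a, b]) complex.Re (phi t)) +i*
  (\int[lebesgue_measure]_(t in `[a, b]) complex.Im (phi t)).

Lemma continuous_itv_integrable (a b : R) (f : R -> R) :
  (forall t, a <= t <= b -> {for t, continuous f}) ->
  (@lebesgue_measure R).-integrable `[a, b] (EFin \o f).
Proof.
move=> h; apply: continuous_compact_integrable; first exact: segment_compact.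
apply: continuous_in_subspaceT => t; rewrite inE /= in_itv /= => tab.
exact: h.
Qed.

Lemma icont_Re a b phi : icont a b phi ->
  (@lebesgue_measure R).-integrable `[a, b] (EFin \o (fun t => complex.Re (phi t))).
Proof.
move=> h; apply: continuous_itv_integrable => t /h h'.
exact: cvg_Re.
Qed.

Lemma icont_Im a b phi : icont a b phi ->
  (@lebesgue_measure R).-integrable `[a, b] (EFin \o (fun t => complex.Im (phi t))).
Proof.
move=> h; apply: continuous_itv_integrable => t /h h'.
exact: cvg_Im.
Qed.

Lemma cintD a b phi psi : icont a b phi -> icont a b psi ->
  cint a b (fun t => phi t + psi t) = cint a b phi + cint a b psi.
Proof.
move=> h1 h2; rewrite /cint; congr (_ +i* _).
  rewrite -RintegralD//; [|exact: icont_Re|exact: icont_Re].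
  by apply: eq_Rintegral => t _; rewrite ReD.
rewrite -RintegralD//; [|exact: icont_Im|exact: icont_Im].
by apply: eq_Rintegral => t _; rewrite ImD.
Qed.

Lemma cintZ a b c phi : icont a b phi ->
  cint a b (fun t => c * phi t) = c * cint a b phi.
Proof.
move=> h; have [hR hI] := (icont_Re h, icont_Im h).
have sZ (r : R) (f : R -> R) : (@lebesgue_measure R).-integrable `[a, b] (EFin \o f) ->
    (@lebesgue_measure R).-integrable `[a, b] (EFin \o (fun t => r * f t)).
  move=> hf; apply: eq_integrable (integrableZl _ r hf) => //=.
case: c => c d; rewrite /cint; congr (_ +i* _).
  rewrite -!RintegralZl// -RintegralB//; [|exact: sZ|exact: sZ].
  by apply: eq_Rintegral => t _; case: (phi t).
rewrite -!RintegralZl// -RintegralD//; [|exact: sZ|exact: sZ].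
by apply: eq_Rintegral => t _; case: (phi t).
Qed.

Lemma eq_cint a b phi psi : (forall t, a <= t <= b -> phi t = psi t) ->
  cint a b phi = cint a b psi.
Proof.
move=> h; rewrite /cint; congr (_ +i* _); apply: eq_Rintegral => t;
  by rewrite inE /= in_itv /= => /h ->.
Qed.

Lemma cint_cst a b c : a <= b -> cint a b (fun=> c) = (b - a)%:C * c.
Proof.
move=> ab; case: c => c d; rewrite /cint !Rintegral_cst//=.
rewrite !lebesgue_measure_itv /= lte_fin; case: ltgtP ab => //= [_|->] _.
  by rewrite /GRing.mul /= !mul0r subr0 addr0; congr (_ +i* _); rewrite mulrC.
by rewrite subrr !mulr0 mul0r.
Qed.

Lemma le_cint_itv a b (f g : R -> R) :
  (forall t, a <= t <= b -> {for t, continuous f}) ->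
  (forall t, a <= t <= b -> {for t, continuous g}) ->
  (forall t, a <= t <= b -> f t <= g t) ->
  \int[lebesgue_measure]_(t in `[a, b]) f t <= \int[lebesgue_measure]_(t in `[a, b]) g t.
Proof.
move=> cf cg fg; apply: le_Rintegral => //; try exact: continuous_itv_integrable.
Qed.

Lemma Rintegral_itv_cst a b (r : R) : a <= b ->
  \int[lebesgue_measure]_(t in `[a, b]) r = r * (b - a).
Proof.
move=> ab; rewrite Rintegral_cst//= lebesgue_measure_itv /= lte_fin.
by case: ltgtP ab => //= -> _; rewrite subrr.
Qed.

(** The factor 2 comes from bounding the real and the imaginary part separately. *)
Lemma cint_le_cst a b phi B : a <= b -> icont a b phi ->
  (forall t, a <= t <= b -> cn (phi t) <= B) ->
  cn (cint a b phi) <= 2 * B * (b - a).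
Proof.
move=> ab h hB.
have real (f : R -> R) : (forall t, a <= t <= b -> {for t, continuous f}) ->
   (forall t, a <= t <= b -> `|f t| <= B) ->
   `|\int[lebesgue_measure]_(t in `[a, b]) f t| <= B * (b - a).
  move=> cf fB.
  have cc (c : R) : forall t, a <= t <= b -> {for t, continuous (fun=> c : R)}.
    by move=> *; exact: cvg_cst.
  rewrite ler_norml -mulNr -!Rintegral_itv_cst//.
  apply/andP; split; apply: le_cint_itv.
  - exact: cc.
  - exact: cf.
  - by move=> t /fB; rewrite ler_norml => /andP[].
  - exact: cf.
  - exact: cc.
  - by move=> t /fB; rewrite ler_norml => /andP[].
apply: le_trans (cn_le _) _; rewrite /= -mulrA mulr_natl mulr2n lerD//.
- apply: real => [t /h hc|t /hB tB]; first exact: cvg_Re.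
  exact: le_trans (Re_le_cn _) tB.
- apply: real => [t /h hc|t /hB tB]; first exact: cvg_Im.
  exact: le_trans (Im_le_cn _) tB.
Qed.

Lemma Rintegral_itv_split a m b (f : R -> R) : a <= m <= b ->
  (forall t, a <= t <= b -> {for t, continuous f}) ->
  \int[lebesgue_measure]_(t in `[a, b]) f t =
  \int[lebesgue_measure]_(t in `[a, m]) f t + \int[lebesgue_measure]_(t in `[m, b]) f t.
Proof.
move=> /andP[am mb] cf; have fi := continuous_itv_integrable cf.
have := @Rintegral_itvB R f (BLeft a) (BRight b) m fi.
rewrite !bnd_simp => /(_ am mb) e.
rewrite -[LHS](subrK (\int[lebesgue_measure]_(t in `[a, m]) f t)) e addrC.
congr (_ + _); rewrite Rintegral_itv_obnd_cbnd//.
apply: integrableS fi => //; apply: subset_itvr.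
by rewrite bnd_simp.
Qed.

Lemma cint_split a m b phi : a <= m <= b -> icont a b phi ->
  cint a b phi = cint a m phi + cint m b phi.
Proof.
move=> amb h; rewrite /cint; congr (_ +i* _).
  by apply: Rintegral_itv_split => // t /h hc; exact: cvg_Re.
by apply: Rintegral_itv_split => // t /h hc; exact: cvg_Im.
Qed.

Lemma cint_le_int a b phi (f : R -> R) : a <= b -> icont a b phi ->
  (forall t, a <= t <= b -> {for t, continuous f}) ->
  (forall t, a <= t <= b -> cn (phi t) <= f t) ->
  cn (cint a b phi) <= 2 * \int[lebesgue_measure]_(t in `[a, b]) f t.
Proof.
move=> ab h cf hf.
have real (g : R -> R) : (forall t, a <= t <= b -> {for t, continuous g}) ->
   (forall t, a <= t <= b -> `|g t| <= f t) ->
   `|\int[lebesgue_measure]_(t in `[a, b]) g t| <= \int[lebesgue_measure]_(t in `[a, b]) f t.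
  move=> cg gf; rewrite ler_norml; apply/andP; split.
    rewrite -mulN1r -RintegralZl//; last exact: continuous_itv_integrable.
    apply: le_cint_itv => // [t tab|t /gf].
      by apply: cvgM; [exact: cvg_cst|exact: cf].
    by rewrite mulN1r ler_norml => /andP[].
  by apply: le_cint_itv => // t /gf; rewrite ler_norml => /andP[].
apply: le_trans (cn_le _) _; rewrite /= mulr_natl mulr2n lerD//.
- apply: real => [t /h hc|t /hf tB]; first exact: cvg_Re.
  exact: le_trans (Re_le_cn _) tB.
- apply: real => [t /h hc|t /hf tB]; first exact: cvg_Im.
  exact: le_trans (Im_le_cn _) tB.
Qed.

End complex_line.

(** * Contour integrals over rectangles and the theorem of Goursat *)

Section cauchy.
Context {R : realType}.
Local Notation C := R[i].
Local Notation cn := (@ComplexField.Normc.normc R).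
Implicit Types (z w : C) (x y : R) (g f : C -> C).

(** Complex differentiability in epsilon-delta form, which is the form in which the subdivision
    argument consumes it. *)
Definition cdiff g z := exists a : C, forall e : R, 0 < e ->
  exists2 d : R, 0 < d & forall z', cn (z' - z) < d ->
    cn (g z' - g z - a * (z' - z)) <= e * cn (z' - z).

Definition crect (x1 x2 y1 y2 : R) : set C :=
  [set z | x1 <= complex.Re z <= x2 /\ y1 <= complex.Im z <= y2].

(** The contour integral of [g] over the boundary of the rectangle, counterclockwise. *)
Definition rect g (x1 x2 y1 y2 : R) : C :=
  cint x1 x2 (fun x => g (x +i* y1) - g (x +i* y2)) +
  'i * cint y1 y2 (fun y => g (x2 +i* y) - g (x1 +i* y)).

(** Continuity along the four sides: all that the contour integral sees. *)
Definition econt g (x1 x2 y1 y2 : R) :=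
  [/\ icont x1 x2 (fun x => g (x +i* y1)), icont x1 x2 (fun x => g (x +i* y2)),
      icont y1 y2 (fun y => g (x1 +i* y)) & icont y1 y2 (fun y => g (x2 +i* y))].

Lemma cdiff_continuous g z : cdiff g z -> {for z, continuous g}.
Proof.
move=> [a /(_ 1 ltr01) [d d0 dg]]; apply/(@cvg_cnP _ _ (nbhs z) (nbhs_filter z)) => e e0.
have a0 : 0 < cn a + 1 by rewrite ltr_wpDl// cn_ge0.
apply/nbhs_cnP; exists (Num.min d (e / (cn a + 1))).
  by rewrite lt_min d0 divr_gt0.
move=> w; rewrite lt_min cnC => /andP[/dg wd we]; rewrite cnC.
have -> : g w - g z = (g w - g z - a * (w - z)) + a * (w - z) by rewrite subrK.
apply: le_lt_trans (cnD _ _) _; rewrite cnM mul1r in wd *.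
apply: (@le_lt_trans _ _ ((cn a + 1) * cn (w - z))).
  by rewrite mulrDl mul1r addrC lerD2l.
by rewrite mulrC -ltr_pdivlMr.
Qed.

Lemma continuous_hline y x : {for x, continuous (fun x => x +i* y : C)}.
Proof. by apply: cvg_complex; [exact: cvg_id|exact: cvg_cst]. Qed.
Lemma continuous_vline x y : {for y, continuous (fun y => x +i* y : C)}.
Proof. by apply: cvg_complex; [exact: cvg_cst|exact: cvg_id]. Qed.

Lemma icont_hline g a b y :
  (forall x, a <= x <= b -> {for x +i* y, continuous g}) -> icont a b (fun x => g (x +i* y)).
Proof.
move=> h t /h gt.
exact: (@cvg_comp _ _ _ (fun x => x +i* y : C) g _ _ _ (@continuous_hline y t) gt).
Qed.
Lemma icont_vline g a b x :
  (forall y, a <= y <= b -> {for x +i* y, continuous g}) -> icont a b (fun y => g (x +i* y)).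
Proof.
move=> h t /h gt.
exact: (@cvg_comp _ _ _ (fun y => x +i* y : C) g _ _ _ (@continuous_vline x t) gt).
Qed.

Lemma rectD f g x1 x2 y1 y2 : econt f x1 x2 y1 y2 -> econt g x1 x2 y1 y2 ->
  rect (fun z => f z + g z) x1 x2 y1 y2 = rect f x1 x2 y1 y2 + rect g x1 x2 y1 y2.
Proof.
move=> [f1 f2 f3 f4] [g1 g2 g3 g4].
have e1 : cint x1 x2 (fun x => f (x +i* y1) + g (x +i* y1) - (f (x +i* y2) + g (x +i* y2)))
  = cint x1 x2 (fun x => f (x +i* y1) - f (x +i* y2)) +
    cint x1 x2 (fun x => g (x +i* y1) - g (x +i* y2)).
  rewrite -cintD; [|exact: icontB|exact: icontB].
  by apply: eq_cint => t _; rewrite opprD addrACA.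
have e2 : cint y1 y2 (fun y => f (x2 +i* y) + g (x2 +i* y) - (f (x1 +i* y) + g (x1 +i* y)))
  = cint y1 y2 (fun y => f (x2 +i* y) - f (x1 +i* y)) +
    cint y1 y2 (fun y => g (x2 +i* y) - g (x1 +i* y)).
  rewrite -cintD; [|exact: icontB|exact: icontB].
  by apply: eq_cint => t _; rewrite opprD addrACA.
by rewrite /rect e1 e2 mulrDr addrACA.
Qed.

Lemma rectZ c g x1 x2 y1 y2 : econt g x1 x2 y1 y2 ->
  rect (fun z => c * g z) x1 x2 y1 y2 = c * rect g x1 x2 y1 y2.
Proof.
move=> [g1 g2 g3 g4].
have e1 : cint x1 x2 (fun x => c * g (x +i* y1) - c * g (x +i* y2))
  = c * cint x1 x2 (fun x => g (x +i* y1) - g (x +i* y2)).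
  rewrite -cintZ; last exact: icontB.
  by apply: eq_cint => t _; rewrite mulrBr.
have e2 : cint y1 y2 (fun y => c * g (x2 +i* y) - c * g (x1 +i* y))
  = c * cint y1 y2 (fun y => g (x2 +i* y) - g (x1 +i* y)).
  rewrite -cintZ; last exact: icontB.
  by apply: eq_cint => t _; rewrite mulrBr.
by rewrite /rect e1 e2 mulrDr mulrCA.
Qed.

Lemma econtD f g x1 x2 y1 y2 : econt f x1 x2 y1 y2 -> econt g x1 x2 y1 y2 ->
  econt (fun z => f z + g z) x1 x2 y1 y2.
Proof. by move=> [? ? ? ?] [? ? ? ?]; split; exact: icontD. Qed.

Lemma econtM f g x1 x2 y1 y2 : econt f x1 x2 y1 y2 -> econt g x1 x2 y1 y2 ->
  econt (fun z => f z * g z) x1 x2 y1 y2.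
Proof. by move=> [? ? ? ?] [? ? ? ?]; split; exact: icontM. Qed.

Lemma econt_cst c x1 x2 y1 y2 : econt (fun=> c) x1 x2 y1 y2.
Proof. by split; exact: icont_cst. Qed.

Lemma econtZ c g x1 x2 y1 y2 : econt g x1 x2 y1 y2 -> econt (fun z => c * g z) x1 x2 y1 y2.
Proof. by move=> h; apply: (@econtM (fun=> c) g _ _ _ _ (econt_cst c _ _ _ _) h). Qed.

Lemma rectB f g x1 x2 y1 y2 : econt f x1 x2 y1 y2 -> econt g x1 x2 y1 y2 ->
  rect (fun z => f z - g z) x1 x2 y1 y2 = rect f x1 x2 y1 y2 - rect g x1 x2 y1 y2.
Proof.
move=> hf hg; have e : - rect g x1 x2 y1 y2 = rect (fun z => (-1) * g z) x1 x2 y1 y2.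
  by rewrite (rectZ _ hg) mulN1r.
rewrite e -(rectD hf (econtZ (-1) hg)).
have -> : (fun z => f z + -1 * g z) = (fun z => f z - g z); last by [].
by apply/funext => z; rewrite mulN1r.
Qed.

Lemma crect_econt g x1 x2 y1 y2 : x1 <= x2 -> y1 <= y2 ->
  (forall z, crect x1 x2 y1 y2 z -> {for z, continuous g}) -> econt g x1 x2 y1 y2.
Proof.
move=> x12 y12 h; split; (apply: icont_hline || apply: icont_vline) => t /andP[t1 t2];
  by apply: h; rewrite /crect /= ?t1 ?t2 ?lexx ?x12 ?y12.
Qed.

Lemma rect_splitx g x1 m x2 y1 y2 : x1 <= m <= x2 -> y1 <= y2 ->
  (forall z, crect x1 x2 y1 y2 z -> {for z, continuous g}) ->
  rect g x1 x2 y1 y2 = rect g x1 m y1 y2 + rect g m x2 y1 y2.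
Proof.
move=> /andP[x1m mx2] y12 h.
have hl y : y1 <= y <= y2 -> icont x1 x2 (fun x => g (x +i* y)).
  by move=> yy; apply: icont_hline => x xx; apply: h.
have vl x : x1 <= x <= x2 -> icont y1 y2 (fun y => g (x +i* y)).
  by move=> xx; apply: icont_vline => y yy; apply: h.
have e2 : cint y1 y2 (fun y => g (x2 +i* y) - g (x1 +i* y)) =
  cint y1 y2 (fun y => g (m +i* y) - g (x1 +i* y)) +
  cint y1 y2 (fun y => g (x2 +i* y) - g (m +i* y)).
  rewrite -cintD.
  - by apply: eq_cint => t _; rewrite [RHS]addrC addrA subrK.
  - by apply: icontB; apply: vl; rewrite ?x1m ?lexx ?mx2 ?(le_trans x1m mx2).
  - by apply: icontB; apply: vl; rewrite ?x1m ?lexx ?mx2 ?(le_trans x1m mx2).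
rewrite /rect e2 (@cint_split _ x1 m x2) ?x1m//.
  by rewrite mulrDr addrACA.
by apply: icontB; apply: hl; rewrite ?y12 ?lexx.
Qed.

Lemma rect_splity g x1 x2 y1 m y2 : x1 <= x2 -> y1 <= m <= y2 ->
  (forall z, crect x1 x2 y1 y2 z -> {for z, continuous g}) ->
  rect g x1 x2 y1 y2 = rect g x1 x2 y1 m + rect g x1 x2 m y2.
Proof.
move=> x12 /andP[y1m my2] h.
have hl y : y1 <= y <= y2 -> icont x1 x2 (fun x => g (x +i* y)).
  by move=> yy; apply: icont_hline => x xx; apply: h.
have vl x : x1 <= x <= x2 -> icont y1 y2 (fun y => g (x +i* y)).
  by move=> xx; apply: icont_vline => y yy; apply: h.
have e2 : cint x1 x2 (fun x => g (x +i* y1) - g (x +i* y2)) =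
  cint x1 x2 (fun x => g (x +i* y1) - g (x +i* m)) +
  cint x1 x2 (fun x => g (x +i* m) - g (x +i* y2)).
  rewrite -cintD.
  - by apply: eq_cint => t _; rewrite addrA subrK.
  - by apply: icontB; apply: hl; rewrite ?y1m ?lexx ?my2 ?(le_trans y1m my2).
  - by apply: icontB; apply: hl; rewrite ?y1m ?lexx ?my2 ?(le_trans y1m my2).
rewrite /rect e2 (@cint_split _ y1 m y2) ?y1m//.
  by rewrite mulrDr addrACA.
by apply: icontB; apply: vl; rewrite ?x12 ?lexx.
Qed.

(** Affine functions have a primitive; this is the case to which Goursat reduces a differentiable
    function at small scale. *)
Lemma rect_affine a b x1 x2 y1 y2 : x1 <= x2 -> y1 <= y2 ->
  rect (fun z => a + b * z) x1 x2 y1 y2 = 0.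
Proof.
move=> x12 y12; rewrite /rect.
rewrite (@eq_cint _ x1 x2 _ (fun=> b * ((y1 - y2)%:C * 'i))); last first.
  move=> t _; rewrite opprD addrACA subrr add0r -mulrBr; congr (_ * _).
  by apply/eqP; rewrite eq_complex /=; apply/andP; split; apply/eqP; ring.
rewrite (@eq_cint _ y1 y2 _ (fun=> b * (x2 - x1)%:C)); last first.
  move=> t _; rewrite opprD addrACA subrr add0r -mulrBr; congr (_ * _).
  by apply/eqP; rewrite eq_complex /=; apply/andP; split; apply/eqP; ring.
rewrite !cint_cst//.
have -> : (y1 - y2)%:C = - (y2 - y1)%:C :> C by rewrite -opprB raddfN.
move: ((y2 - y1)%:C) ((x2 - x1)%:C) => u v.
ring.
Qed.

Lemma rect_le g x1 x2 y1 y2 B : x1 <= x2 -> y1 <= y2 -> econt g x1 x2 y1 y2 ->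
  (forall z, crect x1 x2 y1 y2 z -> cn (g z) <= B) ->
  cn (rect g x1 x2 y1 y2) <= 4 * B * (x2 - x1 + (y2 - y1)).
Proof.
move=> x12 y12 [g1 g2 g3 g4] gB; apply: le_trans (cnD _ _) _.
rewrite mulrDr lerD// ?cnM ?cn_i ?mul1r.
  have -> : 4 * B * (x2 - x1) = 2 * (B + B) * (x2 - x1) by ring.
  apply: (cint_le_cst x12 (icontB g1 g2)).
  move=> t tx; apply: le_trans (cnB _ _) _.
  by rewrite lerD//; apply: gB; rewrite /crect /= tx lexx y12.
have -> : 4 * B * (y2 - y1) = 2 * (B + B) * (y2 - y1) by ring.
apply: (cint_le_cst y12 (icontB g4 g3)).
move=> t tx; apply: le_trans (cnB _ _) _.
by rewrite lerD//; apply: gB; rewrite /crect /= tx lexx x12.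
Qed.

End cauchy.
Section goursat.
Context {R : realType}.
Local Notation C := R[i].
Local Notation cn := (@ComplexField.Normc.normc R).
Implicit Types (z w : C) (x y : R) (g f : C -> C).

Lemma cdiff_affine a b z : cdiff (fun z => a + b * z) z.
Proof.
exists b => e e0; exists 1 => // w _.
have -> : a + b * w - (a + b * z) - b * (w - z) = 0 by ring.
by rewrite cn0 mulr_ge0 ?cn_ge0// ltW.
Qed.

Lemma max4P (a b c d : R) : exists2 m, a + b + (c + d) <= 4 * m &
  [\/ m = a, m = b, m = c | m = d].
Proof.
have [ab|ba] := leP a b; have [cd|dc] := leP c d.
- by have [bd|db] := leP b d; [exists d; [lra|constructor 4]|exists b; [lra|constructor 2]].
- by have [bd|db] := leP b c; [exists c; [lra|constructor 3]|exists b; [lra|constructor 2]].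
- by have [bd|db] := leP a d; [exists d; [lra|constructor 4]|exists a; [lra|constructor 1]].
- by have [bd|db] := leP a c; [exists c; [lra|constructor 3]|exists a; [lra|constructor 1]].
Qed.

(** The contributions of the interior sides cancel, so one of the four quarters carries at least a
    fourth of the integral. *)
Lemma rect_bisect g x1 y1 dx dy : 0 <= dx -> 0 <= dy ->
  (forall z, crect x1 (x1 + dx + dx) y1 (y1 + dy + dy) z -> {for z, continuous g}) ->
  exists p : R * R, [/\ p.1 = x1 \/ p.1 = x1 + dx, p.2 = y1 \/ p.2 = y1 + dy &
    cn (rect g x1 (x1 + dx + dx) y1 (y1 + dy + dy)) <=
    4 * cn (rect g p.1 (p.1 + dx) p.2 (p.2 + dy))].
Proof.
move=> dx0 dy0 gc.
have xm : x1 <= x1 + dx <= x1 + dx + dx by rewrite !lerDl dx0.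
have ym : y1 <= y1 + dy <= y1 + dy + dy by rewrite !lerDl dy0.
have [xm1 xm2] := andP xm; have [ym1 ym2] := andP ym.
have y12 := le_trans ym1 ym2.
rewrite (rect_splitx xm y12 gc).
rewrite (rect_splity xm1 ym); last first.
  by move=> z [/andP[h1 h2] h3]; apply: gc; split => //; rewrite h1 (le_trans h2 xm2).
rewrite (rect_splity xm2 ym); last first.
  by move=> z [/andP[h1 h2] h3]; apply: gc; split => //; rewrite h2 (le_trans xm1 h1).
set A := rect g _ _ _ _; set B := rect g _ _ _ _; set D := rect g _ _ _ _.
set E := rect g _ _ _ _.
have key : cn (A + B + (D + E)) <= cn A + cn B + (cn D + cn E).
  by apply: le_trans (cnD _ _) _; rewrite lerD// cnD.
have [m km em] := max4P (cn A) (cn B) (cn D) (cn E).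
have mm := le_trans key km.
case: em => em; rewrite em in mm.
- by exists (x1, y1); split => //=; left.
- by exists (x1, y1 + dy); split => //=; [left|right].
- by exists (x1 + dx, y1); split => //=; [right|left].
- by exists (x1 + dx, y1 + dy); split => //=; right.
Qed.

(** Nested bisection: the k-th rectangle has perimeter [O(2^-k)] and diameter [O(2^-k)], so an
    integral which is at least a [4^-k] fraction of the original one contradicts the first-order
    expansion of [g] at the limit point, unless the original integral is 0. *)
Lemma goursat g x1 x2 y1 y2 : x1 <= x2 -> y1 <= y2 ->
  (forall z, crect x1 x2 y1 y2 z -> cdiff g z) -> rect g x1 x2 y1 y2 = 0.
Proof.
move=> x12 y12 gd.
have gc z : crect x1 x2 y1 y2 z -> {for z, continuous g}.
  by move/gd; exact: cdiff_continuous.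
pose dx (k : nat) := (x2 - x1) / 2 ^+ k; pose dy (k : nat) := (y2 - y1) / 2 ^+ k.
have dx0 k : 0 <= dx k by rewrite divr_ge0 ?subr_ge0 ?exprn_ge0.
have dy0 k : 0 <= dy k by rewrite divr_ge0 ?subr_ge0 ?exprn_ge0.
have dxS k : dx k = dx k.+1 + dx k.+1.
  by rewrite /dx exprS; field; rewrite expf_neq0// pnatr_eq0.
have dyS k : dy k = dy k.+1 + dy k.+1.
  by rewrite /dy exprS; field; rewrite expf_neq0// pnatr_eq0.
(* [p] is the lower left corner of a rectangle of the k-th generation inside the original one. *)
pose inn k (p : R * R) := [/\ x1 <= p.1, p.1 + dx k <= x2, y1 <= p.2 & p.2 + dy k <= y2].
pose D k (p : R * R) := rect g p.1 (p.1 + dx k) p.2 (p.2 + dy k).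
have step k (p : R * R) : exists q : R * R, inn k p ->
    [/\ inn k.+1 q, p.1 <= q.1 /\ q.1 + dx k.+1 <= p.1 + dx k,
        p.2 <= q.2 /\ q.2 + dy k.+1 <= p.2 + dy k & cn (D k p) <= 4 * cn (D k.+1 q)].
  have [[i1 i2 i3 i4]|] := pselect (inn k p); last by exists p.
  have h1 : p.1 <= p.1 + dx k by rewrite lerDl.
  have h2 : p.2 <= p.2 + dy k by rewrite lerDl.
  have := @rect_bisect g p.1 p.2 (dx k.+1) (dy k.+1) (dx0 _) (dy0 _).
  rewrite -!addrA -dxS -dyS => -[].
    move=> z [/andP[a1 a2] /andP[a3 a4]]; apply: gc; split; apply/andP; split.
    - exact: le_trans i1 a1.
    - exact: le_trans a2 i2.
    - exact: le_trans i3 a3.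
    - exact: le_trans a4 i4.
  move=> q [q1 q2 q3]; exists q => _.
  have [qx1 qx2] : p.1 <= q.1 /\ q.1 + dx k.+1 <= p.1 + dx k.
    by rewrite (dxS k); case: q1 => ->; move: (dx0 k.+1); move: (dx k.+1) => u u0; split; lra.
  have [qy1 qy2] : p.2 <= q.2 /\ q.2 + dy k.+1 <= p.2 + dy k.
    by rewrite (dyS k); case: q2 => ->; move: (dy0 k.+1); move: (dy k.+1) => u u0; split; lra.
  split => //; split.
  - exact: le_trans i1 qx1.
  - exact: le_trans qx2 i2.
  - exact: le_trans i3 qy1.
  - exact: le_trans qy2 i4.
pose s := fix s k := if k is k'.+1 then sval (cid (step k' (s k'))) else (x1, y1).
have sin k : inn k (s k).
  elim: k => [|k IH] /=.
    by rewrite /inn /= /dx /dy expr0 !divr1 ![_ + (_ - _)]addrC !subrK !lexx.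
  by case: cid => q /= /(_ IH) [].
have sS k : [/\ (s k).1 <= (s k.+1).1 /\ (s k.+1).1 + dx k.+1 <= (s k).1 + dx k,
   (s k).2 <= (s k.+1).2 /\ (s k.+1).2 + dy k.+1 <= (s k).2 + dy k &
   cn (D k (s k)) <= 4 * cn (D k.+1 (s k.+1))].
  by rewrite /=; case: cid => q /= /(_ (sin k)) [].
have nested (u w : nat -> R) : (forall k, 0 <= w k) ->
    (forall k, u k <= u k.+1 /\ u k.+1 + w k.+1 <= u k + w k) ->
    exists l, forall k, u k <= l <= u k + w k.
  move=> w0 uS.
  have um k j : (k <= j)%N -> u k <= u j.
    move=> /subnK <-; elim: (j - k)%N => [|i IH]; first by rewrite add0n.
    by rewrite addSn; apply: le_trans IH _; exact: (uS _).1.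
  have wm k j : (k <= j)%N -> u j + w j <= u k + w k.
    move=> /subnK <-; elim: (j - k)%N => [|i IH]; first by rewrite add0n.
    by rewrite addSn; apply: le_trans IH; exact: (uS _).2.
  have ub k j : u j <= u k + w k.
    have [kj|/ltnW jk] := leqP k j.
      by apply: le_trans (wm _ _ kj); rewrite lerDl.
    by apply: le_trans (um _ _ jk) _; rewrite lerDl.
  exists (sup (range u)) => k; apply/andP; split.
    by apply: ub_le_sup; [exists (u k + w k) => _ [j _ <-]|exists k].
  by apply: ge_sup; [exists (u 0%N), 0%N|move=> _ [j _ <-]].
have [lx hx] := nested (fun k => (s k).1) dx dx0 (fun k => let: And3 h _ _ := sS k in h).
have [ly hy] := nested (fun k => (s k).2) dy dy0 (fun k => let: And3 _ h _ := sS k in h).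
pose z0 : C := lx +i* ly.
have z0in : crect x1 x2 y1 y2 z0.
  have := hx 0%N; have := hy 0%N; rewrite /= /dx /dy expr0 !divr1.
  by rewrite ![_ + (_ - _)]addrC !subrK; split.
have Dk k : cn (rect g x1 x2 y1 y2) <= 4 ^+ k * cn (D k (s k)).
  elim: k => [|k IH].
    by rewrite expr0 mul1r /D /= /dx /dy expr0 !divr1 ![_ + (_ - _)]addrC !subrK.
  apply: le_trans IH _; rewrite exprSr -mulrA ler_wpM2l ?exprn_ge0//.
  by case: (sS k).
(* [z0] is the common point of the nested rectangles; [a] is the derivative there. *)
have [a ad] := gd _ z0in.
apply/eqP; rewrite -cn_eq0 eq_le cn_ge0 andbT.
pose L := (x2 - x1) + (y2 - y1).
have L0 : 0 <= L by rewrite addr_ge0 ?subr_ge0.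
suff main (e : R) : 0 < e -> cn (rect g x1 x2 y1 y2) <= 4 * e * L ^+ 2.
  apply/ler_addgt0Pr => e e0; rewrite add0r.
  have K0 : 0 < 4 * (L ^+ 2 + 1) by rewrite mulr_gt0// ltr_wpDl// sqr_ge0.
  apply: le_trans (main (e / (4 * (L ^+ 2 + 1))) (divr_gt0 e0 K0)) _.
  have -> : 4 * (e / (4 * (L ^+ 2 + 1))) * L ^+ 2 = e * (L ^+ 2 / (L ^+ 2 + 1)).
    by field; rewrite gt_eqF// ltr_wpDl// sqr_ge0.
  rewrite ger_pMr// ler_pdivrMr ?ltr_wpDl ?sqr_ge0// mul1r lerDl.
  exact: ler01.
move=> e0; have [d d0 dg] := ad e e0.
have [k kd] : exists k, L / 2 ^+ k < d.
  have [k hk] : exists k : nat, L / d < k%:R by exists (Num.trunc (L / d)).+1; exact: truncnS_gt.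
  exists k; rewrite ltr_pdivrMr ?exprn_gt0// mulrC -ltr_pdivrMr//.
  by apply: lt_le_trans hk _; rewrite -natrX ler_nat ltnW// ltn_expl.
have [i1 i2 i3 i4] := sin k.
have hB z : crect (s k).1 ((s k).1 + dx k) (s k).2 ((s k).2 + dy k) z ->
    cn (g z - (g z0 - a * z0 + a * z)) <= e * (L / 2 ^+ k).
  move=> [zx zy].
  have zz : cn (z - z0) <= L / 2 ^+ k.
    apply: le_trans (cn_le _) _; rewrite ReB ImB /=.
    have -> : L / 2 ^+ k = dx k + dy k by rewrite /L mulrDl.
    move: (hx k) (hy k) => /andP[? ?] /andP[? ?].
    move: zx zy => /andP[? ?] /andP[? ?].
    by rewrite lerD// ler_norml; apply/andP; split; lra.
  have -> : g z - (g z0 - a * z0 + a * z) = g z - g z0 - a * (z - z0) by ring.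
  apply: le_trans (dg _ (le_lt_trans zz kd)) _.
  by rewrite ler_wpM2l// ltW.
have xk : (s k).1 <= (s k).1 + dx k by rewrite lerDl.
have yk : (s k).2 <= (s k).2 + dy k by rewrite lerDl.
have gc' z : crect (s k).1 ((s k).1 + dx k) (s k).2 ((s k).2 + dy k) z -> {for z, continuous g}.
  move=> [/andP[a1 a2] /andP[a3 a4]]; apply: gc; split; apply/andP; split.
  - exact: le_trans i1 a1.
  - exact: le_trans a2 i2.
  - exact: le_trans i3 a3.
  - exact: le_trans a4 i4.
have ec := crect_econt xk yk gc'.
have ac : econt (fun z => g z0 - a * z0 + a * z)
    (s k).1 ((s k).1 + dx k) (s k).2 ((s k).2 + dy k).
  by apply: (crect_econt xk yk) => z _; apply: cdiff_continuous; exact: cdiff_affine.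
apply: le_trans (Dk k) _.
have -> : D k (s k) = rect (fun z => g z - (g z0 - a * z0 + a * z))
    (s k).1 ((s k).1 + dx k) (s k).2 ((s k).2 + dy k).
  by rewrite (rectB ec ac) (rect_affine _ _ xk yk) subr0.
have ec' : econt (fun z => g z - (g z0 - a * z0 + a * z))
    (s k).1 ((s k).1 + dx k) (s k).2 ((s k).2 + dy k).
  case: ec ac => [? ? ? ?] [? ? ? ?]; split; exact: icontB.
apply: le_trans (ler_wpM2l _ (rect_le xk yk ec' hB)) _; first by rewrite exprn_ge0.
have -> : (s k).1 + dx k - (s k).1 + ((s k).2 + dy k - (s k).2) = L / 2 ^+ k.
  by rewrite /L mulrDl -/(dx k) -/(dy k); ring.
have -> : 4 ^+ k = 2 ^+ k * 2 ^+ k :> R by rewrite -exprMn -natrM.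
set t := 2 ^+ k.
have t0 : t != 0 by rewrite expf_neq0// pnatr_eq0.
by rewrite le_eqVlt; apply/orP; left; apply/eqP; field.
Qed.

End goursat.

(** * The Cauchy formula on squares *)

Section cauchy_formula.
Context {R : realType}.
Local Notation C := R[i].
Local Notation cn := (@ComplexField.Normc.normc R).
Implicit Types (z w : C) (x y : R) (g f : C -> C).

Lemma continuous_cnP g z : {for z, continuous g} <->
  forall e : R, 0 < e -> exists2 d : R, 0 < d &
    forall w, cn (w - z) < d -> cn (g w - g z) < e.
Proof.
split=> [/(@cvg_cnP _ _ (nbhs z) (nbhs_filter z)) h e /h /nbhs_cnP [d d0 dh]|h].
  by exists d => // w wd; rewrite cnC; apply: dh; rewrite cnC.
apply/(@cvg_cnP _ _ (nbhs z) (nbhs_filter z)) => e /h [d d0 dh].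
by apply/nbhs_cnP; exists d => // w wd; rewrite cnC; apply: dh; rewrite cnC.
Qed.

Lemma continuous_near f g z : (\forall w \near z, f w = g w) ->
  {for z, continuous g} -> {for z, continuous f}.
Proof.
move=> /nbhs_cnP [d d0 fg] /continuous_cnP gc; apply/continuous_cnP => e /gc [d' d'0 h].
exists (Num.min d d'); first by rewrite lt_min d0.
move=> w; rewrite lt_min => /andP[wd wd'].
rewrite fg; last by rewrite cnC.
by rewrite fg ?subrr ?cn0//; exact: h.
Qed.

(** The difference quotient extends continuously to the point: this turns products, and later the
    Cauchy kernel, into statements on continuity. *)
Lemma cdiff_caratheodory f z : cdiff f z <-> exists2 phi : C -> C,
  {for z, continuous phi} & forall w, f w = f z + phi w * (w - z).
Proof.
split=> [[a ad]|[phi /continuous_cnP phic fE]].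
  exists (fun w => if w == z then a else (f w - f z) / (w - z)).
    apply/continuous_cnP => e e0; have e2 : 0 < e / 2 by rewrite divr_gt0.
    have [d d0 dh] := ad _ e2; exists d => // w wd.
    rewrite eqxx; case: eqVneq => [_|wz]; first by rewrite subrr cn0.
    have wz' : w - z != 0 by rewrite subr_eq0.
    have -> : (f w - f z) / (w - z) - a = (f w - f z - a * (w - z)) / (w - z) by field.
    rewrite cnM cnV ltr_pdivrMr ?cn_gt0//; apply: le_lt_trans (dh _ wd) _.
    rewrite ltr_pM2r ?cn_gt0//; lra.
  move=> w; case: eqVneq => [->|wz]; first by rewrite subrr mulr0 addr0.
  by rewrite divfK ?subr_eq0// addrC subrK.
exists (phi z) => e /phic [d d0 dh]; exists d => // w wd.
have -> : f w - f z - phi z * (w - z) = (phi w - phi z) * (w - z) by rewrite fE; ring.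
by rewrite cnM ler_wpM2r ?cn_ge0// ltW// dh.
Qed.

Lemma cdiff_near f g z : (\forall w \near z, f w = g w) -> cdiff g z -> cdiff f z.
Proof.
move=> /nbhs_cnP [d d0 fg] [a ad]; exists a => e /ad [d' d'0 h].
exists (Num.min d d'); first by rewrite lt_min d0.
move=> w; rewrite lt_min => /andP[wd wd'].
rewrite fg; last by rewrite cnC.
by rewrite (fg z) ?subrr ?cn0//; exact: h.
Qed.

Lemma cdiffM f g z : cdiff f z -> cdiff g z -> cdiff (fun w => f w * g w) z.
Proof.
move=> fd gd; have gc := cdiff_continuous gd.
move/cdiff_caratheodory: fd => [phi phic fE]; move/cdiff_caratheodory: gd => [psi psic gE].
apply/cdiff_caratheodory; exists (fun w => phi w * g w + f z * psi w).
  apply: (@cvgD _ _ _ (nbhs z) _ (fun w => phi w * g w) (fun w => f z * psi w)).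
    exact: (@cvgM _ _ (nbhs z) _ phi g _ _ phic gc).
  exact: (@cvgM _ _ (nbhs z) _ (fun=> f z) psi _ _ (cvg_cst _) psic).
move=> w; rewrite {1}(fE w) {1}(gE w) {1}(gE w); ring.
Qed.

Lemma near_neq z w : z != w -> \forall z' \near z, z' != w.
Proof.
move=> zw; apply/nbhs_cnP; exists (cn (z - w)); first by rewrite cn_gt0 subr_eq0.
by move=> z' h; apply/eqP => e; move: h; rewrite e ltxx.
Qed.

Lemma continuousV_sub w z : z != w -> {for z, continuous (fun z => (z - w)^-1)}.
Proof.
move=> zw; apply: (@cvgV _ _ (nbhs z) _ (fun z => z - w)); first by rewrite subr_eq0.
exact: (@cvgB _ _ _ (nbhs z) _ id (fun=> w) _ _ cvg_id (cvg_cst _)).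
Qed.

Lemma cdiffV_sub w z : z != w -> cdiff (fun z => (z - w)^-1) z.
Proof.
move=> zw; have zw0 : z - w != 0 by rewrite subr_eq0.
apply/cdiff_caratheodory.
exists (fun z' => if z' == w then (z - w)^-1 * (z - w)^-1 else - (z - w)^-1 * (z' - w)^-1).
  apply: (@continuous_near _ (fun z' => - (z - w)^-1 * (z' - w)^-1)).
    by apply: filterS (near_neq zw) => z' /negPf ->.
  by apply: (@cvgM _ _ (nbhs z) _ (fun=> - (z - w)^-1)); [exact: cvg_cst|exact: continuousV_sub].
move=> z'; case: eqVneq => [->|z'w]; first by rewrite subrr invr0; field.
have z'w0 : z' - w != 0 by rewrite subr_eq0.
by field; rewrite z'w0 zw0.
Qed.

Lemma cdiffB_cst f c z : cdiff f z -> cdiff (fun w => f w - c) z.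
Proof.
move=> [a ad]; exists a => e /ad [d d0 h]; exists d => // w /h.
by have -> : f w - c - (f z - c) - a * (w - z) = f w - f z - a * (w - z) by ring.
Qed.

Lemma eq_rect g f x1 x2 y1 y2 : x1 <= x2 -> y1 <= y2 ->
  (forall z, crect x1 x2 y1 y2 z ->
     [\/ complex.Re z = x1, complex.Re z = x2, complex.Im z = y1 | complex.Im z = y2] ->
     g z = f z) ->
  rect g x1 x2 y1 y2 = rect f x1 x2 y1 y2.
Proof.
move=> x12 y12 gf; rewrite /rect.
rewrite (@eq_cint _ x1 x2 (fun x => g (x +i* y1) - g (x +i* y2))
  (fun x => f (x +i* y1) - f (x +i* y2))); last first.
  move=> t tt; congr (_ - _); apply: gf; rewrite /crect /= ?lexx ?y12 ?tt//.
    by constructor 3.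
  by constructor 4.
rewrite (@eq_cint _ y1 y2 (fun y => g (x2 +i* y) - g (x1 +i* y))
  (fun y => f (x2 +i* y) - f (x1 +i* y)))//.
move=> t tt; congr (_ - _); apply: gf; rewrite /crect /= ?lexx ?x12 ?tt//.
  by constructor 2.
by constructor 1.
Qed.

(** Cutting off four rectangles that avoid the exceptional point [w] leaves a square around [w] of
    arbitrarily small size, on which [g] is bounded. *)
Lemma rect_removable g x1 x2 y1 y2 w :
  x1 < complex.Re w < x2 -> y1 < complex.Im w < y2 ->
  (forall z, crect x1 x2 y1 y2 z -> {for z, continuous g}) ->
  (forall z, crect x1 x2 y1 y2 z -> z != w -> cdiff g z) -> rect g x1 x2 y1 y2 = 0.
Proof.
move=> /andP[x1w wx2] /andP[y1w wy2] gc gd.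
set u := complex.Re w in x1w wx2 *; set v := complex.Im w in y1w wy2 *.
have cw : {for w, continuous g} by apply: gc; split; apply/andP; split; exact: ltW.
have [d0 d00 hd0] := (continuous_cnP g w).1 cw 1 ltr01.
pose M := cn (g w) + 1.
have M0 : 0 < M by rewrite ltr_wpDl ?cn_ge0.
have gM z : cn (z - w) < d0 -> cn (g z) <= M.
  move=> /hd0 /ltW h; rewrite -[g z](subrK (g w)) addrC; apply: le_trans (cnD _ _) _.
  by rewrite lerD2l.
apply/eqP; rewrite -cn_eq0 eq_le cn_ge0 andbT; apply/ler_addgt0Pr => e e0; rewrite add0r.
(* [dl] is the half-side of the small square around [w]. *)
have [dl [dl0 h1 [h2 h3] [h4 [h5 h6]]]] : exists dl : R, [/\ 0 < dl, 2 * dl < d0,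
    x1 <= u - dl /\ u + dl <= x2 & y1 <= v - dl /\ (v + dl <= y2 /\ 16 * M * dl <= e)].
  pose m := Num.min (Num.min (d0 / 4) (e / (16 * M)))
    (Num.min (Num.min (u - x1) (x2 - u)) (Num.min (v - y1) (y2 - v))).
  have m0 : 0 < m by rewrite !lt_min !subr_gt0 x1w wx2 y1w wy2 !divr_gt0// mulr_gt0.
  have [ma mb] : m <= d0 / 4 /\ m <= e / (16 * M) by rewrite /m !ge_min !lexx ?orbT.
  have [mc md] : m <= u - x1 /\ m <= x2 - u by rewrite /m !ge_min !lexx ?orbT.
  have [me mf] : m <= v - y1 /\ m <= y2 - v by rewrite /m !ge_min !lexx ?orbT.
  exists m; split => //; [lra|split; lra|split; first lra; split; first lra].
  by rewrite mulrC -ler_pdivlMr// mulr_gt0.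
have x12 : x1 <= x2 by apply: ltW; exact: lt_trans x1w wx2.
have y12 : y1 <= y2 by apply: ltW; exact: lt_trans y1w wy2.
have out a1 a2 b1 b2 : x1 <= a1 <= a2 -> a2 <= x2 -> y1 <= b1 <= b2 -> b2 <= y2 ->
    ~ crect a1 a2 b1 b2 w -> rect g a1 a2 b1 b2 = 0.
  move=> /andP[p1 p2] p3 /andP[q1 q2] q3 nw; apply: goursat => // z zr.
  apply: gd; last by apply/eqP => zw; apply: nw; rewrite -zw.
  case: zr => /andP[r1 r2] /andP[r3 r4]; split; apply/andP; split.
  - exact: le_trans p1 r1.
  - exact: le_trans r2 p3.
  - exact: le_trans q1 r3.
  - exact: le_trans r4 q3.
have sub a1 a2 b1 b2 : x1 <= a1 -> a2 <= x2 -> y1 <= b1 -> b2 <= y2 ->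
    forall z, crect a1 a2 b1 b2 z -> {for z, continuous g}.
  move=> p1 p2 p3 p4 z [/andP[r1 r2] /andP[r3 r4]]; apply: gc; split; apply/andP; split.
  - exact: le_trans p1 r1.
  - exact: le_trans r2 p2.
  - exact: le_trans p3 r3.
  - exact: le_trans r4 p4.
have uu : u - dl <= u + dl by lra.
have vv : v - dl <= v + dl by lra.
have q1 : x1 <= u - dl <= x2 by rewrite h2; lra.
have q2 : u - dl <= u + dl <= x2 by rewrite h3; lra.
have q3 : y1 <= v - dl <= y2 by rewrite h4; lra.
have q4 : v - dl <= v + dl <= y2 by rewrite h5; lra.
rewrite (rect_splitx q1 y12 gc).
rewrite (out x1 (u - dl)) ?lexx ?h2 ?y12//; [|lra|]; last first.
  by case=> /andP[_ h] _; rewrite -/u in h; lra.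
rewrite add0r (rect_splitx q2 y12 (sub _ _ _ _ h2 (lexx _) (lexx _) (lexx _))).
rewrite (out (u + dl) x2) ?lexx ?h3 ?y12//; [|lra|]; last first.
  by case=> /andP[h _] _; rewrite -/u in h; lra.
rewrite addr0 (rect_splity uu q3 (sub _ _ _ _ h2 h3 (lexx _) (lexx _))).
rewrite (out (u - dl) (u + dl) y1 (v - dl)) ?lexx ?h4//; [|rewrite h2; lra|lra|]; last first.
  by case=> _ /andP[_ h]; rewrite -/v in h; lra.
rewrite add0r (rect_splity uu q4 (sub _ _ _ _ h2 h3 h4 (lexx _))).
rewrite (out (u - dl) (u + dl) (v + dl) y2) ?lexx ?h5//; [|rewrite h2; lra|lra|]; last first.
  by case=> _ /andP[h _]; rewrite -/v in h; lra.
rewrite addr0.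
have ec := crect_econt uu vv (sub _ _ _ _ h2 h3 h4 h5).
apply: (le_trans (rect_le uu vv ec (B := M) _)).
  move=> z [/andP[r1 r2] /andP[r3 r4]]; apply: gM.
  apply: le_lt_trans (cn_le _) _; rewrite ReB ImB -/u -/v; apply: le_lt_trans h1.
  have -> : 2 * dl = dl + dl by ring.
  by apply: lerD; rewrite ler_norml; apply/andP; split; lra.
have -> : u + dl - (u - dl) + (v + dl - (v - dl)) = 4 * dl by ring.
by apply: le_trans h6; rewrite le_eqVlt; apply/orP; left; apply/eqP; ring.
Qed.

(** The contour integral over the square of half-side [r] centred at [z0]; [csq] is the closed
    square and [bsq] its boundary. *)
Definition sq (z0 : C) (r : R) g : C :=
  rect g (complex.Re z0 - r) (complex.Re z0 + r) (complex.Im z0 - r) (complex.Im z0 + r).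
Definition csq (z0 : C) (r : R) : set C :=
  [set z | `|complex.Re z - complex.Re z0| <= r /\ `|complex.Im z - complex.Im z0| <= r].
Definition bsq (z0 : C) (r : R) : set C :=
  [set z | csq z0 r z /\
     (`|complex.Re z - complex.Re z0| = r \/ `|complex.Im z - complex.Im z0| = r)].

Lemma crect_csq z0 r : crect (complex.Re z0 - r) (complex.Re z0 + r)
  (complex.Im z0 - r) (complex.Im z0 + r) = csq z0 r.
Proof.
by apply/seteqP; split=> z []; rewrite /crect /csq /= !ler_distl => -> ->.
Qed.

Lemma bsq_le z0 r z : bsq z0 r z -> r <= cn (z - z0).
Proof.
case=> _ [] <-; first by rewrite -ReB Re_le_cn.
by rewrite -ImB Im_le_cn.
Qed.

Lemma eq_sq z0 r g f : 0 <= r -> (forall z, bsq z0 r z -> g z = f z) -> sq z0 r g = sq z0 r f.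
Proof.
move=> r0 h; apply: eq_rect; [lra|lra|move=> z].
rewrite crect_csq => zs zb; apply: h; split => //.
case: zb => ->; [left|left|right|right].
- by rewrite addrC addKr normrN ger0_norm.
- by rewrite addrC addKr ger0_norm.
- by rewrite addrC addKr normrN ger0_norm.
- by rewrite addrC addKr ger0_norm.
Qed.

Definition sqcont (z0 : C) (r : R) g := econt g (complex.Re z0 - r) (complex.Re z0 + r)
  (complex.Im z0 - r) (complex.Im z0 + r).

Lemma bsq_sqcont z0 r g : 0 <= r -> (forall z, bsq z0 r z -> {for z, continuous g}) ->
  sqcont z0 r g.
Proof.
move=> r0 h; have e (a : R) : a - r - a = - r by ring.
have e' (a : R) : a + r - a = r by ring.
split; [apply: icont_hline|apply: icont_hline|apply: icont_vline|apply: icont_vline] => t tt;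
  apply: h; rewrite /bsq /csq /= ?e ?e' ?normrN ?(ger0_norm r0) ?lexx ler_distl tt;
  by (by split => //; right) || (by split => //; left).
Qed.

Lemma sq_le z0 r g B : 0 <= r -> sqcont z0 r g -> (forall z, bsq z0 r z -> cn (g z) <= B) ->
  cn (sq z0 r g) <= 16 * B * r.
Proof.
move=> r0 gc gB.
have e (a : R) : a - r - a = - r by ring.
have e' (a : R) : a + r - a = r by ring.
have B0 : 0 <= B.
  have zb : bsq z0 r ((complex.Re z0 + r) +i* complex.Im z0); last first.
    exact: le_trans (cn_ge0 _) (gB _ zb).
  by rewrite /bsq /csq /= e' subrr normr0 ger0_norm//; split=> //; left.
case: gc => g1 g2 g3 g4; apply: le_trans (cnD _ _) _.
have s (a : R) : a - r <= a + r by lra.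
have es (a : R) : a + r - (a - r) = 2 * r by ring.
have -> : 16 * B * r = 2 * (B + B) * (2 * r) + 2 * (B + B) * (2 * r) by ring.
apply: lerD; rewrite ?cnM ?cn_i ?mul1r.
  have := cint_le_cst (s _) (icontB g1 g2); rewrite es; apply => t tt.
  apply: le_trans (cnB _ _) _; apply: lerD; apply: gB;
  by rewrite /bsq /csq /= ?e ?e' ?normrN ?(ger0_norm r0) ?lexx ler_distl tt; split => //; right.
have := cint_le_cst (s _) (icontB g4 g3); rewrite es; apply => t tt.
apply: le_trans (cnB _ _) _; apply: lerD; apply: gB;
by rewrite /bsq /csq /= ?e ?e' ?normrN ?(ger0_norm r0) ?lexx ler_distl tt; split => //; left.
Qed.

(** The difference quotient of [f] at [w] is continuous on the square and differentiable off [w], so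
    its contour integral vanishes. The integral of the kernel stays as a factor, which [sq_inv_ge]
    bounds away from 0. *)
Lemma cauchy_formula f z0 r w : 0 < r -> (forall z, csq z0 r z -> cdiff f z) ->
  cn (w - z0) < r ->
  sq z0 r (fun z => f z * (z - w)^-1) = f w * sq z0 r (fun z => (z - w)^-1).
Proof.
move=> r0 fd wr.
have [wx wy] : `|complex.Re w - complex.Re z0| < r /\ `|complex.Im w - complex.Im z0| < r.
  by rewrite -ReB -ImB; split; [exact: le_lt_trans (Re_le_cn _) wr|
    exact: le_lt_trans (Im_le_cn _) wr].
have ws : csq z0 r w by split; exact: ltW.
have bw z : bsq z0 r z -> z != w.
  by move=> /bsq_le h; apply/eqP => zw; move: h; rewrite zw leNgt wr.
have [phi phic fE] := (cdiff_caratheodory f w).1 (fd _ ws).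
have phiE z : z != w -> phi z = (f z - f w) * (z - w)^-1.
  by move=> zw; rewrite fE addrC addKr mulfK// subr_eq0.
have phid z : csq z0 r z -> z != w -> cdiff phi z.
  move=> zs zw; apply: (@cdiff_near _ (fun z => (f z - f w) * (z - w)^-1)).
    by apply: filterS (near_neq zw) => z' /phiE.
  by apply: cdiffM; [exact/cdiffB_cst/fd|exact: cdiffV_sub].
have key : sq z0 r phi = 0.
  apply: (@rect_removable _ _ _ _ _ w); rewrite ?crect_csq.
  - by rewrite -ltr_distl.
  - by rewrite -ltr_distl.
  - move=> z zs; have [->//|zw] := eqVneq z w.
    by apply: cdiff_continuous; exact: phid.
  - exact: phid.
have fc z : bsq z0 r z -> {for z, continuous f}.
  by case=> zs _; apply: cdiff_continuous; exact: fd.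
have vc z : bsq z0 r z -> {for z, continuous (fun z => (z - w)^-1)}.
  by move=> zb; apply: continuousV_sub; exact: bw.
have c1 : sqcont z0 r (fun z => (z - w)^-1) by exact: bsq_sqcont (ltW r0) vc.
have c2 : sqcont z0 r (fun z => f z * (z - w)^-1).
  apply: (bsq_sqcont (ltW r0)) => z zb.
  exact: (@cvgM _ _ (nbhs z) _ f _ _ _ (fc _ zb) (vc _ zb)).
move: key; rewrite (@eq_sq _ _ _ (fun z => f z * (z - w)^-1 - f w * (z - w)^-1)).
- rewrite /sq (rectB c2 (econtZ (f w) c1)) (rectZ _ c1) => /eqP.
  by rewrite subr_eq0 => /eqP.
- exact: ltW.
- by move=> z /bw /phiE ->; rewrite mulrBl.
Qed.

(** The two sides of each opposite pair together contribute [i] times the integral of the positive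
    function [k], which is at least [1 / r] on an interval of length [2 * r]; hence the imaginary
    part is at least [2 + 2]. *)
Lemma sq_inv_ge z0 r : 0 < r -> 4 <= cn (sq z0 r (fun z => (z - z0)^-1)).
Proof.
move=> r0; apply: le_trans (Im_le_cn _); apply: le_trans (ler_norm _).
set a := complex.Re z0; set b := complex.Im z0.
have eI (x y : R) : (x +i* y - z0) = (x - a) +i* (y - b) :> C by rewrite /a /b; case: (z0).
pose k (c t : R) := 2 * r / (r ^+ 2 + (t - c) ^+ 2).
have pos (c t : R) : 0 < r ^+ 2 + (t - c) ^+ 2 by rewrite ltr_pwDl ?sqr_ge0// exprn_gt0.
have kc c t : {for t, continuous (k c)}.
  apply: (@cvgM _ _ (nbhs t) _ (fun=> 2 * r)); first exact: cvg_cst.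
  apply: (@cvgV _ _ (nbhs t) _ (fun t => r ^+ 2 + (t - c) ^+ 2)); first by rewrite gt_eqF.
  apply: (@cvgD _ _ _ (nbhs t) _ (fun=> r ^+ 2)); first exact: cvg_cst.
  have h : (fun t => t - c) @ nbhs t --> t - c.
    exact: (@cvgB _ _ _ (nbhs t) _ id (fun=> c) _ _ cvg_id (cvg_cst _)).
  exact: (@cvgM _ _ (nbhs t) _ _ _ _ _ h h).
have kI c : 2 <= \int[lebesgue_measure]_(t in `[c - r, c + r]) k c t.
  have cr : c - r <= c + r by lra.
  have -> : 2 = r^-1 * (c + r - (c - r)) by field; rewrite gt_eqF.
  rewrite -Rintegral_itv_cst//; apply: le_cint_itv => //.
    by move=> t _; exact: cvg_cst.
  move=> t; rewrite -ler_distl => tc.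
  have -> : r^-1 = 2 * r / (2 * r ^+ 2) by field; rewrite gt_eqF.
  rewrite /k ler_pM2l ?mulr_gt0// lef_pV2 ?posrE ?pos ?mulr_gt0 ?exprn_gt0//.
  rewrite mulr_natl mulr2n lerD2l.
  by rewrite -real_normK ?num_real// ler_pXn2r// ?nnegrE ?normr_ge0// ltW.
have e1 : cint (a - r) (a + r) (fun x => (x +i* (b - r) - z0)^-1 - (x +i* (b + r) - z0)^-1)
  = cint (a - r) (a + r) (fun x => 'i * (k a x)%:C).
  apply: eq_cint => t _; apply/eqP; rewrite !eI eq_complex /= /k.
  have p1 := pos a t.
  have q1 : (t - a) ^+ 2 + (b - r - b) ^+ 2 = r ^+ 2 + (t - a) ^+ 2 by ring.
  have q2 : (t - a) ^+ 2 + (b + r - b) ^+ 2 = r ^+ 2 + (t - a) ^+ 2 by ring.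
  rewrite q1 q2; apply/andP; split; apply/eqP; field; by rewrite gt_eqF.
have e2 : cint (b - r) (b + r) (fun y => ((a + r) +i* y - z0)^-1 - ((a - r) +i* y - z0)^-1)
  = cint (b - r) (b + r) (fun x => (k b x)%:C).
  apply: eq_cint => t _; apply/eqP; rewrite !eI eq_complex /= /k.
  have p1 := pos b t.
  have q1 : (a + r - a) ^+ 2 + (t - b) ^+ 2 = r ^+ 2 + (t - b) ^+ 2 by ring.
  have q2 : (a - r - a) ^+ 2 + (t - b) ^+ 2 = r ^+ 2 + (t - b) ^+ 2 by ring.
  rewrite q1 q2; apply/andP; split; apply/eqP; field; by rewrite gt_eqF.
have kC c (u v : R) : icont u v (fun x => (k c x)%:C).
  by move=> t _; apply: cvg_complex; [exact: kc|exact: cvg_cst].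
rewrite /sq /rect -/a -/b e1 e2 (cintZ _ (kC _ _ _)) -mulrDr.
set I1 := cint _ _ _; set I2 := cint _ _ _.
have i1 : 2 <= complex.Re I1 by exact: kI.
have i2 : 2 <= complex.Re I2 by exact: kI.
by rewrite mulrC ImiRe ReD; lra.
Qed.

End cauchy_formula.

(** * Weierstrass' theorem in several variables *)

Section taylor.
Context {R : realType}.
Local Notation C := R[i].
Local Notation cn := (@ComplexField.Normc.normc R).
Implicit Types (z w : C) (x y : R) (g f : C -> C).

(** The Cauchy formula as a property of [f]: unlike differentiability, it passes to uniform limits
    by mere estimation, and it yields a Taylor estimate. Restricting [w] to half the radius keeps
    the kernel bounded. *)
Definition cauchy_rep (r : R) f := sqcont 0 r f /\ forall w, cn w <= r / 2 ->
  sq 0 r (fun z => f z * (z - w)^-1) = f w * sq 0 r (fun z => (z - w)^-1).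

(** The derivative at 0 as the coefficient of [w] in the expansion of the Cauchy formula; the
    denominator and the correction by [f 0] account for the kernel integral on the right-hand side
    of the formula. *)
Definition cder (r : R) f : C :=
  (sq 0 r (fun z => f z * (z^-1 * z^-1)) - f 0 * sq 0 r (fun z => z^-1 * z^-1)) /
  sq 0 r (fun z => z^-1).

Lemma bsq0_le (r : R) z : bsq 0 r z -> r <= cn z.
Proof. by move=> /bsq_le; rewrite subr0. Qed.

Lemma bsq0_neq (r : R) z w : 0 < r -> bsq 0 r z -> cn w <= r / 2 -> r / 2 <= cn (z - w).
Proof.
move=> r0 /bsq0_le rz wr; have : cn z <= cn (z - w) + cn w.
  by rewrite -{1}[z](subrK w) cnD.
lra.
Qed.

Lemma sqcont_kernel (r : R) w : 0 < r -> cn w <= r / 2 -> sqcont 0 r (fun z => (z - w)^-1).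
Proof.
move=> r0 wr; apply: (bsq_sqcont (ltW r0)) => z zb; apply: continuousV_sub.
apply/eqP => zw; have := bsq0_neq r0 zb wr; rewrite zw subrr cn0.
by rewrite leNgt divr_gt0.
Qed.

Lemma cn0_half (r : R) : 0 < r -> cn 0 <= r / 2.
Proof. by move=> r0; rewrite cn0 divr_ge0// ltW. Qed.

Lemma sqcont_inv (r : R) : 0 < r -> sqcont 0 r (fun z => z^-1).
Proof.
move=> r0; have := sqcont_kernel r0 (cn0_half r0).
by rewrite (_ : (fun z : C => (z - 0)^-1) = (fun z : C => z^-1))//; apply/funext => z; rewrite subr0.
Qed.

Lemma sqcont_inv2 (r : R) : 0 < r -> sqcont 0 r (fun z => z^-1 * z^-1).
Proof. by move=> r0; exact: (econtM (sqcont_inv r0) (sqcont_inv r0)). Qed.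

Lemma cnV_bsq (r : R) z w : 0 < r -> bsq 0 r z -> cn w <= r / 2 -> cn (z - w)^-1 <= 2 / r.
Proof.
move=> r0 zb wr; have h := bsq0_neq r0 zb wr.
rewrite cnV -[2 / r]invrK lef_pV2 ?posrE.
- by rewrite invf_div.
- by apply: lt_le_trans h; rewrite divr_gt0.
- by rewrite invr_gt0 divr_gt0.
Qed.

Lemma cnV0_bsq (r : R) z : 0 < r -> bsq 0 r z -> cn z^-1 <= r^-1.
Proof.
move=> r0 /bsq0_le h.
by rewrite cnV lef_pV2 ?posrE//; exact: lt_le_trans h.
Qed.

(** Integrate [1/(z-w) = 1/z + w/z^2 + w^2/(z^2 (z-w))] against [f]. *)
Lemma sq_expand (r B : R) f w : 0 < r -> sqcont 0 r f ->
  (forall z, bsq 0 r z -> cn (f z) <= B) -> cn w <= r / 2 ->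
  exists2 Rm : C, cn Rm <= 32 * B / r ^+ 2 &
    sq 0 r (fun z => f z * (z - w)^-1) =
    sq 0 r (fun z => f z * z^-1) + w * sq 0 r (fun z => f z * (z^-1 * z^-1)) + w * w * Rm.
Proof.
move=> r0 fc fB wr.
have kc := sqcont_kernel r0 wr.
have i1 := sqcont_inv r0; have i2 := sqcont_inv2 r0.
have f1 := econtM fc i1; have f2 := econtM fc i2.
have f3 : sqcont 0 r (fun z => f z * (z^-1 * z^-1) * (z - w)^-1) := econtM f2 kc.
exists (sq 0 r (fun z => f z * (z^-1 * z^-1) * (z - w)^-1)).
  have -> : 32 * B / r ^+ 2 = 16 * (B * (r^-1 * r^-1) * (2 / r)) * r by field; rewrite gt_eqF.
  apply: (sq_le (ltW r0) f3) => z zb; rewrite !cnM.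
  have B0 : 0 <= B := le_trans (cn_ge0 _) (fB _ zb).
  apply: ler_pM; rewrite ?mulr_ge0 ?cn_ge0//; last exact: cnV_bsq.
  apply: ler_pM; rewrite ?mulr_ge0 ?cn_ge0//; first exact: fB.
  by apply: ler_pM; rewrite ?cn_ge0//; exact: cnV0_bsq.
rewrite -(rectZ w f2) -(rectZ (w * w) f3) -(rectD f1 (econtZ w f2)).
rewrite -(rectD (econtD f1 (econtZ w f2)) (econtZ (w * w) f3)).
apply: (eq_sq (ltW r0)) => z zb.
have z0 : z != 0 by rewrite -cn_gt0; apply: lt_le_trans (bsq0_le zb).
have zw : z - w != 0.
  by rewrite -cn_gt0; apply: lt_le_trans (bsq0_neq r0 zb wr); rewrite divr_gt0.
by field; rewrite ?z0 ?zw.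
Qed.

Lemma sq_coef2_le (r B : R) f : 0 < r -> sqcont 0 r f ->
  (forall z, bsq 0 r z -> cn (f z) <= B) ->
  cn (sq 0 r (fun z => f z * (z^-1 * z^-1))) <= 16 * B / r.
Proof.
move=> r0 fc fB; have f2 := econtM fc (sqcont_inv2 r0).
have -> : 16 * B / r = 16 * (B * (r^-1 * r^-1)) * r by field; rewrite gt_eqF.
apply: (sq_le (ltW r0) f2) => z zb; rewrite !cnM.
apply: ler_pM; rewrite ?mulr_ge0 ?cn_ge0//; first exact: fB.
by apply: ler_pM; rewrite ?cn_ge0//; exact: cnV0_bsq.
Qed.

Lemma sq_inv2_le (r : R) : 0 < r -> cn (sq 0 r (fun z => z^-1 * z^-1)) <= 16 / r.
Proof.
move=> r0; have := @sq_coef2_le r 1 (fun=> 1) r0 (econt_cst 1 _ _ _ _).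
rewrite (_ : (fun z : C => 1 * (z^-1 * z^-1)) = (fun z => z^-1 * z^-1)).
  rewrite mulr1; apply => z _; have := @cnM R 1 1; rewrite mulr1.
  by rewrite /= expr1n expr0n addr0 sqrtr1.
by apply/funext => z; rewrite mul1r.
Qed.

Lemma sq_inv0_ge (r : R) : 0 < r -> 4 <= cn (sq 0 r (fun z => z^-1)).
Proof.
move=> /(sq_inv_ge (0 : C)).
by rewrite (_ : (fun z : C => (z - 0)^-1) = (fun z : C => z^-1))//; apply/funext => z; rewrite subr0.
Qed.

Lemma sq_inv0_neq (r : R) : 0 < r -> sq 0 r (fun z => z^-1 : C) != 0.
Proof. by move=> /sq_inv0_ge h; rewrite -cn_gt0; apply: lt_le_trans h. Qed.

Lemma cder_le (r B : R) f : 0 < r -> sqcont 0 r f ->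
  (forall z, csq 0 r z -> cn (f z) <= B) -> cn (cder r f) <= 8 * B / r.
Proof.
move=> r0 fc fB; rewrite /cder cnM cnV.
have K4 := sq_inv0_ge r0; set K := cn (sq 0 r _) in K4 *.
have K0 : 0 < K by apply: lt_le_trans K4.
have f0 : cn (f 0) <= B by apply: fB; rewrite /csq /= subrr normr0 ltW.
have B0 : 0 <= B := le_trans (cn_ge0 _) f0.
rewrite ler_pdivrMr//; apply: le_trans (cnB _ _) _.
rewrite cnM; apply: (@le_trans _ _ (16 * B / r + B * (16 / r))).
  apply: lerD; first by apply: sq_coef2_le => // z [/fB].
  by apply: ler_pM; rewrite ?cn_ge0//; exact: sq_inv2_le.
have -> : 16 * B / r + B * (16 / r) = 8 * B / r * 4 by ring.
by rewrite ler_wpM2l// divr_ge0 ?mulr_ge0// ltW.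
Qed.

Lemma cderB (r : R) f g : 0 < r -> sqcont 0 r f -> sqcont 0 r g ->
  cder r (fun z => f z - g z) = cder r f - cder r g.
Proof.
move=> r0 fc gc; have i2 := sqcont_inv2 r0.
have f2 := econtM fc i2; have g2 := econtM gc i2.
have e : sq 0 r (fun z => (f z - g z) * (z^-1 * z^-1)) =
  sq 0 r (fun z => f z * (z^-1 * z^-1)) - sq 0 r (fun z => g z * (z^-1 * z^-1)).
  by rewrite -(rectB f2 g2); apply: (eq_sq (ltW r0)) => z _; rewrite mulrBl.
rewrite /cder e; move: (sq 0 r _) (sq 0 r _) (sq 0 r _) ((sq 0 r _)^-1) => a b c d.
ring.
Qed.

(** Compare the expansions of both sides of the Cauchy formula. Since the right-hand side contains
    [f w], a first-order bound on [f w - f 0] is proved before the second-order one. *)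
Lemma taylor_estimate (r B : R) f : 0 < r -> cauchy_rep r f ->
  (forall z, csq 0 r z -> cn (f z) <= B) -> forall w, cn w <= r / 2 ->
  cn (f w - f 0 - w * cder r f) <= 80 * B / r ^+ 2 * cn w ^+ 2.
Proof.
move=> r0 [fc frep] fB w wr.
have fb z : bsq 0 r z -> cn (f z) <= B by case=> /fB.
have f0 : cn (f 0) <= B by apply: fB; rewrite /csq /= subrr normr0 ltW.
have B0 : 0 <= B := le_trans (cn_ge0 _) f0.
have wB : cn (f w) <= B.
  apply: fB; rewrite /csq /= !subr0; split.
    by apply: le_trans (Re_le_cn _) (le_trans wr _); lra.
  by apply: le_trans (Im_le_cn _) (le_trans wr _); lra.
have [Rf Rf_le ef] := sq_expand r0 fc fb wr.
have oc : sqcont 0 r (fun=> 1) := econt_cst 1 _ _ _ _.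
have o1 z : bsq 0 r z -> cn ((fun=> 1) z) <= 1.
  by move=> _; rewrite /= expr1n expr0n addr0 sqrtr1.
have [Rk Rk_le ek] := sq_expand r0 oc o1 wr.
have e0 : sq 0 r (fun z => f z * z^-1) = f 0 * sq 0 r (fun z => z^-1).
  have := frep 0 (cn0_half r0).
  rewrite (_ : (fun z : C => f z * (z - 0)^-1) = (fun z : C => f z * z^-1)).
    rewrite (_ : (fun z : C => (z - 0)^-1) = (fun z : C => z^-1))//.
    by apply/funext => z; rewrite subr0.
  by apply/funext => z; rewrite subr0.
have := frep w wr; rewrite ef e0.
move: ek; rewrite (_ : (fun z => 1 * (z - w)^-1) = (fun z => (z - w)^-1)); last first.
  by apply/funext => z; rewrite mul1r.
rewrite (_ : (fun z : C => 1 * z^-1) = (fun z => z^-1)); last first.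
  by apply/funext => z; rewrite mul1r.
rewrite (_ : (fun z : C => 1 * (z^-1 * z^-1)) = (fun z => z^-1 * z^-1)); last first.
  by apply/funext => z; rewrite mul1r.
move=> ->.
have K4 := sq_inv0_ge r0; have K0 := sq_inv0_neq r0.
have A1_le := sq_coef2_le r0 fc fb.
have k1_le := sq_inv2_le r0.
rewrite /cder.
move: K4 K0 A1_le k1_le.
move: (sq 0 r (fun z => z^-1)) (sq 0 r (fun z => f z * (z^-1 * z^-1)))
  (sq 0 r (fun z => z^-1 * z^-1)) => K A1 k1 K4 K0 A1_le k1_le E.
set u := cn w.
have u0 : 0 <= u := cn_ge0 _.
have r2 : 0 < r ^+ 2 by rewrite exprn_gt0.
pose q := 16 * B / r.
have q0 : 0 <= q by rewrite divr_ge0 ?mulr_ge0// ltW.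
have step1 : cn (f w - f 0) <= q * u.
  have e1 : K * (f w - f 0) = w * (A1 + w * Rf - f w * k1 - f w * (w * Rk)).
    have E' : f w * K = f 0 * K + w * A1 + w * w * Rf - f w * (w * k1 + w * w * Rk).
      by rewrite E; ring.
    by rewrite mulrBr ![K * _]mulrC E'; ring.
  have h1 : cn K * cn (f w - f 0) <= u * (q + q + q + q).
    rewrite -cnM e1 cnM ler_wpM2l//.
    apply: le_trans (cnB _ _) (lerD _ _).
      apply: le_trans (cnB _ _) (lerD _ _).
        apply: le_trans (cnD _ _) (lerD _ _) => //.
        rewrite cnM; have -> : q = r / 2 * (32 * B / r ^+ 2).
          by rewrite /q; field; rewrite gt_eqF.
        by apply: ler_pM; rewrite ?cn_ge0.
      rewrite cnM; have -> : q = B * (16 / r) by rewrite /q; ring.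
      by apply: ler_pM; rewrite ?cn_ge0.
    rewrite cnM cnM; have -> : q = B * (r / 2 * (32 * 1 / r ^+ 2)).
      by rewrite /q; field; rewrite gt_eqF.
    by apply: ler_pM; rewrite ?mulr_ge0 ?cn_ge0//; apply: ler_pM; rewrite ?cn_ge0.
  have h2 : 4 * cn (f w - f 0) <= cn K * cn (f w - f 0) by rewrite ler_wpM2r ?cn_ge0.
  have h3 := le_trans h2 h1.
  have e3 : u * (q + q + q + q) = 4 * (q * u) by ring.
  by rewrite e3 ler_pM2l// in h3.
have e2 : K * (f w - f 0 - w * ((A1 - f 0 * k1) / K)) =
    w * w * Rf - w * k1 * (f w - f 0) - w * w * (f w * Rk).
  have E' : f w * K = f 0 * K + w * A1 + w * w * Rf - f w * (w * k1 + w * w * Rk).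
    by rewrite E; ring.
  have -> : K * (f w - f 0 - w * ((A1 - f 0 * k1) / K)) =
    f w * K - f 0 * K - w * (A1 - f 0 * k1) by field.
  by rewrite E'; ring.
set D := f w - f 0 - _ in e2 *.
have h1 : cn K * cn D <= u ^+ 2 * (32 * B / r ^+ 2) + u ^+ 2 * (16 / r * q) + u ^+ 2 * (32 * B / r ^+ 2).
  rewrite -cnM e2; apply: le_trans (cnB _ _) (lerD _ _).
    apply: le_trans (cnB _ _) (lerD _ _).
      by rewrite !cnM -expr2 ler_wpM2l// exprn_ge0.
    rewrite !cnM -/u; have -> : u ^+ 2 * (16 / r * q) = u * (16 / r) * (q * u) by ring.
    by apply: ler_pM; rewrite ?mulr_ge0 ?cn_ge0// ler_wpM2l.
  rewrite !cnM -expr2 ler_wpM2l ?exprn_ge0//.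
  have -> : 32 * B / r ^+ 2 = B * (32 * 1 / r ^+ 2) by ring.
  by apply: ler_pM; rewrite ?cn_ge0.
have h2 : 4 * cn D <= cn K * cn D by rewrite ler_wpM2r ?cn_ge0.
have h3 := le_trans h2 h1.
have e3 : u ^+ 2 * (32 * B / r ^+ 2) + u ^+ 2 * (16 / r * q) + u ^+ 2 * (32 * B / r ^+ 2) =
    4 * (80 * B / r ^+ 2 * u ^+ 2) by rewrite /q; field; rewrite gt_eqF.
by rewrite e3 ler_pM2l// in h3.
Qed.

Lemma cdiff_cauchy_rep (r : R) f : 0 < r -> (forall z, csq 0 r z -> cdiff f z) ->
  cauchy_rep r f.
Proof.
move=> r0 fd; split.
  by apply: (bsq_sqcont (ltW r0)) => z [/fd h _]; exact: cdiff_continuous.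
move=> w wr; apply: (cauchy_formula r0 fd); rewrite subr0; apply: le_lt_trans wr _.
lra.
Qed.

(** The contour integrals of [f - g] and the error at [w] are both at most a constant times the
    uniform distance. *)
Lemma cauchy_rep_limit (r : R) f : 0 < r -> sqcont 0 r f ->
  (forall e, 0 < e -> exists g, cauchy_rep r g /\
     forall z, csq 0 r z -> cn (f z - g z) <= e) -> cauchy_rep r f.
Proof.
move=> r0 fc fg; split=> // w wr; apply/eqP; rewrite -subr_eq0 -cn_eq0 eq_le cn_ge0 andbT.
apply/ler_addgt0Pr => e e0; rewrite add0r.
have e1 : 0 < e / 64 by rewrite divr_gt0.
have [g [[gc grep] gE]] := fg _ e1.
have kc := sqcont_kernel r0 wr.
have fk := econtM fc kc; have gk := econtM gc kc.
have dc : sqcont 0 r (fun z => f z - g z).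
  by case: fc gc => ? ? ? ? [? ? ? ?]; split; exact: icontB.
have dk := econtM dc kc.
have ed : sq 0 r (fun z => (f z - g z) * (z - w)^-1) =
  sq 0 r (fun z => f z * (z - w)^-1) - sq 0 r (fun z => g z * (z - w)^-1).
  by rewrite -(rectB fk gk); apply: (eq_sq (ltW r0)) => z _; rewrite mulrBl.
have -> : sq 0 r (fun z => f z * (z - w)^-1) - f w * sq 0 r (fun z => (z - w)^-1) =
  sq 0 r (fun z => (f z - g z) * (z - w)^-1) - (f w - g w) * sq 0 r (fun z => (z - w)^-1).
  by rewrite ed (grep _ wr); ring.
have ws : csq 0 r w.
  rewrite /csq /= !subr0; split.
    by apply: le_trans (Re_le_cn _) (le_trans wr _); lra.
  by apply: le_trans (Im_le_cn _) (le_trans wr _); lra.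
have -> : e = 16 * (e / 64 * (2 / r)) * r + e / 64 * (16 * (2 / r) * r) by field; rewrite gt_eqF.
apply: le_trans (cnB _ _) (lerD _ _).
  apply: (sq_le (ltW r0) dk) => z zb; rewrite cnM.
  by apply: ler_pM; rewrite ?cn_ge0//; [apply: gE; case: zb|exact: cnV_bsq].
rewrite cnM; apply: ler_pM; rewrite ?cn_ge0//; first exact: gE.
by apply: (sq_le (ltW r0) kc) => z zb; exact: cnV_bsq.
Qed.

Lemma cder_unique (r B : R) f a : 0 < r -> cauchy_rep r f ->
  (forall z, csq 0 r z -> cn (f z) <= B) ->
  (forall e : R, 0 < e -> exists2 d : R, 0 < d & forall w, cn w < d ->
     cn (f w - f 0 - a * w) <= e * cn w) -> cder r f = a.
Proof.
move=> r0 frep fB ad; apply/eqP; rewrite -subr_eq0 -cn_eq0 eq_le cn_ge0 andbT.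
apply/ler_addgt0Pr => e e0; rewrite add0r.
have e2 : 0 < e / 2 by rewrite divr_gt0.
have [d d0 dh] := ad _ e2.
have B0 : 0 <= B.
  by apply: le_trans (cn_ge0 (f 0)) (fB 0 _); rewrite /csq /= subrr normr0 ltW.
pose Q := 80 * B / r ^+ 2.
have Q0 : 0 <= Q by rewrite divr_ge0 ?mulr_ge0 ?exprn_ge0// ltW.
pose t := Num.min (Num.min (d / 2) (r / 2)) (e / 2 / (Q + 1)).
have t0 : 0 < t by rewrite !lt_min !divr_gt0// ltr_wpDl.
have [td tr] : t <= d / 2 /\ t <= r / 2 by rewrite /t !ge_min !lexx ?orbT.
have tQ : t * (Q + 1) <= e / 2.
  by rewrite -ler_pdivlMr ?ltr_wpDl// /t ge_min lexx orbT.
have ct : cn t%:C = t by rewrite cn_real gtr0_norm.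
have h1 : cn (f t%:C - f 0 - a * t%:C) <= e / 2 * t.
  by have := dh t%:C; rewrite ct; apply; lra.
have h2 : cn (f t%:C - f 0 - t%:C * cder r f) <= Q * t ^+ 2.
  by have := taylor_estimate r0 frep fB (w := t%:C); rewrite ct; apply.
have : cn (t%:C * (cder r f - a)) <= e / 2 * t + Q * t ^+ 2.
  have -> : t%:C * (cder r f - a) = (f t%:C - f 0 - a * t%:C) - (f t%:C - f 0 - t%:C * cder r f).
    ring.
  by apply: le_trans (cnB _ _) (lerD _ _).
rewrite cnM ct.
have -> : e / 2 * t + Q * t ^+ 2 = t * (e / 2 + Q * t) by ring.
rewrite ler_pM2l// => /le_trans; apply.
have : Q * t <= t * (Q + 1) by rewrite mulrDr mulr1 mulrC lerDl ltW.
lra.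
Qed.

End taylor.
(** * Differentiability of uniform limits *)

Section weierstrass.
Context {R : realType} {n : nat}.
Local Notation C := R[i].
Local Notation cn := (@ComplexField.Normc.normc R).
Local Notation V := (Cn R n).
Implicit Types (z w h : V) (f g : V -> C).

Lemma real_normE z : exists2 x : R, 0 <= x & `|z| = x%:C.
Proof.
have := normr_ge0 z; case: `|z| => a b; rewrite lecE /= => /andP[/eqP -> a0].
by exists a.
Qed.

(** The norm of [Cn R n] takes its values in [R[i]]; [rnorm] is its real part, hence itself as a
    real number. *)
Definition rnorm z : R := complex.Re `|z|.

Lemma rnormE z : `|z| = (rnorm z)%:C.
Proof. by rewrite /rnorm; have [x _ ->] := real_normE z. Qed.

Lemma rnorm_ge0 z : 0 <= rnorm z.
Proof. by rewrite /rnorm; have [x x0 ->] := real_normE z. Qed.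

Lemma rnorm_gt0 z : (0 < rnorm z) = (z != 0).
Proof. by rewrite -normr_gt0 rnormE ltcR. Qed.

Lemma rnormZ (c : C) z : rnorm (c *: z) = cn c * rnorm z.
Proof.
by have := normrZ c z; rewrite !rnormE normCE -rmorphM => /complexI.
Qed.

Lemma rnormD z w : rnorm (z + w) <= rnorm z + rnorm w.
Proof. by have := ler_normD z w; rewrite !rnormE -rmorphD lecR. Qed.

Lemma rnormN z : rnorm (- z) = rnorm z.
Proof. by have := normrN z; rewrite !rnormE => /complexI. Qed.

Lemma nbhs_rnormP z (A : set V) :
  nbhs z A <-> exists2 d : R, 0 < d & forall w, rnorm (w - z) < d -> A w.
Proof.
split=> [/nbhs_ballP [[e e']] /=|[d d0 dA]].
  rewrite ltcE /= => /andP[/eqP -> e0] bA; exists e => // w we.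
  by apply: bA; rewrite -ball_normE /= distrC rnormE -[_ +i* 0]/(e%:C) ltcR.
apply/nbhs_ballP; exists d%:C => /=; first by rewrite ltcR.
by move=> w; rewrite -ball_normE /= distrC rnormE ltcR; exact: dA.
Qed.

Lemma coord_le_rnorm z j : cn (z 0 j) <= rnorm z.
Proof.
rewrite -lecR -rnormE -normCE.
have h := @le_bigmax _ {nonneg C} _ 0%:nng (fun ij : 'I_1 * 'I_n => `|z ij.1 ij.2|%:nng) (0, j).
by have := h erefl erefl; rewrite -num_le /=; apply.
Qed.

Lemma rnorm_le z b : 0 <= b -> (forall j, cn (z 0 j) <= b) -> rnorm z <= b.
Proof.
move=> b0 zb; rewrite -lecR -rnormE -[`|z|]/(mx_norm z).
have [->|/mx_norm_neq0 [[i j] -> /=]] := eqVneq (mx_norm z) 0; first by rewrite lecR.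
by rewrite ord1 normCE lecR.
Qed.

(** The differentials to be identified are linear forms in coordinates. *)
Definition rowform (a : 'I_n -> C) (h : V) : C := \sum_(j < n) h 0 j * a j.

Lemma rowform_is_linear a : linear (rowform a).
Proof.
move=> c u v; rewrite /rowform scaler_sumr -big_split /=; apply: eq_bigr => j _.
by rewrite !mxE mulrDl scalerAl.
Qed.
HB.instance Definition _ a := GRing.isLinear.Build C V C _ (rowform a) (rowform_is_linear a).

Lemma cn_sum (I : Type) (s : seq I) (P : pred I) (F : I -> C) :
  cn (\sum_(i <- s | P i) F i) <= \sum_(i <- s | P i) cn (F i).
Proof.
elim/big_ind2: _ => //; first by rewrite cn0.
by move=> x1 x2 y1 y2 h1 h2; apply: le_trans (cnD _ _) _; exact: lerD.
Qed.

Lemma rowform_le a h : cn (rowform a h) <= (\sum_(j < n) cn (a j)) * rnorm h.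
Proof.
apply: le_trans (cn_sum _ _ _) _; rewrite mulr_suml; apply: ler_sum => j _.
by rewrite cnM mulrC ler_wpM2l ?cn_ge0// coord_le_rnorm.
Qed.

Lemma continuous_rowform a : continuous (rowform a).
Proof.
move=> z; apply/(@cvg_cnP _ _ (nbhs z) (nbhs_filter z)) => e e0.
have K0 : 0 < \sum_(j < n) cn (a j) + 1.
  by rewrite ltr_wpDl// sumr_ge0// => j _; exact: cn_ge0.
apply/nbhs_rnormP; exists (e / (\sum_(j < n) cn (a j) + 1)); first by rewrite divr_gt0.
move=> w wz; rewrite -linearB; apply: le_lt_trans (rowform_le _ _) _.
rewrite -rnormN opprB; apply: (@le_lt_trans _ _ ((\sum_(j < n) cn (a j) + 1) * rnorm (w - z))).
  by rewrite ler_wpM2r ?rnorm_ge0// lerDl.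
by rewrite mulrC -ltr_pdivlMr.
Qed.

Lemma differentiable_rowform f z a :
  (forall e : R, 0 < e -> exists2 d : R, 0 < d & forall h, rnorm h < d ->
    cn (f (z + h) - f z - rowform a h) <= e * rnorm h) -> differentiable f z.
Proof.
move=> fa.
have lo (eps : C) : 0 < eps -> \forall h \near (0 : V),
    `|f (h + z) - (f z + rowform a h)| <= eps * `|h|.
  case: eps => e e'; rewrite ltcE /= => /andP[/eqP -> e0].
  have [d d0 dh] := fa _ e0.
  apply/nbhs_rnormP; exists d => // h; rewrite subr0 => /dh.
  rewrite normCE rnormE -[_ +i* 0]/(e%:C) -rmorphM lecR.
  by rewrite (addrC z) opprD addrA.
have e : 'd f z = rowform a :> (V -> C).
  by apply: diff_unique; [exact: continuous_rowform|apply/eqaddoP; exact: lo].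
apply/diff_locallyP; rewrite e; split; first exact: continuous_rowform.
by apply/eqaddoP; exact: lo.
Qed.

Lemma differentiable_expand f z : differentiable f z ->
  forall e : R, 0 < e -> exists2 d : R, 0 < d & forall h, rnorm h < d ->
    cn (f (z + h) - f z - 'd f z h) <= e * rnorm h.
Proof.
move=> /diff_locally /eqaddoP fo e e0.
have e0' : 0 < e%:C by rewrite ltcR.
have /nbhs_rnormP [d d0 dh] := fo _ e0'; exists d => // h hd.
have := dh h; rewrite subr0 => /(_ hd); rewrite !fctE /= normCE rnormE -rmorphM lecR.
by rewrite [h + z]addrC opprD addrA.
Qed.

Lemma differentiable_cdiff f z h (c : C) : differentiable f (z + c *: h) ->
  cdiff (fun c => f (z + c *: h)) c.
Proof.
move=> /differentiable_expand fd; exists ('d f (z + c *: h) h) => e e0.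
have h0 : 0 < rnorm h + 1 by rewrite ltr_wpDl ?rnorm_ge0.
have e0' : 0 < e / (rnorm h + 1) by rewrite divr_gt0.
have [d d0 dh] := fd _ e0'; exists (d / (rnorm h + 1)); first by rewrite divr_gt0.
move=> c' c'c; have := dh ((c' - c) *: h).
have hle : cn (c' - c) * rnorm h <= cn (c' - c) * (rnorm h + 1).
  by rewrite ler_wpM2l ?cn_ge0// lerDl.
rewrite rnormZ (le_lt_trans hle) -?ltr_pdivlMr// => /(_ isT).
have -> : z + c *: h + (c' - c) *: h = z + c' *: h.
  by rewrite -addrA -scalerDl (addrC c) subrK.
rewrite linearZ /= -[_ *: 'd _ _ _]mulrC => /le_trans; apply.
rewrite mulrAC ler_pdivrMr// -mulrA ler_wpM2l// 1?ltW//.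
Qed.

(** Weierstrass' theorem for one function and one point. On every complex line through [z0] the
    limit satisfies the Cauchy formula, hence a Taylor estimate that is uniform in the direction.
    Its directional derivatives are limits of those of the approximants, so they depend linearly on
    the direction and form a differential. *)
Lemma differentiable_limit (U : set V) f z0 : nbhs z0 U ->
  (forall e : R, 0 < e -> exists g, (forall z, U z -> differentiable g z) /\
     forall z, U z -> cn (f z - g z) <= e) ->
  differentiable f z0.
Proof.
move=> /nbhs_rnormP [d d0 dU] fg.
have [r [r0 rd] [B rU fB]] : exists2 r : R, 0 < r /\ 3 * r < d & exists2 B : R,
    forall z, rnorm (z - z0) <= 2 * r -> U z & forall z, rnorm (z - z0) <= 2 * r -> cn (f z) <= B.
  have [g [gd gE]] := fg _ ltr01.
  have Uz0 : U z0 by apply: dU; rewrite subrr /rnorm normr0.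
  have [d' d'0 dg] := differentiable_expand (gd _ Uz0) ltr01.
  pose r := Num.min (d / 4) (d' / 4).
  have r0 : 0 < r by rewrite lt_min !divr_gt0.
  have [rd rd'] : r <= d / 4 /\ r <= d' / 4 by rewrite /r !ge_min !lexx ?orbT.
  pose D := \sum_(j < n) cn ('d g z0 (delta_mx 0 j)).
  have hU z : rnorm (z - z0) <= 2 * r -> U z by move=> zr; apply: dU; lra.
  exists r; first by split=> //; lra.
  exists (1 + (2 * r + (D * (2 * r) + cn (g z0)))) => // z zr.
  have -> : f z = (f z - g z) + ((g z - g z0 - 'd g z0 (z - z0)) + ('d g z0 (z - z0) + g z0)).
    ring.
  apply: le_trans (cnD _ _) (lerD (gE _ (hU _ zr)) _).
  apply: le_trans (cnD _ _) (lerD _ _).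
    have := dg (z - z0); rewrite (addrC z0) subrK mul1r => h; apply: (le_trans (h _) zr).
    by apply: le_lt_trans zr _; lra.
  apply: le_trans (cnD _ _) (lerD _ _) => //.
  have -> : 'd g z0 (z - z0) = rowform (fun j => 'd g z0 (delta_mx 0 j)) (z - z0).
    rewrite {1}(row_sum_delta (z - z0)) linear_sum; apply: eq_bigr => j _.
    by rewrite linearZ.
  apply: le_trans (rowform_le _ _) _; rewrite ler_wpM2l//.
  by rewrite sumr_ge0// => j _; exact: cn_ge0.
have B0 : 0 <= B.
  by apply: le_trans (cn_ge0 (f z0)) (fB _ _); rewrite subrr /rnorm normr0 mulr_ge0// ltW.
(* [F h] is the trace of [f] on the complex line through [z0] with direction [h]. *)
pose F h := fun c : C => f (z0 + c *: h).
have lineU h (c : C) : rnorm h <= 1 -> csq 0 r c -> rnorm (z0 + c *: h - z0) <= 2 * r.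
  move=> h1 [c1 c2]; rewrite addrC addKr rnormZ.
  rewrite !subr0 in c1 c2.
  apply: (@le_trans _ _ (2 * r * 1)); last by rewrite mulr1.
  apply: ler_pM; rewrite ?cn_ge0 ?rnorm_ge0//.
  by apply: le_trans (cn_le _) _; lra.
have grep g h : rnorm h <= 1 -> (forall z, U z -> differentiable g z) ->
    cauchy_rep r (fun c => g (z0 + c *: h)).
  move=> h1 gd; apply: cdiff_cauchy_rep => // c /(lineU _ _ h1) cU.
  by apply: differentiable_cdiff; apply: gd; exact: rU.
have fc h : rnorm h <= 1 -> sqcont 0 r (F h).
  move=> h1; apply: (bsq_sqcont (ltW r0)) => c [cs _].
  apply/continuous_cnP => e e0; have e3 : 0 < e / 3 by rewrite divr_gt0.
  have [g [gd gE]] := fg _ e3.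
  have cU := lineU _ _ h1 cs; have Uc := rU _ cU.
  have := cdiff_continuous (differentiable_cdiff (gd _ Uc)).
  move=> /continuous_cnP /(_ _ e3) [d1 d10 dg].
  exists (Num.min d1 r); first by rewrite lt_min d10.
  move=> c'; rewrite lt_min => /andP[/dg cc' cr].
  have Uc' : U (z0 + c' *: h).
    apply: dU; rewrite addrC addKr -[c'](subrK c) scalerDl; apply: le_lt_trans (rnormD _ _) _.
    rewrite (addrC z0) addrK in cU; rewrite rnormZ.
    have : cn (c' - c) * rnorm h <= cn (c' - c) by rewrite ler_piMr ?cn_ge0.
    lra.
  have -> : F h c' - F h c = (F h c' - g (z0 + c' *: h)) +
     ((g (z0 + c' *: h) - g (z0 + c *: h)) + (g (z0 + c *: h) - F h c)) by ring.
  apply: le_lt_trans (cnD _ _) _.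
  have h2 := gE _ Uc'; have h3 := gE _ Uc; rewrite cnC in h3.
  have h4 := cnD (g (z0 + c' *: h) - g (z0 + c *: h)) (g (z0 + c *: h) - F h c).
  rewrite /F in h4 *; lra.
have frep h : rnorm h <= 1 -> cauchy_rep r (F h).
  move=> h1; apply: cauchy_rep_limit => //; first exact: fc.
  move=> e /fg [g [gd gE]]; exists (fun c => g (z0 + c *: h)); split; first exact: grep.
  by move=> c /(lineU _ _ h1) /rU; exact: gE.
have FB h c : rnorm h <= 1 -> csq 0 r c -> cn (F h c) <= B.
  by move=> h1 /(lineU _ _ h1); exact: fB.
have gder g h e : rnorm h <= 1 -> 0 < e -> (forall z, U z -> differentiable g z) ->
    (forall z, U z -> cn (f z - g z) <= e) ->
    cn (cder r (F h) - 'd g z0 h) <= 8 * e / r.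
  move=> h1 e0 gd gE.
  have gr := grep _ _ h1 gd.
  have -> : 'd g z0 h = cder r (fun c => g (z0 + c *: h)).
    apply/esym; apply: (@cder_unique _ r (B + e)) => //.
      move=> c /(lineU _ _ h1) cU; have le1 := gE _ (rU _ cU); rewrite cnC in le1.
      have := cnD (g (z0 + c *: h) - f (z0 + c *: h)) (f (z0 + c *: h)).
      by rewrite subrK; have := fB _ cU; lra.
    move=> e' e'0.
    have Uz0 : U z0 by apply: dU; rewrite subrr /rnorm normr0.
    have [d1 d10 dg] := differentiable_expand (gd _ Uz0) e'0.
    exists d1 => // c cd; have := dg (c *: h); rewrite rnormZ.
    have chc : cn c * rnorm h <= cn c by rewrite ler_piMr ?cn_ge0.
    rewrite (le_lt_trans chc cd) (scale0r h) addr0 linearZ /= => /(_ isT) h2.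
    rewrite [_ * c]mulrC; apply: le_trans h2 _; rewrite ler_wpM2l// ltW//.
  rewrite -cderB//; [|exact: fc|by case: gr].
  apply: cder_le => //.
    by case: (fc h h1) => ? ? ? ?; case: gr => -[? ? ? ?] _; split; exact: icontB.
  by move=> c /(lineU _ _ h1) /rU; exact: gE.
pose a j := cder r (F (delta_mx 0 j)).
have delta1 (j : 'I_n) : rnorm (delta_mx 0 j : V) <= 1.
  apply: rnorm_le => // k; rewrite mxE; case: (_ && _); last by rewrite cn0.
  by rewrite /= expr1n expr0n addr0 sqrtr1.
(* The derivative along [h] is linear in [h], as a uniform limit of differentials. *)
have cderL h : rnorm h <= 1 -> cder r (F h) = rowform a h.
  move=> h1; apply/eqP; rewrite -subr_eq0 -cn_eq0 eq_le cn_ge0 andbT.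
  apply/ler_addgt0Pr => e e0; rewrite add0r.
  pose K := 8 * (n.+1)%:R / r.
  have K0 : 0 < K by rewrite divr_gt0 ?mulr_gt0// ltr0Sn.
  have eK : 0 < e / K by rewrite divr_gt0.
  have [g [gd gE]] := fg _ eK.
  have -> : cder r (F h) - rowform a h = (cder r (F h) - 'd g z0 h) -
      \sum_(j < n) h 0 j * (a j - 'd g z0 (delta_mx 0 j)).
    have dE : 'd g z0 h = \sum_(j < n) h 0 j * 'd g z0 (delta_mx 0 j).
      rewrite {1}(row_sum_delta h) linear_sum; apply: eq_bigr => j _.
      by rewrite linearZ.
    rewrite (eq_bigr _ (fun j _ => mulrBr (h 0 j) (a j) _)) sumrB -dE -/(rowform a h).
    by rewrite opprB addrA subrK.
  have -> : e = 8 * (e / K) / r + (\sum_(j < n) (8 * (e / K) / r)).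
    rewrite sumr_const card_ord -mulr_natl -natr1 /K; field.
    by rewrite !gt_eqF ?ltr0Sn// natr1 ltr0Sn.
  apply: le_trans (cnB _ _) (lerD _ _); first exact: gder.
  apply: le_trans (cn_sum _ _ _) (ler_sum _ _) => j _; rewrite cnM.
  rewrite -[leRHS]mul1r; apply: ler_pM; rewrite ?cn_ge0//.
    exact: le_trans (coord_le_rnorm _ _) h1.
  exact: gder.
apply: (@differentiable_rowform _ _ a) => e e0.
pose Q := 80 * B / r ^+ 2.
have Q0 : 0 <= Q by rewrite divr_ge0 ?mulr_ge0 ?exprn_ge0// ltW.
exists (Num.min (r / 2) (e / (Q + 1))).
  by rewrite lt_min !divr_gt0// ltr_wpDl.
move=> v; rewrite lt_min => /andP[vr ve].
have [->|v0] := eqVneq v 0.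
  by rewrite addr0 subrr linear0 subrr cn0 mulr_ge0 ?rnorm_ge0// ltW.
have v0' : 0 < rnorm v by rewrite rnorm_gt0.
pose h := (rnorm v)^-1%:C *: v.
have nh : rnorm h = 1.
  by rewrite rnormZ cn_real gtr0_norm ?invr_gt0// mulVf ?gt_eqF.
have vh : v = (rnorm v)%:C *: h.
  by rewrite scalerA -rmorphM mulfV ?gt_eqF// scale1r.
have := taylor_estimate r0 (frep _ _) (FB h ^~ _) (w := (rnorm v)%:C).
rewrite nh lexx cn_real gtr0_norm// => /(_ isT isT (ltW vr)).
rewrite cderL ?nh// /F scale0r addr0 -vh -[X in X * rowform _ _]/((rnorm v)%:C).
have vL : rowform a v = (rnorm v)%:C * rowform a h by rewrite {1}vh linearZ.
rewrite -vL.
move=> /le_trans; apply; rewrite -/Q expr2 mulrA ler_wpM2r ?rnorm_ge0//.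
apply: (@le_trans _ _ ((Q + 1) * rnorm v)); first by rewrite ler_wpM2r ?rnorm_ge0// lerDl.
by rewrite mulrC -ler_pdivlMr ?ltr_wpDl// ltW.
Qed.
End weierstrass.

(** * Measurability and iterated integrals on C^n *)

Section borel_Cn.
Context {R : realType}.
Local Notation C := R[i].
Local Notation cn := (@ComplexField.Normc.normc R).

(** The Borel sigma-algebra of a product is generated by open sets, the product sigma-algebra by
    rectangles; they are compared by writing an open set as a countable union of basic rectangles.
    *)
Lemma measurable_union_rect d1 d2 (X : measurableType d1) (Y : measurableType d2)
  (I J : countType) (U : I -> set X) (V : J -> set Y) (O : set (X * Y)) :
  (forall i, measurable (U i)) -> (forall j, measurable (V j)) ->
  (forall p, O p -> exists i j, [/\ U i p.1, V j p.2 & U i `*` V j `<=` O]) ->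
  measurable O.
Proof.
move=> mU mV OUV.
have -> : O = \bigcup_(ij : I * J)
    (if `[< U ij.1 `*` V ij.2 `<=` O >] then U ij.1 `*` V ij.2 else set0).
  apply/seteqP; split=> [p /OUV [i [j [Ui Vj UVO]]]|p [[i j] _] /=].
    by exists (i, j) => //=; rewrite asboolT.
  by case: asboolP => // UVO /UVO.
apply: countable_bigcupT_measurable; first exact: countableP.
by move=> [i j] /=; case: asboolP => // _; exact: measurableX.
Qed.

Definition ratbox (i : rat * rat * nat) : set (R * R) :=
  [set p | `|p.1 - ratr i.1.1| < i.2.+1%:R^-1 /\ `|p.2 - ratr i.1.2| < i.2.+1%:R^-1].

Lemma measurable_ratbox i : measurable (ratbox i).
Proof.
rewrite /ratbox; set e := _^-1.
have -> : [set p : R * R | `|p.1 - ratr i.1.1| < e /\ `|p.2 - ratr i.1.2| < e] =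
   `]ratr i.1.1 - e, ratr i.1.1 + e[ `*` `]ratr i.1.2 - e, ratr i.1.2 + e[.
  by apply/seteqP; split=> p; rewrite /= !in_itv /= !ltr_distl.
by apply: measurableX; exact: measurable_itv.
Qed.

Lemma rat_approx (x e : R) : 0 < e -> exists q : rat, `|x - ratr q| < e.
Proof.
move=> e0; have xe : x - e < x + e by lra.
have [q] := rat_in_itvoo xe; rewrite in_itv /= => qx.
by exists q; rewrite distrC ltr_distl.
Qed.

Lemma ratbox_basis (p : R * R) (d : R) : 0 < d -> exists i, ratbox i p /\
  forall p', ratbox i p' -> `|p'.1 - p.1| < d /\ `|p'.2 - p.2| < d.
Proof.
move=> d0; pose k := Num.trunc (2 / d).
have kd : k.+1%:R^-1 < d / 2.
  have := truncnS_gt (2 / d); rewrite -/k => h.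
  rewrite -[d / 2]invrK ltf_pV2 ?posrE ?invr_gt0 ?divr_gt0//.
  by rewrite invf_div.
have k0 : 0 < k.+1%:R^-1 :> R by rewrite invr_gt0 ltr0Sn.
have [q1 h1] := rat_approx p.1 k0; have [q2 h2] := rat_approx p.2 k0.
exists (q1, q2, k); split=> // p' [/= h1' h2'].
move: kd k0 h1 h2 h1' h2'; set e : R := k.+1%:R^-1; clearbody e => kd k0 h1 h2 h1' h2'.
have tri (a b : R) : `|a - b| <= `|a| + `|b| by exact: ler_normB.
split.
  have -> : p'.1 - p.1 = (p'.1 - ratr q1) - (p.1 - ratr q1) by ring.
  by apply: le_lt_trans (tri _ _) _; lra.
have -> : p'.2 - p.2 = (p'.2 - ratr q2) - (p.2 - ratr q2) by ring.
by apply: le_lt_trans (tri _ _) _; lra.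
Qed.

Definition ratpt n (q : 'rV[rat]_n * 'rV[rat]_n) : Cn R n :=
  \row_j (ratr (q.1 0 j) +i* ratr (q.2 0 j)).

Definition ratball n (i : 'rV[rat]_n * 'rV[rat]_n * nat) : set (Cn R n) :=
  [set z | rnorm (z - ratpt i.1) < i.2.+1%:R^-1].

Lemma open_rball n (z0 : Cn R n) (r : R) : open [set z | rnorm (z - z0) < r].
Proof.
rewrite openE => z /= zr; apply/nbhs_rnormP; exists (r - rnorm (z - z0)).
  by rewrite subr_gt0.
move=> w wz /=; have -> : w - z0 = (w - z) + (z - z0) by rewrite addrA subrK.
by apply: le_lt_trans (rnormD _ _) _; lra.
Qed.

Lemma ratball_basis n (z : Cn R n) (d : R) : 0 < d -> exists i, ratball i z /\
  forall z', ratball i z' -> rnorm (z' - z) < d.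
Proof.
move=> d0; pose k := Num.trunc (2 / d).
have kd : k.+1%:R^-1 < d / 2.
  have := truncnS_gt (2 / d); rewrite -/k => h.
  rewrite -[d / 2]invrK ltf_pV2 ?posrE ?invr_gt0 ?divr_gt0//.
  by rewrite invf_div.
have k0 : 0 < k.+1%:R^-1 :> R by rewrite invr_gt0 ltr0Sn.
have k4 : 0 < k.+1%:R^-1 / 4 :> R by rewrite divr_gt0.
pose q1 := \row_j (sval (cid (rat_approx (complex.Re (z 0 j)) k4))).
pose q2 := \row_j (sval (cid (rat_approx (complex.Im (z 0 j)) k4))).
have zq : rnorm (z - ratpt (q1, q2)) < k.+1%:R^-1.
  apply: (@le_lt_trans _ _ (k.+1%:R^-1 / 2)); last by rewrite ltr_pdivrMr// ltr_pMr// ltr1n.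
  apply: rnorm_le; first by rewrite divr_ge0// ltW.
  move=> j; rewrite !mxE /=; apply: le_trans (cn_le _) _; rewrite ReB ImB /=.
  case: cid => a /= ha; case: cid => b /= hb.
  by move: ha hb; set e : R := k.+1%:R^-1; clearbody e => ha hb; lra.
exists (q1, q2, k); split=> // z' hz'; rewrite /ratball /= in hz'.
have -> : z' - z = (z' - ratpt (q1, q2)) - (z - ratpt (q1, q2)).
  by rewrite opprB addrA subrK.
apply: le_lt_trans (rnormD _ _) _; rewrite rnormN.
by move: kd zq hz'; set e : R := k.+1%:R^-1; clearbody e => kd zq hz'; lra.
Qed.

Lemma borel_open (X : ptopologicalType) (O : set X) : open O -> measurable (O : set (borel X)).
Proof. by move=> oO; exact: sub_sigma_algebra. Qed.

Lemma measurable_open_R2 (O : set (R * R)) :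
  (forall p, O p -> exists2 d : R, 0 < d & forall p', `|p'.1 - p.1| < d ->
     `|p'.2 - p.2| < d -> O p') -> measurable O.
Proof.
move=> oO; pose U i := if `[< ratbox i `<=` O >] then ratbox i else set0.
have -> : O = \bigcup_i U i.
  apply/seteqP; split=> [p Op|p [i _]]; last first.
    by rewrite /U; case: asboolP => // h /h.
  have [d d0 dO] := oO _ Op; have [i [ip ib]] := ratbox_basis p d0.
  exists i => //; rewrite /U asboolT// => p' /ib [h1 h2]; exact: dO.
apply: countable_bigcupT_measurable; first exact: countableP.
by move=> i; rewrite /U; case: asboolP => // _; exact: measurable_ratbox.
Qed.

Lemma measurable_complex : measurable_fun setT (fun p : R * R => p.1 +i* p.2 : borel C).
Proof.
apply: (@measurability _ _ (R * R)%type (borel C) setT _ (@open C)) => //.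
move=> _ [W oW <-]; rewrite setTI; apply: measurable_open_R2 => p Op.
have /nbhs_cnP [d d0 dO] : nbhs (p.1 +i* p.2 : C) W by exact: open_nbhs_nbhs.
exists (d / 2); first by rewrite divr_gt0.
move=> p' h1 h2; apply: dO; apply: le_lt_trans (cn_le _) _.
rewrite ReB ImB /= distrC [X in _ + X]distrC; lra.
Qed.

(** The decomposition [C^(n+1) = R^2 x C^n] by which the integral on [C^n] is iterated. *)
Definition consC n (p : R * R) (z : Cn R n) : Cn R n.+1 :=
  row_mx ((p.1 +i* p.2)%:M : 'M[C]_1) z.

Lemma consC0 n p (z : Cn R n) : consC p z 0 ord0 = p.1 +i* p.2.
Proof. by rewrite /consC mxE; case: splitP => //= i _; rewrite mxE !ord1 eqxx mulr1n. Qed.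

Lemma consC_lift n p (z : Cn R n) j : consC p z 0 (lift ord0 j) = z 0 j.
Proof.
rewrite /consC mxE; case: splitP => [i|k] /=; first by rewrite ord1.
by move=> /eqP; rewrite /bump /= add1n eqSS => /eqP e; congr (z _ _); exact/val_inj.
Qed.

Lemma rnorm_consCB n (p p' : R * R) (z z' : Cn R n) (d : R) :
  `|p'.1 - p.1| < d / 2 -> `|p'.2 - p.2| < d / 2 -> rnorm (z' - z) < d ->
  rnorm (consC p' z' - consC p z) <= d.
Proof.
move=> h1 h2 h3; have d0 : 0 <= d by apply: ltW; apply: le_lt_trans h3; exact: rnorm_ge0.
apply: rnorm_le => // j; rewrite mxE [X in _ + X]mxE.
case: (unliftP ord0 j) => [k|] ->; last first.
  rewrite !consC0.
  by apply: le_trans (cn_le _) _; rewrite ReB ImB /=; lra.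
rewrite !consC_lift; apply: le_trans (ltW h3).
by have := coord_le_rnorm (z' - z) k; rewrite !mxE.
Qed.

Lemma measurable_consC n :
  measurable_fun setT (fun x : (R * R) * borel (Cn R n) => consC x.1 x.2 : borel (Cn R n.+1)).
Proof.
apply: (@measurability _ _ ((R * R) * borel (Cn R n))%type (borel (Cn R n.+1)) setT _ (@open (Cn R n.+1))) => //.
move=> _ [W oW <-]; rewrite setTI.
apply: (@measurable_union_rect _ _ _ _ _ _ ratbox (fun i => @ratball n i : set (borel (Cn R n)))).
- exact: measurable_ratbox.
- by move=> j; apply: borel_open; exact: open_rball.
- move=> [p z] /= Op.
  have /nbhs_rnormP [d d0 dO] : nbhs (consC p z) W by exact: open_nbhs_nbhs.
  have d2 : 0 < d / 2 by rewrite divr_gt0.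
  have d4 : 0 < d / 2 / 2 by rewrite divr_gt0.
  have [i [ip ib]] := ratbox_basis p d4; have [j [jz jb]] := ratball_basis z d2.
  exists i, j; split => // -[p' z'] /= [/ib [h1 h2] /jb h3].
  apply: dO; apply: (@le_lt_trans _ _ (d / 2)); last by lra.
  exact: rnorm_consCB.
Qed.

Local Open Scope ereal_scope.

Lemma integral_CnS n (f : Cn R n.+1 -> \bar R) :
  integral_Cn f = \int[lebesgue_measure \x lebesgue_measure]_p integral_Cn (fun z => f (consC p z)).
Proof. by []. Qed.

Lemma integral_Cn_ge0 n (f : Cn R n -> \bar R) : (forall z, 0 <= f z) -> 0 <= integral_Cn f.
Proof.
elim: n f => [|n IH] f f0 /=; first exact: f0.
by apply: integral_ge0 => p _; exact: IH.
Qed.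

Lemma measurable_integral_plane d (Y : measurableType d) (h : Y * (R * R) -> \bar R) :
  measurable_fun setT h -> (forall x, 0 <= h x)%E ->
  measurable_fun setT (fun y => \int[lebesgue_measure \x lebesgue_measure]_p h (y, p))%E.
Proof.
move=> mh h0.
have -> : (fun y => \int[lebesgue_measure \x lebesgue_measure]_p h (y, p))%E =
  (fun y => \int[lebesgue_measure]_s \int[lebesgue_measure]_t h (y, (s, t)))%E.
  apply/funext => y.
  have mhy := measurable_fun_pair2 y mh.
  by rewrite fubini_tonelli1.
pose k (x : (Y * R) * R) := h (x.1.1, (x.1.2, x.2)).
have mk : measurable_fun setT k.
  apply: (measurableT_comp mh); apply: measurable_fun_pair.
    by apply: measurableT_comp => //; exact: measurable_fst.
  apply: measurable_fun_pair => //.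
  by apply: measurableT_comp => //; exact: measurable_fst.
have mF := @measurable_fun_fubini_tonelli_F _ _ (Y * R)%type _ R lebesgue_measure k mk (fun x => h0 _).
have F0 (x : Y * R) : (0 <= \int[lebesgue_measure]_t k (x, t))%E by apply: integral_ge0 => t _; exact: h0.
exact: (@measurable_fun_fubini_tonelli_F _ _ Y _ R lebesgue_measure _ mF F0).
Qed.

(** The parameter [y] accumulates the coordinates already integrated, so that the induction on [n]
    goes through. *)
Lemma measurable_integral_Cn n d (Y : measurableType d) (f : Y * borel (Cn R n) -> \bar R) :
  measurable_fun setT f -> (forall x, 0 <= f x) ->
  measurable_fun setT (fun y => integral_Cn (fun z : Cn R n => f (y, z))).
Proof.
elim: n d Y f => [|n IH] d Y f mf f0 .
  have h : measurable_fun setT (fun y : Y => (y, (0%R : Cn R 0) : borel (Cn R 0))).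
    by apply: measurable_fun_pair => //; exact: measurable_cst.
  exact: (measurableT_comp mf h).
rewrite /=.
pose g (x : (Y * (R * R)) * borel (Cn R n)) := f (x.1.1, consC x.1.2 x.2).
have mg : measurable_fun setT g.
  apply: (measurableT_comp mf); apply: measurable_fun_pair.
    by apply: measurableT_comp => //; exact: measurable_fst.
  have h : measurable_fun setT (fun x : (Y * (R * R)) * borel (Cn R n) => (x.1.2, x.2)).
    apply: measurable_fun_pair => //.
    by apply: measurableT_comp => //; exact: measurable_fst.
  exact: (measurableT_comp (@measurable_consC n) h).
have := IH _ _ _ mg (fun x => f0 _) => mh.
have h0 (x : Y * (R * R)) : 0 <= integral_Cn (fun z : Cn R n => g (x, z)).
  by apply: integral_Cn_ge0 => z; exact: f0.
exact: (measurable_integral_plane mh h0).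
Qed.

Lemma measurable_inner_integral_Cn n (f : borel (Cn R n.+1) -> \bar R) :
  measurable_fun setT f -> (forall z, 0 <= f z) ->
  measurable_fun setT (fun p : R * R => integral_Cn (fun z => f (consC p z))).
Proof.
move=> mf f0.
apply: (@measurable_integral_Cn _ _ _ (fun x : (R * R) * borel (Cn R n) => f (consC x.1 x.2))) => //.
by apply: (measurableT_comp mf); exact: measurable_consC.
Qed.

Lemma measurable_consC2 n p : measurable_fun setT (fun z : borel (Cn R n) => consC p z : borel (Cn R n.+1)).
Proof. exact: (measurable_fun_pair2 p (@measurable_consC n)). Qed.

(** Measurability is assumed because the inner integrals have to be measurable functions of the
    first coordinate. *)
Lemma le_integral_Cn n (f g : borel (Cn R n) -> \bar R) :
  measurable_fun setT f -> measurable_fun setT g -> (forall z, 0 <= f z) ->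
  (forall z, f z <= g z) -> integral_Cn f <= integral_Cn g.
Proof.
elim: n f g => [|n IH] f g mf mg f0 fg /=; first exact: fg.
have g0 z : 0 <= g z := le_trans (f0 z) (fg z).
apply: ge0_le_integral => //.
- by move=> p _; exact: integral_Cn_ge0.
- exact: measurable_inner_integral_Cn.
- exact: measurable_inner_integral_Cn.
- move=> p _; apply: IH => //.
    exact: (measurableT_comp mf (measurable_consC2 p)).
  exact: (measurableT_comp mg (measurable_consC2 p)).
Qed.

Lemma integral_CnD n (f g : borel (Cn R n) -> \bar R) :
  measurable_fun setT f -> measurable_fun setT g -> (forall z, 0 <= f z) ->
  (forall z, 0 <= g z) -> integral_Cn (fun z => f z + g z) = integral_Cn f + integral_Cn g.
Proof.
elim: n f g => [|n IH] f g mf mg f0 g0 //=.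
rewrite -ge0_integralD//.
- apply: eq_integral => p _; apply: IH => //.
    exact: (measurableT_comp mf (measurable_consC2 p)).
  exact: (measurableT_comp mg (measurable_consC2 p)).
- by move=> p _; exact: integral_Cn_ge0.
- exact: measurable_inner_integral_Cn.
- by move=> p _; exact: integral_Cn_ge0.
- exact: measurable_inner_integral_Cn.
Qed.

Lemma integral_CnZ n (k : R) (f : borel (Cn R n) -> \bar R) : (0 <= k)%R ->
  measurable_fun setT f -> (forall z, 0 <= f z) ->
  integral_Cn (fun z => k%:E * f z) = k%:E * integral_Cn f.
Proof.
move=> k0; elim: n f => [|n IH] f mf f0 //=.
rewrite -ge0_integralZl_EFin//.
- apply: eq_integral => p _; apply: IH => //.
  exact: (measurableT_comp mf (measurable_consC2 p)).
- by move=> p _; exact: integral_Cn_ge0.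
- exact: measurable_inner_integral_Cn.
Qed.

Lemma integral_Cn_sum n (I : Type) (s : seq I) (f : I -> borel (Cn R n) -> \bar R) :
  (forall i, measurable_fun setT (f i)) -> (forall i z, 0 <= f i z) ->
  integral_Cn (fun z => \sum_(i <- s) f i z) = \sum_(i <- s) integral_Cn (f i).
Proof.
move=> mf f0; elim: s => [|i s IH].
  rewrite big_nil; under eq_fun do rewrite big_nil.
  by elim: n f mf f0 => [|n IHn] f mf f0 //=; rewrite integral0_eq// => p _;
    elim: (n) => //= m IHm; rewrite integral0_eq.
rewrite big_cons -IH; under eq_fun do rewrite big_cons.
apply: integral_CnD => //; last by move=> z; exact: sume_ge0.
exact: emeasurable_sum.
Qed.

Lemma integral_CnN n (f : Cn R n -> \bar R) : (forall z, 0 <= f z) ->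
  integral_Cn (fun z => - f z) = - integral_Cn f.
Proof.
elim: n f => [|n IH] f f0 //=.
rewrite -integral_ge0N; last by move=> p _; exact: integral_Cn_ge0.
by apply: eq_integral => p _; exact: IH.
Qed.

End borel_Cn.
(** * Sub-mean value inequalities *)

Section mean_value.
Context {R : realType}.
Local Notation C := R[i].
Local Notation cn := (@ComplexField.Normc.normc R).
Local Notation mu := (@lebesgue_measure R).

Lemma lebesgue_translation (c : R) (f : R -> \bar R) : measurable_fun setT f ->
  (forall x, (0 <= f x)%E) -> (\int[mu]_x f (c + x)%R = \int[mu]_x f x)%E.
Proof.
move=> mf f0; pose phi (x : measurableTypeR R) : measurableTypeR R := c + x.
have mphi : measurable_fun setT phi.
  by apply: measurable_funD; [exact: measurable_cst|exact: measurable_id].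
have := @ge0_integral_pushforward _ _ _ _ R phi mphi mu setT f measurableT mf (fun x _ => f0 x).
rewrite preimage_setT => <-.
apply: eq_measure_integral => A mA _.
apply/esym/lebesgue_measure_unique => // _ [[a b]] _ <-.
rewrite -[RHS]/(mu (phi @^-1` `]a, b]%classic)) (_ : phi @^-1` _ = `]a - c, b - c]%classic); last first.
  by apply/seteqP; split => x; rewrite /= !in_itv /= /phi ltrBlDl lerBrDl.
rewrite !lebesgue_measure_itv /= !lte_fin ltrD2r.
by case: ifP => // _; rewrite -!EFinB; congr _%:E; ring.
Qed.

Lemma lebesgue_reflection (c : R) (f : R -> \bar R) : measurable_fun setT f ->
  (forall x, (0 <= f x)%E) -> (\int[mu]_x f (c - x)%R = \int[mu]_x f x)%E.
Proof.
move=> mf f0; pose phi (x : measurableTypeR R) : measurableTypeR R := - x.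
have mphi : measurable_fun setT phi by exact: oppr_measurable.
have mg : measurable_fun setT (fun x => f (c + x)).
  apply: (measurableT_comp mf).
  by apply: measurable_funD; [exact: measurable_cst|exact: measurable_id].
have := @ge0_integral_pushforward _ _ _ _ R phi mphi mu setT (fun x => f (c + x)) measurableT mg
  (fun x _ => f0 _).
rewrite preimage_setT => e.
rewrite -[LHS]/((\int[mu]_x ((fun x => f (c + x)%R) \o phi) x)%E) -e -(lebesgue_translation c mf f0).
by apply: eq_measure_integral => A mA _; exact: lebesgue_measureN.
Qed.

Lemma cn_dist (z w : C) : `|cn z - cn w| <= cn (z - w).
Proof.
have := cnD (z - w) w; have := cnD (w - z) z; rewrite !subrK cnC ler_norml; lra.
Qed.

Lemma continuous_cn (X : topologicalType) (f : X -> C) (x : X) : {for x, continuous f} ->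
  {for x, continuous (fun x => cn (f x))}.
Proof.
move=> /(@cvg_cnP _ _ (nbhs x) (nbhs_filter x)) fx.
apply/(@cvgrPdist_lt _ _ _ (nbhs x) (nbhs_filter x)) => e /fx.
by apply: filterS => y; apply: le_lt_trans; exact: cn_dist.
Qed.

Lemma closed_csq z0 r : closed (csq z0 r : set C).
Proof.
have -> : csq z0 r = (fun z : C => `|complex.Re z - complex.Re z0|) @^-1` [set x | x <= r] `&`
   (fun z : C => `|complex.Im z - complex.Im z0|) @^-1` [set x | x <= r].
  by apply/seteqP; split.
apply: closedI; (apply: closed_comp; last exact: closed_le).
  move=> z _; apply: (@cvg_norm _ _ _ _ (nbhs_filter z)).
  by apply: (@cvgB _ _ _ (nbhs z)); [exact: continuous_Re|exact: cvg_cst].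
move=> z _; apply: (@cvg_norm _ _ _ _ (nbhs_filter z)).
by apply: (@cvgB _ _ _ (nbhs z)); [exact: continuous_Im|exact: cvg_cst].
Qed.

(** On a closed set a function that is continuous at each of its points is Borel there; outside, the
    product is 0. *)
Lemma measurable_cutoff (X : ptopologicalType) (K : set X) (phi : X -> R) :
  closed K -> (forall x, 0 <= phi x) -> (forall x, K x -> {for x, continuous phi}) ->
  measurable_fun setT (fun x : borel X => (phi x * \1_K x)%:E).
Proof.
move=> cK phi0 phic; apply/measurable_EFinP.
apply: (@measurability _ _ (borel X) R setT _ _ (RGenOInfty.measurableE R)).
move=> _ [_ [c ->] <-]; rewrite setTI.
have mK : measurable (K : set (borel X)).
  by rewrite -[K]setCK; apply: measurableC; apply: sub_sigma_algebra; exact: closed_openC.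
have [c0|c0] := ltP c 0.
  rewrite (_ : _ @^-1` _ = setT); first exact: measurableT.
  apply/seteqP; split=> // x _ /=; rewrite in_itv /= andbT; apply: lt_le_trans c0 _.
  by rewrite mulr_ge0.
have -> : (fun x : borel X => phi x * \1_K x) @^-1` `]c, +oo[ = K `&` (phi @^-1` [set y | c < y])°.
  apply/seteqP; split=> x /=; rewrite in_itv /= andbT indicE.
    case: (boolP (x \in K)) => [/set_mem xK|_]; last by rewrite mulr0 ltNge c0.
    rewrite mulr1 => cx; split => //; apply: (phic _ xK).
    by apply: open_nbhs_nbhs; split => //; exact: open_gt.
  by case=> xK /interior_subset cx; rewrite mem_set// mulr1.
apply: measurableI => //; apply: sub_sigma_algebra; exact: open_interior.
Qed.

Lemma csq_side z0 r t (x y : R) : `|x - complex.Re z0| <= t -> `|y - complex.Im z0| <= t ->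
  t <= r -> csq z0 r (x +i* y).
Proof. by move=> hx hy tr; split; [exact: le_trans hx tr|exact: le_trans hy tr]. Qed.

Local Open Scope ereal_scope.

Lemma EFin_Rintegral_itv (a b : R) (f : R -> R) :
  (forall t, (a <= t <= b)%R -> {for t, continuous f}) ->
  (\int[mu]_(t in `[a, b]) f t)%R%:E = \int[mu]_(t in `[a, b]) (f t)%:E.
Proof.
move=> /continuous_itv_integrable fi; rewrite fineK//.
exact: integrable_fin_num.
Qed.

(** For [t] between [r / 2] and [r], the Cauchy formula on the square of half-side [t] bounds [r *
    |f z0|] by the integral [S t] of [|f|] along its four sides; integrating in [t], each family of
    parallel sides sweeps out a part of the big square. *)
Lemma cauchy_area (f : C -> C) z0 (r : R) : (0 < r)%R -> (forall z, csq z0 r z -> cdiff f z) ->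
  (r ^+ 2 / 8 * cn (f z0))%:E <=
  \int[mu \x mu]_p (cn (f (p.1 +i* p.2)) * \1_(csq z0 r) (p.1 +i* p.2))%:E.
Proof.
move=> r0 fd; set a := complex.Re z0; set b := complex.Im z0.
pose N (x y : R) := cn (f (x +i* y)).
pose Phi (p : R * R) := (N p.1 p.2 * \1_(csq z0 r) (p.1 +i* p.2))%:E.
have Phi0 p : 0 <= Phi p by rewrite lee_fin mulr_ge0 ?cn_ge0// indicE.
have fc z : csq z0 r z -> {for z, continuous (fun z => cn (f z))}.
  by move=> /fd /cdiff_continuous; exact: continuous_cn.
have mPhi : measurable_fun setT Phi.
  apply: (measurableT_comp (measurable_cutoff (@closed_csq z0 r) (fun z => cn_ge0 (f z)) fc)).
  exact: measurable_complex.
(* [G] and [H] are the integrals over the vertical and the horizontal sections of the square. *)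
pose G x := \int[mu]_y Phi (x, y); pose H y := \int[mu]_x Phi (x, y).
have mG : measurable_fun setT G by exact: measurable_fun_fubini_tonelli_F.
have mH : measurable_fun setT H by exact: measurable_fun_fubini_tonelli_G.
have G0 x : 0 <= G x by exact: integral_ge0.
have H0 x : 0 <= H x by exact: integral_ge0.
have iG : \int[mu]_x G x = \int[mu \x mu]_p Phi p by rewrite fubini_tonelli1.
have iH : \int[mu]_x H x = \int[mu \x mu]_p Phi p by rewrite fubini_tonelli2.
have contx t y : csq z0 r (t +i* y) -> {for t, continuous (fun x => N x y)}.
  move=> /fc h.
  exact: (@cvg_comp _ _ _ (fun x => x +i* y : C) (fun z => cn (f z)) _ _ _ (@continuous_hline _ y t) h).
have conty t x : csq z0 r (x +i* t) -> {for t, continuous (fun y => N x y)}.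
  move=> /fc h.
  exact: (@cvg_comp _ _ _ (fun y => x +i* y : C) (fun z => cn (f z)) _ _ _ (@continuous_vline _ x t) h).
have sideH t y : (t <= r)%R -> (`|y - b| <= t)%R ->
    (\int[mu]_(x in `[(a - t)%R, (a + t)%R]) N x y)%R%:E <= H y.
  move=> tr yb; have inc x : (a - t <= x <= a + t)%R -> csq z0 r (x +i* y).
    by rewrite -ler_distl => xa; exact: csq_side tr.
  rewrite EFin_Rintegral_itv; last by move=> x /inc; exact: contx.
  rewrite integral_mkcond; apply: ge0_le_integral => //.
  - by move=> x _; rewrite patchE; case: ifP => // _; rewrite lee_fin cn_ge0.
  - apply/(measurable_restrictT _ _).1 => //; apply/measurable_EFinP.
    apply: subspace_continuous_measurable_fun => //.
    apply: continuous_in_subspaceT => x; rewrite inE /= in_itv /= => /inc; exact: contx.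
  - exact: (measurable_fun_pair1 y mPhi).
  - move=> x _; rewrite patchE; case: ifPn => [|_]; last exact: Phi0.
    rewrite inE /= in_itv /= => /inc h.
    by rewrite /Phi /= indicE mem_set// mulr1.
have sideG t x : (t <= r)%R -> (`|x - a| <= t)%R ->
    (\int[mu]_(y in `[(b - t)%R, (b + t)%R]) N x y)%R%:E <= G x.
  move=> tr xa; have inc y : (b - t <= y <= b + t)%R -> csq z0 r (x +i* y).
    by rewrite -ler_distl => yb; exact: csq_side tr.
  rewrite EFin_Rintegral_itv; last by move=> y /inc; exact: conty.
  rewrite integral_mkcond; apply: ge0_le_integral => //.
  - by move=> y _; rewrite patchE; case: ifP => // _; rewrite lee_fin cn_ge0.
  - apply/(measurable_restrictT _ _).1 => //; apply/measurable_EFinP.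
    apply: subspace_continuous_measurable_fun => //.
    apply: continuous_in_subspaceT => y; rewrite inE /= in_itv /= => /inc; exact: conty.
  - exact: (measurable_fun_pair2 x mPhi).
  - move=> y _; rewrite patchE; case: ifPn => [|_]; last exact: Phi0.
    rewrite inE /= in_itv /= => /inc h.
    by rewrite /Phi /= indicE mem_set// mulr1.
clearbody G H.
pose S t := (H (b - t)%R + H (b + t)%R) + (G (a + t)%R + G (a - t)%R).
have mshift (F : R -> \bar R) (c : R) : measurable_fun [set: R] F -> measurable_fun [set: R] (fun t : R => F (c + t)%R).
  move=> mF; apply: (measurableT_comp mF).
  by apply: measurable_funD; [exact: measurable_cst|exact: measurable_id].
have mrefl (F : R -> \bar R) (c : R) : measurable_fun [set: R] F -> measurable_fun [set: R] (fun t : R => F (c - t)%R).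
  move=> mF; apply: (measurableT_comp mF).
  by apply: measurable_funB; [exact: measurable_cst|exact: measurable_id].
have mS : measurable_fun setT S.
  by apply: emeasurable_funD; apply: emeasurable_funD; (exact: mshift || exact: mrefl).
have circle t : (r / 2 <= t <= r)%R -> (r * cn (f z0))%:E <= S t.
  move=> /andP[rt tr]; have t0 : (0 < t)%R by apply: lt_le_trans rt; rewrite divr_gt0.
  have incs z : csq z0 t z -> csq z0 r z by move=> [h1 h2]; split; apply: le_trans tr.
  have key := sq_inv_ge z0 t0.
  have cf := cauchy_formula t0 (fun z h => fd z (incs z h)) (w := z0).
  rewrite subrr cn0 in cf; have {}cf := cf t0.
  have le1 : (4 * cn (f z0) <= cn (sq z0 t (fun z => f z / (z - z0))))%R.
    by rewrite cf cnM mulrC ler_wpM2l ?cn_ge0.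
  have tE (u v : R) : (`|u + v - u| = `|v|)%R by rewrite addrC addKr.
  have tb : (`|b - t - b| <= t)%R by rewrite tE normrN gtr0_norm.
  have tb' : (`|b + t - b| <= t)%R by rewrite tE gtr0_norm.
  have ta : (`|a - t - a| <= t)%R by rewrite tE normrN gtr0_norm.
  have ta' : (`|a + t - a| <= t)%R by rewrite tE gtr0_norm.
  have aa : (a - t <= a + t)%R by lra.
  have bb : (b - t <= b + t)%R by lra.
  have incx x y : (a - t <= x <= a + t)%R -> (`|y - b| <= t)%R -> csq z0 r (x +i* y).
    by rewrite -ler_distl => xa yb; exact: csq_side tr.
  have incy x y : (b - t <= y <= b + t)%R -> (`|x - a| <= t)%R -> csq z0 r (x +i* y).
    by rewrite -ler_distl => yb xa; exact: csq_side tr.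
  have gsq : sqcont z0 t (fun z => f z / (z - z0))%R.
    apply: (bsq_sqcont (ltW t0)) => z zb.
    have zz : z != z0.
      by have := bsq_le zb; apply: contraTneq => ->; rewrite subrr cn0 -ltNge.
    have h1 := cdiff_continuous (fd z (incs z zb.1)).
    exact: (@cvgM _ _ (nbhs z) _ f _ _ _ h1 (continuousV_sub zz)).
  have far x y : (`|x - a| = t \/ `|y - b| = t)%R -> (cn ((x +i* y) - z0)^-1 <= t^-1)%R.
    move=> h; have tle : (t <= cn ((x +i* y) - z0))%R.
      case: h => <-.
        by apply: le_trans (Re_le_cn _); rewrite ReB.
      by apply: le_trans (Im_le_cn _); rewrite ImB.
    rewrite cnV lef_pV2 ?posrE//; exact: lt_le_trans tle.
  have [g1 g2 g3 g4] := gsq.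
  have tN : (`|b - t - b| = t)%R by rewrite tE normrN gtr0_norm.
  have tN' : (`|b + t - b| = t)%R by rewrite tE gtr0_norm.
  have aN : (`|a - t - a| = t)%R by rewrite tE normrN gtr0_norm.
  have aN' : (`|a + t - a| = t)%R by rewrite tE gtr0_norm.
  have bound x y : (`|x - a| = t \/ `|y - b| = t)%R -> (cn (f (x +i* y) / ((x +i* y) - z0)) <= N x y * t^-1)%R.
    by move=> h; rewrite cnM ler_wpM2l ?cn_ge0// far.
  have contD (u v : R -> R) (s : R) (c : R) : {for s, continuous u} -> {for s, continuous v} ->
      {for s, continuous (fun x => (u x + v x) * c)%R}.
    move=> hu hv; apply: (@cvgM _ _ (nbhs s) _ (fun x => u x + v x)%R (fun=> c)); last exact: cvg_cst.
    exact: (@cvgD _ _ _ (nbhs s) _ u v).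
  have h1 := cint_le_int aa (icontB g1 g2) (f := fun x => ((N x (b - t) + N x (b + t)) / t)%R).
  have {}h1 := h1 (fun x hx => contD _ _ _ _ (contx _ _ (incx _ _ hx tb)) (contx _ _ (incx _ _ hx tb'))).
  have h2 := cint_le_int bb (icontB g4 g3) (f := fun y => ((N (a + t) y + N (a - t) y) / t)%R).
  have {}h2 := h2 (fun x hx => contD _ _ _ _ (conty _ _ (incy _ _ hx ta')) (conty _ _ (incy _ _ hx ta))).
  have {h1 h2} le2 : (cn (sq z0 t (fun z => f z / (z - z0))) <=
      2 * (\int[mu]_(x in `[(a - t)%R, (a + t)%R]) ((N x (b - t) + N x (b + t)) / t)) +
      2 * (\int[mu]_(y in `[(b - t)%R, (b + t)%R]) ((N (a + t) y + N (a - t) y) / t)))%R.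
    apply: le_trans (cnD _ _) (lerD _ _).
      apply: h1 => x hx; apply: le_trans (cnB _ _) _; rewrite mulrDl.
      by apply: lerD; apply: bound; right.
    rewrite cnM cn_i mul1r; apply: h2 => y hy; apply: le_trans (cnB _ _) _; rewrite mulrDl.
    by apply: lerD; apply: bound; left.
  have splitI (u v : R) (F1 F2 : R -> R) : (forall s, (u <= s <= v)%R -> {for s, continuous F1}) ->
      (forall s, (u <= s <= v)%R -> {for s, continuous F2}) ->
      (\int[mu]_(x in `[u, v]) ((F1 x + F2 x) / t) =
       (\int[mu]_(x in `[u, v]) F1 x + \int[mu]_(x in `[u, v]) F2 x) / t)%R.
    move=> c1 c2.
    have i1 := continuous_itv_integrable c1; have i2 := continuous_itv_integrable c2.
    rewrite RintegralZr//; last first.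
      apply: continuous_itv_integrable => s hs.
      exact: (@cvgD _ _ _ (nbhs s) _ F1 F2 _ _ (c1 _ hs) (c2 _ hs)).
    by rewrite RintegralD.
  rewrite !splitI in le2; first last.
  - by move=> s hs; apply: contx; exact: incx.
  - by move=> s hs; apply: contx; exact: incx.
  - by move=> s hs; apply: conty; exact: incy.
  - by move=> s hs; apply: conty; exact: incy.
  have le3 := le_trans le1 le2.
  apply: (@le_trans _ _ ((\int[mu]_(x in `[(a - t)%R, (a + t)%R]) N x (b - t)%R +
      \int[mu]_(x in `[(a - t)%R, (a + t)%R]) N x (b + t)%R) +
     (\int[mu]_(y in `[(b - t)%R, (b + t)%R]) N (a + t)%R y +
      \int[mu]_(y in `[(b - t)%R, (b + t)%R]) N (a - t)%R y))%R%:E).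
    rewrite lee_fin; move: le3; set A1 := Rintegral _ _ _; set A2 := Rintegral _ _ _.
    set A3 := Rintegral _ _ _; set A4 := Rintegral _ _ _ => le3.
    have : (t * (4 * cn (f z0)) <= 2 * (A1 + A2 + (A3 + A4)))%R.
      have -> : (2 * (A1 + A2 + (A3 + A4)) = t * (2 * ((A1 + A2) / t) + 2 * ((A3 + A4) / t)))%R.
        by field; rewrite gt_eqF.
      by rewrite ler_wpM2l// ltW.
    have : (r / 2 * cn (f z0) <= t * cn (f z0))%R by rewrite ler_wpM2r ?cn_ge0.
    lra.
  rewrite !EFinD; apply: leeD.
    by apply: leeD; [exact: (sideH _ _ tr tb)|exact: (sideH _ _ tr tb')].
  by apply: leeD; [exact: (sideG _ _ tr ta')|exact: (sideG _ _ tr ta)].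
have le1 : (r / 2)%:E * (r * cn (f z0))%:E <= \int[mu]_(t in `[(r / 2)%R, r]) S t.
  have -> : (r / 2)%:E * (r * cn (f z0))%:E = \int[mu]_(t in `[(r / 2)%R, r]) (cst (r * cn (f z0))%:E t).
    rewrite integral_cst//= lebesgue_measure_itv /= lte_fin ifT; last by lra.
    by rewrite -EFinB muleC; congr (_ * _%:E); lra.
  apply: ge0_le_integral => //.
  - by move=> t _; rewrite lee_fin mulr_ge0 ?cn_ge0// ltW.
  - exact: measurable_funTS.
have le2 : \int[mu]_(t in `[(r / 2)%R, r]) S t <= \int[mu]_t S t.
  apply: ge0_subset_integral => //.
  by move=> t _; apply: adde_ge0; apply: adde_ge0; (exact: G0 || exact: H0).
have eS : \int[mu]_t S t = 4%:E * \int[mu \x mu]_p Phi p.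
  rewrite /S !ge0_integralD//.
  - rewrite !lebesgue_translation// !lebesgue_reflection// iG iH.
    have -> : 4%:E = 1 + 1 + (1 + 1) :> \bar R by rewrite -!EFinD; congr _%:E; ring.
    by rewrite !ge0_muleDl ?adde_ge0// mul1e.
  - exact: mshift.
  - exact: mrefl.
  - exact: mrefl.
  - exact: mshift.
  - by move=> t _; apply: adde_ge0; (exact: G0 || exact: H0).
  - by apply: emeasurable_funD; (exact: mshift || exact: mrefl).
  - by move=> t _; apply: adde_ge0; (exact: G0 || exact: H0).
  - by apply: emeasurable_funD; (exact: mshift || exact: mrefl).
have := le_trans le1 le2; rewrite eS -EFinM.
set I := integral _ _ _; rewrite -[X in _ -> _ <= X]/I; case: I => [x| |] //=.
- by rewrite -EFinM !lee_fin => h; lra.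
- by move=> _; rewrite leey.
- by rewrite mulrNy gtr0_sg// mul1e.
Qed.

End mean_value.
Section mean_value_Cn.
Context {R : realType}.
Local Notation C := R[i].
Local Notation cn := (@ComplexField.Normc.normc R).

Definition cube n (z0 : Cn R n) (r : R) : set (Cn R n) :=
  [set z | forall j, csq (z0 0 j) r (z 0 j)].

Lemma continuous_coord n (j : 'I_n) : continuous (fun z : Cn R n => z 0 j).
Proof.
move=> z; apply/(@cvg_cnP _ _ (nbhs z) (nbhs_filter z)) => e e0.
apply/nbhs_rnormP; exists e => // w wz; rewrite cnC; apply: le_lt_trans wz.
by have := coord_le_rnorm (w - z) j; rewrite !mxE.
Qed.

Lemma closed_cube n (z0 : Cn R n) r : closed (cube z0 r).
Proof.
have -> : cube z0 r = \bigcap_j ((fun z : Cn R n => z 0 j) @^-1` csq (z0 0 j) r).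
  by apply/seteqP; split=> z h; [move=> j _; exact: h|move=> j; exact: h].
apply: closed_bigI => j _; apply: closed_comp; last exact: closed_csq.
by move=> z _; exact: continuous_coord.
Qed.

Lemma cube_consC n p (z0 z : Cn R n) (a : R * R) r :
  cube (consC a z0) r (consC p z) <-> csq (a.1 +i* a.2) r (p.1 +i* p.2) /\ cube z0 r z.
Proof.
split=> [h|[h1 h2] j].
  by split=> [|j]; [have := h ord0; rewrite !consC0|have := h (lift ord0 j); rewrite !consC_lift].
by case: (unliftP ord0 j) => [k|] ->; rewrite ?consC0 ?consC_lift//; exact: h2.
Qed.

Lemma consC_surj n (z : Cn R n.+1) : exists p z', z = consC p z'.
Proof.
exists (complex.Re (z 0 ord0), complex.Im (z 0 ord0)), (\row_j z 0 (lift ord0 j)).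
apply/rowP => j; case: (unliftP ord0 j) => [k|] ->; rewrite ?consC0 ?consC_lift ?mxE//=.
by case: (z 0 ord0).
Qed.

Lemma differentiable_consC n (f : Cn R n.+1 -> C) p z :
  differentiable f (consC p z) -> differentiable (fun z => f (consC p z)) z.
Proof.
move=> /differentiable_expand fd.
apply: (@differentiable_rowform _ _ _ _ (fun j => 'd f (consC p z) (delta_mx 0 (lift ord0 j)))).
move=> e e0; have [d d0 dh] := fd e e0; exists d => // h hd.
pose h' : Cn R n.+1 := consC (0, 0) h.
have e1 : consC p (z + h) = consC p z + h'.
  apply/rowP => j; rewrite [in RHS]mxE; case: (unliftP ord0 j) => [k|] ->.
    rewrite !consC_lift; exact: mxE.
  by rewrite !consC0 /=; apply/eqP; rewrite eq_complex /= !addr0 !eqxx.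
have e2 : 'd f (consC p z) h' = rowform (fun j => 'd f (consC p z) (delta_mx 0 (lift ord0 j))) h.
  rewrite (row_sum_delta h') linear_sum big_ord_recl /= consC0 /= linearZ /= scale0r add0r.
  by apply: eq_bigr => j _; rewrite consC_lift linearZ.
have hh : rnorm h' <= rnorm h.
  apply: rnorm_le => [|j]; first exact: rnorm_ge0.
  case: (unliftP ord0 j) => [k|] ->; rewrite ?consC0 ?consC_lift /=.
    exact: coord_le_rnorm.
  by rewrite expr0n addr0 sqrtr0 rnorm_ge0.
rewrite e1 -e2; apply: le_trans (dh _ (le_lt_trans hh hd)) _.
by rewrite ler_wpM2l// ltW.
Qed.

Lemma consC_line n (c : C) (z : Cn R n) :
  consC (complex.Re c, complex.Im c) z = consC (0, 0) z + c *: delta_mx 0 ord0.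
Proof.
apply/rowP => j; rewrite [in RHS]mxE [X in _ + X]mxE [X in _ * X]mxE; case: (unliftP ord0 j) => [k|] ->.
  by rewrite !consC_lift /= mulr0 addr0.
by rewrite !consC0 /= mulr1 -[0 +i* 0]/(0 : C) add0r; case: c.
Qed.

Lemma differentiable_cdiff_consC n (f : Cn R n.+1 -> C) (c : C) (z : Cn R n) :
  differentiable f (consC (complex.Re c, complex.Im c) z) ->
  cdiff (fun c => f (consC (complex.Re c, complex.Im c) z)) c.
Proof.
rewrite consC_line => /differentiable_cdiff.
by congr cdiff; apply/funext => c'; rewrite consC_line.
Qed.

Local Open Scope ereal_scope.

(** The one-variable inequality, applied to one coordinate at a time. *)
Lemma mean_value_Cn n (f : Cn R n -> C) z0 (r : R) : (0 < r)%R ->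
  (forall z, cube z0 r z -> differentiable f z) ->
  ((r ^+ 2 / 8) ^+ n * cn (f z0))%:E <= integral_Cn (fun z => (cn (f z) * \1_(cube z0 r) z)%:E).
Proof.
move=> r0; elim: n f z0 => [|n IH] f z0 fd.
  have e0 : cube z0 r (0%R : Cn R 0) by move=> j; have := ltn_ord j; rewrite ltn0.
  by rewrite /= expr0 mul1r indicE mem_set// mulr1 (_ : z0 = 0%R)//; apply/rowP => j; have := ltn_ord j; rewrite ltn0.
have [a [z0' ez]] := consC_surj z0; rewrite {z0}ez in fd *.
rewrite integral_CnS exprS -mulrA EFinM.
set k := (r ^+ 2 / 8)%R; have k0 : (0 < k)%R by rewrite divr_gt0// exprn_gt0.
have contf z : cube (consC a z0') r z -> {for z, continuous (fun z => cn (f z))}.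
  by move=> /fd /differentiable_continuous; exact: continuous_cn.
have mf := measurable_cutoff (@closed_cube _ (consC a z0') r) (fun z => cn_ge0 (f z)) contf.
have ball0 : cube z0' r z0' by move=> j; split; rewrite subrr normr0 ltW.
have step p : csq (a.1 +i* a.2) r (p.1 +i* p.2) ->
    (k ^+ n * cn (f (consC p z0')))%:E <=
    integral_Cn (fun z => (cn (f (consC p z)) * \1_(cube (consC a z0') r) (consC p z))%:E).
  move=> pr; apply: le_trans (IH (fun z => f (consC p z)) z0' _) _.
    move=> z zr; apply: differentiable_consC; apply: fd.
    exact/(cube_consC p z0' z a r).2.
  rewrite le_eqVlt; apply/orP; left; apply/eqP; congr integral_Cn; apply/funext => z.
  congr (_ * _)%:E; rewrite !indicE; congr (nat_of_bool _)%:R; apply/idP/idP; rewrite !inE.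
    by move=> h; apply/(cube_consC p z0' z a r).2.
  by move=> /(cube_consC p z0' z a r) [].
pose g (c : C) := f (consC (complex.Re c, complex.Im c) z0').
have gd c : csq (a.1 +i* a.2) r c -> cdiff g c.
  move=> cr; apply: differentiable_cdiff_consC; apply: fd.
  by apply/(cube_consC (complex.Re c, complex.Im c) z0' z0' a r).2; split => //; case: c cr.
have area := cauchy_area r0 gd.
apply: (@le_trans _ _ ((k ^+ n)%:E * (k * cn (g (a.1 +i* a.2)))%:E)).
  rewrite -!EFinM lee_fin /g /= -surjective_pairing.
  by rewrite le_eqVlt; apply/orP; left; apply/eqP; ring.
apply: le_trans (lee_wpmul2l _ area) _; first by rewrite lee_fin exprn_ge0// ltW.
have mg : measurable_fun setT (fun p : R * R =>
    (cn (g (p.1 +i* p.2)) * \1_(csq (a.1 +i* a.2) r) (p.1 +i* p.2))%:E).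
  have gc c : csq (a.1 +i* a.2) r c -> {for c, continuous (fun c => cn (g c))}.
    by move=> /gd /cdiff_continuous; exact: continuous_cn.
  apply: (measurableT_comp (measurable_cutoff (@closed_csq _ _ r) (fun z => cn_ge0 (g z)) gc)).
  exact: measurable_complex.
rewrite -ge0_integralZl_EFin//; last first.
- by rewrite exprn_ge0// ltW.
- by move=> p _; rewrite lee_fin mulr_ge0 ?cn_ge0// indicE.
apply: ge0_le_integral => //.
- move=> p _; rewrite -EFinM lee_fin !mulr_ge0 ?cn_ge0 ?exprn_ge0 ?indicE//; exact: ltW.
- exact: measurable_funeM.
- apply: (@measurable_inner_integral_Cn _ _ (fun z => (cn (f z) * \1_(cube (consC a z0') r) z)%:E)) => // z.
  by rewrite lee_fin mulr_ge0 ?cn_ge0// indicE.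
- move=> p _; rewrite indicE; case: (boolP (_ \in _)) => [/set_mem pr|_]; last first.
    rewrite mulr0 mule0; apply: integral_Cn_ge0 => z.
    by rewrite lee_fin mulr_ge0 ?cn_ge0// indicE.
  rewrite mulr1 -EFinM; apply: le_trans (step p pr).
  by rewrite lee_fin /g /= -surjective_pairing.
Qed.

End mean_value_Cn.

(** * The top exterior power of a positive (1,1)-form *)

Section wedge.
Context {R : realType} {n : nat}.
Local Notation C := R[i].
Local Notation I := ('I_n * bool)%type.
Local Notation real_frame := (@real_frame R n).
Variable omega : Cn R n -> Cn R n -> R.
Hypothesis omega_linear : forall (t : R) u v w,
  omega (t%:C *: u + v) w = t * omega u w + omega v w.
Hypothesis omega_anti : forall u v, omega u v = - omega v u.
Hypothesis omega_J : forall u v, omega ('i%C *: u) ('i%C *: v) = omega u v.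
Hypothesis omega_pos : forall u, u != 0 -> 0 < omega u ('i%C *: u).

Definition frame_coef (u : Cn R n) (p : I) : R :=
  if p.2 then complex.Im (u 0 p.1) else complex.Re (u 0 p.1).

Lemma frame_expand (u : Cn R n) : u = \sum_p (frame_coef u p)%:C *: real_frame p.
Proof.
rewrite [LHS]row_sum_delta -(pair_bigA _ (fun j b => (frame_coef u (j, b))%:C *: real_frame (j, b))) /=.
apply: eq_bigr => j _; rewrite big_bool /real_frame /frame_coef /= !scalerA mulr1 -scalerDl.
congr (_ *: _); case: (u 0 j) => a b.
by apply/eqP; rewrite eq_complex /=; apply/andP; split; apply/eqP; ring.
Qed.

Lemma omegaDl u v w : omega (u + v) w = omega u w + omega v w.
Proof. by rewrite -[u]scale1r -[1 : C]/(1%:C) omega_linear mul1r scale1r. Qed.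

Lemma omega0l w : omega 0 w = 0.
Proof. by have := omegaDl 0 0 w; rewrite addr0 => /eqP; rewrite -subr_eq0 opprD addrA subrr sub0r oppr_eq0 => /eqP. Qed.

Lemma omegaZl (t : R) u w : omega (t%:C *: u) w = t * omega u w.
Proof. by rewrite -[X in omega X]addr0 omega_linear omega0l addr0. Qed.

Lemma omega_suml (J : finType) (c : J -> R) (v : J -> Cn R n) w :
  omega (\sum_k (c k)%:C *: v k) w = \sum_k c k * omega (v k) w.
Proof.
pose K (u : Cn R n) (x : R) := omega u w = x.
apply: (big_ind2 K) => [|u x u' x' <- <-|k _]; rewrite /K ?omega0l ?omegaDl ?omegaZl//.
Qed.

Lemma omega_sumr (J : finType) (c : J -> R) (v : J -> Cn R n) w :
  omega w (\sum_k (c k)%:C *: v k) = \sum_k c k * omega w (v k).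
Proof.
rewrite omega_anti omega_suml -sumrN; apply: eq_bigr => k _.
by rewrite omega_anti mulrN opprK.
Qed.

(** The value, up to the factor [2^-n], of the top exterior power on an arbitrary system of [2n]
    vectors. *)
Definition wedge_sum (v : I -> Cn R n) : R :=
  \sum_(s : {perm I}) (-1) ^+ s * \prod_(j < n) omega (v (s (j, false))) (v (s (j, true))).

Lemma prod_frame_expand (u : I -> Cn R n) :
  \prod_(j < n) omega (u (j, false)) (u (j, true)) =
  \sum_(h : {ffun I -> I}) \prod_p frame_coef (u p) (h p) *
     \prod_(j < n) omega (real_frame (h (j, false))) (real_frame (h (j, true))).
Proof.
pose c := frame_coef.
pose F j (x : I * I) := c (u (j, false)) x.1 * c (u (j, true)) x.2 * omega (real_frame x.1) (real_frame x.2).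
transitivity (\prod_j \sum_x F j x).
  apply: eq_bigr => j _; rewrite {1}(frame_expand (u (j, false))) {1}(frame_expand (u (j, true))).
  rewrite omega_suml -(pair_bigA _ (fun x y => F j (x, y))) /=; apply: eq_bigr => x _.
  rewrite omega_sumr big_distrr /=; apply: eq_bigr => y _.
  by rewrite /F /= mulrA.
rewrite bigA_distr_bigA /=.
pose to (g : {ffun 'I_n -> I * I}) : {ffun I -> I} := [ffun p => if p.2 then (g p.1).2 else (g p.1).1].
pose fro (h : {ffun I -> I}) : {ffun 'I_n -> I * I} := [ffun j => (h (j, false), h (j, true))].
rewrite [RHS](reindex to); last first.
  exists fro => h _; apply/ffunP => x; rewrite !ffunE /=; first by case: (h x).
  by case: x => j [] /=; rewrite ?ffunE.
have prodI (G : I -> R) : \prod_p G p = \prod_j (G (j, true) * G (j, false)).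
  rewrite (eq_bigr (fun p => G (p.1, p.2))); last by case.
  by rewrite -(pair_bigA _ (fun j b => G (j, b))) /=; apply: eq_bigr => j _; rewrite big_bool.
apply: eq_bigr => g _; rewrite prodI.
rewrite -big_split /=; apply: eq_bigr => j _.
by rewrite !ffunE /= /F -/c [X in _ = X * _]mulrC.
Qed.

(** Multilinearity and antisymmetry: the value on any system of vectors is its determinant times the
    value on the frame. Hence a single system with nonzero value suffices for the frame. *)
Lemma wedge_sum_expand (v : I -> Cn R n) :
  wedge_sum v = (\sum_(s : {perm I}) (-1) ^+ s * \prod_p frame_coef (v (s p)) p) *
                wedge_sum (real_frame).
Proof.
pose A p q := frame_coef (v p) q.
pose O (h : I -> I) := \prod_(j < n) omega (real_frame (h (j, false))) (real_frame (h (j, true))).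
transitivity (\sum_(h : {ffun I -> I}) (\sum_(s : {perm I}) (-1) ^+ s * \prod_p A (s p) (h p)) * O h).
  rewrite /wedge_sum; under eq_bigr do rewrite (prod_frame_expand (fun p => v (_ p))) big_distrr /=.
  rewrite exchange_big /=; apply: eq_bigr => h _; rewrite big_distrl /=.
  by apply: eq_bigr => s _; rewrite mulrA.
rewrite (bigID (fun h : {ffun I -> I} => injectiveb h)) /= addrC big1 ?add0r; last first.
  (* A choice of frame vectors with a repetition contributes 0: composing with the transposition
     changes the sign of the sum. *)
  move=> h /injectivePn [p1 [p2 p12 hp]].
  have odd12 : tperm p1 p2 = true :> bool by rewrite odd_tperm p12.
  set D := \sum_s _.
  suff DN : D = - D.
    have -> : D = 0 by lra.
    by rewrite mul0r.
  rewrite {1}/D (reindex_inj (mulgI (tperm p1 p2))) /= -sumrN; apply: eq_bigr => s _.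
  rewrite odd_permM odd12 signr_addb expr1 mulN1r mulNr; congr (- (_ * _)).
  rewrite (reindex_perm (tperm p1 p2)) /=; apply: eq_bigr => p _.
  rewrite permM tpermK; congr (A _ _).
  by case: tpermP => // ->.
rewrite (reindex (@pval _)) /=; last first.
  pose in_S := insubd (1%g : {perm I}).
  by exists in_S => /= f Uf; first apply: val_inj; apply: insubdK.
rewrite big_distrr /=; apply: eq_big => [t|t _]; first exact: (valP t).
rewrite pvalE; transitivity (((-1) ^+ t * \sum_(s : {perm I}) (-1) ^+ s * \prod_p A (s p) p) * O t).
  congr (_ * _); rewrite (reindex_inj (mulgI t)) /= big_distrr /=; apply: eq_bigr => s _.
  rewrite odd_permM signr_addb mulrA; congr (_ * _).
  by rewrite [RHS](reindex_perm t) /=; apply: eq_bigr => p _; rewrite permM.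
by rewrite [in RHS]mulrA; congr (_ * _); rewrite mulrC.
Qed.

(** The Hermitian product of which [omega], up to sign, is the imaginary part. *)
Definition hprod (u w : Cn R n) : C := omega u ('i%C *: w) -i* omega u w.

Lemma scale_ii (u : Cn R n) : 'i%C *: ('i%C *: u) = - u.
Proof.
rewrite scalerA (_ : 'i%C * 'i%C = -1 :> C) ?scaleN1r//.
by apply/eqP; rewrite eq_complex /=; apply/andP; split; apply/eqP; ring.
Qed.

Lemma omegaNl u w : omega (- u) w = - omega u w.
Proof.
rewrite -scaleN1r (_ : -1 = (-1)%:C :> C); first by rewrite omegaZl mulN1r.
by apply/eqP; rewrite eq_complex /= oppr0 !eqxx.
Qed.

Lemma omegaiC u w : omega ('i%C *: u) w = - omega u ('i%C *: w).
Proof. by rewrite -omega_J scale_ii omegaNl. Qed.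

Lemma hprodD u v w : hprod (u + v) w = hprod u w + hprod v w.
Proof. by apply/eqP; rewrite eq_complex /= !omegaDl opprD !eqxx. Qed.

Lemma hprodZ c u w : hprod (c *: u) w = c * hprod u w.
Proof.
case: c => a b.
have -> : (a +i* b) *: u = a%:C *: u + b%:C *: ('i%C *: u).
  rewrite scalerA -scalerDl; congr (_ *: _).
  by apply/eqP; rewrite eq_complex /=; apply/andP; split; apply/eqP; ring.
rewrite hprodD /hprod !omegaZl omega_J omegaiC; apply/eqP; rewrite eq_complex /=.
by apply/andP; split; apply/eqP; ring.
Qed.

Lemma hprod0P u w : hprod u w = 0 -> omega u w = 0 /\ omega u ('i%C *: w) = 0.
Proof. by move=> /eqP; rewrite eq_complex /= oppr_eq0 => /andP [/eqP ? /eqP ?]. Qed.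

Lemma hprod_sum (u w : Cn R n) : hprod u w = \sum_j u 0 j * hprod (delta_mx 0 j) w.
Proof.
rewrite {1}(row_sum_delta u); pose K (x : Cn R n) (y : C) := hprod x w = y.
apply: (big_ind2 K) => [|x y x' y' <- <-|j _]; rewrite /K ?hprodD ?hprodZ//.
by have := hprodZ 0 0 w; rewrite scale0r mul0r.
Qed.

(** Orthogonality to [k] vectors is [k] linear conditions, which have a nonzero solution when [k <
    n]. *)
Lemma orthogonal_frame k : (k <= n)%N -> exists v : 'I_k -> Cn R n,
  (forall j, v j != 0) /\ forall i j, i != j -> hprod (v i) (v j) = 0.
Proof.
elim: k => [|k IH] kn; first by exists (fun=> 0); split=> [[]|[]].
have [v [v0 vo]] := IH (ltnW kn).
pose G : 'M[C]_(n, k) := \matrix_(i, j) hprod (delta_mx 0 i) (v j).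
have : kermx G != 0.
  rewrite kermx_eq0 -row_leq_rank -ltnNge; apply: leq_ltn_trans kn; exact: rank_leq_col.
move=> /rowV0Pn [u uG u0].
have uv j : hprod u (v j) = 0.
  move/sub_kermxP: uG => /rowP /(_ j); rewrite !mxE => h.
  by rewrite hprod_sum -[RHS]h; apply: eq_bigr => i _; rewrite mxE.
have vu j : hprod (v j) u = 0.
  have [h1 h2] := hprod0P (uv j).
  apply/eqP; rewrite eq_complex /= omega_anti omegaiC h2 opprK eqxx /=.
  by rewrite omega_anti h1 !oppr0.
exists (fun i => if unlift ord_max i is Some j then v j else u); split.
  by move=> i; case: (unlift _ i).
move=> i j; case: (unliftP ord_max i) => [i'|] ->; case: (unliftP ord_max j) => [j'|] -> //; rewrite ?eqxx//.
by move=> h; apply: vo; apply: contra h => /eqP ->.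
Qed.

(** In a system [w_1, i w_1, ..., w_n, i w_n] of pairwise orthogonal complex lines, a permutation
    contributes only if it permutes the pairs, and then each factor has the sign of the swap of the
    corresponding pair; the signs cancel against that of the permutation. Induction on the number of
    swapped pairs. *)
Lemma wedge_orthogonal (v : I -> Cn R n) (a : 'I_n -> R) : (forall j, 0 <= a j) ->
  (forall p q : I, omega (v p) (v q) =
     if p.1 == q.1 then a p.1 * (q.2%:R - p.2%:R) else 0) ->
  forall s : {perm I},
  0 <= (-1) ^+ s * \prod_(j < n) omega (v (s (j, false))) (v (s (j, true))).
Proof.
move=> a0 va s; have [m sm] := ubnP #|[pred j : 'I_n | (s (j, false)).2]|.
elim: m s sm => // m IH s sm.
have [/forallP sp|] := boolP [forall j, (s (j, false)).1 == (s (j, true)).1]; last first.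
  rewrite negb_forall => /existsP [j sj].
  by rewrite (bigD1 j)//= va (negbTE sj) mul0r mulr0.
have sf (j : 'I_n) : (s (j, true)).2 = ~~ (s (j, false)).2.
  have : s (j, false) != s (j, true) by apply/negP => /eqP /perm_inj.
  have /eqP := sp j; case: (s _) => x1 x2; case: (s _) => y1 y2 /= -> h.
  by case: x2 y2 h => [] [] //=; rewrite eqxx.
have [|] := boolP [exists j, (s (j, false)).2]; last first.
  rewrite negb_exists => /forallP s0.
  have sb j : (s (j, false)).2 = false by apply/negbTE/s0.
  have sE (j : 'I_n) b : s (j, b) = ((s (j, false)).1, b).
    rewrite [LHS]surjective_pairing; case: b; first by rewrite sf sb -(eqP (sp j)).
    by rewrite sb.
  have sI j k : (s (j, false)).1 = (s (k, false)).1 -> j = k.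
    by move=> h; have := sE k false; rewrite -h -sE => /perm_inj [].
  have inj1 : injective (fun p : I => if p.2 then p else s p).
    move=> [j b] [k c] /=; case: b c => [] [] //=; last by move=> /perm_inj.
      by rewrite sE => -[].
    by rewrite sE => -[].
  have injc : injective (fun p : I => (p.1, ~~ p.2)) by move=> [j b] [k c] /= [-> /negb_inj ->].
  pose A := perm inj1; pose c := perm injc.
  have cV : (c^-1)%g = c.
    apply/eqP; rewrite eq_invg_mul; apply/eqP.
    by apply/permP => -[j b]; rewrite permM perm1 !permE /= negbK.
  (* A permutation of the pairs without swaps acts twice, on first and on second members, so it is
     the product of two conjugate permutations. *)
  have -> : odd_perm s = false.
    have -> : s = (A * A ^ c)%g :> {perm I}.
      apply/permP => -[j b]; rewrite /conjg !permM cV !permE /=.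
      by rewrite [LHS]sE; case: b => /=; rewrite !sb.
    by rewrite odd_permM odd_permJ addbb.
  rewrite expr0 mul1r; apply: prodr_ge0 => j _.
  by rewrite va sf sb (eqP (sp j)) eqxx /= subr0 mulr1.
move=> /existsP [k sk].
(* Undo the swap of one pair. *)
pose t := tperm (k, false) (k, true) : {perm I}.
have te j b : j != k -> t (j, b) = (j, b).
  by move=> jk; rewrite tpermD// xpair_eqE eq_sym (negbTE jk).
have lt : (#|[pred j : 'I_n | ((t * s)%g (j, false)).2]| < m)%N.
  rewrite -ltnS; apply: leq_trans sm; rewrite ltnS; apply: proper_card.
  apply/fintype.properP; split.
    apply/fintype.subsetP => j; rewrite !inE permM; have [->|jk] := eqVneq j k; last by rewrite te.
    by rewrite tpermL sf sk.
  by exists k; rewrite !inE ?permM ?tpermL ?sf ?sk.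
have := IH _ lt; rewrite odd_permM odd_tperm xpair_eqE eqxx /= signrN.
congr (0 <= _); rewrite mulNr -mulrN; congr (_ * _).
rewrite (bigD1 k)//= [in RHS](bigD1 k)//= -mulNr; congr (_ * _).
  by rewrite !permM tpermL tpermR omega_anti opprK.
by apply: eq_bigr => j jk; rewrite !permM !te.
Qed.

(** On an orthogonal complex basis every term is nonnegative and the identity contributes a positive
    one. *)
Lemma wedge_sum_frame_neq0 : wedge_sum real_frame != 0.
Proof.
have [v [v0 vo]] := orthogonal_frame (leqnn n).
pose w (p : I) := (if p.2 then 'i%C else 1) *: v p.1.
pose a j := omega (v j) ('i%C *: v j).
have a0 j : 0 < a j by exact: omega_pos.
have uu u : omega u u = 0 by have := omega_anti u u => h; lra.
have wa p q : omega (w p) (w q) = if p.1 == q.1 then a p.1 * (q.2%:R - p.2%:R) else 0.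
  case: p q => [j b] [k c]; rewrite /w /=; case: (eqVneq j k) => [<-|jk].
    case: b c => [] []; rewrite ?scale1r ?omega_J ?uu ?subrr ?mulr0 ?subr0 ?sub0r ?mulr1 ?mulrN1//.
  have [h1 h2] := hprod0P (vo _ _ jk).
  by case: b c => [] []; rewrite ?scale1r ?omega_J ?omegaiC ?h1 ?h2 ?oppr0.
have ge0 := wedge_orthogonal (fun j => ltW (a0 j)) wa.
have : 0 < wedge_sum w.
  rewrite /wedge_sum (bigD1 1%g)//= ltr_pwDl//; last by apply: sumr_ge0 => s _; exact: ge0.
  rewrite odd_perm1 expr0 mul1r; apply: prodr_gt0 => j _.
  by rewrite !perm1 wa eqxx /= subr0 mulr1.
rewrite wedge_sum_expand => h; apply/eqP => h0; move: h.
by rewrite h0 mulr0 ltxx.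
Qed.

Lemma wedge_power_neq0 : wedge_power omega != 0.
Proof.
by rewrite mulf_neq0 ?invr_neq0 ?expf_neq0 ?pnatr_eq0//; exact: wedge_sum_frame_neq0.
Qed.

End wedge.

(** * The volume measure in a chart *)

Section cube_volume.
Context {R : realType}.
Local Notation cn := (@ComplexField.Normc.normc R).

Local Open Scope ereal_scope.

Lemma measurable_indic_cube n (z0 : Cn R n) r :
  measurable_fun setT (fun z : borel (Cn R n) => (\1_(cube z0 r) z)%:E : \bar R).
Proof.
have := measurable_cutoff (@closed_cube R n z0 r) (fun=> @ler01 R) (fun z _ => @cst_continuous _ _ _ z).
by under eq_fun do rewrite mul1r; exact.
Qed.

(** The sub-mean value inequality for the constant function 1. *)
Lemma integral_Cn_cube_gt0 n (z0 : Cn R n) (r : R) : (0 < r)%R ->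
  0 < integral_Cn (fun z => (\1_(cube z0 r) z)%:E).
Proof.
move=> r0; have := @mean_value_Cn R n (fun=> 1%R) z0 r r0 (fun z _ => differentiable_cst _ _).
rewrite -[X in cn X]/(1%:C)%R cn_real normr1 mulr1.
under eq_fun do rewrite mul1r.
by apply: lt_le_trans; rewrite lte_fin exprn_gt0// divr_gt0// exprn_gt0.
Qed.

Lemma integral_Cn_cube_fin n (z0 : Cn R n) (r : R) :
  integral_Cn (fun z => (\1_(cube z0 r) z)%:E) < +oo.
Proof.
elim: n z0 => [|n IH] z0; first exact: ltry.
have [a [z0' ->]] := consC_surj z0; rewrite integral_CnS.
set c := integral_Cn (fun z => (\1_(cube z0' r) z)%:E) in IH *.
have e p : integral_Cn (fun z => (\1_(cube (consC a z0') r) (consC p z))%:E) =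
    c * (\1_(csq (a.1 +i* a.2) r) (p.1 +i* p.2))%:E.
  rewrite (_ : (fun z => _) = (fun z => (\1_(csq (a.1 +i* a.2) r) (p.1 +i* p.2))%:E * (\1_(cube z0' r) z)%:E)).
    rewrite integral_CnZ 1?muleC ?indicE//; exact: measurable_indic_cube.
  apply/funext => z; rewrite -EFinM !indicE -natrM mulnb; congr (nat_of_bool _)%:R%:E.
  apply/idP/idP; rewrite ?inE.
    by move=> /cube_consC [h1 h2]; rewrite !mem_set.
  by move=> /andP [/set_mem h1 /set_mem h2]; apply/cube_consC.
have ce0 : 0 <= c by rewrite /c; apply: integral_Cn_ge0 => z; rewrite lee_fin indicE.
have cE : c = (fine c)%:E by rewrite fineK// ge0_fin_numE//; exact: IH.
have c0 : (0 <= fine c)%R by exact: fine_ge0.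
under eq_integral do rewrite e cE.
pose box : set (R * R) := `[(a.1 - r)%R, (a.1 + r)%R]%classic `*` `[(a.2 - r)%R, (a.2 + r)%R]%classic.
have mbox : measurable box by apply: measurableX; exact: measurable_itv.
have boxE p : (\1_(csq (a.1 +i* a.2) r) (p.1 +i* p.2) : R) = \1_box p.
  rewrite !indicE; congr (nat_of_bool _)%:R; apply/idP/idP; rewrite !inE /box /= !in_itv /= -!ler_distlC => -[h1 h2].
    by split; rewrite distrC.
  by split; rewrite distrC.
under eq_integral do rewrite boxE.
rewrite ge0_integralZl_EFin//; last first.
  by apply/measurable_EFinP; exact: measurable_indic.
have -> : (\int[lebesgue_measure \x lebesgue_measure]_x (\1_box x)%:E =
    lebesgue_measure `[(a.1 - r)%R, (a.1 + r)%R]%classic * lebesgue_measure `[(a.2 - r)%R, (a.2 + r)%R]%classic)%E.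
  rewrite integral_indic// setIT. apply: product_measure1E; exact: measurable_itv.
rewrite !lebesgue_measure_itv; case: ifP => _; case: ifP => _; rewrite ?mule0 ?mul0e ?mule0 ?ltry//.
Qed.

End cube_volume.

Section charts.
Context {R : realType} {n : nat} {X : ptopologicalType}.
Context {M : complex_atlas R n X}.
Variable a : chart_index M.
Local Notation dom := (chart_dom a).
Local Notation V := (chart a @` chart_dom a).

Lemma measurable_chart : measurable_fun (dom : set (borel X)) (chart a : borel X -> borel (Cn R n)).
Proof.
apply: (@measurability _ _ (borel X) (borel (Cn R n)) dom _ (@open (Cn R n))) => //.
move=> _ [W oW <-]; apply: borel_open.
rewrite openE => x [dx Wx]; apply: filterI.
  by apply: open_nbhs_nbhs; split => //; exact: chart_dom_open.
by apply: (chart_continuous dx); exact: open_nbhs_nbhs.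
Qed.

Definition chart_set (E : set (Cn R n)) : set X := dom `&` chart a @^-1` E.

Lemma measurable_chart_set (E : set (borel (Cn R n))) : measurable E ->
  measurable (chart_set E : set (borel X)).
Proof. by move=> mE; apply: measurable_chart => //; apply: borel_open; exact: chart_dom_open. Qed.

Lemma chart_set_image E : E `<=` V -> chart a @` chart_set E = E.
Proof.
move=> EV; apply/seteqP; split=> [_ [x [_ xE] <-]//|z Ez].
by have [x dx xz] := EV z Ez; exists x => //; split => //=; rewrite xz.
Qed.

(** Charts are homeomorphisms, so continuity on the manifold can be tested in coordinates. *)
Lemma continuous_in_chart (Y : topologicalType) (g : X -> Y) x : dom x ->
  {for chart a x, continuous (g \o chart_inv a)} -> {for x, continuous g}.
Proof.
move=> dx gc; have gx : (g \o chart_inv a) (chart a x) = g x by rewrite /= chartK.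
have h : (g \o chart_inv a \o chart a) @ x --> g x.
  by rewrite -gx; exact: (@continuous_comp _ _ _ (chart a) (g \o chart_inv a) x (chart_continuous dx) gc).
apply: cvg_trans h; apply: near_eq_cvg.
have : nbhs x dom by apply: open_nbhs_nbhs; split => //; exact: chart_dom_open.
by apply: filterS => y dy /=; rewrite chartK.
Qed.

Lemma open_chart_image (O : set X) : open O -> open (chart a @` (dom `&` O)).
Proof.
move=> oO; rewrite openE => _ [x [dx Ox] <-].
have Vx : V (chart a x) by exists x.
have nV : nbhs (chart a x) V by apply: open_nbhs_nbhs; split => //; exact: chart_im_open.
have nO : nbhs (chart a x) (chart_inv a @^-1` O).
  by apply: (chart_inv_continuous Vx); rewrite chartK//; exact: open_nbhs_nbhs.
apply: filterS2 nV nO => z [y dy <-] /=; rewrite chartK// => Oy; by exists y.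
Qed.

Section volume.
Variable Theta : hermitian_form M.

Lemma volume_density_neq0 z : V z -> volume_density Theta a z != 0.
Proof.
move=> Vz; rewrite mulf_neq0 ?invr_neq0 ?pnatr_eq0 -?lt0n ?fact_gt0//.
apply: wedge_power_neq0.
- exact: form_linear.
- exact: form_antisym.
- exact: form_J.
- exact: form_pos.
Qed.

Lemma continuous_form u v z : V z -> {for z, continuous (fun z => form_at Theta a z u v)}.
Proof. by move=> Vz; have [] := @form_smooth _ _ _ _ Theta a u v 0; move=> h _; exact: h. Qed.

Lemma continuous_bigop (F : Type) (op : R -> R -> R) (x0 : R) (s : seq F) (f : F -> Cn R n -> R) z :
  (forall g h : Cn R n -> R, {for z, continuous g} -> {for z, continuous h} ->
     {for z, continuous (fun z => op (g z) (h z))}) ->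
  (forall i, {for z, continuous (f i)}) ->
  {for z, continuous (fun z => \big[op/x0]_(i <- s) f i z)}.
Proof.
move=> opc fc; elim: s => [|i s IH].
  by rewrite (_ : (fun _ => _) = cst x0); [exact: cst_continuous|apply/funext => y; rewrite big_nil].
rewrite (_ : (fun _ => _) = (fun z => op (f i z) (\big[op/x0]_(i <- s) f i z))); first exact: opc.
by apply/funext => y; rewrite big_cons.
Qed.

Lemma continuous_volume_density z : V z -> {for z, continuous (volume_density Theta a)}.
Proof.
move=> Vz; have mulc (g h : Cn R n -> R) : {for z, continuous g} -> {for z, continuous h} ->
    {for z, continuous (fun z => g z * h z)}.
  by move=> gc hc; exact: (@cvgM _ _ (nbhs z) _ g h _ _ gc hc).
have cstc (c : R) : {for z, continuous (fun _ : Cn R n => c)} by exact: cst_continuous.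
rewrite /volume_density /wedge_power; apply: (mulc _ (fun=> _)) => //.
apply: (mulc (fun=> _)) => //; apply: continuous_bigop => [g h gc hc|s].
  exact: (@cvgD _ _ _ (nbhs z) _ g h _ _ gc hc).
apply: (mulc (fun=> _)) => //; apply: continuous_bigop => // j.
exact: continuous_form.
Qed.

Variable dV : {measure set (borel X) -> \bar R}.
Hypothesis dV_Theta : is_volume_measure Theta dV.

Lemma volume_chart_set (E : set (borel (Cn R n))) : measurable E -> E `<=` V ->
  dV (chart_set E) = integral_Cn (fun z => (volume_density Theta a z * \1_E z)%:E).
Proof.
move=> mE EV; rewrite (dV_Theta (a := a)); first by rewrite chart_set_image.
  exact: measurable_chart_set.
by move=> x [].
Qed.

Lemma cube_nbhs (z : Cn R n) (A : set (Cn R n)) : nbhs z A ->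
  exists2 r : R, 0 < r & cube z r `<=` A.
Proof.
move=> /nbhs_rnormP [e e0 eA]; exists (e / 4); first by rewrite divr_gt0.
move=> w wz; apply: eA; apply: (@le_lt_trans _ _ (e / 2)); last by lra.
apply: rnorm_le => [|j]; first by rewrite divr_ge0// ltW.
rewrite !mxE; apply: le_trans (cn_le _) _; rewrite ReB ImB.
by have [h1 h2] := wz j; lra.
Qed.

Lemma measurable_cube (z : Cn R n) r : measurable (cube z r : set (borel (Cn R n))).
Proof.
by rewrite -[cube _ _]setCK; apply: measurableC; apply: borel_open; apply: closed_openC; exact: closed_cube.
Qed.

Lemma nbhs_chart_im z : V z -> nbhs z V.
Proof. by move=> Vz; apply: open_nbhs_nbhs; split => //; exact: chart_im_open. Qed.

(** The density is continuous and does not vanish. Were it negative at [z], it would be bounded away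
    from 0 on a small cube, whose measure would then be negative. *)
Lemma volume_density_gt0 z : V z -> 0 < volume_density Theta a z.
Proof.
move=> Vz; rewrite lt0r volume_density_neq0//=; rewrite leNgt; apply/negP => neg.
set t := volume_density Theta a in neg *.
have nn : nbhs z [set w | t w < t z / 2].
  have tc : t @ z --> t z := continuous_volume_density Vz.
  have h := cvgr_lt (t z) tc; have tz2 : t z < t z / 2 by lra.
  exact: (h _ _ tz2).
have [r r0 rA] := cube_nbhs (filterI (nbhs_chart_im Vz) nn).
have QV : cube z r `<=` V by move=> w /rA [].
have : (0 <= dV (chart_set (cube z r)))%E by exact: measure_ge0.
rewrite volume_chart_set//; last exact: measurable_cube.
rewrite leNgt => /negP; apply.
have e : (fun w => (t w * \1_(cube z r) w)%:E) = (fun w => (- (`|t w| * \1_(cube z r) w)%:E)%E).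
  apply/funext => w; rewrite -EFinN -mulNr indicE; congr (_%:E).
  case: (boolP (_ \in _)) => [/set_mem /rA [_ /= h]|_]; last by rewrite !mulr0.
  by rewrite ltr0_norm ?opprK//; lra.
rewrite -/t e integral_CnN; last by move=> w; rewrite lee_fin mulr_ge0// indicE.
rewrite oppe_lt0.
have tz : 0 < - t z / 2 by lra.
apply: (@lt_le_trans _ _ ((- t z / 2)%:E * integral_Cn (fun w => (\1_(cube z r) w)%:E))%E).
  by rewrite mule_gt0 ?lte_fin//; exact: integral_Cn_cube_gt0.
rewrite -integral_CnZ; [|exact: ltW|exact: measurable_indic_cube|by move=> w; rewrite lee_fin indicE].
apply: le_integral_Cn.
- by apply: measurable_funeM; exact: measurable_indic_cube.
- apply: measurable_cutoff => //; first exact: closed_cube.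
  move=> w /QV Vw; exact: (@cvg_norm _ _ _ _ (nbhs_filter w) _ _ (continuous_volume_density Vw)).
- by move=> w; rewrite -EFinM lee_fin mulr_ge0 ?indicE// ltW.
- move=> w; rewrite -EFinM lee_fin indicE.
  case: (boolP (_ \in _)) => [/set_mem /rA [_ /= h]|_]; last by rewrite !mulr0.
  by rewrite !mulr1 ltr0_norm; lra.
Qed.

End volume.
End charts.

(** * Comparison of integrals by horizontal layers *)

Section layers.
Context {R : realType}.

(** The largest multiple of [d] below [y], up to [N] layers: for [y >= 0] within their range, a
    lower approximation with error [d]. Integrals of nonnegative functions are thereby compared
    through the measures of superlevel sets only. *)
Definition layers (N : nat) (d y : R) : R := \sum_(k < N) d * (k.+1%:R * d <= y)%R%:R.

Lemma layersS N d y : layers N.+1 d y = d * (d <= y)%R%:R + layers N d (y - d).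
Proof.
rewrite /layers big_ord_recl mul1r; congr (_ + _); apply: eq_bigr => k _.
rewrite /= /bump /= add1n; congr (d * (nat_of_bool _)%:R).
by rewrite -[in LHS](natr1 k.+1) mulrDl mul1r lerBrDr.
Qed.

Lemma layers_ge0 N d y : 0 <= d -> 0 <= layers N d y.
Proof. by move=> d0; apply: sumr_ge0 => k _; rewrite mulr_ge0. Qed.

Lemma layers_le N d y : 0 <= d -> layers N d y <= Num.max y 0.
Proof.
move=> d0; elim: N y => [|N IH] y; first by rewrite /layers big_ord0 le_max lexx orbT.
rewrite layersS; have := IH (y - d); have [dy|dy] := leP d y.
  by rewrite mulr1 => h; rewrite le_max; apply/orP; left; move: h; rewrite max_l; lra.
rewrite mulr0 add0r => h; rewrite le_max; apply/orP; right; move: h; rewrite max_r; lra.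
Qed.

Lemma le_layers N d y : 0 <= d -> y <= N%:R * d -> y <= d + layers N d y.
Proof.
move=> d0; elim: N y => [|N IH] y.
  by rewrite mul0r /layers big_ord0 addr0 => /le_trans; exact.
rewrite -natr1 mulrDl mul1r layersS => h; have [dy|dy] := leP d y.
  by rewrite mulr1; have := IH (y - d); lra.
by rewrite mulr0 add0r; have := layers_ge0 N (y - d) d0; lra.
Qed.

End layers.
Section compact_cube.
Context {R : realType}.
Local Notation C := R[i].

Lemma compact_csq (z0 : C) (r : R) : compact (csq z0 r).
Proof.
have -> : csq z0 r = (fun p : R * R => p.1 +i* p.2 : C) @`
    (`[complex.Re z0 - r, complex.Re z0 + r] `*` `[complex.Im z0 - r, complex.Im z0 + r]).
  apply/seteqP; split=> [[x y] [hx hy]|_ [[x y] [/= hx hy] <-]].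
    by exists (x, y) => //; split; rewrite /= in_itv /= -ler_distl.
  by split; rewrite /= ler_distl; move: hx hy; rewrite !in_itv.
apply: continuous_compact; last by apply: compact_setX; exact: segment_compact.
apply: continuous_subspaceT => p.
by apply: (@cvg_complex _ _ (nbhs p)); [exact: cvg_fst|exact: cvg_snd].
Qed.

Lemma compact_cube n (z0 : Cn R n) (r : R) : compact (cube z0 r).
Proof. by apply: (@rV_compact C n (fun j => csq (z0 0 j) r)) => j; exact: compact_csq. Qed.

Lemma bounded_on_cube n (g : Cn R n -> R) z0 r :
  (forall z, cube z0 r z -> {for z, continuous g}) ->
  exists B, forall z, cube z0 r z -> g z <= B.
Proof.
move=> gc; have : bounded_set (g @` cube z0 r).
  apply: compact_bounded; apply: continuous_compact; last exact: compact_cube.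
  by apply: continuous_in_subspaceT => z /set_mem /gc.
move=> [B [_ hB]]; exists (B + 1) => z zr.
have h : `|g z| <= B + 1 by apply: (hB (B + 1)); [rewrite ltrDl|exists z].
exact: le_trans (ler_norm _) h.
Qed.

End compact_cube.

Section chart_integral.
Context {R : realType} {n : nat} {X : ptopologicalType}.
Context {M : complex_atlas R n X}.
Variables (a : chart_index M) (Theta : hermitian_form M).
Variable dV : {measure set (borel X) -> \bar R}.
Hypothesis dV_Theta : is_volume_measure Theta dV.
Local Notation V := (chart a @` chart_dom a).

Lemma chart_cube_fin (z0 : Cn R n) (r : R) : cube z0 r `<=` V ->
  (dV (chart_set a (cube z0 r)) < +oo)%E.
Proof.
move=> QV; rewrite (volume_chart_set dV_Theta) //; last exact: measurable_cube.
have dc z : cube z0 r z -> {for z, continuous (volume_density Theta a)}.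
  by move=> /QV; exact: continuous_volume_density.
have [B hB] := bounded_on_cube dc.
apply: (@le_lt_trans _ _ (`|B|%:E * integral_Cn (fun w => (\1_(cube z0 r) w)%:E))%E); last first.
  rewrite lte_mul_pinfty ?lee_fin//; exact: integral_Cn_cube_fin.
rewrite -integral_CnZ; [|by []|exact: measurable_indic_cube|by move=> w; rewrite lee_fin indicE].
have e : (fun z => (volume_density Theta a z * \1_(cube z0 r) z)%:E) =
         (fun z => (`|volume_density Theta a z| * \1_(cube z0 r) z)%:E).
  apply/funext => z; rewrite indicE; case: (boolP (_ \in _)) => [/set_mem zr|_]; last by rewrite !mulr0.
  by rewrite gtr0_norm//; apply: (volume_density_gt0 dV_Theta); exact: QV.
rewrite e; apply: le_integral_Cn.
- apply: measurable_cutoff => //; first exact: closed_cube.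
  move=> w /dc wc; exact: (@cvg_norm _ _ _ _ (nbhs_filter w) _ _ wc).
- by apply: measurable_funeM; exact: measurable_indic_cube.
- by move=> w; rewrite lee_fin mulr_ge0 ?indicE.
- move=> w; rewrite -EFinM lee_fin indicE; case: (boolP (_ \in _)) => [/set_mem wr|_]; last by rewrite !mulr0.
  rewrite !mulr1 gtr0_norm; last by apply: (volume_density_gt0 dV_Theta); exact: QV.
  exact: le_trans (hB _ wr) (ler_norm _).
Qed.

(** The measure is known on sets only, through its density in the chart; slicing [g] into layers of
    height [d] transfers the comparison from superlevel sets to integrals, and [d] is arbitrary. *)
Lemma chart_integral_ge (c1 : R) (z0 : Cn R n) (r : R) (g : Cn R n -> R) (G : X -> R) :
  cube z0 r `<=` V -> 0 <= c1 ->
  (forall z, cube z0 r z -> c1 <= volume_density Theta a z) ->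
  (forall z, 0 <= g z) -> (forall z, cube z0 r z -> {for z, continuous g}) ->
  (forall x, 0 <= G x) -> measurable_fun setT (G : borel X -> R) ->
  (forall x, chart_set a (cube z0 r) x -> g (chart a x) <= G x) ->
  (c1%:E * integral_Cn (fun z => (g z * \1_(cube z0 r) z)%:E) <=
   \int[dV]_(x in chart_set a (cube z0 r)) (G x)%:E)%E.
Proof.
move=> QV c10 dc g0 gc G0 mG gG.
set Q := cube z0 r; have mQ : measurable (Q : set (borel (Cn R n))) by exact: measurable_cube.
set U : set (borel X) := chart_set a Q; have mU : measurable U by exact: measurable_chart_set.
pose vol := integral_Cn (fun z : Cn R n => (\1_Q z)%:E).
have vol0 : (0 <= vol)%E by apply: integral_Cn_ge0 => z; rewrite lee_fin indicE.
have volf : (vol < +oo)%E by exact: integral_Cn_cube_fin.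
have volE : vol = (fine vol)%:E by rewrite fineK// ge0_fin_numE.
have fvol0 : 0 <= fine vol by exact: fine_ge0.
have [B hB] := bounded_on_cube gc.
have mg : measurable_fun setT (fun z : borel (Cn R n) => (g z * \1_Q z)%:E).
  by apply: measurable_cutoff => //; exact: closed_cube.
have mg' : measurable_fun setT (fun z : borel (Cn R n) => g z * \1_Q z) by exact/measurable_EFinP.
apply/lee_addgt0Pr => e e0.
pose d := e / (c1 * fine vol + 1).
have cv0 : 0 <= c1 * fine vol by rewrite mulr_ge0.
have d0 : 0 < d by rewrite divr_gt0// ltr_wpDl.
pose N := (Num.trunc (B / d)).+1.
have BN : B <= N%:R * d.
  by rewrite -ler_pdivrMr// ltW// truncnS_gt.
pose E k : set (borel (Cn R n)) := [set z | k.+1%:R * d <= g z * \1_Q z].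
have mE k : measurable (E k).
  have := mg' measurableT `[k.+1%:R * d, +oo[%classic (measurable_itv _).
  by rewrite setTI; congr measurable; apply/seteqP; split=> z /=; rewrite in_itv /= andbT.
have EQ k : E k `<=` Q.
  move=> z; rewrite /E /= indicE; case: (boolP (_ \in _)) => [/set_mem //|_].
  by rewrite mulr0 leNgt mulr_gt0.
have m1 (A : set (borel (Cn R n))) : measurable A ->
    measurable_fun setT (fun z : borel (Cn R n) => (\1_A z)%:E : \bar R).
  by move=> mA; apply/measurable_EFinP; exact: measurable_indic.
(* One layer: the density is at least [c1] on the cube. *)
have layer k : (c1%:E * integral_Cn (fun z => (\1_(E k) z)%:E) <= dV (chart_set a (E k)))%E.
  have EV : E k `<=` V by move=> z /EQ /QV.
  rewrite (volume_chart_set dV_Theta)// -integral_CnZ//; [|exact: m1].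
  have dE : (fun z => (volume_density Theta a z * \1_(E k) z)%:E) =
      (fun z => (`|volume_density Theta a z| * \1_Q z)%:E * (\1_(E k) z)%:E)%E.
    apply/funext => z; rewrite -EFinM !indicE; case: (boolP (z \in E k)) => [/set_mem zE|_]; last by rewrite !mulr0.
    rewrite (mem_set (EQ _ _ zE)) !mulr1 gtr0_norm//.
    by apply: (volume_density_gt0 dV_Theta); exact: EV.
  rewrite dE; apply: le_integral_Cn.
  - by apply: measurable_funeM; exact: m1.
  - apply: emeasurable_funM; last exact: m1.
    apply: measurable_cutoff => //; first exact: closed_cube.
    move=> w /QV Vw; exact: (@cvg_norm _ _ _ _ (nbhs_filter w) _ _ (continuous_volume_density Vw)).
  - by move=> w; rewrite -EFinM lee_fin mulr_ge0 ?indicE.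
  - move=> w; rewrite -!EFinM lee_fin !indicE; case: (boolP (w \in E k)) => [/set_mem wE|_]; last by rewrite !mulr0.
    have wQ := EQ _ _ wE; rewrite mem_set// !mulr1.
    exact: le_trans (dc _ wQ) (ler_norm _).
have lay z : (\sum_(k < N) d%:E * (\1_(E k) z)%:E)%E = (layers N d (g z * \1_Q z))%:E.
  rewrite -sumEFin; apply: eq_bigr => k _; rewrite -EFinM indicE; congr (_ * (nat_of_bool _)%:R)%:E.
  by apply/idP/idP; rewrite inE.
have step1 : (integral_Cn (fun z => (g z * \1_Q z)%:E) <=
   d%:E * vol + \sum_(k < N) d%:E * integral_Cn (fun z => (\1_(E k) z)%:E))%E.
  rewrite -integral_CnZ; [|exact: ltW|exact: m1|by move=> w; rewrite lee_fin indicE].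
  under [X in (_ <= _ + X)%E]eq_bigr => k _ do
    (rewrite -integral_CnZ; [|exact: ltW|exact: m1|by move=> w; rewrite lee_fin indicE]).
  rewrite -integral_Cn_sum; first last.
  - by move=> k z; rewrite -EFinM lee_fin mulr_ge0 ?indicE// ltW.
  - by move=> k; apply: measurable_funeM; exact: m1.
  rewrite -integral_CnD; first last.
  - by move=> z; rewrite lay lee_fin layers_ge0// ltW.
  - by move=> z; rewrite -EFinM lee_fin mulr_ge0 ?indicE// ltW.
  - by apply: emeasurable_sum => k; apply: measurable_funeM; exact: m1.
  - by apply: measurable_funeM; exact: m1.
  apply: le_integral_Cn => //.
  - apply: emeasurable_funD; first by apply: measurable_funeM; exact: m1.
    by apply: emeasurable_sum => k; apply: measurable_funeM; exact: m1.
  - by move=> z; rewrite lee_fin mulr_ge0 ?indicE.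
  - move=> z; rewrite lay -EFinM -EFinD lee_fin indicE; case: (boolP (_ \in _)) => [/set_mem zQ|_].
      by rewrite !mulr1; apply: le_layers; [exact: ltW|apply: le_trans BN; exact: hB].
    by rewrite !mulr0 add0r layers_ge0// ltW.
have step2 : (\sum_(k < N) d%:E * dV (chart_set a (E k)) <= \int[dV]_(x in U) (G x)%:E)%E.
  have mEk k : measurable (chart_set a (E k) : set (borel X)) by exact: measurable_chart_set.
  have m2 k : measurable_fun U (fun x : borel X => (\1_(chart_set a (E k)) x)%:E : \bar R).
    by apply: measurable_funTS; apply/measurable_EFinP; exact: measurable_indic.
  have -> : (\sum_(k < N) d%:E * dV (chart_set a (E k)) =
     \int[dV]_(x in U) \sum_(k < N) d%:E * (\1_(chart_set a (E k)) x)%:E)%E.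
    rewrite ge0_integral_sum//; first last.
    - by move=> k x _; rewrite -EFinM lee_fin mulr_ge0 ?indicE// ltW.
    - by move=> k; apply: measurable_funeM.
    apply: eq_bigr => k _; rewrite ge0_integralZl_EFin//; last exact: ltW.
    rewrite integral_indic//; congr (_ * dV _)%E; apply/esym/setIidl => x [dx /EQ Ex].
    by split.
  apply: ge0_le_integral => //.
  - by move=> x _; apply: sume_ge0 => k _; rewrite -EFinM lee_fin mulr_ge0 ?indicE// ltW.
  - by apply: emeasurable_sum => k; apply: measurable_funeM.
  - by apply: measurable_funTS; exact/measurable_EFinP.
  - move=> x Ux; apply: (@le_trans _ _ (layers N d (g (chart a x) * \1_Q (chart a x)))%:E).
      rewrite -lay; apply: lee_sum => k _; rewrite lee_pmul2l ?lte_fin// lee_fin !indicE.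
      by case: (boolP (x \in _)) => [/set_mem [_ h]|//]; rewrite mem_set.
    have [dx Qx] := Ux; rewrite indicE mem_set// mulr1 lee_fin.
    apply: le_trans (layers_le _ _ (ltW d0)) _.
    by rewrite ge_max G0 andbT; exact: gG.
apply: (@le_trans _ _ (c1%:E * (d%:E * vol + \sum_(k < N) d%:E * integral_Cn (fun z => (\1_(E k) z)%:E)))%E).
  by apply: lee_wpmul2l => //; rewrite lee_fin.
rewrite ge0_muleDr; first last.
- by apply: sume_ge0 => k _; apply: mule_ge0; [by rewrite lee_fin ltW|apply: integral_Cn_ge0 => z; rewrite lee_fin indicE].
- by rewrite mule_ge0// lee_fin ltW.
rewrite addeC; apply: leeD; last first.
  rewrite volE -!EFinM lee_fin /d.
  set D := c1 * fine vol + 1.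
  have -> : c1 * (e / D * fine vol) = (e * (c1 * fine vol)) / D by move: (D^-1) => w; ring.
  rewrite ler_pdivrMr ?ltr_wpDl//.
  by rewrite /D mulrDr mulr1 lerDl ltW.
apply: le_trans step2; rewrite ge0_sume_distrr; last first.
  by move=> k _; apply: mule_ge0; [by rewrite lee_fin ltW|apply: integral_Cn_ge0 => z; rewrite lee_fin indicE].
apply: lee_sum => k _; rewrite muleCA; apply: lee_wpmul2l; first by rewrite lee_fin ltW.
exact: layer.
Qed.

End chart_integral.

(** * Fibres and sections in a trivialization *)

Section fibers.
Context {R : realType} {n : nat} {X : ptopologicalType} {M : complex_atlas R n X}.
Context {L : line_bundle M}.
Variable h : hermitian_metric L.
Local Notation C := R[i].
Local Notation cn := (@ComplexField.Normc.normc R).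
Local Notation hn := (herm_norm h).

Lemma hermDl x (u v w : fiber L x) : herm h (u + v) w = herm h u w + herm h v w.
Proof. by have := herm_linear h 1 u v w; rewrite scale1r mul1r. Qed.

Lemma herm0l x (w : fiber L x) : herm h 0 w = 0.
Proof.
by have := hermDl 0 0 w; rewrite addr0 => /eqP; rewrite -[X in X == _]addr0 (inj_eq (addrI _)) => /eqP <-.
Qed.

Lemma hermZl x c (u w : fiber L x) : herm h (c *: u) w = c * herm h u w.
Proof. by have := herm_linear h c u 0 w; rewrite addr0 herm0l addr0. Qed.

Lemma hermDr x (u v w : fiber L x) : herm h w (u + v) = herm h w u + herm h w v.
Proof. by rewrite herm_sym hermDl rmorphD /= -!herm_sym. Qed.

Lemma hermZr x c (u w : fiber L x) : herm h w (c *: u) = c^* * herm h w u.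
Proof. by rewrite herm_sym hermZl rmorphM /= -herm_sym. Qed.

Lemma herm0r x (w : fiber L x) : herm h w 0 = 0.
Proof. by rewrite herm_sym herm0l rmorph0. Qed.

Lemma herm_ge0 x (u : fiber L x) : 0 <= herm h u u.
Proof. by have [->|u0] := eqVneq u 0; [rewrite herm0l|rewrite ltW// herm_pos]. Qed.

Lemma herm_real x (u : fiber L x) : herm h u u = (complex.Re (herm h u u))%:C.
Proof.
by have := herm_ge0 u; rewrite lecE /= => /andP [/eqP im _]; case: (herm h u u) im => p q /= ->.
Qed.

Lemma Re_herm_ge0 x (u : fiber L x) : 0 <= complex.Re (herm h u u).
Proof. by have := herm_ge0 u; rewrite herm_real lecR. Qed.

Lemma hn_ge0 x (u : fiber L x) : 0 <= hn u. Proof. exact: sqrtr_ge0. Qed.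

Lemma hn_sqr x (u : fiber L x) : hn u ^+ 2 = complex.Re (herm h u u).
Proof. by rewrite /herm_norm sqr_sqrtr// Re_herm_ge0. Qed.

Lemma hn0 x : hn (0 : fiber L x) = 0. Proof. by rewrite /herm_norm herm0l sqrtr0. Qed.

Lemma hnZ x c (u : fiber L x) : hn (c *: u) = cn c * hn u.
Proof.
rewrite /herm_norm hermZl hermZr herm_real mulrA.
have -> : c * c^* = (cn c ^+ 2)%:C.
  rewrite cn_sqr; case: c => a b.
  by apply/eqP; rewrite eq_complex /=; apply/andP; split; apply/eqP; ring.
rewrite -[_%:C * _%:C]rmorphM /= sqrtrM ?sqr_ge0// sqrtr_sqr ger0_norm//; exact: cn_ge0.
Qed.

Lemma hnN x (u : fiber L x) : hn (- u) = hn u.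
Proof. by rewrite -scaleN1r hnZ cnN -[1]/(1%:C) cn_real normr1 mul1r. Qed.

Lemma hnD x (u v : fiber L x) : hn (u + v) <= hn u + hn v.
Proof.
have [k kx] := triv_dom_cover L x.
rewrite -(coordK kx u) -(coordK kx v) -scalerDl !hnZ -mulrDl.
by rewrite ler_wpM2r ?hn_ge0//; exact: cnD.
Qed.

Lemma hnB x (u v : fiber L x) : hn (u - v) = hn (v - u).
Proof. by rewrite -opprB hnN. Qed.

(** The squared length of the local frame, by which norms in the fibre and moduli of coordinates are
    compared. *)
Definition weight (k : triv_index L) (x : X) := complex.Re (herm h (local_frame k x) (local_frame k x)).

Lemma frame_neq0 k x : triv_dom k x -> local_frame k x != 0 :> fiber L x.
Proof.
move=> kx; apply/eqP => e; have := coord_frame kx; rewrite e linear0 => /eqP.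
by rewrite eq_sym oner_eq0.
Qed.

Lemma weight_gt0 k x : triv_dom k x -> 0 < weight k x.
Proof. by move=> /frame_neq0 /(herm_pos h); rewrite herm_real ltcR. Qed.

Lemma herm_coord k x (u v : fiber L x) : triv_dom k x ->
  herm h u v = fiber_coord k x u * (fiber_coord k x v)^* * (weight k x)%:C.
Proof.
by move=> kx; rewrite -{1}(coordK kx u) -{1}(coordK kx v) hermZl hermZr herm_real -mulrA.
Qed.

Lemma hn_coord k x (u : fiber L x) : triv_dom k x ->
  hn u ^+ 2 = cn (fiber_coord k x u) ^+ 2 * weight k x.
Proof. by move=> kx; rewrite -{1}(coordK kx u) hnZ exprMn hn_sqr. Qed.

Lemma continuous_weight k x : triv_dom k x -> {for x, continuous (weight k)}.
Proof.
move=> kx; have [a ax] := chart_dom_cover M x.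
apply: (continuous_in_chart ax).
have [hc _] := @herm_smooth _ _ _ _ _ h k a 0.
by apply: hc; exists x.
Qed.

Lemma continuous_coord_section (s : forall x, fiber L x) k x : holomorphic_section s -> triv_dom k x ->
  {for x, continuous (fun x => fiber_coord k x (s x))}.
Proof.
move=> hs kx; have [a ax] := chart_dom_cover M x.
apply: (continuous_in_chart ax); apply: differentiable_continuous.
by apply: (hs k a); exists x.
Qed.

Lemma continuous_herm (s t : forall x, fiber L x) : holomorphic_section s -> holomorphic_section t ->
  continuous (fun x => complex.Re (herm h (s x) (t x))) /\
  continuous (fun x => complex.Im (herm h (s x) (t x))).
Proof.
move=> hs ht.
have ReM (p q r s' w : R) : (p +i* q) * (r +i* s')^* * w%:C =
    ((p * r + q * s') * w) +i* ((q * r - p * s') * w).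
  by apply/eqP; rewrite eq_complex /=; apply/andP; split; apply/eqP; ring.
suff H x : {for x, continuous (fun x => complex.Re (herm h (s x) (t x)))} /\
  {for x, continuous (fun x => complex.Im (herm h (s x) (t x)))} by split=> x; have [] := H x.
have [k kx] := triv_dom_cover L x.
have sc := continuous_coord_section hs kx; have tc := continuous_coord_section ht kx.
have wc := continuous_weight kx.
have nk : nbhs x (triv_dom k) by apply: open_nbhs_nbhs; split => //; exact: triv_dom_open.
have p1 := @cvg_Re _ _ _ (nbhs_filter x) _ _ sc; have p2 := @cvg_Im _ _ _ (nbhs_filter x) _ _ sc.
have q1 := @cvg_Re _ _ _ (nbhs_filter x) _ _ tc; have q2 := @cvg_Im _ _ _ (nbhs_filter x) _ _ tc.
have e y : triv_dom k y -> herm h (s y) (t y) =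
    ((complex.Re (fiber_coord k y (s y)) * complex.Re (fiber_coord k y (t y)) +
      complex.Im (fiber_coord k y (s y)) * complex.Im (fiber_coord k y (t y))) * weight k y) +i*
    ((complex.Im (fiber_coord k y (s y)) * complex.Re (fiber_coord k y (t y)) -
      complex.Re (fiber_coord k y (s y)) * complex.Im (fiber_coord k y (t y))) * weight k y).
  move=> ky; rewrite (herm_coord _ _ ky); move: (fiber_coord k y (s y)) (fiber_coord k y (t y)) => [p q] [r s']; exact: ReM.
have near_e (f g : X -> R) : (forall y, triv_dom k y -> f y = g y) ->
    {for x, continuous g} -> {for x, continuous f}.
  move=> fg; rewrite /prop_for /continuous_at (fg _ kx); apply: cvg_trans.
  by apply: near_eq_cvg; apply: filterS nk => y /fg.
by split; apply: near_e => [y /e -> /=|]; [reflexivity| |reflexivity|];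
  apply: (@cvgM _ _ (nbhs x)) => //; [apply: (@cvgD _ _ _ (nbhs x))|apply: (@cvgB _ _ _ (nbhs x))];
  apply: (@cvgM _ _ (nbhs x)).
Qed.

End fibers.
Section holomorphic_combinations.
Context {R : realType} {n : nat} {X : ptopologicalType} {M : complex_atlas R n X}.
Context {L : line_bundle M}.
Local Notation C := R[i].
Implicit Types s t : forall x, fiber L x.

Lemma holomorphic_sectionD s t : holomorphic_section s -> holomorphic_section t ->
  holomorphic_section (fun x => s x + t x).
Proof.
move=> hs ht k a z kz.
rewrite (_ : _ \o _ = ((fun x => fiber_coord k x (s x)) \o chart_inv a) +
                      ((fun x => fiber_coord k x (t x)) \o chart_inv a)).
  by apply: differentiableD; [exact: hs|exact: ht].
by apply/funext => y /=; rewrite linearD.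
Qed.

Lemma holomorphic_sectionZ c s : holomorphic_section s -> holomorphic_section (fun x => c *: s x).
Proof.
move=> hs k a z kz.
rewrite (_ : _ \o _ = c *: ((fun x => fiber_coord k x (s x)) \o chart_inv a)).
  by apply: differentiableZ; exact: hs.
by apply/funext => y /=; rewrite linearZ.
Qed.

Lemma holomorphic_sectionB s t : holomorphic_section s -> holomorphic_section t ->
  holomorphic_section (fun x => s x - t x).
Proof.
move=> hs ht; rewrite (_ : (fun x => _) = (fun x => s x + (-1) *: t x)).
  by apply: holomorphic_sectionD => //; exact: holomorphic_sectionZ.
by apply: functional_extensionality_dep => x; rewrite scaleN1r.
Qed.

Lemma holomorphic_section_sum (I : Type) (r : seq I) (P : pred I) (c : I -> C)
    (S : I -> forall x, fiber L x) :
  (forall i, P i -> holomorphic_section (S i)) ->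
  holomorphic_section (fun x => \sum_(i <- r | P i) c i *: S i x).
Proof.
move=> hS; elim: r => [|i r IH].
  rewrite (_ : (fun x => _) = (fun x => 0)); first exact: holomorphic_section0.
  by apply: functional_extensionality_dep => x; rewrite big_nil.
have [Pi|Pi] := boolP (P i); last first.
  rewrite (_ : (fun x => _) = (fun x => \sum_(i <- r | P i) c i *: S i x)) //.
  by apply: functional_extensionality_dep => x; rewrite big_cons (negbTE Pi).
rewrite (_ : (fun x => _) = (fun x => c i *: S i x + \sum_(i <- r | P i) c i *: S i x)).
  by apply: holomorphic_sectionD => //; apply: holomorphic_sectionZ; exact: hS.
by apply: functional_extensionality_dep => x; rewrite big_cons Pi.
Qed.

End holomorphic_combinations.

Lemma continuous_measurable (R : realType) (X : ptopologicalType) (f : X -> R) :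
  continuous f -> measurable_fun setT (f : borel X -> R).
Proof.
move=> fc; apply: (@measurability _ _ (borel X) R setT _ _ (RGenOInfty.measurableE R)).
move=> _ [_ [c ->] <-]; rewrite setTI; apply: borel_open.
rewrite (_ : _ @^-1` _ = f @^-1` [set y | c < y]); last first.
  by apply/seteqP; split=> x; rewrite /= in_itv /= andbT.
by apply: open_comp => // ; exact: open_gt.
Qed.

(** * The local Bergman inequality *)

Section patches.
Context {R : realType} {n : nat} {X : ptopologicalType} {M : complex_atlas R n X}.
Context {L : line_bundle M}.
Variables (h : hermitian_metric L) (Theta : hermitian_form M).
Variable dV : {measure set (borel X) -> \bar R}.
Hypothesis dV_Theta : is_volume_measure Theta dV.
Local Notation C := R[i].
Local Notation cn := (@ComplexField.Normc.normc R).
Local Notation hn := (herm_norm h).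
Implicit Types s t : forall x, fiber L x.

Lemma continuous_hn2 s : holomorphic_section s -> continuous (fun x => hn (s x) ^+ 2).
Proof.
by move=> hs; under eq_fun do rewrite hn_sqr; have [] := continuous_herm h hs hs.
Qed.

Lemma measurable_hn2 s : holomorphic_section s ->
  measurable_fun setT (fun x : borel X => hn (s x) ^+ 2).
Proof. by move=> /continuous_hn2 /continuous_measurable. Qed.

Lemma cube_sub (z0 z : Cn R n) (r t : R) : cube z0 r z -> cube z t `<=` cube z0 (r + t).
Proof.
move=> zr w wt j; have [h1 h2] := zr j; have [h3 h4] := wt j; split.
  have -> : complex.Re (w 0 j) - complex.Re (z0 0 j) =
    (complex.Re (z 0 j) - complex.Re (z0 0 j)) + (complex.Re (w 0 j) - complex.Re (z 0 j)) by ring.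
  by apply: le_trans (ler_normD _ _) _; exact: lerD.
have -> : complex.Im (w 0 j) - complex.Im (z0 0 j) =
  (complex.Im (z 0 j) - complex.Im (z0 0 j)) + (complex.Im (w 0 j) - complex.Im (z 0 j)) by ring.
by apply: le_trans (ler_normD _ _) _; exact: lerD.
Qed.

Lemma cube_mono (z0 : Cn R n) (r t : R) : r <= t -> cube z0 r `<=` cube z0 t.
Proof. by move=> rt z zr j; have [h1 h2] := zr j; split; exact: le_trans rt. Qed.

Lemma nbhs_cube (z0 : Cn R n) (r : R) : 0 < r -> nbhs z0 (cube z0 r).
Proof.
move=> r0; apply/nbhs_rnormP; exists r => // w wr j; have := coord_le_rnorm (w - z0) j.
rewrite !mxE => hj; have := Re_le_cn (w 0 j - z0 0 j); have := Im_le_cn (w 0 j - z0 0 j).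
by rewrite ReB ImB => h1 h2; split; [exact: le_trans h2 (le_trans hj (ltW wr))|exact: le_trans h1 (le_trans hj (ltW wr))].
Qed.

Lemma open_chart_set (a : chart_index M) (O : set (Cn R n)) : open O -> open (chart_set a O).
Proof.
move=> oO; rewrite openE => x [dx Ox]; apply: filterI.
  by apply: open_nbhs_nbhs; split => //; exact: chart_dom_open.
by apply: (chart_continuous dx); exact: open_nbhs_nbhs.
Qed.

(** In a trivialization [s] is a holomorphic function [f] and [|s|^2] is comparable to [|f|^2 =
    |f^2|] up to the weight. Apply the sub-mean value inequality to [f^2] on the cube of half-side
    [r] around the point. *)
Lemma local_bergman (a : chart_index M) (k : triv_index L) (z0 : Cn R n) (q r c1 w0 : R) :
  0 < r -> 0 < c1 -> 0 < w0 ->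
  (forall z, cube z0 q z -> (chart a @` (chart_dom a `&` triv_dom k)) z /\
     [/\ c1 <= volume_density Theta a z, w0 <= weight h k (chart_inv a z) &
         weight h k (chart_inv a z) <= 4 * w0]) ->
  forall s, holomorphic_section s -> forall x, chart_dom a x ->
    cube (chart a x) r `<=` cube z0 q ->
  ((hn (s x) ^+ 2)%:E <= (4 / (c1 * (r ^+ 2 / 8) ^+ n))%:E *
     \int[dV]_(y in chart_set a (cube z0 q)) (hn (s y) ^+ 2)%:E)%E.
Proof.
move=> r0 c10 w00 hQ s hs x dx xQ.
set z := chart a x; have rz : cube z r z by move=> j; split; rewrite subrr normr0 ltW.
pose f := (fun x => fiber_coord k x (s x)) \o chart_inv a.
have fd z' : cube z0 q z' -> differentiable f z' by move=> /hQ [h1 _]; exact: (hs k a).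
have f2d z' : cube z r z' -> differentiable (fun z => f z * f z) z'.
  by move=> /xQ /fd hd; exact: differentiableM.
have mv := mean_value_Cn r0 f2d.
have QV : cube z0 q `<=` chart a @` chart_dom a by move=> z' /hQ [[y [dy _] <-] _]; exists y.
have cube_triv y : chart_set a (cube z0 q) y -> triv_dom k y.
  by move=> [dy /hQ [[y' [dy' ky'] e] _]]; rewrite -(chartK dy) -e chartK.
have cf z' : cube z0 q z' -> {for z', continuous (fun z => w0 * cn (f z * f z))}.
  move=> /fd /differentiable_continuous fc.
  have := @continuous_cn _ _ _ _ (@cvgM _ _ (nbhs z') (nbhs_filter z') _ _ _ _ fc fc) => cc.
  exact: (@cvgM _ _ (nbhs z') _ (fun=> w0) (fun z => cn (f z * f z)) _ _ (cvg_cst _) cc).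
have CI := @chart_integral_ge _ _ _ _ a Theta dV dV_Theta c1 z0 q (fun z => w0 * cn (f z * f z))
  (fun x => hn (s x) ^+ 2) QV (ltW c10) (fun z' hz' => let: conj _ (And3 h1 _ _) := hQ _ hz' in h1).
have {}CI := CI (fun z => mulr_ge0 (ltW w00) (cn_ge0 _)) cf (fun x => sqr_ge0 _) (measurable_hn2 hs).
have Qx : chart_set a (cube z0 q) x by split => //; exact: xQ.
have hnx y : chart_set a (cube z0 q) y -> hn (s y) ^+ 2 = cn (f (chart a y) * f (chart a y)) * weight h k y.
  by move=> Qy; rewrite (hn_coord _ _ (cube_triv _ Qy)) /f /= chartK ?cnM ?expr2//; case: Qy.
have {}CI : (c1%:E * integral_Cn (fun z1 : Cn R n => (w0 * cn (f z1 * f z1) * \1_(cube z0 q) z1)%:E) <=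
   \int[dV]_(y in chart_set a (cube z0 q)) (hn (s y) ^+ 2)%:E)%E.
  apply: CI => y Qy; rewrite (hnx _ Qy) mulrC ler_wpM2l ?cn_ge0//.
  by have [dy /hQ [_ [_ h1 _]]] := Qy; rewrite chartK in h1.
have up : hn (s x) ^+ 2 <= 4 * (w0 * cn (f z * f z)).
  rewrite (hnx _ Qx) mulrA [X in X <= _]mulrC ler_wpM2r ?cn_ge0//.
  by have [dy /hQ [_ [_ _ h1]]] := Qx; rewrite chartK in h1.
set v := (r ^+ 2 / 8) ^+ n in mv *; have v0 : 0 < v by rewrite exprn_gt0// divr_gt0// exprn_gt0.
apply: (@le_trans _ _ ((4 / (c1 * v))%:E * (c1 * (w0 * (v * cn (f z * f z))))%:E)%E).
  rewrite -EFinM lee_fin; apply: le_trans up _; rewrite le_eqVlt; apply/orP; left; apply/eqP.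
  by field; rewrite !gt_eqF.
apply: lee_wpmul2l; first by rewrite lee_fin divr_ge0// mulr_ge0// ltW.
apply: le_trans CI; rewrite EFinM; apply: lee_wpmul2l; first by rewrite lee_fin ltW.
have cf' z' : cube z0 q z' -> {for z', continuous (fun z => cn (f z * f z))}.
  move=> /fd /differentiable_continuous fc.
  exact: (@continuous_cn _ _ _ _ (@cvgM _ _ (nbhs z') (nbhs_filter z') _ _ _ _ fc fc)).
have m1 A B : cube A B `<=` cube z0 q ->
    measurable_fun setT (fun z : borel (Cn R n) => (cn (f z * f z) * \1_(cube A B) z)%:E).
  move=> AB; apply: measurable_cutoff; [exact: closed_cube|by move=> y; exact: cn_ge0|].
  by move=> y /AB; exact: cf'.
under eq_fun do rewrite -mulrA EFinM.
rewrite integral_CnZ; [|exact: ltW|exact: m1|by move=> y; rewrite lee_fin mulr_ge0 ?cn_ge0 ?indicE].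
rewrite EFinM; apply: lee_wpmul2l; first by rewrite lee_fin ltW.
apply: le_trans mv _; apply: le_integral_Cn; [exact: m1|exact: m1| |].
  by move=> y; rewrite lee_fin mulr_ge0 ?cn_ge0 ?indicE.
move=> y; rewrite lee_fin ler_wpM2l ?cn_ge0// !indicE ler_nat.
by case: (boolP (y \in cube z r)) => // /set_mem /xQ yq; rewrite mem_set.
Qed.

(** Three concentric cubes in one chart and one trivialization: evaluation in the inner one [W] is
    controlled by the integral over the middle one [U], and evaluation in [U] by the integral over
    the outer one, hence by the L2 norm. The density and the weight vary by bounded factors on the
    outer cube, by continuity at [x0]. *)
Lemma patch_exists x0 : exists (W U K : set X) (c : R),
  [/\ [/\ open W, W x0, compact K & W `<=` K],
      measurable (U : set (borel X)) /\ (dV U < +oo)%E, 0 <= c,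
      forall s, holomorphic_section s -> forall x, W x ->
        ((hn (s x) ^+ 2)%:E <= c%:E * \int[dV]_(y in U) (hn (s y) ^+ 2)%:E)%E &
      forall s, holomorphic_section s -> forall x, U x ->
        ((hn (s x) ^+ 2)%:E <= c%:E * L2_norm2 h dV s)%E].
Proof.
have [a ax] := chart_dom_cover M x0; have [k kx] := triv_dom_cover L x0.
set z0 := chart a x0; have Vz : (chart a @` chart_dom a) z0 by exists x0.
have x0E : chart_inv a z0 = x0 by rewrite /z0 chartK.
have d0 := volume_density_gt0 dV_Theta Vz.
have w0 := weight_gt0 h kx.
have dc : volume_density Theta a @ z0 --> volume_density Theta a z0 by exact: continuous_volume_density.
have wc : (weight h k \o chart_inv a) @ z0 --> weight h k x0.
  have ic := chart_inv_continuous Vz.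
  have := @continuous_comp _ _ _ (chart_inv a) (weight h k) z0 ic; rewrite /prop_for x0E => hcomp.
  have := hcomp (@continuous_weight _ _ _ _ _ h _ _ kx); rewrite /continuous_at /= x0E; exact.
have n1 : nbhs z0 (chart a @` (chart_dom a `&` triv_dom k)).
  apply: open_nbhs_nbhs; split; last by exists x0.
  by apply: open_chart_image; exact: triv_dom_open.
have n2 : \forall z \near z0, volume_density Theta a z0 / 2 < volume_density Theta a z.
  by apply: (cvgr_gt _ dc); lra.
have n3 : \forall z \near z0, weight h k x0 / 2 < weight h k (chart_inv a z).
  by apply: (cvgr_gt _ wc); lra.
have n4 : \forall z \near z0, weight h k (chart_inv a z) < 2 * weight h k x0.
  by apply: (cvgr_lt _ wc); lra.
have [q q0 hq] := cube_nbhs (filterI n1 (filterI n2 (filterI n3 n4))).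
have hQ z : cube z0 q z -> (chart a @` (chart_dom a `&` triv_dom k)) z /\
     [/\ volume_density Theta a z0 / 2 <= volume_density Theta a z,
      weight h k x0 / 2 <= weight h k (chart_inv a z) &
         weight h k (chart_inv a z) <= 4 * (weight h k x0 / 2)].
  by move=> /hq [h1 [/= h2 [h3 h4]]]; split => //; split; lra.
pose r := q / 3; have r0 : 0 < r by rewrite divr_gt0.
have r2q : r + r <= q by rewrite /r; lra.
have r3q : r + r + r <= q by rewrite /r; lra.
have hQ2 z : cube z0 (r + r) z -> _ := fun hz => hQ z (cube_mono r2q hz).
have dd0 : 0 < volume_density Theta a z0 / 2 by lra.
have ww0 : 0 < weight h k x0 / 2 by lra.
have B1 := local_bergman r0 dd0 ww0 hQ2; have B2 := local_bergman r0 dd0 ww0 hQ.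
set c := 4 / _ in B1 B2.
have c0 : 0 <= c by rewrite /c ltW// divr_gt0// mulr_gt0// exprn_gt0// divr_gt0// exprn_gt0.
have mU (t : R) : measurable (chart_set a (cube z0 t) : set (borel X)).
  by apply: measurable_chart_set; exact: measurable_cube.
exists (chart_set a (cube z0 r)°), (chart_set a (cube z0 (r + r))), (chart_inv a @` cube z0 r), c.
split => //.
- split.
  + by apply: open_chart_set; exact: open_interior.
  + by split => //; exact: nbhs_cube.
  + apply: continuous_compact; last exact: compact_cube.
    apply: continuous_in_subspaceT => z /set_mem zr; apply: chart_inv_continuous.
    have /hQ [[y [dy _] <-] _] : cube z0 q z by apply: cube_mono zr; rewrite /r; lra.
    by exists y.
  + by move=> x [dx /interior_subset xr]; exists (chart a x) => //; rewrite chartK.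
- split; first exact: mU.
  by apply: (chart_cube_fin dV_Theta) => z /hQ2 [[y [dy _] <-] _]; exists y.
- move=> s hs x [dx /interior_subset xr]; apply: B1 => //; exact: cube_sub.
- move=> s hs x [dx xr]; apply: le_trans (B2 s hs x dx _) _.
    by apply: subset_trans (cube_sub xr) _; exact: cube_mono.
  apply: lee_wpmul2l => //; rewrite /L2_norm2; apply: ge0_subset_integral => //.
  - by apply/measurable_EFinP; exact: measurable_hn2.
  - by move=> y _; rewrite lee_fin sqr_ge0.
Qed.

End patches.

(** * Evaluation functionals and orthonormal bases *)

Section cauchy_schwarz.
Context {R : realType}.
Local Notation cn := (@ComplexField.Normc.normc R).

Lemma sum_CS (I : Type) (r : seq I) (P : pred I) (a b : I -> R) :
  (\sum_(i <- r | P i) a i * b i) ^+ 2 <=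
  (\sum_(i <- r | P i) a i ^+ 2) * \sum_(i <- r | P i) b i ^+ 2.
Proof.
elim: r => [|i r IH]; first by rewrite !big_nil expr0n mulr0.
rewrite !big_cons; case: ifP => // _.
set A := \sum_(i <- r | P i) a i ^+ 2 in IH *; set B := \sum_(i <- r | P i) b i ^+ 2 in IH *.
set x := \sum_(i <- r | P i) a i * b i in IH *.
have A0 : 0 <= A by apply: sumr_ge0 => j _; exact: sqr_ge0.
have B0 : 0 <= B by apply: sumr_ge0 => j _; exact: sqr_ge0.
move: (a i) (b i) => u v; clearbody A B x.
have z0 : 0 <= u ^+ 2 * B + v ^+ 2 * A by rewrite addr_ge0// mulr_ge0// sqr_ge0.
suff : 2 * u * v * x <= u ^+ 2 * B + v ^+ 2 * A by lra.
apply: le_trans (ler_norm _) _.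
rewrite -ler_sqr ?nnegrE// -normrX ger0_norm ?sqr_ge0//.
have : 0 <= (u ^+ 2 * B - v ^+ 2 * A) ^+ 2 by exact: sqr_ge0.
have : (u * v) ^+ 2 * x ^+ 2 <= (u * v) ^+ 2 * (A * B) by apply: ler_wpM2l => //; exact: sqr_ge0.
nra.
Qed.

Lemma cn_sum_CS (I : Type) (r : seq I) (P : pred I) (a b : I -> R[i]) :
  cn (\sum_(i <- r | P i) a i * b i) ^+ 2 <=
  (\sum_(i <- r | P i) cn (a i) ^+ 2) * \sum_(i <- r | P i) cn (b i) ^+ 2.
Proof.
apply: le_trans (sum_CS _ _ _ _); under [X in _ <= X ^+ 2]eq_bigr do rewrite -cnM.
rewrite ler_sqr ?nnegrE ?cn_ge0//; last by apply: sumr_ge0 => i _; exact: cn_ge0.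
exact: cn_sum.
Qed.

End cauchy_schwarz.

Section kernels.
Context {R : realType} {n : nat} {X : ptopologicalType} {M : complex_atlas R n X}.
Context {L : line_bundle M}.
Variables (h : hermitian_metric L) (Theta : hermitian_form M).
Variable dV : {measure set (borel X) -> \bar R}.
Hypothesis dV_Theta : is_volume_measure Theta dV.
Local Notation C := R[i].
Local Notation cn := (@ComplexField.Normc.normc R).
Local Notation hn := (herm_norm h).
Local Notation N2 := (L2_norm2 h dV).
Local Notation L2 := (L2_section h dV).
Implicit Types s t : forall x, fiber L x.

Lemma measurable_hn2E s : holomorphic_section s ->
  measurable_fun setT (fun x : borel X => (hn (s x) ^+ 2)%:E).
Proof. by move=> hs; apply/measurable_EFinP; exact: measurable_hn2. Qed.

Lemma L2_norm2_ge0 s : (0 <= N2 s)%E.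
Proof. by apply: integral_ge0 => x _; rewrite lee_fin sqr_ge0. Qed.

Lemma L2_norm2_fin s : L2 s -> N2 s = (fine (N2 s))%:E.
Proof. by move=> [_ sf]; rewrite fineK// ge0_fin_numE// L2_norm2_ge0. Qed.

(** Weighted form of [(a+b)^2 <= 2a^2 + 2b^2], with constants as close to 1 as needed on [a]; it
    replaces the triangle inequality for the L2 norm. *)
Lemma sqr_youngD (a b d : R) : 0 < d -> (a + b) ^+ 2 <= (1 + d) * a ^+ 2 + (1 + d^-1) * b ^+ 2.
Proof.
move=> d0; rewrite -subr_ge0.
have -> : (1 + d) * a ^+ 2 + (1 + d^-1) * b ^+ 2 - (a + b) ^+ 2 = d^-1 * (d * a - b) ^+ 2.
  by field; rewrite gt_eqF.
by rewrite mulr_ge0 ?sqr_ge0// invr_ge0 ltW.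
Qed.

Lemma L2_norm2_youngD s t (d : R) : 0 < d -> holomorphic_section s -> holomorphic_section t ->
  (N2 (fun x => (s x + t x)%R) <= (1 + d)%:E * N2 s + (1 + d^-1)%:E * N2 t)%E.
Proof.
move=> d0 hs ht; rewrite /L2_norm2.
have d1 : 0 <= 1 + d by rewrite addr_ge0// ltW.
have d2 : 0 <= 1 + d^-1 by rewrite addr_ge0// invr_ge0 ltW.
have p0 s' : forall x, [set: borel X] x -> (0 <= (hn (s' x) ^+ 2)%:E)%E.
  by move=> x _; rewrite lee_fin sqr_ge0.
rewrite -!ge0_integralZl_EFin//; try exact: measurable_hn2E.
rewrite -ge0_integralD//.
- apply: ge0_le_integral => //.
  + by move=> x _; rewrite lee_fin sqr_ge0.
  + exact: (measurable_hn2E (holomorphic_sectionD hs ht)).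
  + by apply: emeasurable_funD; apply: measurable_funeM; exact: measurable_hn2E.
  + move=> x _; rewrite -!EFinM -EFinD lee_fin; apply: le_trans (sqr_youngD _ _ d0).
    by rewrite ler_sqr ?nnegrE ?addr_ge0 ?hn_ge0//; exact: hnD.
- by move=> x _; rewrite -EFinM lee_fin mulr_ge0// sqr_ge0.
- by apply: measurable_funeM; exact: measurable_hn2E.
- by move=> x _; rewrite -EFinM lee_fin mulr_ge0// sqr_ge0.
- by apply: measurable_funeM; exact: measurable_hn2E.
- by move=> x _; rewrite lee_fin sqr_ge0.
- by move=> x _; rewrite lee_fin sqr_ge0.
Qed.

Lemma L2_norm2Z c s : holomorphic_section s -> N2 (fun x => c *: s x) = ((cn c ^+ 2)%:E * N2 s)%E.
Proof.
move=> hs; rewrite /L2_norm2 -ge0_integralZl_EFin ?sqr_ge0//.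
- by apply: eq_integral => x _; rewrite hnZ exprMn EFinM.
- by move=> x _; rewrite lee_fin sqr_ge0.
- exact: measurable_hn2E.
Qed.

Lemma L2_sectionD s t : L2 s -> L2 t -> L2 (fun x => s x + t x).
Proof.
move=> [hs fs] [ht ft]; split; first exact: holomorphic_sectionD.
apply: le_lt_trans (L2_norm2_youngD ltr01 hs ht) _.
by rewrite lte_add_pinfty// lte_mul_pinfty// lee_fin invr1.
Qed.

Lemma L2_sectionZ c s : L2 s -> L2 (fun x => c *: s x).
Proof.
move=> [hs fs]; split; first exact: holomorphic_sectionZ.
by rewrite L2_norm2Z// lte_mul_pinfty// lee_fin sqr_ge0.
Qed.

Lemma L2_section0 : L2 (fun x => 0).
Proof.
split; first exact: holomorphic_section0.
by rewrite /L2_norm2; under eq_integral do rewrite hn0 expr0n /=; rewrite integral0 ltry.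
Qed.

Lemma L2_partial_sum d c (S : nat -> forall x, fiber L x) m :
  (forall j, index_lt d j -> L2 (S j)) -> L2 (partial_sum d c S m).
Proof.
move=> hS; rewrite /partial_sum; elim: m => [|m IH].
  rewrite (_ : (fun x => _) = (fun x => 0)); first exact: L2_section0.
  by apply: functional_extensionality_dep => x; rewrite big_ord0.
have [dm|dm] := boolP (index_lt d m); last first.
  rewrite (_ : (fun x => _) = (fun x => \sum_(j < m | index_lt d j) c j *: S j x)) //.
  by apply: functional_extensionality_dep => x; rewrite big_mkcond big_ord_recr /= (negbTE dm) addr0 -big_mkcond.
rewrite (_ : (fun x => _) = (fun x => \sum_(j < m | index_lt d j) c j *: S j x + c m *: S m x)).
  by apply: L2_sectionD => //; apply: L2_sectionZ; exact: hS.
by apply: functional_extensionality_dep => x; rewrite big_mkcond big_ord_recr /= dm -big_mkcond.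
Qed.

Lemma Re_herm_le s t x : `|complex.Re (herm h (s x) (t x))| <= hn (s x) ^+ 2 + hn (t x) ^+ 2 /\
  `|complex.Im (herm h (s x) (t x))| <= hn (s x) ^+ 2 + hn (t x) ^+ 2.
Proof.
have [k kx] := triv_dom_cover L x.
have e : cn (herm h (s x) (t x)) = hn (s x) * hn (t x).
  rewrite -(coordK kx (s x)) -(coordK kx (t x)) hermZl hermZr herm_real !cnM cn_real !hnZ.
  have -> (z : C) : cn z^* = cn z by case: z => a b; rewrite !cnE /= sqrrN.
  by rewrite -hn_sqr ger0_norm ?sqr_ge0//; ring.
have b : hn (s x) * hn (t x) <= hn (s x) ^+ 2 + hn (t x) ^+ 2.
  by have := hn_ge0 h (s x); have := hn_ge0 h (t x); nra.
by split; apply: le_trans b; rewrite -e; [exact: Re_le_cn|exact: Im_le_cn].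
Qed.

Lemma integrable_herm s t : L2 s -> L2 t ->
  dV.-integrable setT (fun x => (complex.Re (herm h (s x) (t x)))%:E) /\
  dV.-integrable setT (fun x => (complex.Im (herm h (s x) (t x)))%:E).
Proof.
move=> [hs fs] [ht ft]; have [c1 c2] := continuous_herm h hs ht.
have dom : dV.-integrable setT (fun x : borel X => (hn (s x) ^+ 2 + hn (t x) ^+ 2)%:E).
  rewrite (_ : (fun x => _) = ((fun x => (hn (s x) ^+ 2)%:E) \+ (fun x => (hn (t x) ^+ 2)%:E))%E); last first.
    by apply/funext => x; rewrite EFinD.
  apply: integrableD => //; apply/integrableP; split; try exact: measurable_hn2E.
    by under eq_integral do rewrite gee0_abs ?lee_fin ?sqr_ge0//.
  by under eq_integral do rewrite gee0_abs ?lee_fin ?sqr_ge0//.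
by split; apply: le_integrable dom => //; try (by apply/measurable_EFinP; exact: continuous_measurable);
  move=> x _; rewrite !abse_EFin lee_fin [leRHS]ger0_norm ?addr_ge0 ?sqr_ge0//; have [] := Re_herm_le s t x.
Qed.

Lemma L2_norm2D_orth s t : L2 s -> L2 t -> L2_inner h dV s t = 0 ->
  N2 (fun x => s x + t x) = (N2 s + N2 t)%E.
Proof.
move=> Ls Lt /eqP; rewrite eq_complex /= => /andP [/eqP Re0 _].
have [iRe _] := integrable_herm Ls Lt.
have Lst := L2_sectionD Ls Lt; have [hs fs] := Ls; have [ht ft] := Lt.
have e x : hn (s x + t x) ^+ 2 = hn (s x) ^+ 2 + hn (t x) ^+ 2 + 2 * complex.Re (herm h (s x) (t x)).
  rewrite !hn_sqr hermDl !hermDr !ReD (herm_sym h (s x) (t x)).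
  by case: (herm h (s x) (t x)) => a b /=; ring.
have is2 u : L2 u -> dV.-integrable setT (fun x => (hn (u x) ^+ 2)%:E).
  move=> [hu fu]; apply/integrableP; split; first exact: measurable_hn2E.
  by under eq_integral do rewrite gee0_abs ?lee_fin ?sqr_ge0//.
rewrite /L2_norm2.
have -> : (\int[dV]_x (hn (s x + t x) ^+ 2)%:E = \int[dV]_x
   (((hn (s x) ^+ 2)%:E + (hn (t x) ^+ 2)%:E) + 2%:E * (complex.Re (herm h (s x) (t x)))%:E))%E.
  by apply: eq_integral => x _; rewrite e !EFinD EFinM.
rewrite integralD//; first last.
- exact: integrableZl.
- by apply: integrableD => //; exact: is2.
rewrite integralD//; try exact: is2.
rewrite integralZl//.
have : (\int[dV]_x (complex.Re (herm h (s x) (t x)))%:E = 0)%E.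
  by rewrite -[LHS]fineK ?integrable_fin_num// -/(Rintegral _ _ _) Re0.
by move=> ->; rewrite mule0 adde0.
Qed.

Lemma L2_inner0r s : L2_inner h dV s (fun x => 0) = 0.
Proof.
have z (f : X -> R) : (forall x, f x = 0) -> (\int[dV]_x f x)%R = 0.
  by move=> f0; rewrite /Rintegral; under eq_integral do rewrite f0; rewrite integral0.
by rewrite /L2_inner !z// => x; rewrite herm0r.
Qed.

Lemma L2_innerZD c s t u : L2 s -> L2 t -> L2 u -> L2_inner h dV u (fun x => s x + c *: t x) =
  L2_inner h dV u s + c^* * L2_inner h dV u t.
Proof.
move=> Ls Lt Lu; have [i1 i2] := integrable_herm Lu Ls; have [i3 i4] := integrable_herm Lu Lt.
case: c => a b.
have i5 (k : R) f : dV.-integrable setT (fun x => (f x)%:E) -> dV.-integrable setT (fun x => (k * f x)%:E).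
  by move=> fi; under eq_fun do rewrite EFinM; exact: integrableZl.
have eR x : complex.Re (herm h (u x) (s x + (a +i* b) *: t x)) =
   complex.Re (herm h (u x) (s x)) + (a * complex.Re (herm h (u x) (t x)) + b * complex.Im (herm h (u x) (t x))).
  by rewrite hermDr hermZr ReD; case: (herm h (u x) (t x)) => p q /=; ring.
have eI x : complex.Im (herm h (u x) (s x + (a +i* b) *: t x)) =
   complex.Im (herm h (u x) (s x)) + (a * complex.Im (herm h (u x) (t x)) + (- b) * complex.Re (herm h (u x) (t x))).
  by rewrite hermDr hermZr ImD; case: (herm h (u x) (t x)) => p q /=; ring.
rewrite /L2_inner; under eq_Rintegral do rewrite eR.
under [X in _ +i* X]eq_Rintegral do rewrite eI.
have D f g : dV.-integrable setT (fun x => (f x)%:E) -> dV.-integrable setT (fun x => (g x)%:E) ->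
   dV.-integrable setT (fun x => (f x + g x)%:E).
  by move=> fi gi; under eq_fun do rewrite EFinD; exact: integrableD.
rewrite !RintegralD ?RintegralZl//; try exact: i5; try (by apply: D; exact: i5).
by apply/eqP; rewrite eq_complex /=; apply/andP; split; apply/eqP; ring.
Qed.

Lemma L2_innerC s t : L2 s -> L2 t -> L2_inner h dV t s = (L2_inner h dV s t)^*.
Proof.
move=> Ls Lt; have [_ i2] := integrable_herm Ls Lt.
apply/eqP; rewrite eq_complex /=; apply/andP; split; apply/eqP.
  by apply: eq_Rintegral => x _; rewrite (herm_sym h (s x)); case: (herm h (s x) (t x)).
rewrite -mulN1r -RintegralZl//; apply: eq_Rintegral => x _.
by rewrite (herm_sym h (s x)) mulN1r; case: (herm h (s x) (t x)).
Qed.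

Section orthonormal.
Variables (d : option nat) (S : nat -> forall x, fiber L x).
Hypothesis S_L2 : forall j, index_lt d j -> L2 (S j).
Hypothesis S_on : forall j k, index_lt d j -> index_lt d k -> L2_inner h dV (S j) (S k) = (j == k)%:R.

Lemma partial_sumS c m : partial_sum d c S m.+1 =
  if index_lt d m then (fun x => partial_sum d c S m x + c m *: S m x) else partial_sum d c S m.
Proof.
apply: functional_extensionality_dep => x; rewrite /partial_sum big_mkcond big_ord_recr /= -big_mkcond.
by case: ifP => //; rewrite addr0.
Qed.

Lemma partial_sum0 c : partial_sum d c S 0 = (fun x => 0).
Proof. by apply: functional_extensionality_dep => x; rewrite /partial_sum big_ord0. Qed.

Lemma L2_inner_partial c m k : index_lt d k -> (m <= k)%N ->
  L2_inner h dV (S k) (partial_sum d c S m) = 0.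
Proof.
move=> dk; elim: m => [|m IH] mk; first by rewrite partial_sum0 L2_inner0r.
rewrite partial_sumS; case: ifP => dm; last by rewrite IH// ltnW.
rewrite (L2_innerZD _ (L2_partial_sum _ _ S_L2) (S_L2 dm) (S_L2 dk)) IH; last exact: ltnW.
by rewrite S_on// gtn_eqF// mulr0 addr0.
Qed.

Lemma L2_norm2_basis k : index_lt d k -> N2 (S k) = 1%E.
Proof.
move=> dk; have := S_on dk dk; rewrite eqxx => /eqP; rewrite eq_complex /= => /andP [/eqP h1 _].
have [i1 _] := integrable_herm (S_L2 dk) (S_L2 dk).
rewrite /L2_norm2; under eq_integral do rewrite hn_sqr.
by rewrite -[LHS]fineK ?integrable_fin_num// -/(Rintegral _ _ _) h1.
Qed.

Lemma pythagoras c m : N2 (partial_sum d c S m) = (\sum_(j < m | index_lt d j) cn (c j) ^+ 2)%:E.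
Proof.
elim: m => [|m IH].
  rewrite partial_sum0 big_ord0 /L2_norm2.
  by under eq_integral do rewrite hn0 expr0n /=; rewrite integral0.
rewrite partial_sumS big_mkcond big_ord_recr /= -big_mkcond; case: ifP => dm; last by rewrite addr0.
rewrite EFinD -IH.
have Lp := L2_partial_sum c m S_L2; have Lm := L2_sectionZ (c m) (S_L2 dm).
rewrite L2_norm2D_orth//.
  by rewrite L2_norm2Z ?L2_norm2_basis ?mule1//; case: (S_L2 dm).
have := L2_innerZD (c m) L2_section0 (S_L2 dm) Lp; rewrite L2_inner0r add0r.
rewrite (_ : (fun x => 0 + _) = (fun x => c m *: S m x)).
  by move=> ->; rewrite L2_innerC// ?L2_inner_partial// ?rmorph0 ?mulr0//; exact: S_L2.
by apply: functional_extensionality_dep => x; rewrite add0r.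
Qed.

End orthonormal.

Section functional.
Variables (p : nat) (a : 'I_p -> C) (k : 'I_p -> triv_index L) (pt : 'I_p -> X).
Hypothesis k_pt : forall i, triv_dom (k i) (pt i).

(** Linear functionals on sections given by finitely many evaluations in trivializations: their
    values determine the finite-dimensional marginals of the random section. *)
Definition eval_comb s : C := \sum_i a i * fiber_coord (k i) (pt i) (s (pt i)).

Lemma eval_combZD c s t : eval_comb (fun x => s x + c *: t x) = eval_comb s + c * eval_comb t.
Proof.
rewrite /eval_comb mulr_sumr -big_split /=; apply: eq_bigr => i _.
by rewrite linearD linearZ mulrDr /= !mulrA [a i * c]mulrC.
Qed.

Lemma eval_combB s t : eval_comb (fun x => s x - t x) = eval_comb s - eval_comb t.
Proof.
rewrite -[eval_comb t in RHS]mul1r -mulNr -eval_combZD; congr eval_comb.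
by apply: functional_extensionality_dep => x; rewrite scaleN1r.
Qed.

Lemma eval_comb_partial d c S m :
  eval_comb (partial_sum d c S m) = \sum_(j < m | index_lt d j) c j * eval_comb (S j).
Proof.
elim: m => [|m IH].
  by rewrite partial_sum0 big_ord0 /eval_comb big1// => i _; rewrite linear0 mulr0.
rewrite partial_sumS big_mkcond big_ord_recr /= -big_mkcond; case: ifP => dm; last by rewrite addr0.
by rewrite eval_combZD IH.
Qed.

Lemma eval_comb_bound : exists2 B : R, 0 <= B & forall s, L2 s -> ((cn (eval_comb s) ^+ 2)%:E <= B%:E * N2 s)%E.
Proof.
have H i : exists2 B : R, 0 <= B & forall s, L2 s ->
    ((cn (fiber_coord (k i) (pt i) (s (pt i))) ^+ 2)%:E <= B%:E * N2 s)%E.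
  have [W [U [K [c [[_ Wx _ _] [mU fU] c0 b1 b2]]]]] := patch_exists h dV_Theta (pt i).
  have w0 := weight_gt0 h (k_pt i).
  exists ((weight h (k i) (pt i))^-1 * c); first by rewrite mulr_ge0// invr_ge0 ltW.
  move=> s [hs fs].
  have : ((hn (s (pt i)) ^+ 2)%:E <= c%:E * N2 s)%E.
    apply: le_trans (b1 _ hs _ Wx) _; apply: lee_wpmul2l => //.
    rewrite /L2_norm2; apply: ge0_subset_integral => //; first exact: measurable_hn2E.
    by move=> y _; rewrite lee_fin sqr_ge0.
  rewrite (hn_coord h (s (pt i)) (k_pt i)) (L2_norm2_fin (conj hs fs)) -!EFinM !lee_fin => hb.
  by rewrite -mulrA ler_pdivlMl// mulrC.
pose B i := s2val (cid2 (H i)); have B0 i : 0 <= B i := s2valP (cid2 (H i)).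
have BP i s : L2 s -> _ := s2valP' (cid2 (H i)) s.
pose A := (\sum_i cn (a i) ^+ 2).
have A0 : 0 <= A by apply: sumr_ge0 => i _; exact: sqr_ge0.
exists (A * \sum_i B i); first by rewrite mulr_ge0// sumr_ge0.
move=> s Ls; have sE := L2_norm2_fin Ls; rewrite sE -EFinM lee_fin.
apply: le_trans (cn_sum_CS _ _ _ _) _; rewrite -mulrA; apply: ler_wpM2l => //.
rewrite mulr_suml; apply: ler_sum => i _.
by have := BP i s Ls; rewrite sE -EFinM lee_fin.
Qed.

End functional.

Section basis_change.
Variables (d : option nat) (S S' : nat -> forall x, fiber L x).
Hypothesis S_basis : orthonormal_basis h dV d S.
Hypothesis S'_basis : orthonormal_basis h dV d S'.
Variables (p : nat) (a : 'I_p -> C) (k : 'I_p -> triv_index L) (pt : 'I_p -> X).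
Hypothesis k_pt : forall i, triv_dom (k i) (pt i).
Local Notation ell := (eval_comb a k pt).

(** The partial sums of the squared norm of the functional [ell], computed in a basis. *)
Definition norm_sum (S : nat -> forall x, fiber L x) m : R :=
  \sum_(j < m | index_lt d j) cn (ell (S j)) ^+ 2.

(** Let [V] be the partial sum for [S]. The section [s = \sum_(j < m) (ell (S j))^* S j] has squared
    norm [V] and [ell s = V]. Approximate [s] in L2 by a partial sum [q] in the basis [S'];
    Cauchy-Schwarz gives [|ell q|^2 <= |q|^2 * B'], and the continuity of [ell] controls [ell (s -
    q)]. In the limit [V^2 <= V * B']. *)
Lemma norm_sum_le (B' : R) m : (forall m', norm_sum S' m' <= B') -> norm_sum S m <= B'.
Proof.
move=> hB'; have [S_L2 S_on _] := S_basis; have [S'_L2 S'_on S'_dense] := S'_basis.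
have [B B0 hB] := eval_comb_bound a k_pt.
set V := norm_sum S m; have V0 : 0 <= V by apply: sumr_ge0 => j _; exact: sqr_ge0.
have B'0 : 0 <= B' by apply: le_trans (hB' 0%N); rewrite /norm_sum big_ord0.
have [VE|Vn] := eqVneq V 0; first by rewrite VE.
have Vp : 0 < V by rewrite lt0r Vn.
pose s := partial_sum d (fun j => (ell (S j))^*) S m.
have Ls : L2 s by exact: L2_partial_sum.
have cnJ (z : C) : cn z^* = cn z by case: z => u v; rewrite !cnE /= sqrrN.
have Ns : N2 s = V%:E.
  by rewrite (pythagoras S_L2 S_on) /V /norm_sum; under eq_bigr do rewrite cnJ.
have es : ell s = V%:C.
  rewrite eval_comb_partial /V /norm_sum rmorph_sum; apply: eq_bigr => j _ /=.
  rewrite cn_sqr; case: (ell (S j)) => u v.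
  by apply/eqP; rewrite eq_complex /=; apply/andP; split; apply/eqP; ring.
have key (dl e : R) : 0 < dl -> 0 < e ->
    V ^+ 2 <= (1 + dl) ^+ 2 * V * B' + e * ((1 + dl) * (1 + dl^-1) * B' + (1 + dl^-1) * B).
  move=> dl0 e0; have [m' [c he]] := S'_dense s Ls e e0.
  set q := partial_sum d c S' m' in he.
  have Lq : L2 q by exact: L2_partial_sum.
  have Lr : L2 (fun x => s x - q x).
    by split; [exact: holomorphic_sectionB (proj1 Ls) (proj1 Lq)|apply: lt_trans he (ltry _)].
  have d1 : 0 <= 1 + dl^-1 by rewrite addr_ge0// invr_ge0 ltW.
  have d2 : 0 <= 1 + dl by rewrite addr_ge0// ltW.
  have r1 : cn (ell (fun x => s x - q x)) ^+ 2 <= B * e.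
    rewrite -lee_fin; apply: le_trans (hB _ Lr) _; rewrite EFinM; apply: lee_wpmul2l => //.
    exact: ltW.
  have qE := L2_norm2_fin Lq.
  have Nq : fine (N2 q) <= (1 + dl) * V + (1 + dl^-1) * e.
    rewrite -lee_fin -qE (_ : q = (fun x => s x + (-1) *: (s x - q x))); last first.
      by apply: functional_extensionality_dep => x; rewrite scaleN1r opprB addrC subrK.
    apply: le_trans (L2_norm2_youngD dl0 (proj1 Ls) (holomorphic_sectionZ (-1) (proj1 Lr))) _.
    rewrite L2_norm2Z; last exact: (proj1 Lr).
    rewrite Ns [X in (_ <= X)%E]EFinD; apply: leeD; first by rewrite -EFinM.
    rewrite [X in (_ <= X)%E]EFinM; apply: lee_wpmul2l => //.
    by rewrite cnN -[1]/(1%:C) cn_real normr1 expr1n mul1e ltW.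
  have r2 : cn (ell q) ^+ 2 <= fine (N2 q) * B'.
    rewrite eval_comb_partial; apply: le_trans (cn_sum_CS _ _ _ _) _.
    rewrite qE (pythagoras S'_L2 S'_on) /=; apply: ler_wpM2l; last exact: hB'.
    by apply: sumr_ge0 => j _; exact: sqr_ge0.
  have eD : ell s = ell q + ell (fun x => s x - q x) by rewrite eval_combB addrC subrK.
  have : V ^+ 2 <= (1 + dl) * cn (ell q) ^+ 2 + (1 + dl^-1) * cn (ell (fun x => s x - q x)) ^+ 2.
    apply: le_trans (sqr_youngD _ _ dl0); rewrite ler_sqr ?nnegrE ?addr_ge0 ?cn_ge0//.
    by rewrite -[X in X <= _](ger0_norm V0) -cn_real -es eD; exact: cnD.
  have h1 : (1 + dl) * cn (ell q) ^+ 2 <= (1 + dl) * (((1 + dl) * V + (1 + dl^-1) * e) * B').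
    by apply: ler_wpM2l => //; apply: le_trans r2 _; exact: ler_wpM2r.
  have h2 := ler_wpM2l d1 r1.
  move=> hV; apply: le_trans hV _; apply: le_trans (lerD h1 h2) _.
  by rewrite le_eqVlt; apply/orP; left; apply/eqP; move: (dl^-1) => w; ring.
have key2 dl : 0 < dl -> V <= (1 + dl) ^+ 2 * B'.
  move=> dl0; rewrite -(ler_pM2l Vp) -expr2 mulrA [V * _]mulrC.
  have := key dl; set K := (1 + dl) * (1 + dl^-1) * B' + (1 + dl^-1) * B => keyK.
  have K0 : 0 <= K by rewrite addr_ge0// !mulr_ge0// addr_ge0// ?invr_ge0 ltW.
  apply/ler_addgt0Pr => e e0; have e1 : 0 < e / (K + 1) by rewrite divr_gt0// ltr_wpDl.
  apply: le_trans (keyK _ dl0 e1) _; rewrite lerD2l mulrAC ler_pdivrMr ?ltr_wpDl//.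
  by rewrite ler_pM2l// lerDl.
apply/ler_addgt0Pr => e e0.
pose dl := Num.min 1 (e / (3 * B' + 1)).
have dl0 : 0 < dl by rewrite lt_min ltr01 divr_gt0// ltr_wpDl// mulr_ge0.
have dl1 : dl <= 1 by rewrite ge_min lexx.
have dlB : 3 * B' * dl <= e.
  apply: (@le_trans _ _ ((3 * B' + 1) * (e / (3 * B' + 1)))); last by rewrite mulrC divfK// gt_eqF// ltr_wpDl// mulr_ge0.
  have dl2 : dl <= e / (3 * B' + 1) by rewrite /dl ge_min lexx orbT.
  by apply: ler_pM dl2; rewrite ?mulr_ge0 ?(ltW dl0) ?lerDl.
apply: le_trans (key2 _ dl0) _; clearbody dl; nra.
Qed.

(** The same section [s] gives [V^2 = |ell s|^2 <= B * V] for the continuity constant [B] of [ell].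
    *)
Lemma norm_sum_bounded : exists B : R, forall m, norm_sum S m <= B.
Proof.
have [S_L2 S_on _] := S_basis; have [B B0 hB] := eval_comb_bound a k_pt.
exists B => m; set V := norm_sum S m.
have V0 : 0 <= V by apply: sumr_ge0 => j _; exact: sqr_ge0.
have [VE|Vn] := eqVneq V 0; first by rewrite VE.
have Vp : 0 < V by rewrite lt0r Vn.
pose s := partial_sum d (fun j => (ell (S j))^*) S m.
have Ls : L2 s by exact: L2_partial_sum.
have cnJ (z : C) : cn z^* = cn z by case: z => u v; rewrite !cnE /= sqrrN.
have Ns : N2 s = V%:E.
  by rewrite (pythagoras S_L2 S_on) /V /norm_sum; under eq_bigr do rewrite cnJ.
have es : ell s = V%:C.
  rewrite eval_comb_partial /V /norm_sum rmorph_sum; apply: eq_bigr => j _ /=.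
  rewrite cn_sqr; case: (ell (S j)) => u v.
  by apply/eqP; rewrite eq_complex /=; apply/andP; split; apply/eqP; ring.
have := hB _ Ls; rewrite Ns es cn_real real_normK ?num_real// -EFinM lee_fin.
by rewrite expr2 ler_pM2r.
Qed.

End basis_change.

End kernels.

(** * Rotation invariance of the standard Gaussian *)

Section gauss2.
Context {R : realType}.
Local Notation mu := (@lebesgue_measure R).
Local Notation RR := (measurableTypeR R * measurableTypeR R)%type.
Local Notation gamma := (normal_prob (0 : R) 1).
Local Notation phi := (normal_pdf (0 : R) 1).

Definition gauss2_density (p : RR) : R := phi p.1 * phi p.2.

Lemma gauss2_density_ge0 p : 0 <= gauss2_density p.
Proof. by rewrite mulr_ge0 ?normal_pdf_ge0. Qed.

Lemma gauss2_densityE p : gauss2_density p = (normal_peak (1 : R)) ^+ 2 * expR (- ((p.1 ^+ 2 + p.2 ^+ 2) / 2)).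
Proof.
rewrite /gauss2_density !normal_pdfE ?oner_eq0// /normal_fun !subr0 expr1n.
rewrite mulrACA -expr2 -expRD; congr (_ * expR _).
by rewrite mulrDl opprD !mulNr.
Qed.

Lemma measurable_gauss2_density : measurable_fun setT gauss2_density.
Proof.
by apply: measurable_funM; apply: measurableT_comp => //; exact: measurable_normal_pdf.
Qed.

Local Open Scope ereal_scope.

Definition gauss2 (E : set RR) : \bar R := \int[mu \x mu]_(p in E) (gauss2_density p)%:E.

Let gauss2_0 : gauss2 set0 = 0. Proof. by rewrite /gauss2 integral_set0. Qed.

Let gauss2_ge0 E : 0 <= gauss2 E.
Proof. by apply: integral_ge0 => p _; rewrite lee_fin gauss2_density_ge0. Qed.

Let gauss2_sigma_additive : semi_sigma_additive gauss2.
Proof.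
move=> F mF tF mUF; rewrite /gauss2 ge0_integral_bigcup//=; last first.
- by move=> p _; rewrite lee_fin gauss2_density_ge0.
- by apply: measurable_funTS; apply/measurable_EFinP; exact: measurable_gauss2_density.
by apply: is_cvg_ereal_nneg_natsum_cond => k _ _; exact: gauss2_ge0.
Qed.

HB.instance Definition _ := isMeasure.Build _ RR R gauss2 gauss2_0 gauss2_ge0 gauss2_sigma_additive.

Lemma integral_patch_indic d (T : measurableType d) (m : {measure set T -> \bar R}) (E : set T) (f : T -> R) :
  \int[m]_(x in E) (f x)%:E = \int[m]_x (\1_E x * f x)%:E.
Proof.
rewrite integral_mkcond; apply: eq_integral => x _; rewrite patchE indicE.
by case: ifP => _; rewrite ?mul1r ?mul0r.
Qed.

Lemma product_gaussE E : measurable E -> (gamma \x gamma) E = gauss2 E.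
Proof.
move=> mE; have := @product_measure_unique _ _ _ _ R gamma gamma gauss2 _ E mE.
apply => A B mA mB.
rewrite /= /gauss2 integral_patch_indic fubini_tonelli1; last 2 first.
- apply/measurable_EFinP; apply: measurable_funM; last exact: measurable_gauss2_density.
  by apply: measurable_indic; exact: measurableX.
- by move=> p; rewrite lee_fin mulr_ge0 ?gauss2_density_ge0// indicE.
have mp (C : set (measurableTypeR R)) : measurable C -> measurable_fun setT (fun x => (\1_C x * phi x)%:E).
  move=> mC; apply/measurable_EFinP; apply: measurable_funM; last exact: measurable_normal_pdf.
  exact: measurable_indic.
have p0 (C : set R) x : 0 <= (\1_C x * phi x)%:E by rewrite lee_fin mulr_ge0 ?normal_pdf_ge0// indicE.
have gE C : gamma C = \int[mu]_x (\1_C x * phi x)%:E by rewrite /= /normal_prob integral_patch_indic.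
have gf C : measurable C -> gamma C = (fine (gamma C))%:E by move=> mC; rewrite fineK// fin_num_measure.
transitivity (\int[mu]_x ((\1_A x * phi x)%:E * gamma B)).
  apply: eq_integral => x _; rewrite gE -ge0_integralZl_EFin//; last 2 first.
  - exact: mp.
  - by rewrite mulr_ge0 ?normal_pdf_ge0// indicE.
  apply: eq_integral => y _; rewrite -EFinM; congr _%:E.
  rewrite /gauss2_density /= [RHS]mulrACA; congr (_ * _)%R.
  by rewrite !indicE -natrM mulnb; congr (nat_of_bool _)%:R; apply/idP/idP; [move=> /set_mem [? ?]|move=> /andP[/set_mem ? /set_mem ?]; apply: mem_set]; rewrite ?mem_set.
rewrite (gf _ mB); under eq_integral do rewrite muleC.
rewrite ge0_integralZl_EFin//; last 2 first.
- exact: mp.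
- by rewrite fine_ge0.
by rewrite -gE muleC.
Qed.

(** Shears preserve Lebesgue measure by translation invariance along each line. *)
Lemma shear1 (a : R) (F : RR -> \bar R) : measurable_fun setT F -> (forall p, 0 <= F p) ->
  \int[mu \x mu]_p F (p.1 + a * p.2, p.2)%R = \int[mu \x mu]_p F p.
Proof.
move=> mF F0.
have mG : measurable_fun setT (fun p : RR => F (p.1 + a * p.2, p.2)%R).
  apply: (measurableT_comp mF); apply: measurable_fun_pair => //=.
  apply: measurable_funD => //; apply: measurable_funM => //.
rewrite fubini_tonelli2; [|exact: mG|by move=> p; exact: F0].
rewrite [RHS]fubini_tonelli2; [|exact: mF|exact: F0].
apply: eq_integral => y _.
rewrite /fubini_G /= -[RHS](lebesgue_translation (a * y)%R)//.
  by apply: eq_integral => x _; rewrite addrC.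
exact: (measurable_fun_pair1 y mF).
Qed.

Lemma shear2 (b : R) (F : RR -> \bar R) : measurable_fun setT F -> (forall p, 0 <= F p) ->
  \int[mu \x mu]_p F (p.1, p.2 + b * p.1)%R = \int[mu \x mu]_p F p.
Proof.
move=> mF F0.
have mG : measurable_fun setT (fun p : RR => F (p.1, p.2 + b * p.1)%R).
  apply: (measurableT_comp mF); apply: measurable_fun_pair => //=.
  apply: measurable_funD => //; apply: measurable_funM => //.
rewrite fubini_tonelli1; [|exact: mG|by move=> p; exact: F0].
rewrite [RHS]fubini_tonelli1; [|exact: mF|exact: F0].
apply: eq_integral => x _.
rewrite /fubini_F /= -[RHS](lebesgue_translation (b * x)%R)//.
  by apply: eq_integral => y _; rewrite addrC.
exact: (measurable_fun_pair2 x mF).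
Qed.

Definition rot2 (c s : R) (p : RR) : RR := (c * p.1 + s * p.2, c * p.2 - s * p.1)%R.

Lemma measurable_rot2 c s : measurable_fun setT (rot2 c s).
Proof.
by apply: measurable_fun_pair; [apply: measurable_funD|apply: measurable_funB]; apply: measurable_funM.
Qed.

(** A rotation other than the half-turn is a product of three shears, with parameters [s/(1+c)],
    [-s] and [s/(1+c)]; so the rotation invariance of Lebesgue measure reduces to its translation
    invariance. *)
Lemma integral_rot2 (c s : R) (F : RR -> \bar R) : (c ^+ 2 + s ^+ 2 = 1)%R -> (1 + c != 0)%R ->
  measurable_fun setT F -> (forall p, 0 <= F p) ->
  \int[mu \x mu]_p F (rot2 c s p) = \int[mu \x mu]_p F p.
Proof.
move=> cs c1 mF F0; pose a := (s / (1 + c))%R.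
have ac : (a * (1 + c) = s)%R by rewrite /a divfK.
have as1 : (1 - a * s = c)%R.
  have e : (a * s * (1 + c) = s ^+ 2)%R by rewrite mulrAC ac expr2.
  apply: (mulIf c1); rewrite mulrBl e mul1r.
  have -> : (s ^+ 2 = 1 - c ^+ 2)%R by rewrite -cs addrC addKr.
  by ring.
pose F2 p := F (p.1 + a * p.2, p.2)%R; pose F1 p := F2 (p.1, p.2 + (- s) * p.1)%R.
have m2 : measurable_fun setT F2.
  apply: (measurableT_comp mF); apply: measurable_fun_pair => //=.
  by apply: measurable_funD => //; apply: measurable_funM.
have m1 : measurable_fun setT F1.
  apply: (measurableT_comp m2); apply: measurable_fun_pair => //=.
  by apply: measurable_funD => //; apply: measurable_funM.
transitivity (\int[mu \x mu]_p F1 (p.1 + a * p.2, p.2)%R).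
  apply: eq_integral => -[x y] _; rewrite /F1 /F2 /rot2 /=; congr (F (_, _)).
    have sE : (s = a * (2 - a * s))%R by rewrite -[LHS]ac -[c in LHS]as1; ring.
    have -> : (c * x + s * y = (1 - a * s) * x + a * (2 - a * s) * y)%R by rewrite as1 -sE.
    by ring.
  by rewrite -[X in (X * y)%R]as1; ring.
rewrite shear1//; last by move=> p; exact: F0.
rewrite shear2//; last by move=> p; exact: F0.
by rewrite shear1.
Qed.

Lemma gauss_rot2 (c s : R) (E : set RR) : (c ^+ 2 + s ^+ 2 = 1)%R -> (1 + c != 0)%R ->
  measurable E -> (gamma \x gamma) (rot2 c s @^-1` E) = (gamma \x gamma) E.
Proof.
move=> cs c1 mE.
have mE' : measurable (rot2 c s @^-1` E) by rewrite -[X in measurable X]setTI; exact: measurable_rot2.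
rewrite !product_gaussE// /gauss2 [LHS]integral_patch_indic [RHS]integral_patch_indic.
rewrite -[RHS](integral_rot2 cs c1); first last.
- by move=> p; rewrite lee_fin mulr_ge0 ?gauss2_density_ge0// indicE.
- apply/measurable_EFinP; apply: measurable_funM; last exact: measurable_gauss2_density.
  exact: measurable_indic.
apply: eq_integral => p _; congr (_ * _)%:E; rewrite !gauss2_densityE /rot2 /=.
rewrite (_ : (c * p.1 + s * p.2) ^+ 2 + _ = (c ^+ 2 + s ^+ 2) * (p.1 ^+ 2 + p.2 ^+ 2))%R; first by rewrite cs mul1r.
by ring.
Qed.

Lemma gauss_opp (A : set (measurableTypeR R)) : measurable A -> gamma (-%R @^-1` A) = gamma A.
Proof.
move=> mA; rewrite /= /normal_prob [LHS]integral_patch_indic [RHS]integral_patch_indic.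
rewrite -[RHS](@lebesgue_reflection R 0); first last.
- by move=> x; rewrite lee_fin mulr_ge0 ?normal_pdf_ge0// indicE.
- apply/measurable_EFinP; apply: measurable_funM; last exact: measurable_normal_pdf.
  exact: measurable_indic.
apply: eq_integral => x _; rewrite sub0r; congr (_ * _)%:E.
by rewrite !normal_pdfE ?oner_eq0// /normal_fun !subr0 sqrrN.
Qed.

End gauss2.
(** * Random sequences and independent Gaussians *)

Section laws.
Context {R : realType}.

Lemma law_unique d d' (T : measurableType d) (T2 : measurableType d') (P : probability T R)
  (G : set (set T2)) (Z Y : T -> T2) :
  measurable = <<s G >> -> setI_closed G -> G setT ->
  measurable_fun setT Z -> measurable_fun setT Y ->
  (forall A, G A -> P (Z @^-1` A) = P (Y @^-1` A)) ->
  forall E, measurable E -> P (Z @^-1` E) = P (Y @^-1` E).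
Proof.
move=> mG GI GT mZ mY GE E mE.
pose m1 : {measure set T2 -> \bar R} := measure_function_pushforward__canonical__measure_function_Measure P mZ.
pose m2 : {measure set T2 -> \bar R} := measure_function_pushforward__canonical__measure_function_Measure P mY.
apply: (@measure_unique _ R T2 G (fun=> setT) mG GI (fun=> GT) _ m1 m2) => //.
  by rewrite bigcup_const//; exists 0%N.
move=> _; rewrite /m1 /= /pushforward preimage_setT.
by apply: le_lt_trans (probability_le1 P measurableT) (ltry _).
Qed.

Definition cylinder : set (set (nat -> R)) :=
  [set A | exists m (B : nat -> set (measurableTypeR R)), (forall i, measurable (B i)) /\
    A = [set x | forall i, (i < m)%N -> B i (x i)]].

End laws.

Notation seqR R := (g_sigma_algebraType (@cylinder R)).

Section sequences.
Context {R : realType}.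

Lemma cylinder_setI : setI_closed (@cylinder R).
Proof.
move=> _ _ [m [B [mB ->]]] [m' [B' [mB' ->]]].
exists (maxn m m'), (fun i => (if (i < m)%N then B i else setT) `&` (if (i < m')%N then B' i else setT)).
split; first by move=> i; apply: measurableI; case: ifP.
apply/seteqP; split=> x.
  by move=> [h h'] i _; split; case: ifP => // im; [exact: h|exact: h'].
move=> h; split=> i im.
  by have := h i; rewrite leq_max im => /(_ isT) [].
by have := h i; rewrite leq_max im orbT => /(_ isT) [].
Qed.

Lemma cylinder_setT : @cylinder R setT.
Proof. by exists 0%N, (fun=> setT); split => //; apply/seteqP; split. Qed.

Lemma measurable_seq_coord k : measurable_fun setT (fun x : seqR R => x k : R).
Proof.
move=> _ B mB; rewrite setTI; apply: sub_sigma_algebra.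
exists k.+1, (fun i => if i == k then B else setT); split; first by move=> i; case: ifP.
apply/seteqP; split=> x /=; first by move=> h i _; case: eqP => // ->.
by move/(_ k (ltnSn k)); rewrite eqxx.
Qed.

Lemma measurable_to_seq d (T : measurableType d) (Z : T -> nat -> R) :
  (forall k, measurable_fun setT (fun t => Z t k)) -> measurable_fun setT (Z : T -> seqR R).
Proof.
move=> mZ; apply: (@measurability _ _ T (seqR R) setT Z (@cylinder R)) => //.
move=> _ [_ [m [B [mB ->]]] <-]; rewrite setTI.
have -> : Z @^-1` [set x | forall i, (i < m)%N -> B i (x i)] =
   \bigcap_(i in [set i | (i < m)%N]) ((fun t => Z t i) @^-1` B i) by [].
apply: bigcap_measurableType.
by move=> i _; rewrite -[X in measurable X]setTI; exact: (mZ i measurableT (B i) (mB i)).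
Qed.

Section iid.
Context d (T : measurableType d).
Variable P : probability T R.
Local Notation gamma := (normal_prob (0 : R) 1).

(** Only [m] terms are constrained, because a finite-dimensional space of sections provides finitely
    many Gaussians. *)
Definition gauss_iid (m : nat) (xi : nat -> T -> R) :=
  (forall k, measurable_fun setT (xi k)) /\
  forall B : nat -> set (measurableTypeR R), (forall i, measurable (B i)) ->
    P [set w | forall i, (i < m)%N -> B i (xi i w)] = (\prod_(i < m) gamma (B i))%E.

(** Replaces the terms on which [gauss_iid m] is silent, so that the law of the whole sequence is
    determined. *)
Definition trunc_seq (m : nat) (x : nat -> R) : nat -> R := fun k => if (k < m)%N then x k else 0.

Lemma measurable_trunc m (xi : nat -> T -> R) : (forall k, measurable_fun setT (xi k)) ->
  measurable_fun setT (fun w => trunc_seq m (xi ^~ w) : seqR R).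
Proof.
move=> mx; apply: measurable_to_seq => k; rewrite /trunc_seq.
by case: (k < m)%N; [exact: mx|exact: measurable_cst].
Qed.

(** A cylinder in the truncated sequence is a product event in the first [m] terms. *)
Lemma gauss_iid_law m xi xi' : gauss_iid m xi -> gauss_iid m xi' ->
  forall E : set (seqR R), measurable E ->
  P [set w | E (trunc_seq m (xi ^~ w))] = P [set w | E (trunc_seq m (xi' ^~ w))].
Proof.
move=> [mx hx] [mx' hx'].
apply: (@law_unique _ _ _ _ (seqR R) P (@cylinder R) (fun w => trunc_seq m (xi ^~ w))
  (fun w => trunc_seq m (xi' ^~ w))) => //.
- exact: cylinder_setI.
- exact: cylinder_setT.
- exact: measurable_trunc.
- exact: measurable_trunc.
move=> _ [m' [B [mB ->]]].
pose B' i := if (i < m')%N then B i else setT.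
have mB' i : measurable (B' i) by rewrite /B'; case: ifP.
have [h|h] := pselect (forall i, (m <= i)%N -> (i < m')%N -> B i 0); last first.
  suff e (z : nat -> T -> R) : (fun w => trunc_seq m (z ^~ w)) @^-1` [set x | forall i, (i < m')%N -> B i (x i)] = set0.
    by rewrite !e.
  apply/seteqP; split=> // w hw; apply: h => i mi im.
  by have := hw i im; rewrite /trunc_seq ltnNge mi.
have e (z : nat -> T -> R) : (fun w => trunc_seq m (z ^~ w)) @^-1` [set x | forall i, (i < m')%N -> B i (x i)] =
    [set w | forall i, (i < m)%N -> B' i (z i w)].
  apply/seteqP; split=> w hw i im.
    by rewrite /B'; case: ifP => // im'; have := hw i im'; rewrite /trunc_seq im.
  rewrite /trunc_seq; case: ifP => im'; last by apply: h => //; rewrite leqNgt im'.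
  by have := hw i im'; rewrite /B' im.
by rewrite !e hx// hx'.
Qed.

Lemma gauss_iid_le m m' xi : (m' <= m)%N -> gauss_iid m xi -> gauss_iid m' xi.
Proof.
move=> mm [mx hx]; split=> // B mB.
pose B' i := if (i < m')%N then B i else setT.
have mB' i : measurable (B' i) by rewrite /B'; case: ifP.
have -> : [set w | forall i, (i < m')%N -> B i (xi i w)] = [set w | forall i, (i < m)%N -> B' i (xi i w)].
  apply/seteqP; split=> w hw i im; first by rewrite /B'; case: ifP => // im'; exact: hw.
  by have := hw i (leq_trans im mm); rewrite /B' im.
rewrite hx// -(subnK mm) addnC big_split_ord /= [X in (_ * X)%E]big1 ?mule1.
  by apply: eq_bigr => i _; rewrite /B' /= ltn_ord.
by move=> i _; rewrite /B' /= ltnNge leq_addr /=; exact: probability_setT.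
Qed.

Lemma gauss_iid_flip m xi (J : pred nat) : gauss_iid m xi ->
  gauss_iid m (fun k w => if J k then - xi k w else xi k w).
Proof.
move=> [mx hx]; split=> [k|B mB].
  by case: (J k); [under eq_fun do rewrite -sub0r; apply: measurable_funB => //|]; exact: mx.
pose B' i : set (measurableTypeR R) := if J i then -%R @^-1` B i else B i.
have mB' i : measurable (B' i).
  by rewrite /B'; case: ifP => // _; rewrite -[X in measurable X]setTI; exact: (@oppr_measurable R setT measurableT (B i) (mB i)).
have -> : [set w | forall i, (i < m)%N -> B i (if J i then - xi i w else xi i w)] =
   [set w | forall i, (i < m)%N -> B' i (xi i w)].
  by apply/seteqP; split=> w hw i im; have := hw i im; rewrite /B'; case: (J i).
rewrite hx//; apply: eq_bigr => i _; rewrite /B'; case: (J i) => //; exact: gauss_opp.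
Qed.

Definition rot_seq (i j : nat) (c s : R) (x : nat -> R) : nat -> R :=
  fun k => if k == i then c * x i + s * x j else if k == j then c * x j - s * x i else x k.

(** The law of the pair of rotated coordinates, restricted to the event [C] on the other
    coordinates, is a multiple of the planar Gaussian, which is invariant. *)
Lemma gauss_iid_rot m xi i j (c s : R) : (i < m)%N -> (j < m)%N -> i != j ->
  c ^+ 2 + s ^+ 2 = 1 -> 1 + c != 0 -> gauss_iid m xi ->
  gauss_iid m (fun k w => rot_seq i j c s (xi ^~ w) k).
Proof.
move=> im jm ij cs c1 [mx hx]; split=> [k|B mB].
  rewrite /rot_seq; case: eqP => _; last case: eqP => _; last exact: mx.
    by apply: measurable_funD; apply: measurable_funM.
  by apply: measurable_funB; apply: measurable_funM.
pose K := (\prod_(k < m | (k != Ordinal im) && (k != Ordinal jm)) gamma (B k))%E.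
have K0 : (0 <= K)%E by apply: prode_ge0 => k _; exact: measure_ge0.
have prodE (B' : nat -> set (measurableTypeR R)) :
   (forall k, k != i -> k != j -> B' k = B k) ->
   (\prod_(k < m) gamma (B' k) = gamma (B' i) * gamma (B' j) * K)%E.
  move=> B'E; rewrite (bigD1 (Ordinal im))//= (bigD1 (Ordinal jm))/=; last by rewrite -val_eqE eq_sym.
  rewrite muleA; congr (_ * _)%E; apply: eq_bigr => k /andP[ki kj]; congr gamma; exact: B'E.
have Kf : K = (fine K)%:E.
  rewrite fineK// /K; elim/big_ind: _ => // [x y x1 y1|k _]; first exact: fin_numM.
  exact: fin_num_measure.
pose C := [set w | forall k, (k < m)%N -> k != i -> k != j -> B k (xi k w)].
have mC : measurable C.
  have -> : C = \bigcap_(k in [set k | [&& (k < m)%N, k != i & k != j]]) (xi k @^-1` B k).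
    apply/seteqP; split=> w hw k; first by move=> /and3P [h1 h2 h3]; exact: hw.
    by move=> h1 h2 h3; apply: hw; apply/and3P.
  by apply: bigcap_measurableType => k _; rewrite -[X in measurable X]setTI; exact: (mx k measurableT (B k) (mB k)).
pose Z w : (measurableTypeR R * measurableTypeR R)%type := (xi i w, xi j w).
have mZ : measurable_fun setT Z by apply: measurable_fun_pair; exact: mx.
pose m1 : {measure set (measurableTypeR R * measurableTypeR R) -> \bar R} :=
  measure_function_pushforward__canonical__measure_function_Measure
    (measure_function_mrestr__canonical__measure_function_Measure P mC) mZ.
have fK0 : 0 <= fine K by exact: fine_ge0.
pose m2 : {measure set (measurableTypeR R * measurableTypeR R) -> \bar R} :=
  measure_function_mscale__canonical__measure_function_Measure (NngNum fK0)
    (gamma \x gamma)%E.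
have m1E E : m1 E = P (Z @^-1` E `&` C) by [].
have m2E E : m2 E = (K * (gamma \x gamma) E)%E by rewrite Kf.
have m12 E : measurable E -> m1 E = m2 E.
  move=> mE.
  apply: (@measure_unique _ R _ [set A `*` B | A in measurable & B in measurable] (fun=> setT)) => //.
  - exact: measurable_prod_measurableType.
  - move=> _ _ [A mA [A' mA' <-]] [D mD [D' mD' <-]]; rewrite -setXI.
    by exists (A `&` D); [exact: measurableI|exists (A' `&` D') => //; exact: measurableI].
  - by move=> _; exists setT => //; exists setT => //; rewrite setXTT.
  - by rewrite bigcup_const//; exists 0%N.
  - move=> _ [A mA [A' mA' <-]]; rewrite m1E m2E product_measure1E//.
    pose B' k := if k == i then A else if k == j then A' else B k.
    have -> : Z @^-1` (A `*` A') `&` C = [set w | forall k, (k < m)%N -> B' k (xi k w)].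
      apply/seteqP; split=> w.
        move=> [[/= hA hA'] hC] k km; rewrite /B'; case: eqVneq => [->//|ki].
        by case: eqVneq => [->//|kj]; exact: hC.
      move=> hw; split; first split => /=.
      + by have := hw i im; rewrite /B' eqxx.
      + by have := hw j jm; rewrite /B' eqxx eq_sym (negbTE ij).
      + by move=> k km ki kj; have := hw k km; rewrite /B' (negbTE ki) (negbTE kj).
    rewrite hx; last by move=> k; rewrite /B'; case: ifP => // _; case: ifP.
    rewrite prodE; last by move=> k ki kj; rewrite /B' (negbTE ki) (negbTE kj).
    by rewrite /B' eqxx eqxx eq_sym (negbTE ij) muleC.
  - move=> _; rewrite m1E; apply: le_lt_trans (ltry 1); apply: probability_le1.
    by rewrite preimage_setT setTI.
have mBB : measurable (B i `*` B j) by exact: measurableX.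
have mrot : measurable (rot2 c s @^-1` (B i `*` B j)).
  by rewrite -[X in measurable X]setTI; exact: measurable_rot2.
have -> : [set w | forall k, (k < m)%N -> B k (rot_seq i j c s (xi ^~ w) k)] =
    Z @^-1` (rot2 c s @^-1` (B i `*` B j)) `&` C.
  apply/seteqP; split=> w.
    move=> hw; split; first split => /=.
    + by have := hw i im; rewrite /rot_seq eqxx.
    + by have := hw j jm; rewrite /rot_seq eqxx eq_sym (negbTE ij).
    + by move=> k km ki kj; have := hw k km; rewrite /rot_seq (negbTE ki) (negbTE kj).
  move=> [[/= h1 h2] hC] k km; rewrite /rot_seq; case: eqVneq => [->//|ki].
  by case: eqVneq => [->//|kj]; exact: hC.
rewrite -m1E m12// m2E gauss_rot2// product_measure1E// muleC.
by rewrite (prodE B).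
Qed.

End iid.
End sequences.
(** * Linear forms with equal Gram matrices *)

Section orthogonal.
Context {R : realType}.
Implicit Types (x y b : nat -> R).

Definition dot (m : nat) x y : R := \sum_(k < m) x k * y k.

Definition flip_seq (i : nat) x : nat -> R := fun k => if k == i then - x i else x k.

(** Products of plane rotations and reflections that fix the coordinates below [o]. Generators are
    recorded instead of orthogonal matrices because the invariance of the law is known for
    generators. *)
Inductive orth (o m : nat) : ((nat -> R) -> nat -> R) -> Prop :=
| orth_id : orth o m id
| orth_rot i j c s f : (o <= i < m)%N -> (o <= j < m)%N -> i != j ->
    c ^+ 2 + s ^+ 2 = 1 -> 1 + c != 0 -> orth o m f -> orth o m (fun x => rot_seq i j c s (f x))
| orth_flip i f : (o <= i < m)%N -> orth o m f -> orth o m (fun x => flip_seq i (f x)).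

Lemma dotC m x y : dot m x y = dot m y x.
Proof. by apply: eq_bigr => k _; rewrite mulrC. Qed.

Lemma dot_rot m i j c s x y : (i < m)%N -> (j < m)%N -> i != j -> c ^+ 2 + s ^+ 2 = 1 ->
  dot m (rot_seq i j c s x) (rot_seq i j c s y) = dot m x y.
Proof.
move=> im jm ij cs; rewrite /dot.
have ji : Ordinal jm != Ordinal im by rewrite -val_eqE eq_sym.
have D (z : nat -> R) : \sum_(k < m) z k = z i + (z j + \sum_(k < m | (k != Ordinal im) && (k != Ordinal jm)) z k).
  by rewrite (bigD1 (Ordinal im))//= (bigD1 (Ordinal jm) ji).
rewrite (D (fun k => rot_seq i j c s x k * rot_seq i j c s y k)) (D (fun k => x k * y k)) !addrA; congr (_ + _); last first.
  by apply: eq_bigr => k /andP[ki kj]; rewrite /rot_seq -!val_eqE /= in ki kj *; rewrite (negbTE ki) (negbTE kj).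
rewrite /rot_seq !eqxx eq_sym (negbTE ij) /=.
rewrite -[x i * y i + _]mul1r -cs; ring.
Qed.

Lemma dot_flip m i x y : dot m (flip_seq i x) (flip_seq i y) = dot m x y.
Proof. by apply: eq_bigr => k _; rewrite /flip_seq; case: eqP => [->|//]; rewrite mulrNN. Qed.

Lemma orth_dot o m f : orth o m f -> forall x y, dot m (f x) (f y) = dot m x y.
Proof.
elim=> // [i j c s g /andP[_ im] /andP[_ jm] ij cs _ _ IH|i g _ _ IH] x y; rewrite -[RHS]IH.
  exact: dot_rot.
exact: dot_flip.
Qed.

Lemma orth_low o m f : orth o m f -> forall x k, (k < o)%N -> f x k = x k.
Proof.
elim=> // [i j c s g /andP[oi _] /andP[oj _] ij cs _ _ IH|i g /andP[oi _] _ IH] x k ko.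
  by rewrite /rot_seq !ltn_eqF ?IH// (leq_trans ko).
by rewrite /flip_seq ltn_eqF ?IH// (leq_trans ko).
Qed.

Lemma orth_comp o m f g : orth o m f -> orth o m g -> orth o m (fun x => f (g x)).
Proof.
move=> hf hg; elim: hf => // [i j c s f' oi oj ij cs c1 _ IH|i f' oi _ IH].
  exact: (orth_rot oi oj ij cs c1 IH).
exact: (orth_flip oi IH).
Qed.

Lemma rot_seqK i j c s x : i != j -> c ^+ 2 + s ^+ 2 = 1 ->
  rot_seq i j c (- s) (rot_seq i j c s x) = x.
Proof.
move=> ij cs; apply/funext => k; have ji : (j == i) = false by rewrite eq_sym (negbTE ij).
rewrite /rot_seq !eqxx ji.
case: eqVneq => [->|_]; first by rewrite -[RHS]mul1r -cs; ring.
by case: eqVneq => [->|//]; rewrite -[RHS]mul1r -cs; ring.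
Qed.

Lemma flip_seqK i x : flip_seq i (flip_seq i x) = x.
Proof. by apply/funext => k; rewrite /flip_seq eqxx; case: eqP => [->|//]; rewrite opprK. Qed.

Lemma orth_inv o m f : orth o m f -> exists g, [/\ orth o m g, cancel f g & cancel g f].
Proof.
elim=> [|i j c s f' oi oj ij cs c1 _ [g [og fg gf]]|i f' oi _ [g [og fg gf]]].
- by exists id; split => //; exact: orth_id.
- exists (fun x => g (rot_seq i j c (- s) x)); split.
  + by apply: orth_comp => //; apply: (orth_rot oi oj ij) => //; rewrite ?sqrrN//; exact: orth_id.
  + by move=> x; rewrite rot_seqK.
  + by move=> x; rewrite gf -{1}[s]opprK rot_seqK// sqrrN.
- exists (fun x => g (flip_seq i x)); split.
  + by apply: orth_comp => //; apply: orth_flip => //; exact: orth_id.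
  + by move=> x; rewrite flip_seqK.
  + by move=> x; rewrite gf flip_seqK.
Qed.

Lemma orth_iid d (T : measurableType d) (P : probability T R) o m f xi : orth o m f ->
  gauss_iid P m xi -> gauss_iid P m (fun k w => f (xi ^~ w) k).
Proof.
move=> hf hx; elim: hf => // [i j c s g /andP[_ im] /andP[_ jm] ij cs c1 _ IH|i g _ _ IH].
  exact: (gauss_iid_rot im jm ij cs c1 IH).
have := gauss_iid_flip (pred1 i) IH; congr gauss_iid.
apply/funext => k; apply/funext => w; rewrite /flip_seq /=; by case: eqP => // ->.
Qed.

(** Givens rotations in the planes [(o, j)] annihilate the coordinates [j > o] one after the other;
    a reflection fixes the sign of the remaining one. *)
Lemma orth_reduce o m b : (o < m)%N -> exists f, [/\ orth o m f,
  forall k, (o < k < m)%N -> f b k = 0 & 0 <= f b o].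
Proof.
move=> om.
suff H t : (o + t < m)%N -> exists2 f, orth o m f & forall k, (o < k <= o + t)%N -> f b k = 0.
  have [|f fo f0] := H (m - o.+1)%N; first by rewrite -addnS -subSn// subSS subnKC// ltnW.
  have f0' k : (o < k < m)%N -> f b k = 0.
    move=> /andP [ok km]; apply: f0; rewrite ok/= -ltnS -addnS -subSn// subSS subnKC//.
    exact: ltnW.
  have [pos|neg] := leP 0 (f b o); first by exists f.
  exists (fun x => flip_seq o (f x)); split.
  - by apply: orth_flip; rewrite ?leqnn.
  - by move=> k /andP [ok km]; rewrite /flip_seq gtn_eqF// f0'// ok.
  - by rewrite /flip_seq eqxx oppr_ge0 ltW.
elim: t => [|t IH] tm.
  by exists id; [exact: orth_id|move=> k; rewrite addn0 => /andP [/leq_trans h /h]; rewrite ltnn].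
have [|f fo f0] := IH; first by apply: leq_trans tm; rewrite ltnS addnS.
set j := (o + t.+1)%N in tm *; have oj : (o < j)%N by rewrite /j addnS ltnS leq_addr.
have lej k : (o < k <= j)%N -> (k == j) || (o < k <= o + t)%N.
  by move=> /andP [ok]; rewrite leq_eqVlt /j addnS ltnS => /orP [->//|->]; rewrite ok orbT.
have [bj|bj] := eqVneq (f b j) 0.
  by exists f => // k /lej /orP [/eqP ->|/f0].
set u := f b o; set v := f b j in bj.
pose r := Num.sqrt (u ^+ 2 + v ^+ 2).
have uv0 : 0 < u ^+ 2 + v ^+ 2 by rewrite ltr_wpDl ?sqr_ge0// exprn_even_gt0.
have r0 : 0 < r by rewrite sqrtr_gt0.
have r2 : r ^+ 2 = u ^+ 2 + v ^+ 2 by rewrite sqr_sqrtr// ltW.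
have cs : (u / r) ^+ 2 + (v / r) ^+ 2 = 1.
  by rewrite !expr_div_n -mulrDl -r2 divff// gt_eqF// exprn_gt0.
(* The angle is not the half-turn, since [v] does not vanish. *)
have c1 : 1 + u / r != 0.
  apply: contra bj => /eqP h; have e : u / r = - 1 by rewrite -[LHS](addKr 1) h addr0.
  have : (v / r) ^+ 2 = 0 by move: cs; rewrite e sqrrN expr1n => /eqP; rewrite -subr_eq0 addrAC subrr add0r => /eqP.
  by move=> /eqP; rewrite sqrf_eq0 mulf_eq0 invr_eq0 (gt_eqF r0) orbF.
exists (fun x => rot_seq o j (u / r) (v / r) (f x)).
  apply: (@orth_rot o m o j (u / r) (v / r) f _ _ _ cs c1 fo); first by rewrite leqnn om.
    by rewrite (ltnW oj) tm.
  by rewrite neq_ltn oj.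
move=> k /lej; rewrite /rot_seq; case: (eqVneq k j) => [->|kj] /=.
  by rewrite gtn_eqF// -/u -/v; move=> _; move: (r^-1) => z; ring.
by move=> /andP [ok kt]; rewrite gtn_eqF// f0// ok.
Qed.

(** Induction on the number [p] of forms. Orthogonal maps bring the first form of each system to the
    same vector [(b_0, ..., b_(o-1), r, 0, ...)]. If [r] is nonzero, equality of the Gram matrices
    forces the coordinates [o] of all the forms to agree as well, and the induction continues with
    one more common coordinate. *)
Lemma gram_equiv d (T : measurableType d) (P : probability T R) (m p o : nat)
  (B B' : nat -> nat -> R) (xi : nat -> T -> R) :
  (forall i k, (i < p)%N -> (k < o)%N -> B i k = B' i k) ->
  (forall i j, (i < p)%N -> (j < p)%N -> dot m (B i) (B j) = dot m (B' i) (B' j)) ->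
  gauss_iid P m xi ->
  exists xi', [/\ gauss_iid P m xi', forall k, (k < o)%N -> xi' k = xi k &
    forall i w, (i < p)%N -> dot m (B i) (xi ^~ w) = dot m (B' i) (xi' ^~ w)].
Proof.
elim: p o B B' xi => [|p IH] o B B' xi low gram hx; first by exists xi.
have [mo|om] := leqP m o.
  exists xi; split => // i w ip; apply: eq_bigr => k _; rewrite low//.
  exact: leq_trans (ltn_ord k) mo.
have [f [fo f0 fp]] := orth_reduce (B 0%N) om; have [f' [fo' f0' fp']] := orth_reduce (B' 0%N) om.
pose C i := f (B i); pose C' i := f' (B' i).
have Clow i k : (i < p.+1)%N -> (k < o)%N -> C i k = C' i k.
  by move=> ip ko; rewrite /C /C' (orth_low fo)// (orth_low fo')// low.
have Cgram i j : (i < p.+1)%N -> (j < p.+1)%N -> dot m (C i) (C j) = dot m (C' i) (C' j).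
  by move=> ip jp; rewrite /C /C' (orth_dot fo) (orth_dot fo') gram.
have dotC0 i : (i < p.+1)%N -> C 0%N o * C i o = C' 0%N o * C' i o.
  move=> ip; have := Cgram 0%N i isT ip; rewrite /dot.
  rewrite (bigD1 (Ordinal om))//= [X in _ = X -> _](bigD1 (Ordinal om))//=.
  have -> : \sum_(k < m | k != Ordinal om) C 0%N k * C i k = \sum_(k < m | k != Ordinal om) C' 0%N k * C' i k.
    apply: eq_bigr => k; rewrite -val_eqE /= neq_ltn => /orP [ko|ok].
      by rewrite !Clow.
    by rewrite /C /C' f0 ?f0' ?mul0r// ok ltn_ord.
  by move/addIr.
have r_eq : C 0%N o = C' 0%N o.
  have := dotC0 0%N isT; rewrite -!expr2 => /eqP; rewrite eqrXn2// => /eqP; exact.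
(* When [r = 0] the first form lives on the common coordinates already, and the number of common
   coordinates does not increase. *)
pose o' := if C 0%N o == 0 then o else o.+1.
have oo' : (o <= o')%N by rewrite /o'; case: ifP.
have C0z k : (o' <= k < m)%N -> C 0%N k = 0.
  rewrite /o'; case: eqVneq => [r0|_] /andP [ok km]; last by rewrite /C f0// ok.
  by move: ok; rewrite leq_eqVlt => /orP [/eqP <-//|ok]; rewrite /C f0// ok.
have low' i k : (i < p.+1)%N -> (k < o')%N -> C i k = C' i k.
  rewrite /o'; case: eqVneq => [r0|rn] ip; first exact: Clow.
  rewrite ltnS leq_eqVlt => /orP [/eqP ->|]; last exact: Clow.
  by have := dotC0 i ip; rewrite -r_eq; exact: mulfI.
have C00 k : (k < m)%N -> C 0%N k = C' 0%N k.
  move=> km; have [ko|ok] := ltnP k o'; first exact: low'.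
  rewrite C0z ?ok//; move: ok; rewrite /o'; case: eqVneq => [r0|_] ok; last by rewrite /C' f0'// ok.
  by move: ok; rewrite leq_eqVlt => /orP [/eqP <-|ok]; [rewrite -r_eq|rewrite /C' f0'// ok].
have [xi2 [iid2 low2 eq2]] := IH o' (fun i => C i.+1) (fun i => C' i.+1)
  (fun k w => f (xi ^~ w) k) (fun i k ip => low' i.+1 k ip) (fun i j ip jp => Cgram i.+1 j.+1 ip jp)
  (orth_iid fo hx).
have [g [og fg gf]] := orth_inv fo'.
exists (fun k w => g (xi2 ^~ w) k); split.
- exact: (orth_iid og iid2).
- move=> k ko; apply/funext => w; rewrite (orth_low og)// low2 ?(orth_low fo)//.
  exact: leq_trans oo'.
- move=> i w ip; rewrite -(orth_dot fo) -[RHS](orth_dot fo') gf.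
  case: i ip => [|i] ip; last exact: eq2.
  apply: eq_bigr => k _; rewrite -/(C 0%N) -/(C' 0%N) -C00//.
  have [ko|ok] := ltnP k o'; first by rewrite low2.
  by rewrite C0z ?mul0r// ok ltn_ord.
Qed.

End orthogonal.

(** * Laws of Gaussian vectors *)

Section gaussian_vectors.
Context {R : realType} d (T : measurableType d) (P : probability T R).
Local Notation gamma := (normal_prob (0 : R) 1).
Implicit Types (B : nat -> nat -> R) (c : nat -> R) (xi : nat -> T -> R).

Lemma measurable_dot m (b : nat -> R) : measurable_fun setT (fun x : seqR R => dot m b x).
Proof.
elim: m => [|m IH].
  rewrite (_ : (fun _ : seqR R => _) = cst 0); first exact: measurable_cst.
  by apply/funext => x; rewrite /dot big_ord0.
rewrite (_ : (fun _ : seqR R => _) = (fun x : seqR R => dot m b x + b m * x m)); last first.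
  by apply/funext => x; rewrite /dot big_ord_recr.
apply: measurable_funD => //; apply: measurable_funM => //.
exact: measurable_seq_coord.
Qed.

Lemma dot_trunc m (b x : nat -> R) : dot m b (trunc_seq m x) = dot m b x.
Proof. by apply: eq_bigr => k _; rewrite /trunc_seq ltn_ord. Qed.

(** Lower orthants; they generate the sigma-algebra of sequences and are stable under intersection,
    and moving [c] by a small amount is the form in which errors in the covariance are absorbed. *)
Definition below p c (x : nat -> R) := forall i, (i < p)%N -> x i < c i.

Lemma measurable_forall_lt e (U : measurableType e) p c (F : nat -> U -> R) :
  (forall i, measurable_fun setT (F i)) -> measurable [set u | below p c (F ^~ u)].
Proof.
move=> mF; have -> : [set u | below p c (F ^~ u)] = \bigcap_(i in [set i | (i < p)%N]) (F i @^-1` `]-oo, c i[).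
  by apply/seteqP; split=> u h i ip; have := h i ip; rewrite /= in_itv.
apply: bigcap_measurableType => i _; rewrite -[X in measurable X]setTI.
exact: (mF i measurableT _ (measurable_itv _)).
Qed.

(** By [gram_equiv] both systems are the same linear forms, in two sequences with the same law. *)
Lemma gauss_gram_law m p B B' c xi : gauss_iid P m xi ->
  (forall i j, (i < p)%N -> (j < p)%N -> dot m (B i) (B j) = dot m (B' i) (B' j)) ->
  P [set w | below p c (fun i => dot m (B i) (xi ^~ w))] =
  P [set w | below p c (fun i => dot m (B' i) (xi ^~ w))].
Proof.
move=> hx gram; have [|xi' [hx' _ e]] := @gram_equiv R d T P m p 0 B B' xi _ gram hx; first by [].
pose E := [set x : seqR R | below p c (fun i => dot m (B' i) x)].
have mE : measurable E by apply: measurable_forall_lt => i; exact: measurable_dot.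
have tE z w : E (trunc_seq m (z ^~ w)) = below p c (fun i => dot m (B' i) (z ^~ w)).
  by apply/propext; split => h i ip; have := h i ip; rewrite dot_trunc.
transitivity (P [set w | E (trunc_seq m (xi' ^~ w))]).
  congr (P _); apply/seteqP; split=> w /=; rewrite tE => h i ip.
    by rewrite -e//; exact: h.
  by rewrite e//; exact: h.
rewrite (gauss_iid_law hx' hx mE); congr (P _).
by apply/seteqP; split=> w /=; rewrite tE.
Qed.

Lemma measurable_abs_gt e (U : measurableType e) (f : U -> R) (t : R) : measurable_fun setT f ->
  measurable [set u | t < `|f u|].
Proof.
move=> mf; have -> : [set u | t < `|f u|] = f @^-1` (~` `[- t, t]).
  apply/seteqP; split=> u /=; rewrite in_itv /= -ler_norml.
    by rewrite ltNge => /negP.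
  by move=> /negP; rewrite -ltNge.
by rewrite -[X in measurable X]setTI; apply: mf => //; apply: measurableC; exact: measurable_itv.
Qed.

Lemma gauss_tail (e : R) : 0 < e -> exists2 t : R, 0 < t & (gamma [set x : R | (t < `|x|)%R] <= e%:E)%E.
Proof.
move=> e0; pose F (n : nat) : set (measurableTypeR R) := [set x : R | n.+1%:R < `|x|].
have mF n : measurable (F n).
  exact: (@measurable_abs_gt _ (measurableTypeR R) id).
have capF : \bigcap_n F n = set0.
  apply/seteqP; split=> // x /(_ (Num.trunc `|x|) I); rewrite /F /=.
  by apply/negP; rewrite -leNgt ltW// truncnS_gt.
have := @nonincreasing_cvg_mu _ _ _ gamma F.
rewrite capF measure0 => H.
have : gamma \o F @ \oo --> 0%E.
  apply: H => //.
  - by apply: le_lt_trans (probability_le1 gamma _) (ltry _); exact: mF.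
  - apply/nonincreasing_seqP => n; apply/subsetPset => x; rewrite /F /=; apply: le_lt_trans.
    by rewrite ler_nat.
move=> /fine_cvgP [_ /cvgrPdist_lt /(_ e e0)] [n _ /(_ n (leqnn n))] /=.
rewrite sub0r normrN => h; exists n.+1%:R => //.
rewrite -[leLHS]fineK ?fin_num_measure ?lee_fin//; last exact: mF.
by apply: le_trans (ler_norm _) (ltW h).
Qed.

Lemma gauss_iid_coord m xi k (A : set (measurableTypeR R)) : gauss_iid P m xi -> (k < m)%N ->
  measurable A -> P (xi k @^-1` A) = gamma A.
Proof.
move=> [mx hx] km mA; pose B i := if i == k then A else setT.
have -> : xi k @^-1` A = [set w | forall i, (i < m)%N -> B i (xi i w)].
  apply/seteqP; split=> w; first by move=> h i _; rewrite /B; case: eqP => // ->.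
  by move/(_ k km); rewrite /B eqxx.
rewrite hx; last by move=> i; rewrite /B; case: ifP.
rewrite (bigD1 (Ordinal km))//= /B eqxx big1 ?mule1// => i.
by rewrite -val_eqE /= => /negbTE ->; exact: probability_setT.
Qed.

(** A symmetric matrix [D] is a difference of two Gram matrices of vectors with entries [O(sqrt
    |D|)]: for each pair [(a, b)], polarize the symmetric product of [e_a] and [e_b] with weight [D
    a b]. There is one column per pair [(a, b)], encoded as [k = a * p + b]. *)
Definition pad_col (s : bool) (D : nat -> nat -> R) p (i k : nat) : R :=
  let a := (k %/ p)%N in let b := (k %% p)%N in
  Num.sqrt `|D a b| / 2 * ((i == a)%:R + (-1) ^+ s * (if 0 <= D a b then 1 else -1) * (i == b)%:R).

Definition pad (s : bool) (D : nat -> nat -> R) p n B i : nat -> R :=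
  fun k => if (k < n)%N then B i k else pad_col s D p i (k - n).

Lemma sum_divmod p m (F : nat -> nat -> R) :
  \sum_(k < m * p) F (k %/ p)%N (k %% p)%N = \sum_(a < m) \sum_(b < p) F a b.
Proof.
elim: m => [|m IH]; first by rewrite mul0n !big_ord0.
rewrite big_ord_recr /= -IH mulSn addnC big_split_ord /=; congr (_ + _).
apply: eq_bigr => b _; have p0 : (0 < p)%N by exact: leq_trans (ltn_ord b).
by rewrite divnMDl// divn_small// addn0 modnMDl modn_small.
Qed.

Lemma dot_pad s D p n B i m (x : nat -> R) : m = (n + p * p)%N ->
  dot m (pad s D p n B i) x = dot n (B i) x + \sum_(k < p * p) pad_col s D p i k * x (n + k)%N.
Proof.
move=> ->; rewrite /dot big_split_ord /=; congr (_ + _); apply: eq_bigr => k _; rewrite /pad.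
  by rewrite ltn_ord.
by rewrite ltnNge leq_addr /= addKn.
Qed.

(** The pair [(a, b)] contributes [D a b / 2] times the symmetric product of [e_a] and [e_b] to the
    difference of the two paddings; [(a, b)] and [(b, a)] together give [D a b]. *)
Lemma pad_gram D p n B B' i j m : m = (n + p * p)%N -> (i < p)%N -> (j < p)%N ->
  (forall a b, D a b = dot n (B a) (B b) - dot n (B' a) (B' b)) ->
  dot m (pad true D p n B i) (pad true D p n B j) =
  dot m (pad false D p n B' i) (pad false D p n B' j).
Proof.
move=> mE ip jp DE; rewrite !dot_pad//.
have e s C l : dot n (C l) (pad s D p n C j) = dot n (C l) (C j).
  by apply: eq_bigr => k _; rewrite /pad ltn_ord.
have e2 s C (k : 'I_(p * p)) : pad s D p n C j (n + k)%N = pad_col s D p j k.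
  by rewrite /pad ltnNge leq_addr /= addKn.
rewrite !e; under eq_bigr do rewrite e2; under [in RHS]eq_bigr do rewrite e2.
suff : \sum_(k < p * p) pad_col false D p i k * pad_col false D p j k -
   \sum_(k < p * p) pad_col true D p i k * pad_col true D p j k = D i j.
  by rewrite DE; lra.
rewrite -sumrB.
have Ds a b : D a b = D b a by rewrite !DE dotC [dot n (B' a) _]dotC.
pose F a b := D a b / 2 * ((i == a)%:R * (j == b)%:R + (i == b)%:R * (j == a)%:R).
rewrite (eq_bigr (fun k : 'I_(p * p) => F (k %/ p)%N (k %% p)%N)); last first.
  move=> k _; rewrite /pad_col /F; set a := (k %/ p)%N; set b := (k %% p)%N.
  set w := Num.sqrt _; set sg := if _ then _ else _.
  have hD : D a b = w ^+ 2 * sg.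
    rewrite sqr_sqrtr// /sg; case: (leP 0 (D a b)) => h; first by rewrite ger0_norm// mulr1.
    by rewrite ltr0_norm// mulrN1 opprK.
  rewrite hD expr0 expr1 /=; clearbody w sg; by field.
rewrite sum_divmod.
have S1 l (G : nat -> R) : (l < p)%N -> \sum_(a < p) (l == a)%:R * G a = G l.
  move=> lp; rewrite (bigD1 (Ordinal lp))//= eqxx mul1r big1 ?addr0// => a.
  by rewrite -val_eqE /= eq_sym => /negbTE ->; rewrite mul0r.
transitivity (\sum_(a < p) ((i == a)%:R * (D a j / 2) + (j == a)%:R * (D a i / 2))).
  apply: eq_bigr => a _; rewrite -(S1 j (fun b => D a b / 2))// -(S1 i (fun b => D a b / 2))//.
  rewrite !mulr_sumr -big_split /=; apply: eq_bigr => b _; rewrite /F; ring.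
by rewrite big_split /= (S1 i (fun a => D a j / 2))// (S1 j (fun a => D a i / 2))// (Ds j i); field.
Qed.

Lemma pad_col_le s D p i k (e : R) : 0 <= e -> (forall a b, (a < p)%N -> (b < p)%N -> `|D a b| <= e ^+ 2) ->
  (k < p * p)%N -> `|pad_col s D p i k| <= e.
Proof.
move=> e0 De kp; rewrite /pad_col; set a := (k %/ p)%N; set b := (k %% p)%N.
have p0 : (0 < p)%N by rewrite lt0n; apply: contraTneq kp => ->.
have wle : Num.sqrt `|D a b| <= e.
  rewrite -[leRHS](ger0_norm e0) -[leRHS]sqrtr_sqr ler_sqrt ?sqr_ge0//; apply: De; last exact: ltn_pmod.
  by rewrite ltn_divLR.
rewrite normrM (le_trans (ler_pM _ _ (lexx _) (_ : _ <= 2)))//.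
  apply: le_trans (ler_normD _ _) _; rewrite (_ : 2 = 1 + 1)//; apply: lerD.
    by case: eqP; rewrite ?normr1 ?normr0.
  rewrite !normrM normrX normrN normr1 expr1n mul1r.
  have -> : `|if 0 <= D a b then 1 else -1| = 1 :> R by case: ifP; rewrite ?normrN normr1.
  by case: eqP; rewrite mul1r ?normr1 ?normr0.
by rewrite ger0_norm ?divr_ge0// divfK.
Qed.

Lemma measurable_event_dot m n (b : nat -> R) xi (t : R) : (forall k, measurable_fun setT (xi k)) ->
  measurable [set w | t < `|\sum_(k < m) b k * xi (n + k)%N w|].
Proof.
move=> mx; apply: measurable_abs_gt; apply: measurable_sum => k.
by apply: measurable_funM.
Qed.

(** Each coordinate is bounded by some [t] outside a set of small probability; then the combination
    is small if its coefficients are. The point is that [e] depends on the number [q] of terms, not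
    on [n] or [m]. *)
Lemma small_combination (q : nat) (dl ep : R) : 0 < dl -> 0 < ep -> exists2 e : R, 0 < e &
  forall m n xi (b : nat -> R), gauss_iid P m xi -> (n + q <= m)%N ->
    (forall k, (k < q)%N -> `|b k| <= e) ->
    (P [set w | (dl < `|\sum_(k < q) b k * xi (n + k)%N w|)%R] <= ep%:E)%E.
Proof.
move=> dl0 ep0; have q1 : 0 < q.+1%:R :> R by [].
have [|t t0 ht] := @gauss_tail (ep / q.+1%:R); first by rewrite divr_gt0.
exists (dl / (q.+1%:R * t)); first by rewrite divr_gt0// mulr_gt0.
move=> m n xi b hx nq hb; have [mx _] := hx.
have mt : measurable [set x : measurableTypeR R | t < `|x|].
  exact: (@measurable_abs_gt _ (measurableTypeR R) id).
have mk (k : 'I_q) : measurable (xi (n + k)%N @^-1` [set x : R | t < `|x|]).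
  by rewrite -[X in measurable X]setTI; exact: (mx _ measurableT _ mt).
apply: (@le_trans _ _ (P (\big[setU/set0]_(k < q) (xi (n + k)%N @^-1` [set x : R | t < `|x|])))).
  apply: le_measure; rewrite ?inE.
  - exact: measurable_event_dot.
  - by apply: bigsetU_measurable => k _.
  - move=> w /= hw; apply: contrapT => hn; move: hw; apply/negP; rewrite -leNgt.
    apply: le_trans (ler_norm_sum _ _ _) _.
    apply: (@le_trans _ _ (\sum_(k < q) dl / q.+1%:R)).
      apply: ler_sum => k _; rewrite normrM.
      have ht' : `|xi (n + k)%N w| <= t.
        rewrite leNgt; apply/negP => h; apply: hn; rewrite -(bigcup_mkord q (fun k => xi (n + k)%N @^-1` [set x : R | t < `|x|])); exists k => //=.
      apply: le_trans (ler_pM _ _ (hb _ (ltn_ord k)) ht') _ => //.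
      by rewrite invfM mulrA mulfVK ?gt_eqF.
    rewrite sumr_const card_ord -[_ *+ q]mulr_natr -mulrA ger_pMr// mulrC ler_pdivrMr// mul1r.
    by rewrite ler_nat.
have mk' k : (k < q)%N -> measurable (xi (n + k)%N @^-1` [set x : R | t < `|x|]) by move=> kq; exact: (mk (Ordinal kq)).
apply: le_trans (Boole_inequality P mk') _.
apply: (@le_trans _ _ (\sum_(k < q) (ep / q.+1%:R)%:E)%E).
  apply: lee_sum => k _; apply: le_trans ht.
  have km : (n + k < m)%N by apply: leq_trans nq; rewrite ltn_add2l.
  have h := gauss_iid_coord hx km mt.
  by rewrite le_eqVlt; apply/orP; left; apply/eqP; exact: h.
rewrite sumEFin lee_fin sumr_const card_ord -[_ *+ q]mulr_natr -mulrA ger_pMr// mulrC ler_pdivrMr// mul1r.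
by rewrite ler_nat.
Qed.

(** Pad both systems to equal Gram matrices, at the cost of an error that is small in probability,
    uniformly in the number [n] of variables. *)
Lemma gauss_gram_close (p : nat) (dl ep : R) : 0 < dl -> 0 < ep -> exists2 e : R, 0 < e &
  forall n xi B B' c, gauss_iid P (n + p * p) xi ->
    (forall i j, (i < p)%N -> (j < p)%N -> `|dot n (B i) (B j) - dot n (B' i) (B' j)| <= e) ->
    (P [set w | below p c (fun i => dot n (B i) (xi ^~ w))] <=
     P [set w | below p (fun i => (c i + dl)%R) (fun i => dot n (B' i) (xi ^~ w))] + ep%:E)%E.
Proof.
move=> dl0 ep0; have dl2 : 0 < dl / 2 by rewrite divr_gt0.
have q1 : 0 < (p + p).+1%:R :> R by [].
have [|e e0 he] := @small_combination (p * p) (dl / 2) (ep / (p + p).+1%:R) dl2; first by rewrite divr_gt0.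
exists (e ^+ 2); first by rewrite exprn_gt0.
move=> n xi B B' c hx hB; have [mx _] := hx.
pose D a b := dot n (B a) (B b) - dot n (B' a) (B' b).
set m := (n + p * p)%N in hx.
have gram i j : (i < p)%N -> (j < p)%N -> dot m (pad true D p n B i) (pad true D p n B j) =
    dot m (pad false D p n B' i) (pad false D p n B' j) by move=> ip jp; exact: pad_gram.
pose bad s i := [set w | dl / 2 < `|\sum_(k < p * p) pad_col s D p i k * xi (n + k)%N w|].
have mbad s i : measurable (bad s i) by exact: (@measurable_event_dot _ _ (pad_col s D p i)).
have Pbad s i : (P (bad s i) <= (ep / (p + p).+1%:R)%:E)%E.
  apply: (he m n xi (pad_col s D p i)) => // k kp; apply: pad_col_le => //; exact: ltW.
pose Bad s := \big[setU/set0]_(i < p) bad s i.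
have mBad s : measurable (Bad s) by apply: bigsetU_measurable => i _.
have PBad s : (P (Bad s) <= (p%:R * (ep / (p + p).+1%:R))%:E)%E.
  apply: le_trans (Boole_inequality P (fun i _ => mbad s i)) _.
  apply: (@le_trans _ _ (\sum_(i < p) (ep / (p + p).+1%:R)%:E)%E); first by apply: lee_sum => i _; exact: Pbad.
  by rewrite sumEFin lee_fin sumr_const card_ord mulr_natl.
have notBad s w i : ~ Bad s w -> (i < p)%N ->
    `|\sum_(k < p * p) pad_col s D p i k * xi (n + k)%N w| <= dl / 2.
  move=> nb ip; rewrite leNgt; apply/negP => h; apply: nb; rewrite /Bad -bigcup_mkord.
  by exists i.
have mdot k b : measurable_fun setT (fun w => dot k b (xi ^~ w)).
  by apply: measurable_sum => i; apply: measurable_funM.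
pose E0 := [set w | below p c (fun i => dot n (B i) (xi ^~ w))].
pose c1 i := c i + dl / 2.
pose E1 := [set w | below p c1 (fun i => dot m (pad true D p n B i) (xi ^~ w))].
pose E2 := [set w | below p c1 (fun i => dot m (pad false D p n B' i) (xi ^~ w))].
pose E3 := [set w | below p (fun i => c i + dl) (fun i => dot n (B' i) (xi ^~ w))].
have E01 : E0 `<=` E1 `|` Bad true.
  move=> w hw; have [|nb] := pselect (Bad true w); first by right.
  left=> i ip; rewrite dot_pad// /c1; have := notBad true w i nb ip; have := hw i ip.
  by move=> h1 h2; have := ler_norm (\sum_(k < p * p) pad_col true D p i k * xi (n + k)%N w); lra.
have E23 : E2 `<=` E3 `|` Bad false.
  move=> w hw; have [|nb] := pselect (Bad false w); first by right.
  left=> i ip; have := notBad false w i nb ip; have := hw i ip; rewrite dot_pad// /c1.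
  rewrite ler_norml => h1 /andP [h2 h3]; lra.
have mE0 : measurable E0 by apply: measurable_forall_lt => i; exact: mdot.
have mE1 : measurable E1 by apply: measurable_forall_lt => i; exact: mdot.
have mE2 : measurable E2 by apply: measurable_forall_lt => i; exact: mdot.
have mE3 : measurable E3 by apply: measurable_forall_lt => i; exact: mdot.
have E12 : P E1 = P E2 by exact: (@gauss_gram_law m p).
have U2 (A C A' : set T) : measurable A -> measurable C -> measurable A' -> A `<=` A' `|` C ->
    (P A <= P A' + P C)%E.
  move=> mA mC mA' sub; apply: (@le_trans _ _ (P (A' `|` C))).
    by apply: le_measure; rewrite ?inE//; exact: measurableU.
  exact: measureU2.
apply: le_trans (U2 E0 (Bad true) E1 mE0 (mBad _) mE1 E01) _; rewrite E12.
apply: le_trans (leeD2r _ (U2 E2 (Bad false) E3 mE2 (mBad _) mE3 E23)) _.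
rewrite -addeA; apply: leeD2l; apply: le_trans (leeD (PBad _) (PBad _)) _.
rewrite -EFinD lee_fin -mulrDl -natrD mulrCA ger_pMr// ler_pdivrMr// mul1r.
by rewrite ler_nat.
Qed.

End gaussian_vectors.

(** * A maximal inequality for Gaussian quadratic forms *)

Section second_moment.
Context {R : realType} d (T : measurableType d) (P : probability T R).
Local Notation mu := (@lebesgue_measure R).
Local Notation gamma := (normal_prob (0 : R) 1).

(** By [y <= e^y], the factor [x^2] is absorbed by half of the exponent, which leaves the density of
    variance 2. *)
Lemma sqr_pdf_le (x : R) : x ^+ 2 * normal_pdf 0 1 x <=
  4 * normal_peak 1 / normal_peak (Num.sqrt 2) * normal_pdf 0 (Num.sqrt 2) x.
Proof.
have s20 : Num.sqrt 2 != 0 :> R by rewrite sqrtr_eq0 -ltNge.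
rewrite !normal_pdfE ?oner_eq0// /normal_fun !subr0 expr1n sqr_sqrtr//.
rewrite mulrA divfK ?gt_eqF ?normal_peak_gt0//.
have -> : 2 *+ 2 = 4 :> R by rewrite -mulrnA.
have -> : - x ^+ 2 / 2 = - (x ^+ 2 / 4) + - x ^+ 2 / 4 by lra.
rewrite expRD; set e := expR (- x ^+ 2 / 4); set p : R := normal_peak 1.
have pe0 : 0 <= p * e by rewrite mulr_ge0 ?normal_peak_ge0 ?expR_ge0.
have h : x ^+ 2 * expR (- (x ^+ 2 / 4)) <= 4.
  by rewrite expRN ler_pdivrMr ?expR_gt0//; have := expR_ge1Dx (x ^+ 2 / 4); lra.
have := ler_wpM2l pe0 h; move: (expR _) => E1; clearbody p e; move: (x ^+ 2) => y; lra.
Qed.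

Lemma layer_gamma_bounded : exists2 C : R, 0 <= C & forall N,
  (\sum_(k < N) gamma [set x : R | (k.+1%:R <= x ^+ 2)%R] <= C%:E)%E.
Proof.
pose K : R := 4 * normal_peak 1 / normal_peak (Num.sqrt 2).
have K0 : 0 <= K by rewrite divr_ge0 ?mulr_ge0 ?normal_peak_ge0.
have s20 : Num.sqrt 2 != 0 :> R by rewrite sqrtr_eq0 -ltNge.
exists K => // N.
have mx2 : measurable_fun setT (fun x : measurableTypeR R => x ^+ 2 : measurableTypeR R).
  by apply: measurable_funX; exact: measurable_id.
have mS k : measurable [set x : measurableTypeR R | k.+1%:R <= x ^+ 2].
  have := mx2 measurableT `[k.+1%:R, +oo[%classic (measurable_itv _).
  by rewrite setTI; congr measurable; apply/seteqP; split=> w /=; rewrite in_itv /= andbT.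
have mphi s : measurable_fun setT (fun x => (normal_pdf (0 : R) s x)%:E).
  by apply/measurable_EFinP; exact: measurable_normal_pdf.
apply: (@le_trans _ _ (\int[mu]_x (layers N 1 (x ^+ 2) * normal_pdf 0 1 x)%:E)%E).
  rewrite le_eqVlt; apply/orP; left; apply/eqP.
  transitivity (\int[mu]_x \sum_(k < N) (\1_[set x : R | k.+1%:R <= x ^+ 2] x * normal_pdf 0 1 x)%:E)%E.
    rewrite ge0_integral_sum//; first last.
    - by move=> k x _; rewrite lee_fin mulr_ge0 ?normal_pdf_ge0// indicE.
    - move=> k; apply/measurable_EFinP; apply: measurable_funM; last exact: measurable_normal_pdf.
      exact: measurable_indic.
    by apply: eq_bigr => k _; rewrite /= /normal_prob integral_patch_indic.
  apply: eq_integral => x _; rewrite sumEFin -mulr_suml; congr (_ * _)%:E.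
  apply: eq_bigr => k _; rewrite mul1r mulr1 indicE; congr (nat_of_bool _)%:R.
  by apply/idP/idP; rewrite inE.
apply: (@le_trans _ _ (\int[mu]_x (K%:E * (normal_pdf 0 (Num.sqrt 2) x)%:E))%E); last first.
  rewrite ge0_integralZl_EFin//; try exact: mphi; try by move=> x _; rewrite lee_fin normal_pdf_ge0.
  by rewrite integral_normal_pdf mule1.
apply: ge0_le_integral => //.
- by move=> x _; rewrite lee_fin mulr_ge0 ?normal_pdf_ge0// layers_ge0.
- apply/measurable_EFinP; apply: measurable_funM; last exact: measurable_normal_pdf.
  apply: measurable_sum => k; apply: measurable_funM => //.
  rewrite (_ : (fun x => _) = \1_[set x : measurableTypeR R | k.+1%:R <= x ^+ 2]); first exact: measurable_indic.
  apply/funext => x; rewrite indicE mulr1; congr (nat_of_bool _)%:R.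
  by apply/idP/idP; rewrite inE.
- by apply: measurable_funeM; exact: mphi.
- move=> x _; rewrite -EFinM lee_fin; apply: le_trans (sqr_pdf_le x).
  apply: ler_wpM2r; first exact: normal_pdf_ge0.
  apply: le_trans (layers_le _ _ ler01) _; by rewrite max_l// sqr_ge0.
Qed.

(** The variance enters only as a finite bound. The bound is obtained by layers, since [gauss_iid]
    speaks of probabilities of events. *)
Lemma second_moment : exists2 v : R, 0 <= v & forall m xi k, gauss_iid P m xi -> (k < m)%N ->
  (\int[P]_w (xi k w ^+ 2)%:E <= v%:E)%E.
Proof.
have [C C0 hC] := layer_gamma_bounded; exists (1 + C); first by rewrite addr_ge0.
move=> m xi k hx km; have [mx _] := hx.
have mxi2 : measurable_fun setT (fun w => xi k w ^+ 2) by apply: measurable_funX; exact: mx.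
have mA N : measurable [set w | xi k w ^+ 2 <= N%:R].
  have := mxi2 measurableT `]-oo, N%:R]%classic (measurable_itv _).
  by rewrite setTI; congr measurable; apply/seteqP; split=> w /=; rewrite in_itv.
pose g N w := (xi k w ^+ 2 * \1_[set w | xi k w ^+ 2 <= N%:R] w)%:E : \bar R.
have mg N : measurable_fun setT (g N).
  by apply/measurable_EFinP; apply: measurable_funM => //; exact: measurable_indic.
have g0 N w : setT w -> (0 <= g N w)%E by rewrite lee_fin mulr_ge0 ?sqr_ge0// indicE.
have gnd w : setT w -> {homo (g ^~ w) : a b / (a <= b)%N >-> (a <= b)%E}.
  move=> _ a b ab; rewrite lee_fin ler_wpM2l ?sqr_ge0// !indicE ler_nat.
  case: (boolP (w \in _)) => // /set_mem /= h; rewrite mem_set//=.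
  by apply: le_trans h _; rewrite ler_nat.
have glim w : limn (g ^~ w) = (xi k w ^+ 2)%:E.
  apply/cvg_lim => //; apply: cvg_near_cst; exists (Num.trunc (xi k w ^+ 2)).+1 => // N /= hN.
  rewrite /g indicE mem_set ?mulr1//=; apply: (@le_trans _ _ ((Num.trunc (xi k w ^+ 2)).+1%:R)).
    by rewrite ltW// truncnS_gt.
  by rewrite ler_nat.
have -> : (\int[P]_w (xi k w ^+ 2)%:E = \int[P]_w limn (g ^~ w))%E.
  by apply: eq_integral => w _; rewrite glim.
rewrite (monotone_convergence P measurableT mg g0 gnd).
apply: lime_le.
  apply: ereal_nondecreasing_is_cvgn => a b ab; apply: ge0_le_integral => //.
    by move=> w _; exact: g0.
  by move=> w _; exact: gnd.
apply: nearW => N.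
have mL j : measurable (xi k @^-1` [set x : R | j.+1%:R <= x ^+ 2]).
  have := mxi2 measurableT `[j.+1%:R, +oo[%classic (measurable_itv _).
  by rewrite setTI; congr measurable; apply/seteqP; split=> w /=; rewrite in_itv /= andbT.
have mS j : measurable [set x : measurableTypeR R | j.+1%:R <= x ^+ 2].
  have mx2 : measurable_fun setT (fun x : measurableTypeR R => x ^+ 2 : measurableTypeR R).
    by apply: measurable_funX; exact: measurable_id.
  have := mx2 measurableT `[j.+1%:R, +oo[%classic (measurable_itv _).
  by rewrite setTI; congr measurable; apply/seteqP; split=> w /=; rewrite in_itv /= andbT.
have LE w : (\sum_(j < N) (\1_(xi k @^-1` [set x : R | j.+1%:R <= x ^+ 2]) w)%:E = (layers N 1 (xi k w ^+ 2))%:E)%E.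
  rewrite sumEFin; congr _%:E; apply: eq_bigr => j _; rewrite mul1r mulr1 indicE; congr (nat_of_bool _)%:R.
  by apply/idP/idP; rewrite inE.
apply: (@le_trans _ _ (\int[P]_w (1%:E + \sum_(j < N) (\1_(xi k @^-1` [set x : R | j.+1%:R <= x ^+ 2]) w)%:E))%E).
  apply: ge0_le_integral => //.
  - by move=> w _; exact: g0.
  - apply: emeasurable_funD => //; apply: emeasurable_sum => j; apply/measurable_EFinP; exact: measurable_indic.
  - move=> w _; rewrite LE -EFinD lee_fin indicE; case: (boolP (w \in _)) => [/set_mem /= h|_].
      by rewrite mulr1; apply: le_layers => //; rewrite mulr1.
    by rewrite mulr0 addr_ge0// layers_ge0.
rewrite ge0_integralD//; first last.
- by apply: emeasurable_sum => j; apply/measurable_EFinP; exact: measurable_indic.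
- by move=> w _; rewrite LE lee_fin layers_ge0.
rewrite integral_cst// EFinD; apply: leeD.
  by rewrite mul1e; exact: probability_le1.
rewrite ge0_integral_sum//; last first.
  by move=> j; apply/measurable_EFinP; exact: measurable_indic.
apply: le_trans (hC N); apply: lee_sum => j _; rewrite integral_indic// setIT.
have h := gauss_iid_coord hx km (mS j).
by rewrite le_eqVlt; apply/orP; left; apply/eqP; exact: h.
Qed.

End second_moment.
Section levy.
Context {R : realType} d (T : measurableType d) (P : probability T R).

Lemma gauss_iid_integral m (xi xi' : nat -> T -> R) (G : seqR R -> R) :
  gauss_iid P m xi -> gauss_iid P m xi' -> measurable_fun setT G -> (forall x, 0 <= G x) ->
  (forall x, G (trunc_seq m x) = G x) ->
  (\int[P]_w (G (xi ^~ w))%:E = \int[P]_w (G (xi' ^~ w))%:E)%E.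
Proof.
move=> hx hx' mG G0 Gt.
pose Z (z : nat -> T -> R) w : seqR R := trunc_seq m (z ^~ w).
have mZ := measurable_trunc m hx.1; have mZ' := measurable_trunc m hx'.1.
have mG' : measurable_fun setT (EFin \o G) by exact/measurable_EFinP.
have G0' : {in [set: seqR R], forall y, (0 <= (EFin \o G) y)%E} by move=> y _; rewrite lee_fin.
have := @ge0_integral_pushforward _ _ _ _ R (Z xi) mZ P setT (EFin \o G) measurableT mG' G0'.
have := @ge0_integral_pushforward _ _ _ _ R (Z xi') mZ' P setT (EFin \o G) measurableT mG' G0'.
rewrite !preimage_setT => e' e.
transitivity (\int[P]_w (EFin \o G \o Z xi) w)%E; first by apply: eq_integral => w _; rewrite /= Gt.
rewrite -e; transitivity (\int[P]_w (EFin \o G \o Z xi') w)%E; last by apply: eq_integral => w _; rewrite /= Gt.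
rewrite -e'; apply: eq_measure_integral => A mA _.
exact: (gauss_iid_law hx hx').
Qed.

Section quadratic.
Variable q : nat -> nat -> R.

(** In the application [q] is the matrix of inner products of sections over a patch, and [qform q m
    x] is the squared norm of the [m]-th partial sum. *)
Definition qform m (x : nat -> R) : R := \sum_(i < m) \sum_(j < m) q i j * (x i * x j).

Hypothesis q_ge0 : forall m x, 0 <= qform m x.

Lemma qform_ext m x y : (forall k, (k < m)%N -> x k = y k) -> qform m x = qform m y.
Proof. by move=> xy; apply: eq_bigr => i _; apply: eq_bigr => j _; rewrite !xy. Qed.

Lemma qform_trunc m k x : (k <= m)%N -> qform m (trunc_seq k x) = qform k x.
Proof.
move=> km; have S (F : nat -> R) : (forall i, (k <= i)%N -> F i = 0) -> \sum_(i < m) F i = \sum_(i < k) F i.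
  move=> F0; rewrite -(subnKC km) big_split_ord /= [X in _ + X]big1 ?addr0// => i _.
  by apply: F0; rewrite leq_addr.
rewrite /qform (S (fun i => \sum_(j < m) q i j * (trunc_seq k x i * trunc_seq k x j))); last first.
  by move=> i ki; apply: big1 => j _; rewrite /trunc_seq ltnNge ki mul0r mulr0.
apply: eq_bigr => i _; rewrite (S (fun j => q i j * (trunc_seq k x i * trunc_seq k x j))); last first.
  by move=> j kj; rewrite [trunc_seq k x j]/trunc_seq ltnNge kj !mulr0.
by apply: eq_bigr => j _; rewrite /trunc_seq !ltn_ord.
Qed.

Lemma parallelogram m x y :
  qform m (fun k => x k + y k) + qform m (fun k => x k - y k) = 2 * qform m x + 2 * qform m y.
Proof.
rewrite /qform !mulr_sumr -!big_split /=; apply: eq_bigr => i _.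
by rewrite !mulr_sumr -!big_split /=; apply: eq_bigr => j _; ring.
Qed.

Lemma measurable_qform m : measurable_fun setT (qform m : seqR R -> R).
Proof.
apply: measurable_sum => i; apply: measurable_sum => j.
by apply: measurable_funM => //; apply: measurable_funM; exact: measurable_seq_coord.
Qed.

Lemma qform_diag_ge0 i : 0 <= q i i.
Proof.
have := q_ge0 i.+1 (fun k => (k == i)%:R).
rewrite /qform (bigD1 ord_max)//= (bigD1 ord_max)//= eqxx !mulr1 !big1 ?addr0//.
  move=> k; rewrite -val_eqE /= => /negbTE ->; apply: big1 => j _; by rewrite mul0r mulr0.
by move=> k; rewrite -val_eqE /= => /negbTE ->; rewrite !mulr0.
Qed.

(** Changing the signs of the terms from [k] on preserves the law of independent Gaussians: the
    source of all the inequalities below. *)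
Definition flip_from (k : nat) (x : nat -> R) : nat -> R := fun i => if (k <= i)%N then - x i else x i.

(** Parallelogram identity: the partial sum up to [k] is the mean of the sum up to [m] and its
    reflection at [k]. *)
Lemma qform_flip_from m k x : (k <= m)%N ->
  2 * qform k x <= qform m x + qform m (flip_from k x).
Proof.
move=> km; pose y i := if (k <= i)%N then x i else 0.
have := parallelogram m (trunc_seq k x) y.
rewrite (qform_ext (y := x)); last first.
  by move=> i _; rewrite /trunc_seq /y; case: ltnP; rewrite ?addr0 ?add0r.
rewrite (qform_ext (x := fun i => _ - _) (y := flip_from k x)); last first.
  by move=> i _; rewrite /trunc_seq /y /flip_from; case: ltnP; rewrite ?subr0 ?sub0r.
by move=> ->; rewrite (qform_trunc x km) lerDl mulr_ge0.
Qed.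

Lemma qform_flip_last m x :
  qform m.+1 x + qform m.+1 (flip_from m x) = 2 * qform m x + 2 * (q m m * x m ^+ 2).
Proof.
pose y i := if (m <= i)%N then x i else 0.
have := parallelogram m.+1 (trunc_seq m x) y.
rewrite (qform_ext (y := x)); last first.
  by move=> i _; rewrite /trunc_seq /y; case: ltnP; rewrite ?addr0 ?add0r.
rewrite (qform_ext (x := fun i => _ - _) (y := flip_from m x)); last first.
  by move=> i _; rewrite /trunc_seq /y /flip_from; case: ltnP; rewrite ?subr0 ?sub0r.
move=> ->; rewrite (qform_trunc x (leqnSn m)); congr (_ + 2 * _).
rewrite /qform (bigD1 ord_max)//= (bigD1 ord_max)//= /y leqnn !big1 ?addr0 ?expr2//.
  by move=> k; rewrite -val_eqE /= => /eqP kn; apply: big1 => j _; rewrite leqNgt ltn_neqAle (introN eqP kn) -ltnS ltn_ord mul0r mulr0.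
by move=> k; rewrite -val_eqE /= => /eqP kn; rewrite [(m <= k)%N]leqNgt ltn_neqAle (introN eqP kn) -ltnS ltn_ord !mulr0.
Qed.

Lemma flip_from_iid m k xi : gauss_iid P m xi -> gauss_iid P m (fun i w => flip_from k (xi ^~ w) i).
Proof. by move=> hx; exact: (gauss_iid_flip (fun i => (k <= i)%N) hx). Qed.

(** The cross terms with the last variable cancel on average under reflection. *)
Lemma qform_expectation (v : R) m xi : 0 <= v ->
  (forall m xi k, gauss_iid P m xi -> (k < m)%N -> (\int[P]_w (xi k w ^+ 2)%:E <= v%:E)%E) ->
  gauss_iid P m xi -> (\int[P]_w (qform m (xi ^~ w))%:E <= (v * \sum_(i < m) q i i)%:E)%E.
Proof.
move=> v0 hv; elim: m => [|m IH] hx.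
  under eq_integral do rewrite /qform big_ord0.
  by rewrite integral0 big_ord0 mulr0.
have [mx _] := hx.
have mQ k (z : nat -> T -> R) : (forall i, measurable_fun setT (z i)) -> measurable_fun setT (fun w => (qform k (z ^~ w))%:E).
  move=> mz; apply/measurable_EFinP.
  apply: measurable_sum => i; apply: measurable_sum => j.
  by apply: measurable_funM => //; apply: measurable_funM.
have hf := flip_from_iid m hx.
have eqf : (\int[P]_w (qform m.+1 (flip_from m (xi ^~ w)))%:E = \int[P]_w (qform m.+1 (xi ^~ w))%:E)%E.
  apply: (gauss_iid_integral (G := qform m.+1) hf hx) => //; first exact: measurable_qform.
  by move=> x; exact: qform_trunc.
have m2 : measurable_fun setT (fun w => (xi m w ^+ 2)%:E).
  by apply/measurable_EFinP; apply: measurable_funX; exact: mx.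
have key : (2%:E * \int[P]_w (qform m.+1 (xi ^~ w))%:E =
   2%:E * \int[P]_w (qform m (xi ^~ w))%:E + 2%:E * ((q m m)%:E * \int[P]_w (xi m w ^+ 2)%:E))%E.
  have -> : (2%:E * \int[P]_w (qform m.+1 (xi ^~ w))%:E = \int[P]_w (qform m.+1 (xi ^~ w))%:E + \int[P]_w (qform m.+1 (xi ^~ w))%:E)%E.
    by rewrite -mule2n muleC mule_natr.
  rewrite -{2}eqf -ge0_integralD//; try (by move=> w _; rewrite lee_fin); try exact: mQ; last first.
    by apply: mQ; case: hf.
  under eq_integral do rewrite -EFinD qform_flip_last EFinD !EFinM.
  rewrite ge0_integralD//; first last.
  - by apply: measurable_funeM; apply: measurable_funeM.
  - by move=> w _; rewrite -!EFinM lee_fin mulr_ge0// mulr_ge0 ?sqr_ge0 ?qform_diag_ge0.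
  - by apply: measurable_funeM; exact: mQ.
  - by move=> w _; rewrite -EFinM lee_fin mulr_ge0.
  rewrite !ge0_integralZl_EFin ?qform_diag_ge0//; try exact: mQ; try exact: measurable_funeM;
    try (by move=> w _; rewrite lee_fin ?sqr_ge0); by move=> w _; rewrite -EFinM lee_fin mulr_ge0 ?sqr_ge0 ?qform_diag_ge0.
have two : (0 < 2%:E :> \bar R)%E by [].
rewrite -(@lee_pmul2l _ 2%:E)// key -ge0_muleDr; first last.
- by rewrite mule_ge0 ?lee_fin ?qform_diag_ge0//; apply: integral_ge0 => w _; rewrite lee_fin sqr_ge0.
- by apply: integral_ge0 => w _; rewrite lee_fin.
rewrite lee_pmul2l// big_ord_recr /= mulrDr EFinD; apply: leeD.
  by apply: IH; exact: gauss_iid_le hx.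
rewrite [X in (_ <= X)%E]EFinM muleC [X in (_ <= X)%E]muleC [X in (_ <= X)%E]muleC.
apply: lee_wpmul2r; first by rewrite lee_fin qform_diag_ge0.
exact: (hv m.+1).
Qed.

Lemma qform_flip_low k l x : (l <= k)%N -> qform l (flip_from k x) = qform l x.
Proof. by move=> lk; apply: qform_ext => i il; rewrite /flip_from leqNgt (leq_trans il lk). Qed.

(** Levy: let [A k] be the event that [k] is the first index at which the form exceeds [t]. On [A
    k], either the final value or its reflection from [k] on exceeds [t], by the parallelogram
    identity; both cases have the same probability since [A k] only involves the terms before [k].
    *)
Lemma levy_inequality m xi (t : R) : gauss_iid P m xi ->
  (P [set w | exists2 k, (k <= m)%N & (t < qform k (xi ^~ w))%R] <=
   2%:E * P [set w | (t < qform m (xi ^~ w))%R])%E.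
Proof.
move=> hx; have [mx _] := hx.
pose A k : set (seqR R) := [set x | (forall l, (l < k)%N -> qform l x <= t) /\ t < qform k x].
pose F : set (seqR R) := [set x | t < qform m x].
have mgt k : measurable [set x : seqR R | t < qform k x].
  have := @measurable_qform k measurableT `]t, +oo[%classic (measurable_itv _).
  by rewrite setTI; congr measurable; apply/seteqP; split=> w /=; rewrite in_itv /= andbT.
have mle k : measurable [set x : seqR R | qform k x <= t].
  have := @measurable_qform k measurableT `]-oo, t]%classic (measurable_itv _).
  by rewrite setTI; congr measurable; apply/seteqP; split=> w /=; rewrite in_itv.
have mA k : measurable (A k).
  have -> : A k = (\bigcap_(l in [set l | (l < k)%N]) [set x : seqR R | qform l x <= t]) `&` [set x | t < qform k x].
    by apply/seteqP; split.
  by apply: measurableI => //; apply: bigcap_measurableType => l _.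
have mF : measurable F by exact: mgt.
pose pre (E : set (seqR R)) : set T := [set w | E (xi ^~ w)].
have mpre E : measurable E -> measurable (pre E).
  move=> mE; rewrite -[X in measurable X]setTI.
  have mxi : measurable_fun setT (fun w => xi ^~ w : seqR R) by exact: measurable_to_seq.
  exact: (mxi measurableT E mE).
have half k : (k <= m)%N -> (P (pre (A k)) <= 2%:E * P (pre (A k `&` F)))%E.
  move=> km; pose F' : set (seqR R) := [set x | t < qform m (flip_from k x)].
  have mflip : measurable_fun setT (fun x : seqR R => flip_from k x : seqR R).
    apply: measurable_to_seq => i; rewrite /flip_from; case: (k <= i)%N; last exact: measurable_seq_coord.
    rewrite (_ : (fun x : seqR R => - x i) = (fun x : seqR R => 0 - x i)); last first.
      by apply/funext => x; rewrite sub0r.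
    by apply: measurable_funB => //; exact: measurable_seq_coord.
  have mF' : measurable F'.
    rewrite (_ : F' = setT `&` (fun x : seqR R => flip_from k x : seqR R) @^-1` F); last by rewrite setTI.
    exact: (mflip measurableT F mF).
  have sub : pre (A k) `<=` pre (A k `&` F) `|` pre (A k `&` F').
    move=> w [h1 h2]; have h3 := qform_flip_from (xi ^~ w) km.
    have [Fw|nF] := pselect (F (xi ^~ w)); first by left.
    right; split => //; rewrite /F' /=.
    move/negP: nF; rewrite /F /= -leNgt => nF; lra.
  have e : P (pre (A k `&` F')) = P (pre (A k `&` F)).
    have mE : measurable (A k `&` F) by exact: measurableI.
    have Et (z : nat -> R) : (A k `&` F) (trunc_seq m z) <-> (A k `&` F) z.
      have qt l x : (l <= m)%N -> qform l (trunc_seq m x) = qform l x.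
        by move=> lm; apply: qform_ext => i il; rewrite /trunc_seq (leq_trans il lm).
      split; move=> [[h1 h2] h3].
        split; [split|]; [|by move: h2; rewrite qt|by move: h3; rewrite /F /= qt].
        by move=> l lk; rewrite -(qt l) ?(leq_trans (ltnW lk) km)//; exact: h1.
      split; [split|]; [|by rewrite qt|by rewrite /F /= qt].
      by move=> l lk; rewrite qt ?(leq_trans (ltnW lk) km)//; exact: h1.
    have := gauss_iid_law (flip_from_iid k hx) hx mE.
    rewrite (_ : [set w | _] = pre (A k `&` F')); last first.
      apply/seteqP; split=> w /=.
        move=> /(Et (flip_from k (xi ^~ w))) [[h1 h2] h3]; split => //; split; last by rewrite -(@qform_flip_low k k).
        by move=> l lk; rewrite -(@qform_flip_low k l) ?(ltnW lk)//; exact: h1.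
      move=> [[h1 h2] h3]; apply/(Et (flip_from k (xi ^~ w))); split => //; split; last by rewrite (@qform_flip_low k k).
      by move=> l lk; rewrite (@qform_flip_low k l) ?(ltnW lk)//; exact: h1.
    move=> ->; congr (P _); apply/seteqP; split=> w /=; first by move/(Et (xi ^~ w)).
    by move=> h; apply/(Et (xi ^~ w)).
  apply: (@le_trans _ _ (P (pre (A k `&` F) `|` pre (A k `&` F')))).
    by apply: le_measure; rewrite ?inE//; [apply: mpre|apply: measurableU; apply: mpre; exact: measurableI].
  apply: le_trans (measureU2 _ _ _) _; try (by apply: mpre; exact: measurableI).
  rewrite [X in (_ <= X)%E](_ : _ = P (pre (A k `&` F)) + P (pre (A k `&` F)))%E.
    by apply: leeD => //; rewrite le_eqVlt; apply/orP; left; apply/eqP; exact: e.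
  by rewrite -mule2n muleC mule_natr.
have cover : [set w | exists2 k, (k <= m)%N & (t < qform k (xi ^~ w))%R] `<=`
    \big[setU/set0]_(k < m.+1) pre (A k).
  move=> w [k km hk]; rewrite -(bigcup_mkord m.+1 (fun k => pre (A k))).
  have ex : exists k, t < qform k (xi ^~ w) by exists k.
  have [k0 hk0 min0] := ex_minnP ex; exists k0; first by rewrite /= ltnS (leq_trans (min0 _ hk)).
  split => // l lk; rewrite leNgt; apply/negP => hl.
  by have := min0 _ hl; rewrite leqNgt lk.
have mcov : measurable (\big[setU/set0]_(k < m.+1) pre (A k)).
  by apply: bigsetU_measurable => k _; exact: mpre.
have mE : measurable [set w | exists2 k, (k <= m)%N & (t < qform k (xi ^~ w))%R].
  have -> : [set w | exists2 k, (k <= m)%N & (t < qform k (xi ^~ w))%R] =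
     \big[setU/set0]_(k < m.+1) pre [set x | t < qform k x].
    rewrite -(bigcup_mkord m.+1 (fun k => pre [set x | t < qform k x])).
    by apply/seteqP; split=> w [k km hk]; exists k.
  by apply: bigsetU_measurable => k _; exact: mpre.
apply: le_trans (le_measure P _ _ cover) _; rewrite ?inE//.
apply: le_trans (Boole_inequality P (fun k _ => mpre _ (mA k))) _.
apply: (@le_trans _ _ (\sum_(k < m.+1) 2%:E * P (pre (A k `&` F)))%E).
  by apply: lee_sum => k _; apply: half; rewrite -ltnS.
rewrite -ge0_sume_distrr//; apply: lee_wpmul2l => //.
have tA : trivIset setT (fun k => pre (A k `&` F)).
  apply/trivIsetP => i j _ _; rewrite neq_ltn => /orP [ij|ij]; apply/seteqP; split=> // w.
    by move=> [[[_ h1] _] [[/(_ i ij) h2 _] _]]; move: h1; rewrite ltNge h2.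
  by move=> [[[/(_ j ij) h2 _] _] [[_ h1] _]]; move: h1; rewrite ltNge h2.
have mAF k : measurable (pre (A k `&` F)) by apply: mpre; exact: measurableI.
have add := @measure_bigsetU _ _ _ P (fun k => pre (A k `&` F)) mAF tA m.+1.
apply: (@le_trans _ _ (P (\big[setU/set0]_(k < m.+1) pre (A k `&` F)))).
  by rewrite le_eqVlt; apply/orP; left; apply/eqP; exact: (esym add).
apply: le_measure; rewrite ?inE.
- by apply: bigsetU_measurable => k _; apply: mpre; exact: measurableI.
- exact: (mpre F).
- rewrite -(bigcup_mkord m.+1 (fun k => pre (A k `&` F))).
  by move=> w [k _ [_ h]].
Qed.

(** Levy and Markov, then [m] to infinity; the bound is by the trace of [q]. *)
Lemma qform_maximal (v B t : R) xi : 0 <= v ->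
  (forall m xi k, gauss_iid P m xi -> (k < m)%N -> (\int[P]_w (xi k w ^+ 2)%:E <= v%:E)%E) ->
  0 < t -> (forall m, gauss_iid P m xi) -> (forall m, \sum_(i < m) q i i <= B) ->
  measurable [set w | exists k, t < qform k (xi ^~ w)] /\
  (t%:E * P [set w | exists k, (t < qform k (xi ^~ w))%R] <= (2 * (v * B))%:E)%E.
Proof.
move=> v0 hv t0 hx hB; have [mx _] := hx 0%N.
pose E m := [set w | exists2 k, (k <= m)%N & t < qform k (xi ^~ w)].
pose D k := [set w | t < qform k (xi ^~ w)].
have mQ k : measurable_fun setT (fun w => qform k (xi ^~ w)).
  apply: measurable_sum => i; apply: measurable_sum => j.
  by apply: measurable_funM => //; apply: measurable_funM.
have mD k : measurable (D k).
  have := mQ k measurableT `]t, +oo[%classic (measurable_itv _).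
  by rewrite setTI; congr measurable; apply/seteqP; split=> w /=; rewrite in_itv /= andbT.
have mE m : measurable (E m).
  have -> : E m = \bigcup_(k in [set k | (k <= m)%N]) D k by apply/seteqP; split=> w [k km hk]; exists k.
  exact: bigcup_measurable.
have cupE : [set w | exists k, t < qform k (xi ^~ w)] = \bigcup_m E m.
  by apply/seteqP; split=> w; [move=> [k hk]; exists k => //; exists k|move=> [m _ [k _ hk]]; exists k].
have mcup : measurable (\bigcup_m E m) by exact: bigcup_measurable.
rewrite cupE; split => //.
have B0 : 0 <= B by have := hB 0%N; rewrite big_ord0.
have PE m : (t%:E * P (E m) <= (2 * (v * B))%:E)%E.
  apply: (@le_trans _ _ (t%:E * (2%:E * P (D m)))%E).
    by apply: lee_wpmul2l; [rewrite lee_fin ltW|exact: levy_inequality].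
  rewrite muleCA EFinM; apply: lee_wpmul2l => //.
  apply: (@le_trans _ _ (\int[P]_w (qform m (xi ^~ w))%:E)%E); last first.
    by apply: le_trans (qform_expectation v0 hv (hx m)) _; rewrite lee_fin ler_wpM2l.
  have -> : (t%:E * P (D m) = \int[P]_w (t * \1_(D m) w)%:E)%E.
    under eq_integral do rewrite EFinM.
    rewrite ge0_integralZl_EFin//; [|by apply/measurable_EFinP; exact: measurable_indic|exact: ltW].
    by rewrite integral_indic// setIT.
  apply: ge0_le_integral => //.
  - by move=> w _; rewrite lee_fin mulr_ge0 ?indicE// ltW.
  - by apply/measurable_EFinP; apply: measurable_funM => //; exact: measurable_indic.
  - exact/measurable_EFinP.
  - move=> w _; rewrite lee_fin indicE; case: (boolP (w \in _)) => [/set_mem hw|_]; last by rewrite mulr0.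
    by rewrite mulr1 ltW.
have cvgE : P \o E @ \oo --> P (\bigcup_m E m).
  apply: nondecreasing_cvg_mu => //; apply/nondecreasing_seqP => m; apply/subsetPset => w [k km hk].
  by exists k => //; exact: leq_trans km _.
have Pfin : P (\bigcup_m E m) \is a fin_num by exact: fin_num_measure.
rewrite -lee_pdivlMl// -EFinM; rewrite -(cvg_lim _ cvgE)//.
apply: lime_le; first by apply/cvg_ex; exists (P (\bigcup_m E m)).
by apply: nearW => m /=; rewrite EFinM lee_pdivlMl.
Qed.

End quadratic.

(** The tail of the sequence, so that [qform q k (cut_seq M x)] is the squared norm of the
    difference of the partial sums at [k] and [M]. *)
Definition cut_seq (M : nat) (x : nat -> R) : nat -> R := fun k => if (k < M)%N then 0 else x k.

Lemma bounded_tail (a : nat -> R) (B e : R) : (forall i, 0 <= a i) ->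
  (forall m, \sum_(i < m) a i <= B) -> 0 < e ->
  exists M, forall m, \sum_(i < m) (if (M <= i)%N then a i else 0) <= e.
Proof.
move=> a0 aB e0; pose A := [set y | exists m, y = \sum_(i < m) a i].
have supA : has_sup A by split; [exists (\sum_(i < 0) a i), 0%N|exists B => y [m ->]].
have [_ [M ->] hM] := sup_adherent e0 supA; exists M => m.
have [mM|Mm] := leqP m M.
  by rewrite big1 ?ltW// => i _; rewrite leqNgt (leq_trans (ltn_ord i) mM).
have hm : \sum_(i < m) a i <= sup A by apply: sup_upper_bound => //; exists m.
rewrite -(subnKC (ltnW Mm)) big_split_ord /= in hm; rewrite -(subnKC (ltnW Mm)) big_split_ord /=.
rewrite [X in X + _]big1 ?add0r; last by move=> i _; rewrite leqNgt ltn_ord.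
rewrite (eq_bigr (fun i : 'I_(m - M) => a (M + i)%N)) => [|i _]; last by rewrite leq_addr.
by move: hm hM; lra.
Qed.

(** Applied to the tails, whose traces tend to 0, the maximal inequality makes the partial sums
    almost surely Cauchy for the seminorm defined by [q]. *)
Lemma gauss_cauchy (q : nat -> nat -> R) (xi : nat -> T -> R) (B : R) :
  (forall m x, 0 <= qform q m x) -> (forall m, gauss_iid P m xi) ->
  (forall m, \sum_(i < m) q i i <= B) ->
  P.-negligible [set w | ~ forall r : R, 0 < r -> exists M, forall k,
    qform q k (cut_seq M (xi ^~ w)) <= r].
Proof.
move=> q0 hx hB; have [v v0 hv] := second_moment P.
(* The form of the tail from [M] on. *)
pose qc M i j := if (M <= i)%N && (M <= j)%N then q i j else 0.
have qcE M m x : qform (qc M) m x = qform q m (cut_seq M x).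
  apply: eq_bigr => i _; apply: eq_bigr => j _; rewrite /qc /cut_seq !ltnNge.
  by case: (M <= i)%N; case: (M <= j)%N; rewrite /= ?mul0r ?mulr0.
have qc0 M m x : 0 <= qform (qc M) m x by rewrite qcE.
pose t n : R := n.+1%:R^-1.
have t0 n : 0 < t n by rewrite invr_gt0.
pose E M n := [set w | exists k, t n < qform (qc M) k (xi ^~ w)].
have qB M m : \sum_(i < m) qc M i i <= B.
  apply: le_trans (hB m); apply: ler_sum => i _; rewrite /qc.
  by case: ifP => // _; exact: (qform_diag_ge0 q0).
have mE M n : measurable (E M n) by have [] := qform_maximal (qc0 M) v0 hv (t0 n) hx (qB M).
have null n : P (\bigcap_M E M n) = 0%E.
  have mI : measurable (\bigcap_M E M n) by exact: bigcap_measurableType.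
  apply/eqP; rewrite eq_le measure_ge0 andbT; apply/lee_addgt0Pr => e e0; rewrite add0e.
  have vp : 0 < 2 * v + 1 by rewrite ltr_wpDl// mulr_ge0.
  have [|M hM] := @bounded_tail (fun i => q i i) B (e * t n / (2 * v + 1)) (qform_diag_ge0 q0) hB.
    by rewrite divr_gt0// mulr_gt0.
  have [|_ hP] := qform_maximal (B := e * t n / (2 * v + 1)) (qc0 M) v0 hv (t0 n) hx.
    move=> m; apply: le_trans (hM m); apply: ler_sum => i _; rewrite /qc.
    by case: (M <= i)%N.
  apply: (@le_trans _ _ (P (E M n))).
    by apply: le_measure; rewrite ?inE// => w; exact.
  rewrite -lee_pdivlMl// in hP; apply: le_trans hP _; rewrite -EFinM lee_fin.
  rewrite [X in X <= _](_ : _ = e * (2 * v / (2 * v + 1))); last first.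
    by move: (t0 n) vp => tn vp; field; rewrite !gt_eqF.
  by rewrite ger_pMr// ler_pdivrMr// mul1r lerDl.
apply: (@negligibleS _ _ _ _ (\bigcup_n \bigcap_M E M n)).
  move=> w /= hw; apply: contrapT => hn; apply: hw => r r0.
  pose n := Num.trunc r^-1.
  have tr : t n <= r.
    by rewrite /t -[leRHS]invrK lef_pV2 ?posrE ?invr_gt0// ltW// truncnS_gt.
  have : ~ (\bigcap_M E M n) w by move=> h; apply: hn; exists n.
  move=> h; have [M hM] : exists M, ~ E M n w.
    by apply: contrapT => h'; apply: h => M _; apply: contrapT => h2; apply: h'; exists M.
  exists M => k; rewrite -qcE; apply: le_trans tr; rewrite leNgt; apply/negP => hk.
  by apply: hM; exists k.
apply: negligible_bigcup => n; exists (\bigcap_M E M n); split => //; [exact: bigcap_measurableType|exact: null].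
Qed.

End levy.

(** * Real coordinates of the random series *)

Section from_eta.
Context {R : realType} d (T : measurableType d) (P : probability T R).
Variables (dim : option nat) (eta : nat -> {RV P >-> borel R[i]}).
Hypothesis eta_iid : iid_std_complex_gaussian dim eta.
Local Notation gamma := (normal_prob (0 : R) 1).

(** The real and imaginary parts of the [eta j], scaled to unit variance and enumerated in the order
    Re, Im. *)
Definition real_gauss (k : nat) (w : T) : R :=
  Num.sqrt 2 * (if odd k then complex.Im (eta k./2 w) else complex.Re (eta k./2 w)).

Lemma measurable_Re : measurable_fun setT (@complex.Re R : borel R[i] -> R).
Proof. by apply: (@continuous_measurable R R[i]); exact: continuous_Re. Qed.

Lemma measurable_Im : measurable_fun setT (@complex.Im R : borel R[i] -> R).
Proof. by apply: (@continuous_measurable R R[i]); exact: continuous_Im. Qed.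

Lemma measurable_real_gauss k : measurable_fun setT (real_gauss k).
Proof.
rewrite /real_gauss; apply: measurable_funM => //; case: (odd k).
  by apply: (measurableT_comp measurable_Im); exact: measurable_funPT.
by apply: (measurableT_comp measurable_Re); exact: measurable_funPT.
Qed.

Lemma prod_double N (F : nat -> \bar R) :
  (\prod_(k < N.*2) F k = \prod_(j < N) (F j.*2 * F j.*2.+1))%E.
Proof.
elim: N => [|N IH]; first by rewrite !big_ord0.
by rewrite doubleS !big_ord_recr /= IH -muleA.
Qed.

Lemma gauss_iid_double N : (forall j, (j < N)%N -> index_lt dim j) -> gauss_iid P N.*2 real_gauss.
Proof.
move=> dN; split; first exact: measurable_real_gauss.
move=> B mB; have [law ind] := eta_iid.
have s20 : Num.sqrt 2 != 0 :> R by rewrite sqrtr_eq0 -ltNge.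
pose B' j : set (borel R[i]) := [set z | B j.*2 (Num.sqrt 2 * complex.Re z) /\ B j.*2.+1 (Num.sqrt 2 * complex.Im z)].
have mB' j : measurable (B' j).
  have m1 : measurable_fun setT (fun z : borel R[i] => Num.sqrt 2 * complex.Re z : measurableTypeR R).
    by apply: measurable_funM => //; exact: measurable_Re.
  have m2 : measurable_fun setT (fun z : borel R[i] => Num.sqrt 2 * complex.Im z : measurableTypeR R).
    by apply: measurable_funM => //; exact: measurable_Im.
  apply: measurableI; rewrite -[X in measurable X]setTI; [exact: (m1 measurableT _ (mB _))|exact: (m2 measurableT _ (mB _))].
have lawB' j : (j < N)%N -> P (eta j @^-1` B' j) = (gamma (B j.*2) * gamma (B j.*2.+1))%E.
  move=> jN; have := law j (dN j jN) (B' j) (mB' j).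
  rewrite /distribution /std_complex_gaussian /pushforward => ->.
  have e (p : R * R) : (p.1 +i* p.2) / (Num.sqrt 2)%:C = (p.1 / Num.sqrt 2) +i* (p.2 / Num.sqrt 2) :> R[i].
    rewrite -fmorphV /=; apply/eqP; rewrite eq_complex /=; apply/andP; split; apply/eqP.
      by rewrite mulr0 subr0.
    by rewrite mulr0 add0r.
  have eS : (fun p : R * R => (p.1 +i* p.2) / (Num.sqrt 2)%:C : borel R[i]) @^-1` B' j =
      B j.*2 `*` B j.*2.+1.
    have eB (p : R * R) : B' j ((p.1 +i* p.2) / (Num.sqrt 2)%:C) = (B j.*2 p.1 /\ B j.*2.+1 p.2).
      by rewrite e /B' /= ![Num.sqrt 2 * _]mulrC !divfK.
    by apply/funext => p; exact: eB.
  have h : ((gamma \x gamma) (B j.*2 `*` B j.*2.+1) = gamma (B j.*2) * gamma (B j.*2.+1))%E.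
    exact: (product_measure1E gamma gamma (mB _) (mB _)).
  by rewrite eS; exact: h.
have := ind (iota 0 N) B' (iota_uniq 0 N) _ mB'.
have allN : all (index_lt dim) (iota 0 N) by apply/allP => j; rewrite mem_iota add0n => /dN.
move=> /(_ allN).
have -> : \bigcap_(j in [set` iota 0 N]) eta j @^-1` B' j = [set w | forall i, (i < N.*2)%N -> B i (real_gauss i w)].
  apply/seteqP; split=> w hw.
    move=> i iN; have := hw i./2; rewrite /= mem_iota add0n.
    have iN' : (i./2 < N)%N by rewrite -ltn_double (leq_ltn_trans _ iN)// -{2}(odd_double_half i) leq_addl.
    move=> /(_ iN') [h1 h2]; rewrite /real_gauss; case: (boolP (odd i)) => oi.
      by move: h2; rewrite -[X in B X](_ : i = _)//; rewrite -{1}(odd_double_half i) oi.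
    by move: h1; rewrite -[X in B X](_ : i = _)//; rewrite -{1}(odd_double_half i) (negbTE oi).
  move=> j; rewrite /= mem_iota add0n => jN; split.
    have := hw j.*2; rewrite ltn_double => /(_ jN).
    by rewrite /real_gauss odd_double doubleK.
  have := hw j.*2.+1; rewrite -doubleS leq_double => /(_ jN).
  by rewrite /real_gauss /= odd_double /= uphalf_double.
have eI : iota 0 N = index_iota 0 N by rewrite /index_iota subn0.
move=> ->; rewrite (prod_double N (fun k => gamma (B k))) eI big_mkord.
by apply: eq_bigr => j _; exact: lawB'.
Qed.

Lemma gauss_iid_eta m : (forall k, (k < m)%N -> index_lt dim k./2) -> gauss_iid P m real_gauss.
Proof.
move=> h; apply: (@gauss_iid_le _ _ _ _ (uphalf m).*2).
  by rewrite uphalf_half -{1}(odd_double_half m) doubleD leq_add2r; case: (odd m).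
apply: gauss_iid_double => j jm; rewrite -(doubleK j); apply: h.
by rewrite -(ltn_double) in jm; move: jm; rewrite uphalf_half doubleD -{3}(odd_double_half m); case: (odd m) => //=;
  rewrite ?add0n // add1n add2n -doubleS ltn_double ltnS -leq_double => /leq_ltn_trans; apply.
Qed.

End from_eta.

Section real_basis.
Context {R : realType} {n : nat} {X : ptopologicalType} {M : complex_atlas R n X}.
Context {L : line_bundle M}.
Local Notation C := R[i].
Variables (dim : option nat) (S : nat -> forall x, fiber L x).

(** The vectors [S j / sqrt 2] and [i S j / sqrt 2]: the coordinates of the series on them are the
    [real_gauss]. The value 0 outside the index range makes sums over all indices meaningful. *)
Definition real_basis (k : nat) : forall x, fiber L x := fun x =>
  if index_lt dim k./2 then ((Num.sqrt 2)^-1%:C * (if odd k then 'i%C else 1)) *: S k./2 x else 0.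

Lemma partial_sum_real (c : nat -> C) (m : nat) x :
  partial_sum dim c S m x = \sum_(k < m.*2) (Num.sqrt 2 * (if odd k then complex.Im (c k./2) else complex.Re (c k./2)))%:C *: real_basis k x.
Proof.
have s20 : Num.sqrt 2 != 0 :> R by rewrite sqrtr_eq0 -ltNge.
rewrite /partial_sum; elim: m => [|m IH]; first by rewrite !big_ord0.
rewrite doubleS !big_ord_recr /= -IH big_mkcond big_ord_recr /= -big_mkcond -addrA; congr (_ + _).
rewrite /real_basis /= odd_double doubleK uphalf_double /=; case: ifP => _; last by rewrite !scaler0 addr0.
rewrite !scalerA -scalerDl; congr (_ *: _); case: (c m) => a b.
apply/eqP; rewrite eq_complex /=; apply/andP; split; apply/eqP; field; exact: s20.
Qed.

End real_basis.
(** * Energy of partial sums on a patch *)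

Section local_energy.
Context {R : realType} {n : nat} {X : ptopologicalType} {M : complex_atlas R n X}.
Context {L : line_bundle M}.
Variables (h : hermitian_metric L) (Theta : hermitian_form M).
Variable dV : {measure set (borel X) -> \bar R}.
Hypothesis dV_Theta : is_volume_measure Theta dV.
Local Notation C := R[i].
Local Notation cn := (@ComplexField.Normc.normc R).
Local Notation hn := (herm_norm h).
Local Notation N2 := (L2_norm2 h dV).
Local Notation L2 := (L2_section h dV).

Definition energy (U : set X) (sg : nat -> forall x, fiber L x) (k l : nat) : R :=
  \int[dV]_(x in U) complex.Re (herm h (sg k x) (sg l x)).

Definition lin_comb (sg : nat -> forall x, fiber L x) (m : nat) (y : nat -> R) : forall x, fiber L x :=
  fun x => \sum_(k < m) (y k)%:C *: sg k x.

Lemma hn_lin_comb sg m y x : hn (lin_comb sg m y x) ^+ 2 =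
  \sum_(k < m) \sum_(l < m) (y k * y l) * complex.Re (herm h (sg k x) (sg l x)).
Proof.
rewrite hn_sqr /lin_comb.
have sl (I : Type) (r : seq I) (F : I -> fiber L x) w : herm h (\sum_(i <- r) F i) w = \sum_(i <- r) herm h (F i) w.
  by apply: (big_morph (fun v => herm h v w)); [move=> u v; exact: hermDl|exact: herm0l].
have sr (I : Type) (r : seq I) (F : I -> fiber L x) w : herm h w (\sum_(i <- r) F i) = \sum_(i <- r) herm h w (F i).
  by apply: (big_morph (fun v => herm h w v)); [move=> u v; exact: hermDr|exact: herm0r].
have sR (I : Type) (r : seq I) (F : I -> C) : complex.Re (\sum_(i <- r) F i) = \sum_(i <- r) complex.Re (F i).
  by apply: (big_morph (@complex.Re R)); [move=> u v; exact: ReD|].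
rewrite sl sR; apply: eq_bigr => k _; rewrite sr sR; apply: eq_bigr => l _.
by rewrite hermZl hermZr; case: (herm h (sg k x) (sg l x)) => a b /=; ring.
Qed.

Lemma qform_energy (U : set (borel X)) sg m y : measurable U -> (forall k, L2 (sg k)) ->
  (qform (energy U sg) m y)%:E = (\int[dV]_(x in U) (hn (lin_comb sg m y x) ^+ 2)%:E)%E.
Proof.
move=> mU sgL.
have iU k l : dV.-integrable U (fun x => (complex.Re (herm h (sg k x) (sg l x)))%:E).
  have [i1 _] := integrable_herm (sgL k) (sgL l).
  by apply: (integrableS measurableT mU _ i1).
under eq_integral do rewrite hn_lin_comb -sumEFin.
rewrite integral_sum//=; last first.
  move=> k; under eq_fun do rewrite -sumEFin.
  apply: integrable_sum => // l _; under eq_fun do rewrite EFinM; exact: integrableZl.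
rewrite /qform -sumEFin; apply: eq_bigr => k _; under [RHS]eq_integral do rewrite -sumEFin.
rewrite integral_sum//=; last first.
  by move=> l; under eq_fun do rewrite EFinM; exact: integrableZl.
rewrite -sumEFin; apply: eq_bigr => l _; under [RHS]eq_integral do rewrite EFinM.
rewrite integralZl// mulrC EFinM; congr (_ * _)%E.
by rewrite /energy /Rintegral fineK// integrable_fin_num.
Qed.

Lemma energy_ge0 (U : set (borel X)) sg m y : measurable U -> (forall k, L2 (sg k)) ->
  0 <= qform (energy U sg) m y.
Proof.
move=> mU sgL; rewrite -lee_fin qform_energy//; apply: integral_ge0 => x _.
by rewrite lee_fin sqr_ge0.
Qed.

Section basis.
Variables (dim : option nat) (S : nat -> forall x, fiber L x).
Hypothesis S_basis : orthonormal_basis h dV dim S.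
Variables (U : set (borel X)) (c : R).
Hypothesis c_ge0 : 0 <= c.
Hypothesis mU : measurable U.
Hypothesis U_fin : (dV U < +oo)%E.
Hypothesis U_bound : forall s, holomorphic_section s -> forall x, U x ->
  ((hn (s x) ^+ 2)%:E <= c%:E * N2 s)%E.
Local Notation sg := (real_basis dim S).

(** Bessel's inequality for the evaluation at [x]: the section [\sum_j (S j x)^* S j], read in a
    trivialization, has squared norm [V] and value [V] at [x], and [U_bound] compares the two. *)
Lemma bessel_pointwise m x : U x -> \sum_(j < m | index_lt dim j) hn (S j x) ^+ 2 <= c.
Proof.
move=> Ux; have [S_L2 S_on _] := S_basis; have [k kx] := triv_dom_cover L x.
pose f j := fiber_coord k x (S j x).
pose V := \sum_(j < m | index_lt dim j) cn (f j) ^+ 2.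
have V0 : 0 <= V by apply: sumr_ge0 => j _; exact: sqr_ge0.
have -> : \sum_(j < m | index_lt dim j) hn (S j x) ^+ 2 = V * weight h k x.
  by rewrite mulr_suml; apply: eq_bigr => j _; exact: hn_coord.
have w0 := weight_gt0 h kx.
pose s := partial_sum dim (fun j => (f j)^*) S m.
have Ls : L2 s by exact: L2_partial_sum.
have cnJ (z : C) : cn z^* = cn z by case: z => u v; rewrite !cnE /= sqrrN.
have Ns : N2 s = V%:E.
  by rewrite (pythagoras S_L2 S_on) /V; under eq_bigr do rewrite cnJ.
have sx : fiber_coord k x (s x) = V%:C.
  rewrite linear_sum /V rmorph_sum; apply: eq_bigr => j _ /=; rewrite linearZ /= -/(f j).
  rewrite cn_sqr; case: (f j) => u v.
  by apply/eqP; rewrite eq_complex /=; apply/andP; split; apply/eqP; ring.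
have := U_bound (proj1 Ls) Ux; rewrite Ns (hn_coord h (s x) kx) sx cn_real (ger0_norm V0) -EFinM lee_fin => hV.
have [VE|Vn] := eqVneq V 0.
  by rewrite VE mul0r.
have Vp : 0 < V by rewrite lt0r Vn.
by rewrite -(ler_pM2l Vp) mulrA -expr2 [X in _ <= X]mulrC.
Qed.

Lemma real_basis_L2 k : L2 (sg k).
Proof.
have [S_L2 _ _] := S_basis; have [dk|dk] := boolP (index_lt dim k./2).
  rewrite (_ : sg k = fun x => ((Num.sqrt 2)^-1%:C * (if odd k then 'i%C else 1)) *: S k./2 x).
    by apply: L2_sectionZ; exact: S_L2.
  by apply: functional_extensionality_dep => x; rewrite /real_basis dk.
rewrite (_ : sg k = fun x => 0); first exact: L2_section0.
by apply: functional_extensionality_dep => x; rewrite /real_basis (negbTE dk).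
Qed.

Lemma hn_real_basis m x : \sum_(k < m.*2) hn (sg k x) ^+ 2 = \sum_(j < m | index_lt dim j) hn (S j x) ^+ 2.
Proof.
elim: m => [|m IH]; first by rewrite !big_ord0.
rewrite doubleS !big_ord_recr /= IH [RHS]big_mkcond big_ord_recr /= -big_mkcond -addrA; congr (_ + _).
rewrite /real_basis /= odd_double doubleK uphalf_double /=; case: ifP => _; last by rewrite hn0 expr0n addr0.
rewrite !hnZ mulr1 cnM cn_i mulr1 cn_real !exprMn real_normK ?num_real// exprVn sqr_sqrtr//.
by field.
Qed.

(** Integrate the pointwise Bessel inequality over [U], which has finite volume. *)
Lemma energy_trace m : \sum_(k < m) energy U sg k k <= c * fine (dV U).
Proof.
have diag k : (energy U sg k k)%:E = (\int[dV]_(x in U) (hn (sg k x) ^+ 2)%:E)%E.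
  have [i1 _] := integrable_herm (real_basis_L2 k) (real_basis_L2 k).
  rewrite /energy /Rintegral fineK; last by apply: integrable_fin_num => //; apply: (integrableS measurableT mU _ i1).
  by apply: eq_integral => x _; rewrite hn_sqr.
have d0 k : 0 <= energy U sg k k.
  by rewrite -lee_fin diag; apply: integral_ge0 => x _; rewrite lee_fin sqr_ge0.
apply: (@le_trans _ _ (\sum_(k < m.*2) energy U sg k k)).
  have -> : m.*2 = (m + m)%N by rewrite addnn.
  by rewrite big_split_ord /= lerDl; apply: sumr_ge0.
rewrite -lee_fin -sumEFin; under eq_bigr do rewrite diag.
rewrite -ge0_integral_sum//; first last.
- by move=> k x _; rewrite lee_fin sqr_ge0.
- by move=> k; apply: measurable_funTS; apply: measurable_hn2E; case: (real_basis_L2 k).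
apply: (@le_trans _ _ (\int[dV]_(x in U) (cst c%:E) x)%E).
  apply: ge0_le_integral => //.
  - by move=> x _; apply: sume_ge0 => k _; rewrite lee_fin sqr_ge0.
  - apply: emeasurable_sum => k; apply: measurable_funTS; apply: measurable_hn2E; by case: (real_basis_L2 k).
  - by move=> x Ux; rewrite sumEFin lee_fin hn_real_basis; exact: bessel_pointwise.
rewrite integral_cst// EFinM fineK// ge0_fin_numE//.
Qed.

End basis.
End local_energy.

(** * Uniform limits of holomorphic sections *)

Section countable_base.
Context {X : ptopologicalType}.

Lemma countable_base : @second_countable X -> exists b : nat -> set X,
  (forall i, open (b i)) /\ forall x V, nbhs x V -> exists i, b i x /\ b i `<=` V.
Proof.
move=> [B /countable_injP[f f_inj] [Bo Bx]].
pose b i := xget set0 [set O | B O /\ f O = i].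
have bP O : B O -> b (f O) = O.
  move=> BO; rewrite /b; case: xgetP; last by move=> /(_ O)[].
  by move=> O2 _ [BO2 fO2]; apply: f_inj; rewrite ?inE.
exists b; split.
  move=> i; rewrite /b; case: xgetP => [V _ [BV _]|_]; first exact: Bo.
  exact: open0.
move=> x V xV; have [ O [BO Ox] OV] := Bx x V xV.
by exists (f O); rewrite bP.
Qed.

Lemma compact_subcover (W : nat -> set X) (K : set X) : compact K ->
  (forall i, open (W i)) -> (forall x, exists i, W i x) ->
  exists N, forall x, K x -> exists2 i, (i < N)%N & W i x.
Proof.
move=> Kc Wo Wx; rewrite compact_cover in Kc.
have [|D' _ KD'] := Kc nat setT W (fun i _ => Wo i).
  by move=> x _; have [i Wi] := Wx x; exists i.
exists (\max_(i <- finmap.enum_fset D') i).+1 => x Kx; have [i Di Wi] := KD' x Kx.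
by exists i => //; rewrite ltnS; exact: (@leq_bigmax_seq _ (finmap.enum_fset D') xpredT id i Di).
Qed.

End countable_base.

Section uniform_limits.
Context {R : realType} {n : nat} {X : ptopologicalType} {M : complex_atlas R n X}.
Context {L : line_bundle M}.
Variable h : hermitian_metric L.
Local Notation C := R[i].
Local Notation cn := (@ComplexField.Normc.normc R).
Local Notation hn := (herm_norm h).
Implicit Types (u : nat -> forall x, fiber L x) (W : set X).

(** Bounds are non-strict here and in [ulimit], so that they pass to pointwise limits. *)
Definition ucauchy W u := forall e : R, 0 < e ->
  exists N : nat, forall m m' x, (N <= m)%N -> (N <= m')%N -> W x -> hn (u m x - u m' x) <= e.

Definition ulimit W u (s : forall x, fiber L x) := forall e : R, 0 < e ->
  exists N : nat, forall m x, (N <= m)%N -> W x -> hn (u m x - s x) <= e.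

Lemma cauchy_real (v : nat -> R) :
  (forall e : R, 0 < e -> exists N : nat, forall m m', (N <= m)%N -> (N <= m')%N -> `|v m - v m'| <= e) ->
  cvgn v.
Proof.
move=> vc; apply: cauchy_cvg; apply: cauchy_exP => e e0.
have [N Nh] := vc (e / 2) (divr_gt0 e0 (ltr0Sn R 1)); exists (v N); exists N => // m /= Nm.
by rewrite /ball /= (le_lt_trans (Nh _ _ _ _))// ltr_pdivrMr// ltr_pMr// ltr1n.
Qed.

Lemma cauchy_complex (v : nat -> C) :
  (forall e : R, 0 < e -> exists N : nat, forall m m', (N <= m)%N -> (N <= m')%N -> cn (v m - v m') <= e) ->
  exists l : C, forall e : R, 0 < e -> exists N : nat, forall m, (N <= m)%N -> cn (v m - l) <= e.
Proof.
move=> vc.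
have cR : cvgn (fun m => complex.Re (v m)).
  apply: cauchy_real => e e0; have [N Nh] := vc e e0; exists N => m m' Nm Nm'.
  apply: le_trans (Nh m m' Nm Nm'); rewrite -ReB; exact: Re_le_cn.
have cI : cvgn (fun m => complex.Im (v m)).
  apply: cauchy_real => e e0; have [N Nh] := vc e e0; exists N => m m' Nm Nm'.
  apply: le_trans (Nh m m' Nm Nm'); rewrite -ImB; exact: Im_le_cn.
exists (limn (fun m => complex.Re (v m)) +i* limn (fun m => complex.Im (v m))) => e e0.
have := cvg_complex (@eventually_filter) cR cI => /cvg_cnP-/(_ e e0)[N _ Nh]; exists N => m Nm.
have /= := Nh m Nm; rewrite cnC => /ltW.
by case: (v m).
Qed.

Lemma fiber_complete u x : ucauchy [set x] u ->
  exists v : fiber L x, forall e : R, 0 < e -> exists N : nat, forall m, (N <= m)%N -> hn (u m x - v) <= e.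
Proof.
move=> uc; have [k kx] := triv_dom_cover L x.
have w0 := weight_gt0 h kx.
pose s := Num.sqrt (weight h k x).
have s0 : 0 < s by rewrite sqrtr_gt0.
have hnE (v : fiber L x) : hn v = cn (fiber_coord k x v) * s.
  by apply/eqP; rewrite -(@eqrXn2 _ 2)// ?mulr_ge0 ?hn_ge0 ?cn_ge0 ?ltW// (hn_coord h v kx) exprMn sqr_sqrtr// ltW.
have [|l hl] := @cauchy_complex (fun m => fiber_coord k x (u m x)).
  move=> e e0; have [N Nh] := uc (e * s) (mulr_gt0 e0 s0); exists N => m m' Nm Nm'.
  by have := Nh m m' x Nm Nm' erefl; rewrite hnE linearB ler_pM2r.
exists (l *: local_frame k x) => e e0; have [N Nh] := hl (e / s) (divr_gt0 e0 s0); exists N => m Nm.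
rewrite hnE linearB linearZ /= coord_frame// mulr1 -ler_pdivlMr//; exact: Nh.
Qed.

Lemma ucauchyS W W' u : W' `<=` W -> ucauchy W u -> ucauchy W' u.
Proof. by move=> WW uc e e0; have [N Nh] := uc e e0; exists N => m m' x Nm Nm' /WW; exact: Nh. Qed.

(** The pointwise limit exists in each fibre and is attained uniformly on each [W i]; Weierstrass'
    theorem is applied in a chart and a trivialization, on a neighbourhood where the weight is
    bounded below. *)
Lemma holomorphic_limit (W : nat -> set X) u : (forall i, open (W i)) -> (forall x, exists i, W i x) ->
  (forall m, holomorphic_section (u m)) -> (forall i, ucauchy (W i) u) ->
  exists2 s, holomorphic_section s & forall i, ulimit (W i) u s.
Proof.
move=> Wo Wx uh uc.
have xlim x : exists v : fiber L x, forall e : R, 0 < e ->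
    exists N : nat, forall m, (N <= m)%N -> hn (u m x - v) <= e.
  have [i Wi] := Wx x; apply: fiber_complete; apply: ucauchyS (uc i).
  by move=> _ ->.
pose s x := projT1 (cid (xlim x)).
have sP x := projT2 (cid (xlim x)); rewrite -/(s _) in sP.
have sl i : ulimit (W i) u s.
  move=> e e0; have [N Nh] := uc i e e0; exists N => m x Nm Wix.
  apply/ler_addgt0Pr => e' e'0; have [N' Nh'] := sP x e' e'0.
  have -> : u m x - s x = (u m x - u (maxn N N') x) + (u (maxn N N') x - s x).
    by rewrite addrA subrK.
  apply: le_trans (hnD _ _ _) _; apply: lerD; first by apply: Nh; rewrite ?leq_maxl.
  by apply: Nh'; rewrite leq_maxr.
exists s => // k a _ [x [ax kx] <-].
have [i Wix] := Wx x; have w0 := weight_gt0 h kx.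
pose w1 := weight h k x / 2; have w1_gt0 : 0 < w1 by exact: divr_gt0.
have : nbhs x [set y | w1 < weight h k y].
  have cw : weight h k y @[y --> x] --> weight h k x := continuous_weight kx.
  apply: (cw [set r | w1 < r]); apply: open_nbhs_nbhs; split; first exact: open_gt.
  by rewrite /= /w1 ltr_pdivrMr// ltr_pMr// ltr1n.
move=> xw; have xO : nbhs x (W i `&` triv_dom k `&` [set y | w1 < weight h k y]).
  apply: filterI => //; apply: open_nbhs_nbhs; split => //.
  by apply: openI => //; exact: triv_dom_open.
have [V [Vo Vx] VW] : exists2 V, open V /\ V x & V `<=` W i `&` triv_dom k `&` [set y | w1 < weight h k y].
  by move: xO; rewrite nbhsE => -[V oV VV]; exists V.
pose U := chart a @` (chart_dom a `&` V).
have sw : 0 < Num.sqrt w1 by rewrite sqrtr_gt0.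
apply: (@differentiable_limit _ _ U).
  by apply: open_nbhs_nbhs; split; [exact: open_chart_image|exists x].
move=> e e0; have [N Nh] := sl i (e * Num.sqrt w1) (mulr_gt0 e0 sw).
exists ((fun y => fiber_coord k y (u N y)) \o chart_inv a); split.
  by move=> _ [y [ay /VW[[_ ky] _]] <-]; apply: uh; exists y.
move=> _ [y [ay /VW[[Wy ky] /= wy]] <-]; rewrite chartK// cnC -linearB.
have wy0 := weight_gt0 h ky.
rewrite -(@ler_pM2r _ (Num.sqrt w1))//; apply: le_trans (Nh N y (leqnn N) Wy).
rewrite -(@ler_pXn2r _ 2)// ?nnegrE ?mulr_ge0 ?cn_ge0 ?hn_ge0 ?sqrtr_ge0//.
by rewrite (hn_coord h _ ky) exprMn sqr_sqrtr ?(ltW w1_gt0)// ler_wpM2l ?sqr_ge0// ltW.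
Qed.

End uniform_limits.

(** * Almost sure locally uniform convergence *)

Section random_series.
Context {R : realType} {n : nat} {X : ptopologicalType} {M : complex_atlas R n X}.
Context {L : line_bundle M}.
Variables (h : hermitian_metric L) (Theta : hermitian_form M).
Variable dV : {measure set (borel X) -> \bar R}.
Hypothesis dV_Theta : is_volume_measure Theta dV.
Hypothesis X_second_countable : @second_countable X.
Local Notation C := R[i].
Local Notation cn := (@ComplexField.Normc.normc R).
Local Notation hn := (herm_norm h).
Local Notation N2 := (L2_norm2 h dV).
Local Notation L2 := (L2_section h dV).

(** The sets provided by [patch_exists]. The property is inherited by open subsets, so that patches
    can be taken in a countable base. *)
Definition bergman_patch (W : set X) := [/\ open W, exists2 K, compact K & W `<=` K &
  exists (U : set (borel X)) (c : R), [/\ measurable U /\ (dV U < +oo)%E, 0 <= c,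
    forall s, holomorphic_section s -> forall x, W x ->
      ((hn (s x) ^+ 2)%:E <= c%:E * \int[dV]_(y in U) (hn (s y) ^+ 2)%:E)%E &
    forall s, holomorphic_section s -> forall x, U x ->
      ((hn (s x) ^+ 2)%:E <= c%:E * N2 s)%E]].

Lemma countable_patches : exists W : nat -> set X,
  (forall i, bergman_patch (W i)) /\ forall x V, nbhs x V -> exists i, W i x /\ W i `<=` V.
Proof.
have [b [bo bx]] := countable_base X_second_countable.
pose W i := if `[< bergman_patch (b i) >] then b i else set0.
exists W; split.
  move=> i; rewrite /W; case: asboolP => // _; split; first exact: open0.
    by exists set0 => //; exact: compact0.
  by exists set0, 0; split => //; rewrite measure0.
move=> x V xV; have [W0 [U [K [c [[W0o W0x Kc WK] UM c0 e1 e2]]]]] := patch_exists h dV_Theta x.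
have [i [bix bV]] : exists i, b i x /\ b i `<=` V `&` W0.
  by apply: bx; apply: filterI => //; exact: open_nbhs_nbhs.
exists i; rewrite /W asboolT; first by split => // y /bV[].
split => //; first by exists K => // y /bV[_ /WK].
by exists U, c; split => // s hs y /bV[_]; exact: e1.
Qed.

Section basis.
Context d (T : measurableType d) (P : probability T R).
Variables (dim : option nat) (eta : nat -> {RV P >-> borel C}).
Hypothesis eta_iid : iid_std_complex_gaussian dim eta.
Variable S : nat -> forall x, fiber L x.
Hypothesis S_basis : orthonormal_basis h dV dim S.

Lemma partial_sum_hol (c : nat -> C) m : holomorphic_section (partial_sum dim c S m).
Proof. by apply: holomorphic_section_sum => j /[dup] _; have [SL _ _] := S_basis => /SL[]. Qed.

Lemma partial_sum_stationary D (c : nat -> C) m x : dim = Some D -> (D <= m)%N ->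
  partial_sum dim c S m x = partial_sum dim c S D x.
Proof.
move=> -> /subnKC <-; elim: (m - D)%N => [|k IH]; first by rewrite addn0.
rewrite addnS -IH /partial_sum [in LHS]big_mkcond big_ord_recr /= -big_mkcond.
by rewrite ltnNge leq_addr /= addr0.
Qed.

Lemma lin_comb_cut sg M' m y x : (M' <= m)%N ->
  lin_comb sg m (cut_seq M' y) x = lin_comb sg m y x - lin_comb sg M' y x :> fiber L x.
Proof.
move=> /subnKC <-; elim: (m - M')%N => [|k IH].
  by rewrite addn0 subrr /lin_comb big1// => k _; rewrite /cut_seq ltn_ord scale0r.
rewrite addnS /lin_comb !big_ord_recr /= -!/(lin_comb _ _ _ _) IH addrAC; congr (_ + _).
by rewrite /cut_seq ltnNge leq_addr.
Qed.

(** In finite dimension the series is finite. Otherwise, almost surely, the energies over [U] of the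
    tails tend to 0, and the Bergman inequality turns this into uniform convergence on [W]. *)
Lemma ucauchy_patch W : bergman_patch W ->
  P.-negligible [set w | ~ ucauchy h W (partial_sum dim (fun j => eta j w) S)].
Proof.
move=> [_ _ [U [c [[mU U_fin] c0 e1 e2]]]].
case: (dim =P None) => [dE|]; last first.
  case dE: dim => [D|//] _; rewrite (_ : [set w | _] = set0); first exact: negligible_set0.
  apply/seteqP; split => w //=; apply => e e0; exists D => m m' x Dm Dm' _.
  by rewrite -dE !(partial_sum_stationary _ _ dE)// subrr hn0 ltW.
have sgL k : L2 (real_basis dim S k) by exact: (real_basis_L2 S_basis).
pose q := energy h dV U (real_basis dim S).
have q0 m y : 0 <= qform q m y by exact: energy_ge0.
have xi_iid m : gauss_iid P m (real_gauss eta) by apply: (gauss_iid_eta eta_iid) => k _; rewrite dE.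
have qB m : \sum_(i < m) q i i <= c * fine (dV U) by exact: (energy_trace S_basis c0 mU U_fin e2).
apply: negligibleS (gauss_cauchy q0 xi_iid qB) => w /= + wc; apply => e e0.
(* [c * r <= (e / 2) ^+ 2], where [c] is the Bergman constant. *)
pose r := (e / 2) ^+ 2 / (c + 1).
have r0 : 0 < r by rewrite divr_gt0 ?exprn_gt0 ?divr_gt0// ltr_wpDl.
have [N Nh] := wc r r0; exists N.
pose u m x := lin_comb (real_basis dim S) m (real_gauss eta ^~ w) x.
have lc_hol m y : holomorphic_section (lin_comb (real_basis dim S) m y).
  by apply: holomorphic_section_sum => k _; case: (sgL k).
have near_N m x : (N <= m)%N -> W x -> hn (u m x - u N x) <= e / 2.
  move=> Nm Wx; rewrite -(@ler_pXn2r _ 2)// ?nnegrE ?hn_ge0 ?(ltW (divr_gt0 _ _))//.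
  rewrite -lin_comb_cut// -lee_fin; apply: le_trans (e1 _ (lc_hol _ _) _ Wx) _.
  rewrite -qform_energy// -EFinM lee_fin; apply: (@le_trans _ _ (c * r)).
    by apply: ler_wpM2l => //; exact: Nh.
  by rewrite /r mulrCA ler_piMr ?sqr_ge0// ler_pdivrMr ?mul1r ?lerDl// ltr_wpDl.
have uE m x : partial_sum dim (fun j => eta j w) S m x = u m.*2 x by exact: partial_sum_real.
move=> m m' x Nm Nm' Wx; rewrite !uE.
have le2 k : (N <= k)%N -> (N <= k.*2)%N by move=> /leq_trans; apply; rewrite -addnn leq_addr.
have -> : u m.*2 x - u m'.*2 x = (u m.*2 x - u N x) + (u N x - u m'.*2 x) by rewrite addrA subrK.
apply: le_trans (hnD _ _ _) _; rewrite [leRHS]splitr; apply: lerD; first by apply: near_N => //; exact: le2.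
by rewrite hnB; apply: near_N => //; exact: le2.
Qed.

End basis.
End random_series.

(** * Sampling a section on a dense set *)

Section measurable_quantifiers.
Context d (T : measurableType d).

Lemma measurable_forall (F : nat -> set T) :
  (forall i, measurable (F i)) -> measurable [set w | forall i, F i w].
Proof.
move=> mF; rewrite (_ : [set w | _] = \bigcap_i F i); first exact: bigcapT_measurable.
by apply/seteqP; split => w wF i => //; exact: (wF i I).
Qed.

Lemma measurable_exists (F : nat -> set T) :
  (forall i, measurable (F i)) -> measurable [set w | exists i, F i w].
Proof.
move=> mF; rewrite (_ : [set w | _] = \bigcup_i F i); first exact: bigcupT_measurable.
by apply/seteqP; split => [w|w]; case=> i; [move=> Fi|move=> _ Fi]; exists i.
Qed.

Lemma measurable_imp (Q : Prop) (A : set T) : measurable A -> measurable [set w | Q -> A w].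
Proof.
move=> mA; have [q|nq] := pselect Q.
  by rewrite (_ : [set w | _] = A)//; apply/seteqP; split => w /= => [|?]; [exact|].
by rewrite (_ : [set w | _] = setT)//; apply/seteqP; split => w //= _ /nq.
Qed.

Lemma measurable_guard (Q : Prop) (A : set T) : measurable A -> measurable [set w | Q /\ A w].
Proof.
move=> mA; have [q|nq] := pselect Q.
  by rewrite (_ : [set w | _] = A)//; apply/seteqP; split => w /= => [[]|].
by rewrite (_ : [set w | _] = set0)//; apply/seteqP; split => w //= [/nq].
Qed.

End measurable_quantifiers.

Section sampling.
Context {R : realType} {n : nat} {X : ptopologicalType} {M : complex_atlas R n X}.
Context {L : line_bundle M}.
Variable (h : hermitian_metric L).
Variable W : nat -> set X.
Hypothesis W_base : forall x V, nbhs x V -> exists i, W i x /\ W i `<=` V.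
Local Notation C := R[i].
Local Notation cn := (@ComplexField.Normc.normc R).
Local Notation hn := (herm_norm h).
Implicit Types (s t : forall x, fiber L x) (y : nat -> R).

(** One point in each nonempty set of the countable base: a dense sequence. *)
Definition sample (p : nat) : X := xget point (W p).

Definition sample_triv (p : nat) : triv_index L := projT1 (cid (triv_dom_cover L (sample p))).

Lemma sample_trivP p : triv_dom (sample_triv p) (sample p).
Proof. exact: projT2 (cid (triv_dom_cover L (sample p))). Qed.

Definition sample_coord p s : C := fiber_coord (sample_triv p) (sample p) (s (sample p)).

(** The real and imaginary parts of the coordinates of [s] at the sample points, in a single real
    sequence: everything random is read off this sequence. *)
Definition ev s (i : nat) : R :=
  if odd i then complex.Im (sample_coord i./2 s) else complex.Re (sample_coord i./2 s).

(** The squared norm of a section at the [p]-th sample point, in terms of its sample sequence. *)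
Definition sample_norm2 p y : R :=
  weight h (sample_triv p) (sample p) * (y p.*2 ^+ 2 + y p.*2.+1 ^+ 2).

Lemma hn_sample p s : hn (s (sample p)) ^+ 2 = sample_norm2 p (ev s).
Proof.
rewrite (hn_coord h _ (sample_trivP p)) mulrC /sample_norm2 /ev /= odd_double doubleK uphalf_double /=.
by rewrite -/(sample_coord p s) cn_sqr.
Qed.

Lemma evB s t : ev (fun x => s x - t x) = fun i => ev s i - ev t i.
Proof. by apply/funext => i; rewrite /ev /sample_coord linearB; case: ifP => _; rewrite ?ReB ?ImB. Qed.

Lemma ev0 i : ev (fun x => 0) i = 0.
Proof. by rewrite /ev /sample_coord linear0; case: ifP. Qed.

Lemma hn_sampleB p s t : hn (s (sample p) - t (sample p)) ^+ 2 =
  sample_norm2 p (fun i => ev s i - ev t i).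
Proof. by rewrite -evB -hn_sample. Qed.

Lemma ev_bound i s : weight h (sample_triv i./2) (sample i./2) * ev s i ^+ 2 <= hn (s (sample i./2)) ^+ 2.
Proof.
rewrite hn_sample /sample_norm2; apply: ler_wpM2l; first exact/ltW/(weight_gt0 h (sample_trivP _)).
by rewrite -{1}(odd_double_half i); case: (odd i); rewrite ?add1n ?add0n ?lerDl ?lerDr sqr_ge0.
Qed.

(** By continuity a non-strict bound on an open set needs checking at the sample points only. *)
Lemma hn_dense (V : set X) s r : open V -> holomorphic_section s -> 0 <= r ->
  (forall p, V (sample p) -> hn (s (sample p)) ^+ 2 <= r ^+ 2) -> forall x, V x -> hn (s x) <= r.
Proof.
move=> Vo hs r0 sr x Vx; rewrite -(@ler_pXn2r _ 2)// ?nnegrE ?hn_ge0// leNgt; apply/negP => rx.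
have : nbhs x (V `&` [set y | r ^+ 2 < hn (s y) ^+ 2]).
  apply: filterI; first exact: open_nbhs_nbhs.
  have cs : hn (s y) ^+ 2 @[y --> x] --> hn (s x) ^+ 2 :=
    @continuous_hn2 _ _ _ _ _ h s hs x.
  by apply: (cs [set y | r ^+ 2 < y]); apply: open_nbhs_nbhs; split; first exact: open_gt.
move=> /W_base[p [Wx sub]]; have : W p (sample p) by rewrite /sample; case: xgetP => // /(_ x).
by move=> /sub[Vq /=]; rewrite ltNge sr.
Qed.

Lemma measurable_sample_norm2 d (T : measurableType d) p (F : nat -> T -> R) (r : R) :
  (forall i, measurable_fun setT (F i)) -> measurable [set w | sample_norm2 p (F ^~ w) <= r].
Proof.
move=> mF; have mN : measurable_fun setT (fun w => sample_norm2 p (F ^~ w)).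
  by apply: measurable_funM => //; apply: measurable_funD; apply: measurable_funX.
rewrite (_ : [set w | _] = setT `&` (fun w => sample_norm2 p (F ^~ w)) @^-1` `]-oo, r]%classic).
  exact: mN.
by apply/seteqP; split => w /=; rewrite in_itv /=; [split|case].
Qed.

End sampling.

(** * The limit as a function of the sample space *)

Section random_limit.
Context {R : realType} {n : nat} {X : ptopologicalType} {M : complex_atlas R n X}.
Context {L : line_bundle M}.
Variables (h : hermitian_metric L) (dV : {measure set (borel X) -> \bar R}).
Variable W : nat -> set X.
Hypothesis W_patch : forall i, bergman_patch h dV (W i).
Hypothesis W_base : forall x V, nbhs x V -> exists i, W i x /\ W i `<=` V.
Context d (T : measurableType d) (P : probability T R).
Variables (dim : option nat) (eta : nat -> {RV P >-> borel R[i]}).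
Variable S : nat -> forall x, fiber L x.
Hypothesis S_basis : orthonormal_basis h dV dim S.
Local Notation hn := (herm_norm h).
Local Notation ev := (ev W).

Definition partials (w : T) : nat -> forall x, fiber L x := partial_sum dim (fun j => eta j w) S.

(** The coefficients of the [i]-th sample value of the partial sums, as a linear form in the
    Gaussians. *)
Definition sample_row (i k : nat) : R := ev (real_basis dim S k) i.

Lemma ev_partials w m i : ev (partials w m) i = dot m.*2 (sample_row i) (real_gauss eta ^~ w).
Proof.
rewrite /dot /sample_row /ev /sample_coord /partials partial_sum_real linear_sum /=.
have sR (J : Type) (r : seq J) (F : J -> R[i]) : complex.Re (\sum_(j <- r) F j) = \sum_(j <- r) complex.Re (F j).
  by apply: (big_morph (@complex.Re R)); [move=> u v; exact: ReD|].
have sI (J : Type) (r : seq J) (F : J -> R[i]) : complex.Im (\sum_(j <- r) F j) = \sum_(j <- r) complex.Im (F j).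
  by apply: (big_morph (@complex.Im R)); [move=> [u1 u2] [v1 v2]|].
have mI (t : R) (z : R[i]) : complex.Im (t%:C * z) = complex.Im z * t by case: z => a b /=; ring.
have mR (t : R) (z : R[i]) : complex.Re (t%:C * z) = complex.Re z * t by case: z => a b /=; ring.
by case: ifP => _; [rewrite sI|rewrite sR]; apply: eq_bigr => k _; rewrite linearZ ?mI ?mR.
Qed.

Lemma measurable_ev_partials m i : measurable_fun setT (fun w => ev (partials w m) i).
Proof.
rewrite (_ : (fun w => _) = fun w => \sum_(k < m.*2) sample_row i k * real_gauss eta k w).
  apply: measurable_sum => k; apply: measurable_funM => //; exact: measurable_real_gauss.
by apply/funext => w; exact: ev_partials.
Qed.

(** The event on which the series converges: it is measurable, being expressed by countably many
    sample values, and it has full probability. *)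
Definition conv_set : set T := [set w | forall i, ucauchy h (W i) (partials w)].

Lemma W_cover x : exists i, W i x.
Proof. by have [i [Wi _]] := W_base (@filterT _ (nbhs x) _); exists i. Qed.

Lemma ucauchy_sampleP w i : ucauchy h (W i) (partials w) <-> forall l : nat, exists N : nat, forall m m' p : nat,
  ((N <= m)%N /\ (N <= m')%N) /\ W i (sample W p) ->
  sample_norm2 h W p (fun i => ev (partials w m) i - ev (partials w m') i) <= (l.+1%:R^-1) ^+ 2.
Proof.
split.
  move=> uc l; have [N Nh] := uc l.+1%:R^-1 ltac:(by rewrite invr_gt0); exists N => m m' p [[Nm Nm'] Wp].
  by rewrite -hn_sampleB; apply: lerXn2r; rewrite ?nnegrE ?hn_ge0 ?invr_ge0//; exact: Nh.
move=> uc e e0; have [l le] : exists l : nat, l.+1%:R^-1 <= e :> R.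
  by exists (Num.truncn e^-1); rewrite invf_ple ?posrE ?ltr0Sn// ltW// truncnS_gt.
have [N Nh] := uc l; exists N => m m' x Nm Nm' Wx; apply: le_trans le.
have hs : holomorphic_section (fun x => partials w m x + (-1) *: partials w m' x).
  by apply: holomorphic_sectionD; [|apply: holomorphic_sectionZ]; exact: (partial_sum_hol S_basis).
have [Wo _ _] := W_patch i.
have := hn_dense W_base Wo hs (r := l.+1%:R^-1) _ _ Wx; rewrite scaleN1r; apply => [|p Wp].
  by rewrite invr_ge0.
by rewrite scaleN1r hn_sampleB; exact: Nh.
Qed.

Lemma measurable_conv_set : measurable conv_set.
Proof.
apply: (measurable_forall (F := fun i => [set w | ucauchy h (W i) (partials w)])) => i; rewrite (_ : [set w | _] = [set w | forall l : nat, exists N : nat, forall m m' p : nat,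
  ((N <= m)%N /\ (N <= m')%N) /\ W i (sample W p) ->
  sample_norm2 h W p (fun i => ev (partials w m) i - ev (partials w m') i) <= (l.+1%:R^-1) ^+ 2]); last first.
  by apply/seteqP; split => w /ucauchy_sampleP.
apply: measurable_forall => l; apply: measurable_exists => N; apply: measurable_forall => m.
apply: measurable_forall => m'; apply: measurable_forall => p; apply: measurable_imp.
apply: (@measurable_sample_norm2 _ _ _ _ _ _ _ _ _ p (fun i w => ev (partials w m) i - ev (partials w m') i)) => k.
by apply: measurable_funB; exact: measurable_ev_partials.
Qed.

Local Notation psi := (random_section h dim eta S).

(** On [conv_set] the series has a holomorphic sum in the Frechet sense, because a compact set is
    covered by finitely many patches; conversely the sum selected by [frechet_sum] is the uniform
    limit on each patch, because patches are contained in compact sets. *)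
Lemma psi_conv w : conv_set w -> forall i, ulimit h (W i) (partials w) (sval (psi w)).
Proof.
move=> cw.
have [s hs sl] := @holomorphic_limit _ _ _ _ _ h W (partials w) (fun i => let: And3 o _ _ := W_patch i in o) W_cover
  (partial_sum_hol S_basis _) cw.
have : is_frechet_sum h dim (fun j => eta j w) S (psi w).
  rewrite /random_section /frechet_sum; case: xgetP => // /(_ (exist _ s hs)); case => K e Kc e0.
  have [N KN] := compact_subcover Kc (fun i => let: And3 o _ _ := W_patch i in o) W_cover.
  have [m mh] : exists m : nat -> nat, forall i k x, (m i <= k)%N -> W i x -> hn (partials w k x - s x) <= e / 2.
    have sl' i : exists m : nat, forall k x, (m <= k)%N -> W i x -> hn (partials w k x - s x) <= e / 2.
      exact: (sl i (e / 2) (divr_gt0 e0 (ltr0Sn R 1))).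
    by exists (fun i => projT1 (cid (sl' i))) => i; exact: projT2 (cid (sl' i)).
  exists (\max_(i < N) m i)%N => // k /= Nk x /KN[i iN Wx].
  apply: le_lt_trans (mh i k x _ Wx) _.
    by apply: leq_trans Nk; exact: (leq_bigmax (Ordinal iN)).
  by rewrite ltr_pdivrMr// ltr_pMr// ltr1n.
move=> fs i e e0; have [_ [K Kc WK] _] := W_patch i; have [N _ Nh] := fs K e Kc e0.
by exists N => m x Nm Wx; apply: ltW; apply: Nh => //; exact: WK.
Qed.

(** A Frechet sum would make the partial sums Cauchy on every patch; so outside [conv_set] the
    default value 0 is taken. *)
Lemma psi_nconv w : ~ conv_set w -> psi w = @zero_section _ _ _ _ L.
Proof.
move=> ncw; rewrite /random_section /frechet_sum; case: xgetP => // s _ fs; case: ncw => i e e0.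
have [_ [K Kc WK] _] := W_patch i; have [N _ Nh] := fs K (e / 2) Kc (divr_gt0 e0 (ltr0Sn R 1)).
exists N => m m' x Nm Nm' /WK Kx; rewrite -[X in hn X](subrKA (sval s x)) [leRHS]splitr.
by apply: le_trans (hnD _ _ _) _; rewrite [X in _ + X]hnB; apply: lerD; apply: ltW; exact: Nh.
Qed.

Lemma ev_psi_cvg w i : conv_set w -> ev (partials w m) i @[m --> \oo] --> ev (sval (psi w)) i.
Proof.
move=> cw; apply/cvgrPdist_le => e e0; have [j Wj] := W_cover (sample W i./2).
have w0 := weight_gt0 h (@sample_trivP _ _ _ _ L W i./2).
set g := weight _ _ _ in w0; have sg0 : 0 < Num.sqrt g by rewrite sqrtr_gt0.
have [N Nh] := psi_conv cw j (mulr_gt0 e0 sg0); exists N => // m /= Nm.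
have := Nh m _ Nm Wj; rewrite -(@ler_pXn2r _ 2)// ?nnegrE ?hn_ge0 ?mulr_ge0// ?(ltW e0) ?(ltW sg0)//.
rewrite exprMn (sqr_sqrtr (ltW w0)) => eh.
have := le_trans (ev_bound h W i (fun x => partials w m x - sval (psi w) x)) eh.
rewrite -/g mulrC ler_pM2r// evB => h2.
rewrite -(@ler_pXn2r _ 2)// ?nnegrE ?(ltW e0)// real_normK ?num_real//.
by rewrite -sqrrN opprB.
Qed.

(** The sample values are limits of those of the partial sums, cut off outside [conv_set]. *)
Lemma measurable_ev_psi i : measurable_fun setT (fun w => ev (sval (psi w)) i).
Proof.
pose f m w := ev (partials w m) i * \1_conv_set w.
apply: (@measurable_fun_cvg _ _ _ _ f) => //.
  move=> m; apply: measurable_funM; first exact: measurable_ev_partials.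
  exact: measurable_indic measurable_conv_set.
move=> w _; rewrite /f indicE; case: (boolP (w \in conv_set)).
  by rewrite inE => cw; under eq_fun do rewrite mulr1; exact: ev_psi_cvg.
move/negP; rewrite inE => ncw; under eq_fun do rewrite mulr0.
by rewrite psi_nconv//= ev0; exact: cvg_cst.
Qed.

End random_limit.

(** * Open sets of sections through sample values *)

Section separability.
Context {R : realType} {n : nat} {X : ptopologicalType} {M : complex_atlas R n X}.
Context {L : line_bundle M}.
Variables (h : hermitian_metric L) (dV : {measure set (borel X) -> \bar R}).
Variable W : nat -> set X.
Hypothesis W_patch : forall i, bergman_patch h dV (W i).
Hypothesis W_base : forall x V, nbhs x V -> exists i, W i x /\ W i `<=` V.
Variables (K : countType) (center : K -> forall x, fiber L x).
Hypothesis center_hol : forall q, holomorphic_section (center q).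
Local Notation hn := (herm_norm h).
Local Notation ev := (ev W).
Implicit Types s t : H0 L.

(** [s] lies in the closure of the countable family [center], on which the balls around the centers
    form a countable base. *)
Definition approximable s := forall I l : nat, exists q : K, forall i x, (i < I)%N -> W i x ->
  hn (sval s x - center q x) <= l.+1%:R^-1.

(** The sample values of the closed ball of radius [1/(l+1)] for the sup norm over the first [I]
    patches. *)
Definition tube (I l : nat) (y0 : nat -> R) : set (nat -> R) := [set y | forall i p,
  (i < I)%N /\ W i (sample W p) -> sample_norm2 h W p (fun k => y k - y0 k) <= (l.+1%:R^-1) ^+ 2].

(** The sequences by which [U] is recognized on approximable sections. *)
Definition trace_set (U : set (H0 L)) : set (nat -> R) := [set y | exists q I l,
  (forall t, tube I l (ev (center q)) (ev (sval t)) -> U t) /\ tube I l (ev (center q)) y].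

Lemma patch_open i : open (W i).
Proof. by have [] := W_patch i. Qed.

Lemma tubeP I l q s : tube I l (ev (center q)) (ev (sval s)) <->
  forall i x, (i < I)%N -> W i x -> hn (sval s x - center q x) <= l.+1%:R^-1.
Proof.
split=> [sq i x iI Wx|sq i p [iI Wp]]; last first.
  by rewrite -hn_sampleB; apply: lerXn2r; rewrite ?nnegrE ?hn_ge0 ?invr_ge0//; exact: sq Wp.
have hs : holomorphic_section (fun x => sval s x + (-1) *: center q x).
  by apply: holomorphic_sectionD; [exact: (proj2_sig s)|exact: holomorphic_sectionZ].
have := hn_dense W_base (patch_open i) hs (r := l.+1%:R^-1) _ _ Wx; rewrite scaleN1r; apply => [|p Wp].
  by rewrite invr_ge0.
by rewrite scaleN1r hn_sampleB; exact: (sq i p (conj iI Wp)).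
Qed.

(** If [s] belongs to [U], a ball of radius [e] around [s] lies in [U]; a center at distance less
    than [e / 2] provides a ball that contains [s] and is contained in [U]. *)
Lemma trace_setP U s : frechet_open h U -> approximable s -> U s <-> trace_set U (ev (sval s)).
Proof.
move=> Uo sa; split; last by move=> [q [I [l [sub st]]]]; exact: sub.
move=> /Uo[C [e [Cc e0 CU]]].
have [I CI] := compact_subcover Cc patch_open (W_cover W_base).
have [l le] : exists l : nat, l.+1%:R^-1 < e / 2 :> R.
  exists (Num.truncn (e / 2)^-1); rewrite invf_plt ?posrE ?divr_gt0 ?ltr0Sn//; exact: truncnS_gt.
have [q sq] := sa I l; exists q, I, l; split; last exact/tubeP.
move=> t /tubeP tq; apply: CU => x /CI[i iI Wx].
rewrite -(subrKA (center q x)) [ltRHS]splitr; apply: le_lt_trans (hnD _ _ _) _.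
rewrite [X in _ + X]hnB; apply: ltrD; apply: le_lt_trans le; [exact: tq Wx|exact: sq Wx].
Qed.

Lemma measurable_trace_set U : measurable (trace_set U : set (seqR R)).
Proof.
rewrite (_ : trace_set U = [set y | exists c, match @unpickle K c with
    Some q => exists I l, (forall t, tube I l (ev (center q)) (ev (sval t)) -> U t) /\ tube I l (ev (center q)) y
  | None => False end]); last first.
  apply/seteqP; split=> y.
    by move=> [q yq]; exists (pickle q); rewrite pickleK.
  by move=> [c]; case: unpickle => // q yq; exists q.
apply: (@measurable_exists _ (seqR R)) => c; case: unpickle => [q|]; last exact: measurable0.
apply: (@measurable_exists _ (seqR R)) => I; apply: (@measurable_exists _ (seqR R)) => l.
apply: (@measurable_guard _ (seqR R)).
apply: (@measurable_forall _ (seqR R)) => i; apply: (@measurable_forall _ (seqR R)) => p.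
apply: (@measurable_imp _ (seqR R)).
apply: (@measurable_sample_norm2 _ _ _ _ _ _ _ _ (seqR R) p (fun k y => y k - ev (center q) k)) => k.
by apply: measurable_funB => //; exact: measurable_seq_coord.
Qed.

End separability.

(** * Rational combinations of a basis *)

Section rational_combinations.
Context {R : realType} {n : nat} {X : ptopologicalType} {M : complex_atlas R n X}.
Context {L : line_bundle M}.
Variables (h : hermitian_metric L) (dV : {measure set (borel X) -> \bar R}).
Local Notation C := R[i].
Local Notation cn := (@ComplexField.Normc.normc R).
Local Notation hn := (herm_norm h).

Definition ratc (q : rat * rat) : C := ratr q.1 +i* ratr q.2.

Lemma ratc_approx (z : C) e : 0 < e -> exists q, cn (z - ratc q) <= e.
Proof.
move=> e0; have e2 : 0 < e / 2 by exact: divr_gt0.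
have [q1 h1] := rat_approx (complex.Re z) e2; have [q2 h2] := rat_approx (complex.Im z) e2.
exists (q1, q2); apply: le_trans (cn_le _) _; rewrite ReB ImB /= [leRHS]splitr.
by apply: lerD; exact: ltW.
Qed.

Variables (dim : option nat) (S : nat -> forall x, fiber L x).
Hypothesis S_basis : orthonormal_basis h dV dim S.

Definition rat_comb (a : seq (rat * rat)) : forall x, fiber L x :=
  partial_sum dim (fun j => ratc (nth (0, 0) a j)) S (size a).

Lemma patch_bounded W j : bergman_patch h dV W -> index_lt dim j ->
  exists2 B : R, 0 <= B & forall x, W x -> hn (S j x) <= B.
Proof.
move=> [_ _ [U [c [[mU _] c0 e1 _]]]] dj; have [S_L2 _ _] := S_basis; have [Sh Sfin] := S_L2 j dj.
exists (Num.sqrt (c * fine (L2_norm2 h dV (S j)))); first exact: sqrtr_ge0.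
move=> x Wx; have N0 : 0 <= fine (L2_norm2 h dV (S j)) by apply: fine_ge0; exact: L2_norm2_ge0.
rewrite -(@ler_pXn2r _ 2)// ?nnegrE ?hn_ge0 ?sqrtr_ge0// [X in _ <= X]sqr_sqrtr ?mulr_ge0//.
rewrite -lee_fin [X in (_ <= X)%E]EFinM -(L2_norm2_fin (S_L2 j dj)); apply: le_trans (e1 _ Sh _ Wx) _.
apply: lee_wpmul2l; first by rewrite lee_fin.
apply: ge0_subset_integral => //; first exact: measurable_hn2E.
by move=> y _; rewrite lee_fin sqr_ge0.
Qed.

(** The basis sections are bounded on patches by their L2 norm, so coefficients may be perturbed to
    rational ones. *)
Lemma partial_sum_approx (W : nat -> set X) I c m e : (forall i, bergman_patch h dV (W i)) -> 0 < e ->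
  exists a, forall i x, (i < I)%N -> W i x -> hn (partial_sum dim c S m x - rat_comb a x) <= e.
Proof.
move=> W_patch e0.
have bd i j : exists B : R, 0 <= B /\ (index_lt dim j -> forall x, W i x -> hn (S j x) <= B).
  have [dj|] := boolP (index_lt dim j); last by exists 0.
  by have [B B0 Bh] := patch_bounded (W_patch i) dj; exists B.
pose B i j := projT1 (cid (bd i j)).
have B0 i j : 0 <= B i j by case: (projT2 (cid (bd i j))).
have Bh i j : index_lt dim j -> forall x, W i x -> hn (S j x) <= B i j by case: (projT2 (cid (bd i j))).
pose D := \sum_(i < I) \sum_(j < m) B i j.
have D0 : 0 <= D by apply: sumr_ge0 => i _; apply: sumr_ge0.
have dl0 : 0 < e / (D + 1) by rewrite divr_gt0// ltr_wpDl.
pose q j := projT1 (cid (ratc_approx (c j) dl0)).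
have qh j : cn (c j - ratc (q j)) <= e / (D + 1) := projT2 (cid (ratc_approx (c j) dl0)).
exists (mkseq q m) => i x iI Wx.
have -> : partial_sum dim c S m x - rat_comb (mkseq q m) x =
    \sum_(j < m | index_lt dim j) (c j - ratc (q j)) *: S j x.
  rewrite /rat_comb /partial_sum size_mkseq -sumrB; apply: eq_bigr => j _.
  by rewrite nth_mkseq// scalerBl.
have hsum (J : Type) (r : seq J) (Q : pred J) (F : J -> fiber L x) :
    hn (\sum_(j <- r | Q j) F j) <= \sum_(j <- r | Q j) hn (F j).
  elim/big_rec2: _ => [|j u v _ uv]; first by rewrite hn0.
  by apply: le_trans (hnD _ _ _) _; rewrite lerD2l.
apply: le_trans (hsum _ _ _ _) _.
apply: (@le_trans _ _ (\sum_(j < m) e / (D + 1) * B i j)).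
  rewrite big_mkcond; apply: ler_sum => j _; case: ifP => dj; last by rewrite mulr_ge0// ltW.
  by rewrite hnZ; apply: ler_pM; rewrite ?cn_ge0 ?hn_ge0//; exact: Bh.
rewrite -mulr_sumr -mulrA ler_piMr ?(ltW e0)// mulrC ler_pdivrMr ?ltr_wpDl// mul1r.
apply: ler_wpDr => //; rewrite /D (bigD1 (Ordinal iI))//= lerDl.
by apply: sumr_ge0 => i' _; apply: sumr_ge0.
Qed.

End rational_combinations.

(** * Measurability of the random section *)

Section measurable_random_section.
Context {R : realType} {n : nat} {X : ptopologicalType} {M : complex_atlas R n X}.
Context {L : line_bundle M}.
Variables (h : hermitian_metric L) (dV : {measure set (borel X) -> \bar R}).
Variable W : nat -> set X.
Hypothesis W_patch : forall i, bergman_patch h dV (W i).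
Hypothesis W_base : forall x V, nbhs x V -> exists i, W i x /\ W i `<=` V.
Context d (T : measurableType d) (P : probability T R).
Variables (dim : option nat) (eta : nat -> {RV P >-> borel R[i]}).
Variable S : nat -> forall x, fiber L x.
Hypothesis S_basis : orthonormal_basis h dV dim S.
Variables (K : countType) (center : K -> forall x, fiber L x).
Hypothesis center_hol : forall q, holomorphic_section (center q).
Hypothesis center_S : forall a, exists q, center q = rat_comb dim S a.
Local Notation hn := (herm_norm h).
Local Notation psi := (random_section h dim eta S).

Lemma approximable_psi w : approximable h W center (psi w).
Proof.
move=> I l; have [cw|ncw] := pselect (conv_set h W dim eta S w); last first.
  have [q qE] := center_S [::]; exists q => i x _ _.
  by rewrite (psi_nconv W_patch ncw) qE /rat_comb /partial_sum big_ord0 subrr hn0 invr_ge0.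
have e0 : 0 < l.+1%:R^-1 / 2 :> R by rewrite divr_gt0// invr_gt0.
have lim i := psi_conv W_patch W_base S_basis cw i e0.
pose N i := projT1 (cid (lim i)).
have Nh i m x : (N i <= m)%N -> W i x -> hn (partials dim eta S w m x - sval (psi w) x) <= l.+1%:R^-1 / 2.
  exact: (projT2 (cid (lim i))).
pose m := (\max_(i < I) N i)%N.
have [a ah] := partial_sum_approx S_basis I (fun j => eta j w) m W_patch e0.
have [q qE] := center_S a; exists q => i x iI Wx; rewrite qE.
rewrite -(subrKA (partials dim eta S w m x)) [leRHS]splitr; apply: le_trans (hnD _ _ _) _.
apply: lerD; last exact: ah iI Wx.
by rewrite hnB; apply: Nh Wx; exact: (leq_bigmax (Ordinal iI)).
Qed.

Lemma psi_preimage U : frechet_open h U ->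
  psi @^-1` U = (fun w => ev W (sval (psi w)) : seqR R) @^-1` trace_set h W center U.
Proof.
move=> Uo; have tP w := trace_setP W_patch W_base center_hol Uo (approximable_psi w).
by apply/seteqP; split => w; [move=> /tP|move=> wU; apply/tP].
Qed.

Lemma measurable_ev_psi_seq : measurable_fun setT (fun w => ev W (sval (psi w)) : seqR R).
Proof. apply: measurable_to_seq => i; have := measurable_ev_psi W_patch W_base eta S_basis i; exact. Qed.

Lemma measurable_psi : measurable_fun setT (psi : T -> g_sigma_algebraType (frechet_open h)).
Proof.
apply: (@measurability _ _ T (g_sigma_algebraType (frechet_open h)) setT psi (frechet_open h)) => //.
move=> _ [U Uo <-]; rewrite setTI psi_preimage// -[X in measurable X]setTI.
by apply: (measurable_ev_psi_seq measurableT); exact: measurable_trace_set.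
Qed.

End measurable_random_section.

(** * Determination of laws by lower orthants *)

Section rays.
Context {R : realType}.

(** Lower orthants of finitely many coordinates as a generating system: a small error in the
    variables amounts to a small shift of such an event. *)
Definition rays : set (set (nat -> R)) := [set A | exists p c, A = below p c].

Lemma rays_setI : setI_closed rays.
Proof.
move=> _ _ [p [c ->]] [p' [c' ->]].
exists (maxn p p'), (fun i => if (i < p)%N then if (i < p')%N then Num.min (c i) (c' i) else c i else c' i).
apply/seteqP; split => x.
  move=> [xc xc'] i; rewrite leq_max; case: ifP => [ip _|_ /= ip']; last exact: xc'.
  by case: ifP => ip'; rewrite ?lt_min ?xc ?xc'.
move=> xc; split => i ip; have := xc i; rewrite leq_max ip ?orbT => /(_ isT).
  by case: ifP => _ //; rewrite lt_min => /andP[].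
by case: ifP => _ //; rewrite lt_min => /andP[].
Qed.

Lemma rays_setT : rays setT.
Proof. by exists 0%N, (fun=> 0); apply/seteqP; split. Qed.

(** A half-line condition on a single coordinate [k] is a countable union of orthants: the other
    coordinates below [k] are bounded by an arbitrarily large integer. *)
Lemma measurable_ray_coord k : measurable_fun setT (fun x : g_sigma_algebraType rays => x k : measurableTypeR R).
Proof.
apply: (measurability _ (RGenInftyO.measurableE R)) => _ [_ [r ->] <-]; rewrite setTI.
rewrite (_ : _ @^-1` _ = \bigcup_j (below k.+1 (fun i => if i == k then r else j%:R))).
  by apply: bigcupT_measurable => j; apply: sub_sigma_algebra; exists k.+1, (fun i => if i == k then r else j%:R).
apply/seteqP; split => x /=; rewrite in_itv /=.
  move=> xr; pose B := \sum_(i < k) `|x i|.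
  exists (Num.truncn B).+1 => // i; rewrite ltnS => ik; case: eqVneq => [->//|nik].
  have ik' : (i < k)%N by rewrite ltn_neqAle nik.
  apply: le_lt_trans (truncnS_gt B); apply: le_trans (ler_norm _) _.
  by rewrite /B (bigD1 (Ordinal ik'))//= lerDl; apply: sumr_ge0.
by move=> [j _ /(_ k)]; rewrite ltnSn eqxx => /(_ isT).
Qed.

Lemma seq_law_unique d (T : measurableType d) (P : probability T R) (Z Y : T -> seqR R) :
  measurable_fun setT Z -> measurable_fun setT Y ->
  (forall p c, P [set w | below p c (Z w)] = P [set w | below p c (Y w)]) ->
  forall E : set (seqR R), measurable E -> P (Z @^-1` E) = P (Y @^-1` E).
Proof.
move=> mZ mY h E mE.
have mE' : measurable (E : set (g_sigma_algebraType rays)).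
  have mid : measurable_fun setT ((fun x => x) : g_sigma_algebraType rays -> seqR R).
    by apply: measurable_to_seq => k; exact: measurable_ray_coord.
  by rewrite -[E]setTI; exact: (mid measurableT E mE).
have mF (F : T -> seqR R) : measurable_fun setT F -> measurable_fun setT (F : T -> g_sigma_algebraType rays).
  move=> mF; apply: (@measurability _ _ T (g_sigma_algebraType rays) setT F rays) => //.
  move=> _ [_ [p [c ->]] <-]; rewrite setTI.
  apply: (@measurable_forall_lt _ _ _ p c (fun i w => F w i)) => i.
  exact: (measurableT_comp (measurable_seq_coord i) mF).
apply: (@law_unique R _ _ T (g_sigma_algebraType rays) P rays Z Y) => //.
- exact: rays_setI.
- exact: rays_setT.
- exact: mF.
- exact: mF.
- by move=> _ [p [c ->]]; exact: h.
Qed.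

End rays.

(** * Convergence in probability of orthant events *)

Section in_probability.
Context {R : realType} d (T : measurableType d) (P : probability T R).

(** The events that some term from [N] on deviates decrease to a null set. *)
Lemma as_close (F : nat -> nat -> T -> R) (Y : nat -> T -> R) (p : nat) (dl ep : R) :
  (forall m i, measurable_fun setT (F m i)) -> (forall i, measurable_fun setT (Y i)) ->
  P.-negligible [set w | ~ forall i, F m i w @[m --> \oo] --> Y i w] -> 0 < dl -> 0 < ep ->
  exists N, forall m, (N <= m)%N ->
    (P [set w | exists2 i, (i < p)%N & (dl < `|F m i w - Y i w|)%R] <= ep%:E)%E.
Proof.
move=> mF mY neg dl0 ep0.
pose A m := [set w | exists2 i, (i < p)%N & dl < `|F m i w - Y i w|].
have mA m : measurable (A m).
  rewrite (_ : A m = [set w | exists i, (i < p)%N /\ dl < `|F m i w - Y i w|]); last first.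
    by apply/seteqP; split => w; case=> i; [move=> h1 h2; exists i|case=> h1 h2; exists i].
  apply: measurable_exists => i; apply: measurable_guard; apply: (@measurable_abs_gt _ _ _ (fun w => F m i w - Y i w)).
  exact: measurable_funB.
pose B N := [set w | exists k, A (N + k)%N w].
have mB N : measurable (B N) by apply: measurable_exists => k.
have capB : P (\bigcap_N B N) = 0%E.
  have [Z [mZ PZ subZ]] := neg.
  apply/eqP; rewrite eq_le measure_ge0 andbT -PZ; apply: le_measure; rewrite ?inE//.
    exact: bigcapT_measurable.
  move=> w Bw; apply: subZ => cw.
  have near i : exists N, forall m, (N <= m)%N -> `|F m i w - Y i w| <= dl.
    have /cvgrPdist_le /(_ dl dl0)[N _ Nh] := cw i; exists N => m Nm; rewrite distrC; exact: Nh.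
  pose N i := projT1 (cid (near i)).
  have Nh i m : (N i <= m)%N -> `|F m i w - Y i w| <= dl by exact: (projT2 (cid (near i))).
  have [k [i ip]] := Bw (\max_(i < p) N i)%N I.
  rewrite ltNge Nh//; apply: leq_trans (leq_addr _ _); exact: (leq_bigmax (Ordinal ip)).
have cvgB : P (B N) @[N --> \oo] --> 0%E.
  rewrite -capB; apply: nonincreasing_cvg_mu => //.
  - by apply: le_lt_trans (probability_le1 P (mB 0%N)) _; rewrite ltry.
  - exact: bigcapT_measurable.
  - move=> N N' NN'; apply/subsetPset => w [k Ak]; exists (N' - N + k)%N.
    by rewrite addnA subnKC.
have [N _ Nh] : \forall N \near \oo, (P (B N) <= ep%:E)%E.
  have /fine_cvgP[fB /cvgrPdist_le /(_ ep ep0) lB] := cvgB.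
  near=> N; rewrite -(fineK (x := P (B N))); last by near: N.
  rewrite lee_fin; apply: le_trans (ler_norm _) _; rewrite -normrN -sub0r.
  by near: N.
exists N => m Nm; apply: le_trans (Nh N (leqnn N)); apply: le_measure; rewrite ?inE//; first exact: mA.
by move=> w Aw; exists (m - N)%N; rewrite subnKC.
Unshelve. all: by end_near. Qed.

Lemma below_close (F Y : nat -> T -> R) p c (dl : R) (ep : \bar R) :
  (forall i, measurable_fun setT (F i)) -> (forall i, measurable_fun setT (Y i)) ->
  (P [set w | exists2 i, (i < p)%N & (dl < `|F i w - Y i w|)%R] <= ep)%E ->
  (P [set w | below p c (Y ^~ w)] <= P [set w | below p (fun i => c i + dl)%R (F ^~ w)] + ep)%E.
Proof.
move=> mF mY Pep; set A := [set w | exists2 i, _ & _] in Pep.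
have mA : measurable A.
  rewrite (_ : A = [set w | exists i, (i < p)%N /\ dl < `|F i w - Y i w|]); last first.
    by apply/seteqP; split => w; case=> i; [move=> h1 h2; exists i|case=> h1 h2; exists i].
  apply: measurable_exists => i; apply: measurable_guard; apply: (@measurable_abs_gt _ _ _ (fun w => F i w - Y i w)).
  exact: measurable_funB.
have mb c' (G : nat -> T -> R) : (forall i, measurable_fun setT (G i)) -> measurable [set w | below p c' (G ^~ w)].
  exact: measurable_forall_lt.
apply: le_trans (leeD2l _ Pep); apply: le_trans (measureU2 _ _ _) => //; last exact: mb.
apply: le_measure; rewrite ?inE//; [exact: mb|by apply: measurableU => //; exact: mb|].
move=> w Yc; have [|nA] := pselect (A w); first by right.
left => i ip; have := Yc i ip; rewrite -(ltrD2r dl); apply: le_lt_trans.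
rewrite -lerBlDl; apply: le_trans (ler_norm _) _; rewrite leNgt; apply/negP => h.
by apply: nA; exists i.
Qed.

(** The open orthant is the increasing union of the orthants shifted inwards; so the errors on [c]
    disappear in the limit, whatever mass the boundary carries. *)
Lemma below_continuous (Y : nat -> T -> R) p (c : nat -> R) (B : \bar R) : (forall i, measurable_fun setT (Y i)) ->
  (forall dl : R, 0 < dl -> (P [set w | below p (fun i => c i - dl)%R (Y ^~ w)] <= B)%E) ->
  (P [set w | below p c (Y ^~ w)] <= B)%E.
Proof.
move=> mY h; pose A (l : nat) := [set w | below p (fun i => c i - l.+1%:R^-1) (Y ^~ w)].
have mA l : measurable (A l) by exact: measurable_forall_lt.
have AE : [set w | below p c (Y ^~ w)] = \bigcup_l A l.
  apply/seteqP; split => w; last first.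
    by move=> [l _ Al] i ip; apply: lt_trans (Al i ip) _; rewrite ltrBlDr ltrDl invr_gt0.
  move=> Yc.
  have near i : exists l : nat, (i < p)%N -> Y i w < c i - l.+1%:R^-1.
    have [ip|] := boolP (i < p)%N; last by exists 0%N.
    have g0 : 0 < c i - Y i w by rewrite subr_gt0; exact: Yc.
    exists (Num.truncn (c i - Y i w)^-1) => _; rewrite ltrBrDr addrC -ltrBrDr.
    by rewrite invf_plt ?posrE ?ltr0Sn//; exact: truncnS_gt.
  pose l i := projT1 (cid (near i)).
  exists (\max_(i < p) l i)%N => // i ip; apply: lt_le_trans (projT2 (cid (near i)) ip) _.
  rewrite lerD2l lerN2 lef_pV2 ?posrE ?ltr0Sn// ler_nat ltnS.
  exact: (leq_bigmax (Ordinal ip)).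
have cA : P (A l) @[l --> \oo] --> P (\bigcup_l A l).
  apply: nondecreasing_cvg_mu => //; first exact: bigcupT_measurable.
  move=> l l' ll'; apply/subsetPset => w Al i ip; apply: lt_le_trans (Al i ip) _.
  by rewrite lerD2l lerN2 lef_pV2 ?posrE ?ltr0Sn// ler_nat ltnS.
rewrite AE -(cvg_lim _ cA)//; apply: lime_le; first by apply/cvg_ex; exists (P (\bigcup_l A l)).
by apply: nearW => l; apply: h; rewrite invr_gt0.
Qed.

End in_probability.

(** * Covariances in two bases *)

Section gram.
Context {R : realType} {n : nat} {X : ptopologicalType} {M : complex_atlas R n X}.
Context {L : line_bundle M}.
Variables (h : hermitian_metric L) (Theta : hermitian_form M).
Variable dV : {measure set (borel X) -> \bar R}.
Hypothesis dV_Theta : is_volume_measure Theta dV.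
Variables (dim : option nat) (W : nat -> set X).
Local Notation C := R[i].
Local Notation cn := (@ComplexField.Normc.normc R).
Implicit Types S : nat -> forall x, fiber L x.
Local Notation row := (sample_row W dim).

(** Two increasing sequences with the same upper bounds have the same supremum. *)
Lemma interleaved_close (u v : nat -> R) (B : R) : {homo u : a b / (a <= b)%N >-> a <= b} ->
  {homo v : a b / (a <= b)%N >-> a <= b} ->
  (forall b m, (forall m', v m' <= b) -> u m <= b) -> (forall b m, (forall m', u m' <= b) -> v m <= b) ->
  (forall m, u m <= B) ->
  forall e, 0 < e -> exists N, forall m, (N <= m)%N -> `|u m - v m| <= e.
Proof.
move=> uN vN uv vu uB e e0; pose s := sup (range u).
have hs : has_sup (range u) by split; [exists (u 0%N), 0%N|exists B => _ [m _ <-]].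
have us m : u m <= s by apply: ub_le_sup; [exact: (proj2 hs)|exists m].
have vs m : v m <= s by exact: vu.
have [_ [N1 _ <-] h1] := sup_adherent e0 hs.
have [N2 h2] : exists N, s - e < v N.
  apply/not_existsP => nv; have /uv : forall m', v m' <= s - e by move=> m'; rewrite leNgt; apply/negP/nv.
  by move=> /(_ N1); rewrite leNgt h1.
exists (maxn N1 N2) => m; rewrite geq_max => /andP[/uN um /vN vm].
rewrite ler_norml; apply/andP; split.
  rewrite lerBrDl; apply: (@le_trans _ _ (s - e)); first by rewrite lerD2r.
  exact: ltW (lt_le_trans h1 um).
rewrite lerBlDr -lerBlDl; apply: (@le_trans _ _ (s - e)); first by rewrite lerD2r.
exact: ltW (lt_le_trans h2 vm).
Qed.

(** Makes the [i]-th sample value the real part of a complex linear functional: [Im z = Re (- i z)].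
    *)
Definition phase (i : nat) : C := if odd i then - 'i%C else 1.

Definition pair_coef (a b : C) (t : 'I_2) : C := if t == ord0 then a else b.

Lemma evE s i : ev W s i = complex.Re (phase i * @sample_coord _ _ _ _ L W i./2 s).
Proof. by rewrite /ev /phase; case: odd; case: (sample_coord _ _ _) => a b /=; ring. Qed.

(** The squared norm of [ell_i + sg * ell_j], where [ell_i] is the functional of which the [i]-th
    sample value is the real part. *)
Definition pair_norm S i j (sg : C) : nat -> R :=
  norm_sum dim (pair_coef (phase i) (sg * phase j))
    (fun t => @sample_triv _ _ _ _ L W (if t == ord0 then i./2 else j./2))
    (fun t => sample W (if t == ord0 then i./2 else j./2)) S.

Let u S i k := phase i * @sample_coord _ _ _ _ L W i./2 (S k).

Lemma row_even S i k : row S i k.*2 = if index_lt dim k then (Num.sqrt 2)^-1 * complex.Re (u S i k) else 0.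
Proof.
rewrite /sample_row evE /sample_coord /real_basis doubleK odd_double; case: ifP => _; last by rewrite linear0 mulr0.
rewrite linearZ /= /u /sample_coord mulr1 mulrCA; move: (phase i * _) => z.
by case: z => a b /=; ring.
Qed.

Lemma row_odd S i k : row S i k.*2.+1 = if index_lt dim k then - ((Num.sqrt 2)^-1 * complex.Im (u S i k)) else 0.
Proof.
rewrite /sample_row evE /sample_coord /real_basis /= uphalf_double odd_double /=; case: ifP => _; last by rewrite linear0 mulr0.
rewrite linearZ /= /u /sample_coord mulrCA; move: (phase i * _) => z.
by case: z => a b /=; ring.
Qed.

Lemma row_stationary D S i b m : dim = Some D -> (D <= m)%N -> dot m.*2 (row S i) b = dot D.*2 (row S i) b.
Proof.
move=> dE /subnKC <-; elim: (m - D)%N => [|k IH]; first by rewrite addn0.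
have dk : index_lt dim (D + k) = false by rewrite dE /= ltnNge leq_addr.
by rewrite addnS doubleS -IH /dot !big_ord_recr /= row_even row_odd dk !mul0r !addr0.
Qed.

Lemma pair_normS S i j sg m : pair_norm S i j sg m.+1 =
  pair_norm S i j sg m + if index_lt dim m then cn (u S i m + sg * u S j m) ^+ 2 else 0.
Proof.
rewrite /pair_norm /norm_sum big_mkcond big_ord_recr /= -big_mkcond; congr (_ + _); case: ifP => // _.
by rewrite /eval_comb !big_ord_recl big_ord0 addr0 /pair_coef /= /u /sample_coord mulrA.
Qed.

(** Polarization: [4 Re (u^* v) = |u+v|^2 - |u-v|^2], and each complex index contributes [Re (u^* v)
    / 2] because of the normalization of [real_basis]. *)
Lemma gram_polarization S i j m :
  dot m.*2 (row S i) (row S j) = (pair_norm S i j 1 m - pair_norm S i j (-1) m) / 8.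
Proof.
have s2 : Num.sqrt 2 != 0 :> R by rewrite sqrtr_eq0 -ltNge.
have s22 : (Num.sqrt 2)^-1 ^+ 2 = 2^-1 :> R by rewrite exprVn sqr_sqrtr.
rewrite /dot; elim: m => [|m IH].
  by rewrite !big_ord0 /pair_norm /norm_sum !big_ord0 subrr mul0r.
rewrite doubleS !big_ord_recr /= IH !pair_normS !row_even !row_odd.
case: (index_lt dim m); last by rewrite !mulr0 !addr0.
rewrite !cn_sqr !ReD !ImD mul1r mulN1r; case: (u S i m) => a b; case: (u S j m) => a' b' /=.
move: (Num.sqrt 2)^-1 s22 => t t2.
rewrite -addrA (_ : t * a * (t * a') + _ = t ^+ 2 * (a * a' + b * b')); last by ring.
by rewrite t2; field.
Qed.

Lemma norm_sum_homo p (a : 'I_p -> C) (k : 'I_p -> triv_index L) pt S :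
  {homo norm_sum dim a k pt S : m m' / (m <= m')%N >-> m <= m'}.
Proof.
move=> m m' /subnKC <-; elim: (m' - m)%N => [|l IH]; first by rewrite addn0.
apply: le_trans IH _; rewrite addnS /norm_sum [leRHS]big_mkcond big_ord_recr /= -big_mkcond lerDl.
by case: ifP => // _; exact: sqr_ge0.
Qed.

(** By polarization it suffices to compare norms of functionals, whose suprema in the two bases
    agree. *)
Lemma gram_close S S' : orthonormal_basis h dV dim S -> orthonormal_basis h dV dim S' ->
  forall p e, 0 < e -> exists N, forall m, (N <= m)%N -> forall i j, (i < p)%N -> (j < p)%N ->
    `|dot m.*2 (row S i) (row S j) - dot m.*2 (row S' i) (row S' j)| <= e.
Proof.
move=> S_basis S'_basis p e e0.
have close i j sg : exists N, forall m, (N <= m)%N -> `|pair_norm S i j sg m - pair_norm S' i j sg m| <= e.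
  have kP (t : 'I_2) : triv_dom (@sample_triv _ _ _ _ L W (if t == ord0 then i./2 else j./2))
    (sample W (if t == ord0 then i./2 else j./2)) by exact: sample_trivP.
  have [B uB] := norm_sum_bounded dV_Theta S_basis (pair_coef (phase i) (sg * phase j)) kP.
  apply: (@interleaved_close _ _ B) => //; try exact: norm_sum_homo.
    by move=> b m; exact: (norm_sum_le dV_Theta S_basis S'_basis kP).
  by move=> b m; exact: (norm_sum_le dV_Theta S'_basis S_basis kP).
pose N i j sg := projT1 (cid (close i j sg)).
have Nh i j sg m : (N i j sg <= m)%N -> `|pair_norm S i j sg m - pair_norm S' i j sg m| <= e.
  exact: (projT2 (cid (close i j sg))).
exists (\max_(i < p) \max_(j < p) maxn (N i j 1%R) (N i j (-1)%R))%N => m Nm i j ip jp.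
have : (maxn (N i j 1%R) (N i j (-1)%R) <= m)%N.
  apply: leq_trans Nm; apply: leq_trans (leq_bigmax (Ordinal ip)).
  exact: (leq_bigmax (Ordinal jp)).
rewrite geq_max => /andP[/Nh h1 /Nh h2]; rewrite !gram_polarization.
move: h1 h2; rewrite !ler_norml; lra.
Qed.

End gram.

(** * Equality of the two laws *)

Section same_law.
Context {R : realType} {n : nat} {X : ptopologicalType} {M : complex_atlas R n X}.
Context {L : line_bundle M}.
Variables (h : hermitian_metric L) (Theta : hermitian_form M).
Variable dV : {measure set (borel X) -> \bar R}.
Hypothesis dV_Theta : is_volume_measure Theta dV.
Variable W : nat -> set X.
Hypothesis W_patch : forall i, bergman_patch h dV (W i).
Hypothesis W_base : forall x V, nbhs x V -> exists i, W i x /\ W i `<=` V.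
Context d (T : measurableType d) (P : probability T R).
Variables (dim : option nat) (eta : nat -> {RV P >-> borel R[i]}).
Hypothesis eta_iid : iid_std_complex_gaussian dim eta.
Implicit Types S : nat -> forall x, fiber L x.
Local Notation row := (sample_row W dim).
Local Notation xi w := (real_gauss eta ^~ w).
Local Notation psi := (random_section h dim eta).

Lemma measurable_dot_xi m b : measurable_fun setT (fun w => dot m b (xi w)).
Proof.
apply: measurable_sum => k; apply: measurable_funM => //; exact: measurable_real_gauss.
Qed.

(** The approximate equality of laws at the level of partial sums. In infinite dimension further
    independent Gaussians are available for the padding; in finite dimension the Gram matrices agree
    exactly. *)
Lemma below_partial S S' p dl ep : orthonormal_basis h dV dim S -> orthonormal_basis h dV dim S' ->
  0 < dl -> 0 < ep -> exists N, forall m c, (N <= m)%N ->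
  (P [set w | below p c (fun i => dot m.*2 (row S i) (xi w))] <=
   P [set w | below p (fun i => c i + dl)%R (fun i => dot m.*2 (row S' i) (xi w))] + ep%:E)%E.
Proof.
move=> S_basis S'_basis dl0 ep0; case: (dim =P None) => [dE|].
  have [e e0 eP] := gauss_gram_close P p dl0 ep0.
  have [N Nh] := gram_close dV_Theta W S_basis S'_basis p e0; exists N => m c Nm.
  apply: eP; last by move=> i j ip jp; exact: Nh.
  by apply: (gauss_iid_eta eta_iid) => k _; rewrite dE.
case dE: dim => [D|//] _; rewrite -dE; exists D => m c Dm.
have stat S0 i b : dot m.*2 (row S0 i) b = dot D.*2 (row S0 i) b by exact: row_stationary.
have setE S0 c' : [set w | below p c' (fun i => dot m.*2 (row S0 i) (xi w))] =
    [set w | below p c' (fun i => dot D.*2 (row S0 i) (xi w))].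
  by apply/seteqP; split => w hw i ip; have := hw i ip; rewrite stat.
have gramE i j : dot D.*2 (row S i) (row S j) = dot D.*2 (row S' i) (row S' j).
  apply/eqP; rewrite -subr_eq0 -normr_le0; apply/ler_addgt0Pr => e e0; rewrite add0r.
  have [N Nh] := gram_close dV_Theta W S_basis S'_basis (maxn i j).+1 e0.
  have := Nh (maxn N D) (leq_maxl _ _) i j; rewrite !ltnS leq_maxl leq_maxr => /(_ isT isT).
  by rewrite !(row_stationary _ _ _ _ dE (leq_maxr N D)).
have gD : gauss_iid P D.*2 (real_gauss eta).
  by apply: (gauss_iid_eta eta_iid) => k kD; rewrite dE /= ltn_half_double.
rewrite !setE (gauss_gram_law c gD (fun i j _ _ => gramE i j)).
apply: le_trans (leeDl _ _); last by rewrite lee_fin ltW.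
have mb c' : measurable [set w | below p c' (fun i => dot D.*2 (row S' i) (xi w))].
  by apply: (@measurable_forall_lt _ _ _ p c' (fun i w => dot D.*2 (row S' i) (xi w))) => i; exact: measurable_dot_xi.
apply: le_measure; rewrite ?inE//.
by move=> w wc i ip; apply: lt_trans (wc i ip) _; rewrite ltrDl.
Qed.

Lemma ev_psi_neg S : orthonormal_basis h dV dim S ->
  P.-negligible [set w | ~ forall i, dot m.*2 (row S i) (xi w) @[m --> \oo] --> ev W (sval (psi S w)) i].
Proof.
move=> S_basis; have := negligible_bigcup (fun i => ucauchy_patch eta_iid S_basis (W_patch i)).
apply: negligibleS => w /= nc; apply: contrapT => nU; apply: nc => i.
under eq_fun do rewrite -ev_partials; apply: (ev_psi_cvg W_patch W_base S_basis) => j.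
by apply: contrapT => nj; apply: nU; exists j.
Qed.

(** Pass from the limit to a partial sum, from [S] to [S'], and back to the limit; each step costs a
    third of the margins. *)
Lemma below_psi_le S S' p c : orthonormal_basis h dV dim S -> orthonormal_basis h dV dim S' ->
  (P [set w | below p c (ev W (sval (psi S w)))] <= P [set w | below p c (ev W (sval (psi S' w)))])%E.
Proof.
move=> S_basis S'_basis.
have mY S0 : orthonormal_basis h dV dim S0 -> forall i, measurable_fun setT (fun w => ev W (sval (psi S0 w)) i).
  move=> S0_basis i; exact: (measurable_ev_psi W_patch W_base eta S0_basis i).
apply: (below_continuous (Y := fun i w => ev W (sval (psi S w)) i)); first exact: mY.
move=> dl3 dl30; pose dl := dl3 / 3; have dl0 : 0 < dl by exact: divr_gt0.
apply/lee_addgt0Pr => ep3 ep30; pose ep := ep3 / 3; have ep0 : 0 < ep by exact: divr_gt0.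
pose F S0 m i w := dot m.*2 (row S0 i) (xi w).
have mF S0 m i : measurable_fun setT (F S0 m i) by exact: measurable_dot_xi.
have [N1 h1] := as_close p (mF S) (mY S S_basis) (ev_psi_neg S_basis) dl0 ep0.
have [N2 h2] := as_close p (mF S') (mY S' S'_basis) (ev_psi_neg S'_basis) dl0 ep0.
have [N3 h3] := below_partial p S_basis S'_basis dl0 ep0.
pose m := maxn N1 (maxn N2 N3).
have k1 := h1 m (leq_maxl _ _).
have k2 : (P [set w | exists2 i, (i < p)%N & (dl < `|ev W (sval (psi S' w)) i - F S' m i w|)%R] <= ep%:E)%E.
  rewrite (_ : [set w | _] = [set w | exists2 i, (i < p)%N & (dl < `|F S' m i w - ev W (sval (psi S' w)) i|)%R]).
    by apply: h2; rewrite /m (leq_trans (leq_maxl N2 N3))// leq_maxr.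
  by apply/seteqP; split => w; case=> i ip; rewrite distrC => hi; exists i.
have k3 := h3 m _ (leq_trans (leq_maxr N2 N3) (leq_maxr _ _)).
apply: le_trans (below_close _ (mF S m) (mY S S_basis) k1) _.
apply: le_trans (leeD2r _ (k3 _)) _.
apply: le_trans (leeD2r _ (leeD2r _ (below_close _ (mY S' S'_basis) (mF S' m) k2))) _.
rewrite -!addeA -!EFinD (_ : ep + (ep + ep) = ep3); last by rewrite /ep; field.
rewrite (_ : (fun i => c i - dl3 + dl + dl + dl) = c)//.
by apply/funext => i; rewrite /dl; field.
Qed.

(** The preimage of an open set under either random section is the event that its sample sequence
    belongs to the same [trace_set], and the sample sequences have the same law. *)
Lemma psi_law S S' (K : countType) (center : K -> forall x, fiber L x) :
  orthonormal_basis h dV dim S -> orthonormal_basis h dV dim S' ->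
  (forall q, holomorphic_section (center q)) ->
  (forall a, exists q, center q = rat_comb dim S a) -> (forall a, exists q, center q = rat_comb dim S' a) ->
  forall B : set (g_sigma_algebraType (frechet_open h)), measurable B -> P (psi S @^-1` B) = P (psi S' @^-1` B).
Proof.
move=> S_basis S'_basis center_hol cS cS'.
have mS := measurable_ev_psi_seq W_patch W_base eta S_basis.
have mS' := measurable_ev_psi_seq W_patch W_base eta S'_basis.
have ev_law (E : set (seqR R)) : measurable E ->
    P ((fun w => ev W (sval (psi S w)) : seqR R) @^-1` E) = P ((fun w => ev W (sval (psi S' w)) : seqR R) @^-1` E).
  apply: (seq_law_unique mS mS') => p c.
  by apply/eqP; rewrite eq_le !below_psi_le.
apply: (@law_unique R _ _ T (g_sigma_algebraType (frechet_open h)) P (frechet_open h)) => //.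
- move=> A B Ao Bo s [As Bs]; have [K1 [e1 [K1c e10 sub1]]] := Ao s As; have [K2 [e2 [K2c e20 sub2]]] := Bo s Bs.
  exists (K1 `|` K2), (Num.min e1 e2); split; [exact: compactU|by rewrite lt_min e10|].
  by move=> t ts; split; [apply: sub1|apply: sub2] => x Kx;
    apply: lt_le_trans (ts x _) _; rewrite ?ge_min ?lexx ?orbT//; [left|right].
- by move=> s _; exists set0, 1; split => //; exact: compact0.
- exact: (measurable_psi W_patch W_base eta S_basis center_hol cS).
- exact: (measurable_psi W_patch W_base eta S'_basis center_hol cS').
- move=> U Uo; rewrite (psi_preimage W_patch W_base eta S_basis center_hol cS Uo).
  rewrite (psi_preimage W_patch W_base eta S'_basis center_hol cS' Uo); apply: ev_law.
  exact: measurable_trace_set.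
Qed.

End same_law.

Theorem proposition2p3 (R : realType) (n : nat)
  (X : ptopologicalType) (M : complex_atlas R n X)
  (X_hausdorff : hausdorff_space X) (X_second_countable : @second_countable X)
  (X_connected : connected [set: X])
  (Theta : hermitian_form M) (L : line_bundle M) (h : hermitian_metric L)
  (dV : {measure set (borel X) -> \bar R}) (dV_Theta : is_volume_measure Theta dV)
  (d : option nat) (d_dim : L2_dim h dV d) (d_ge1 : size_le 1 d)
  (disp : measure_display) (T : measurableType disp) (P : probability T R)
  (eta : nat -> {RV P >-> borel R[i]})
  (eta_iid : iid_std_complex_gaussian d eta)
  (S S' : nat -> forall x, fiber L x)
  (S_basis : orthonormal_basis h dV d S)
  (S'_basis : orthonormal_basis h dV d S') :
  same_distribution (h := h) P (random_section h d eta S) (random_section h d eta S').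
Proof.
have [W [W_patch W_base]] := countable_patches h dV_Theta X_second_countable.
pose center (q : bool * seq (rat * rat)) := rat_comb d (if q.1 then S else S') q.2.
have center_hol q : holomorphic_section (center q).
  by case: q => -[] a; [exact: (partial_sum_hol S_basis)|exact: (partial_sum_hol S'_basis)].
have cS a : exists q, center q = rat_comb d S a by exists (true, a).
have cS' a : exists q, center q = rat_comb d S' a by exists (false, a).
split.
- exact: (measurable_psi W_patch W_base eta S_basis center_hol cS).
- exact: (measurable_psi W_patch W_base eta S'_basis center_hol cS').
- exact: (psi_law dV_Theta W_patch W_base eta_iid S_basis S'_basis center_hol cS cS').
Qed.
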